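(* Let $L_1,L_2,L_3\in\mathbb{Z}[x_1,x_2]$ be linear forms which are linearly independent (i.e. pairwise non-proportional, so that each pairwise resultant is non-zero). For $X\ge 1$ put $$T(X)=\sum_{\substack{x_1,x_2\in\mathbb{N}\\ x_1,x_2\le X}}\tau\big(L_1(x_1,x_2)L_2(x_1,x_2)L_3(x_1,x_2)\big).$$ Then for any $\varepsilon>0$ there exist constants $c_0,c_1,c_2,c_3\in\mathbb{R}$, with $c_0>0$, such that $$T(X)=\sum_{i=0}^3 c_iX^2(\log X)^{3-i}+O_{\varepsilon,L_1,L_2,L_3}\big(X^{2-\frac14+\varepsilon}\big),$$ where the implied constant depends only on $\varepsilon$ and $L_1,L_2,L_3$.
   Context: $\tau(n)=\sum_{d\mid n}1$ is the divisor function, extended to non-zero negative integers by $\tau(-n)=\tau(n)$; we use the convention $\tau(0)=0$. $\mathbb{N}=\{1,2,3,\dots\}$. *)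

(* Defs.v *)
From Stdlib Require Import Reals ZArith List.
Import ListNotations.
Open Scope R_scope.

(* Divisor function on integers: tau n = #{d in N : d | n}, tau(-n)=tau(n), tau 0 = 0. *)
Definition tau (n : Z) : nat :=
  length (filter (fun d : nat => Z.eqb (Z.rem n (Z.of_nat d)) 0%Z)
                 (seq 1 (Z.abs_nat n))).

Definition linform : Type := (Z * Z)%type.
Definition evalL (L : linform) (x1 x2 : Z) : Z := (fst L * x1 + snd L * x2)%Z.

Definition resL (L M : linform) : Z := (fst L * snd M - fst M * snd L)%Z.

Definition floorN (X : R) : nat := Z.to_nat (Int_part X).

Definition T (L1 L2 L3 : linform) (X : R) : R :=
  fold_right Rplus 0
    (map (fun x1 : nat =>
       fold_right Rplus 0
         (map (fun x2 : nat =>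
            let z1 := Z.of_nat x1 in let z2 := Z.of_nat x2 in
            INR (tau (evalL L1 z1 z2 * evalL L2 z1 z2 * evalL L3 z1 z2)%Z))
          (seq 1 (floorN X))))
     (seq 1 (floorN X))).

(* Main.v *)
(** Moebius inversion writes tau(L1 L2 L3) as a combination of products t1 t2 t3, where ti counts
    the multiples d of a fixed modulus di that divide Li(x). Dirichlet's hyperbola trick reduces each
    ti to multiples d = di mi with di mi^2 <= |Li(x)|, so that one has to count the points x of a
    convex polygon in the lattice {di mi | Li(x), i = 1, 2, 3}. The number of such points is density
    times area up to O(X / |v| + 1) for a short vector v of the lattice; summed over the moduli, using
    |v| >= X^(3/4) for all but a few of them and the divisor bound for the rest, the errors are
    O(X^(7/4 + eps)). A Fourier expansion of the densities turns the main term into an absolutely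
    convergent series times sums of monomials in log |Li(x)|, hence into a cubic polynomial in log X.
    The leading coefficient is positive by comparison with the sum of tau(L1) tau(L2) tau(L3). *)

Require Import Defs.
From Stdlib Require Import Reals ZArith Lra Lia Psatz Arith List Permutation Classical.
Import ListNotations.
Open Scope R_scope.

(** The exponent 2 - 1/4 is a balance: X^(3/2+eps) admissible systems of moduli each cost X/V when
    their lattice has no nonzero vector of size at most V, while the shorter vectors cost about X V
    in total; V = X^(3/4) makes both X^(7/4). For fixed moduli and signs the hyperbola condition is
    linear in x, hence the convex polygons. Translates of a lattice are compared with each other,
    and the main term stays a sum over points x, so that no area or integral is ever evaluated. The
    frequencies and the Moebius variables range over an infinite family, whose series must converge
    absolutely even after logarithms are absorbed and one exponent 1 is lowered to 1/2 by the error
    of a harmonic sum. The count of frequencies may grow like o1, but nonzero resultants force the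
    three denominators to agree up to a bounded factor, and an lcm inequality then leaves a power
    below -1 of a single lcm. The sum of this series carries Moebius signs, so its positivity cannot
    be read off; the series of the comparison sum has nonnegative terms, one of them equal to 1. *)

(** * Finite sums over lists, counting by injections *)

Definition Sum {A} (l : list A) (f : A -> R) : R := fold_right Rplus 0 (map f l).
Definition iv (b : bool) : R := if b then 1 else 0.

Lemma iv_bounds b : 0 <= iv b <= 1.
Proof. destruct b; simpl; lra. Qed.

Lemma iv_and b c : iv (b && c) = iv b * iv c.
Proof. destruct b, c; simpl; lra. Qed.

Lemma Sum_cons {A} (x : A) l f : Sum (x :: l) f = f x + Sum l f.
Proof. reflexivity. Qed.

Lemma Sum_app {A} (l l' : list A) f : Sum (l ++ l') f = Sum l f + Sum l' f.
Proof. induction l; simpl; [unfold Sum at 2; simpl; lra|]. rewrite !Sum_cons, IHl. lra. Qed.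

Lemma Sum_ext {A} (l : list A) f g :
  (forall x, In x l -> f x = g x) -> Sum l f = Sum l g.
Proof.
  induction l; intros H; [reflexivity|]. rewrite !Sum_cons, (H a) by (left; auto).
  rewrite IHl; auto. intros; apply H; right; auto.
Qed.

Lemma Sum_le {A} (l : list A) f g :
  (forall x, In x l -> f x <= g x) -> Sum l f <= Sum l g.
Proof.
  induction l; intros H; [unfold Sum; simpl; lra|]. rewrite !Sum_cons.
  pose proof (H a (or_introl eq_refl)).
  assert (Sum l f <= Sum l g) by (apply IHl; intros; apply H; right; auto). lra.
Qed.

Lemma Sum_plus {A} (l : list A) f g : Sum l (fun x => f x + g x) = Sum l f + Sum l g.
Proof. induction l; [unfold Sum; simpl; lra|]. rewrite !Sum_cons, IHl. lra. Qed.

Lemma Sum_scal {A} (l : list A) c f : Sum l (fun x => c * f x) = c * Sum l f.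
Proof. induction l; [unfold Sum; simpl; lra|]. rewrite !Sum_cons, IHl. lra. Qed.

Lemma Sum_scal_r {A} (l : list A) c f : Sum l (fun x => f x * c) = Sum l f * c.
Proof. induction l; [unfold Sum; simpl; lra|]. rewrite !Sum_cons, IHl. lra. Qed.

Lemma Sum_minus {A} (l : list A) f g : Sum l (fun x => f x - g x) = Sum l f - Sum l g.
Proof. induction l; [unfold Sum; simpl; lra|]. rewrite !Sum_cons, IHl. lra. Qed.

Lemma Sum_const {A} (l : list A) c : Sum l (fun _ => c) = INR (length l) * c.
Proof.
  induction l; [unfold Sum; simpl; lra|]. rewrite Sum_cons, IHl.
  change (length (a :: l)) with (S (length l)). rewrite S_INR. lra.
Qed.

Lemma Sum_zero {A} (l : list A) f : (forall x, In x l -> f x = 0) -> Sum l f = 0.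
Proof. intros H. rewrite (Sum_ext l f (fun _ => 0) H), Sum_const. lra. Qed.

Lemma Sum_nonneg {A} (l : list A) f : (forall x, In x l -> 0 <= f x) -> 0 <= Sum l f.
Proof. intros H. rewrite <- (Sum_zero l (fun _ => 0)) by auto. apply Sum_le; auto. Qed.

Lemma Sum_abs {A} (l : list A) f : Rabs (Sum l f) <= Sum l (fun x => Rabs (f x)).
Proof.
  induction l; [unfold Sum; simpl; rewrite Rabs_R0; lra|]. rewrite !Sum_cons.
  eapply Rle_trans; [apply Rabs_triang|]. lra.
Qed.

Lemma Sum_abs_diff {A} (l : list A) f g (e : A -> R) :
  (forall x, In x l -> Rabs (f x - g x) <= e x) -> Rabs (Sum l f - Sum l g) <= Sum l e.
Proof.
  intros H. rewrite <- Sum_minus. eapply Rle_trans; [apply Sum_abs|]. apply Sum_le; auto.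
Qed.

Lemma Sum_swap {A B} (l : list A) (l' : list B) f :
  Sum l (fun x => Sum l' (fun y => f x y)) = Sum l' (fun y => Sum l (fun x => f x y)).
Proof.
  induction l.
  - change (0 = Sum l' (fun y => 0)). rewrite Sum_zero; auto.
  - rewrite Sum_cons, IHl, <- Sum_plus. apply Sum_ext. intros; rewrite Sum_cons; auto.
Qed.

Lemma Sum_map {A B} (g : A -> B) l f : Sum (map g l) f = Sum l (fun x => f (g x)).
Proof. unfold Sum. rewrite map_map. reflexivity. Qed.

Lemma Sum_filter {A} (p : A -> bool) l f : Sum (filter p l) f = Sum l (fun x => iv (p x) * f x).
Proof.
  induction l; [reflexivity|]. simpl. rewrite Sum_cons. destruct (p a); simpl.
  - rewrite Sum_cons, IHl. lra.
  - rewrite IHl; lra.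
Qed.

Lemma length_filter_Sum {A} (p : A -> bool) l : INR (length (filter p l)) = Sum l (fun x => iv (p x)).
Proof.
  induction l; [reflexivity|]. simpl filter. rewrite Sum_cons. destruct (p a).
  - change (length (a :: filter p l)) with (S (length (filter p l))). rewrite S_INR, IHl. simpl iv. lra.
  - rewrite IHl. simpl iv. lra.
Qed.

Lemma Sum_mult {A B} (l : list A) (l' : list B) f g :
  Sum l f * Sum l' g = Sum l (fun x => Sum l' (fun y => f x * g y)).
Proof.
  rewrite <- Sum_scal_r. apply Sum_ext. intros. rewrite Sum_scal. auto.
Qed.

Lemma Sum_list_prod {A B} (l : list A) (l' : list B) f :
  Sum (list_prod l l') f = Sum l (fun x => Sum l' (fun y => f (x, y))).
Proof.
  induction l; [reflexivity|]. simpl list_prod. rewrite Sum_app, Sum_map, Sum_cons, IHl. auto.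
Qed.

Lemma Sum_ge_term {A} (l : list A) f a :
  (forall x, In x l -> 0 <= f x) -> In a l -> f a <= Sum l f.
Proof.
  induction l; intros H Ha; [destruct Ha|]. rewrite Sum_cons.
  assert (0 <= Sum l f) by (apply Sum_nonneg; intros; apply H; right; auto).
  destruct Ha as [->|Ha]; [lra|].
  pose proof (H a0 (or_introl eq_refl)).
  assert (f a <= Sum l f) by (apply IHl; auto; intros; apply H; right; auto). lra.
Qed.

Lemma Sum_ind_unique {A} (l : list A) (p : A -> bool) a f :
  NoDup l -> In a l -> (forall x, In x l -> (p x = true <-> x = a)) ->
  Sum l (fun x => iv (p x) * f x) = f a.
Proof.
  induction l; intros Hn Ha Hp; [destruct Ha|]. inversion Hn; subst. rewrite Sum_cons.
  destruct Ha as [->|Ha].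
  - replace (p a) with true by (symmetry; apply Hp; [left|]; auto).
    rewrite Sum_zero; [simpl; lra|]. intros x Hx.
    destruct (p x) eqn:E; [|simpl; lra]. apply Hp in E; [|right; auto]. subst; contradiction.
  - destruct (p a0) eqn:E.
    + apply Hp in E; [|left; auto]. subst; contradiction.
    + simpl iv. rewrite IHl; auto; [lra|]. intros; apply Hp; right; auto.
Qed.

Lemma NoDup_map_on {A B} (f : A -> B) l :
  (forall x y, In x l -> In y l -> f x = f y -> x = y) -> NoDup l -> NoDup (map f l).
Proof.
  induction l; intros H Hn; simpl; [constructor|]. inversion Hn; subst. constructor.
  - rewrite in_map_iff. intros [x [E Hx]]. apply H in E; [subst; contradiction|right; auto|left; auto].
  - apply IHl; auto. intros; apply H; auto; right; auto.
Qed.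

Lemma NoDup_list_prod {A B} (l : list A) (l' : list B) :
  NoDup l -> NoDup l' -> NoDup (list_prod l l').
Proof.
  intros Hl Hl'. induction Hl; simpl; [constructor|]. apply NoDup_app; auto.
  - apply NoDup_map_on; auto. intros a b _ _ E. congruence.
  - intros [a b] H1 H2. apply in_map_iff in H1. destruct H1 as [y [E _]].
    apply in_prod_iff in H2. destruct H2. congruence.
Qed.

Lemma inj_length {A B} (f : A -> B) l l' :
  NoDup l -> (forall x, In x l -> In (f x) l') ->
  (forall x y, In x l -> In y l -> f x = f y -> x = y) -> (length l <= length l')%nat.
Proof.
  intros Hn Hi Hj. rewrite <- (length_map f). apply NoDup_incl_length.
  - apply NoDup_map_on; auto.
  - intros y Hy. apply in_map_iff in Hy. destruct Hy as [x [<- Hx]]. auto.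
Qed.

Lemma Sum_incl_le {A} (l l' : list A) f :
  NoDup l -> incl l l' -> (forall x, In x l' -> 0 <= f x) -> Sum l f <= Sum l' f.
Proof.
  revert l'. induction l; intros l' Hn Hi Hp.
  - apply Sum_nonneg; auto.
  - inversion Hn; subst. assert (Ha : In a l') by (apply Hi; left; auto).
    apply in_split in Ha. destruct Ha as [u [w ->]].
    rewrite Sum_app, !Sum_cons.
    assert (Sum l f <= Sum (u ++ w) f).
    { apply IHl; auto.
      - intros x Hx. specialize (Hi x (or_intror Hx)). apply in_app_iff in Hi. apply in_app_iff.
        destruct Hi as [|[->|]]; auto. contradiction.
      - intros x Hx. apply Hp. apply in_app_iff in Hx. apply in_app_iff. simpl; tauto. }
    rewrite Sum_app in H. lra.
Qed.

Lemma Sum_seq_extend n m (f : nat -> R) : (n <= m)%nat ->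
  (forall k, (n < k <= m)%nat -> f k = 0) -> Sum (seq 1 m) f = Sum (seq 1 n) f.
Proof.
  intros H Hf. replace m with (n + (m - n))%nat by lia. rewrite seq_app, Sum_app.
  rewrite (Sum_zero (seq (1 + n) (m - n))); [lra|]. intros x Hx. apply in_seq in Hx. apply Hf; lia.
Qed.

Lemma Sum_seq_S s n (f : nat -> R) : Sum (seq s (S n)) f = Sum (seq s n) f + f (s + n)%nat.
Proof. rewrite seq_S, Sum_app. unfold Sum at 2; simpl. lra. Qed.

(** * Divisors *)

(** The test agrees with [Nat.divide] at 0 as well: [divb d 0] always holds. This is why a vector on
    which a form vanishes needs separate treatment in the error term. *)
Definition divb (d n : nat) : bool := (n mod d =? 0)%nat.
Definition divs (n : nat) : list nat := filter (fun d => divb d n) (seq 1 n).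
Definition tauN (n : nat) : R := INR (length (divs n)).

Lemma divb_iff d n : divb d n = true <-> Nat.divide d n.
Proof. unfold divb. rewrite Nat.eqb_eq. apply Nat.Lcm0.mod_divide. Qed.

Lemma divb_le d n : (1 <= n)%nat -> divb d n = true -> (d <= n)%nat.
Proof.
  intros Hn H. apply divb_iff in H. apply Nat.divide_pos_le; auto; lia.
Qed.

Lemma in_divs n d : (1 <= n)%nat -> (In d (divs n) <-> Nat.divide d n).
Proof.
  intros Hn. unfold divs. rewrite filter_In, in_seq. split.
  - intros [H1 H2]. apply divb_iff in H2; auto.
  - intros H. assert (d <> 0)%nat by (intros ->; destruct H; lia).
    assert (d <= n)%nat by (apply Nat.divide_pos_le; auto; lia).
    split; [lia|]. apply divb_iff; auto.
Qed.

Lemma NoDup_divs n : NoDup (divs n).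
Proof. apply NoDup_filter, seq_NoDup. Qed.

Lemma divs_pos n d : (1 <= n)%nat -> Nat.divide d n -> (1 <= d <= n)%nat.
Proof.
  intros Hn H. assert (d <> 0)%nat by (intros ->; destruct H; lia).
  assert (d <= n)%nat by (apply Nat.divide_pos_le; auto; lia). lia.
Qed.

Lemma Sum_divs n Y f : (1 <= n <= Y)%nat ->
  Sum (divs n) f = Sum (seq 1 Y) (fun d => iv (divb d n) * f d).
Proof.
  intros H. unfold divs. rewrite Sum_filter. symmetry. apply Sum_seq_extend; [lia|].
  intros k Hk. destruct (divb k n) eqn:E; [|simpl; lra].
  apply divb_le in E; lia.
Qed.

Lemma tauN_Sum n Y : (1 <= n <= Y)%nat -> tauN n = Sum (seq 1 Y) (fun d => iv (divb d n)).
Proof.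
  intros H. unfold tauN, divs. rewrite length_filter_Sum. symmetry. apply Sum_seq_extend; [lia|].
  intros k Hk. destruct (divb k n) eqn:E; [|reflexivity]. apply divb_le in E; lia.
Qed.

Lemma Sum_ind_div_le n Y : (1 <= n)%nat -> Sum (seq 1 Y) (fun d => iv (divb d n)) <= tauN n.
Proof.
  intros H. rewrite (tauN_Sum n (Nat.max n Y)) by lia.
  apply Sum_incl_le; [apply seq_NoDup| |intros; apply iv_bounds].
  intros x. rewrite !in_seq. lia.
Qed.

Lemma tauN_ge1 n : (1 <= n)%nat -> 1 <= tauN n.
Proof.
  intros H. unfold tauN. assert (In 1%nat (divs n)) by (apply in_divs; auto; apply Nat.divide_1_l).
  destruct (divs n); [destruct H0|]. simpl length. rewrite S_INR. pose proof (pos_INR (length l)). lra.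
Qed.

Lemma tauN_le n : tauN n <= INR n.
Proof.
  unfold tauN. apply le_INR. unfold divs. eapply Nat.le_trans; [apply filter_length_le|]. rewrite length_seq; auto.
Qed.

(* [D] is recovered from the pair [(gcd D b, D / gcd D b)]. *)
Lemma tauN_mul_le a b : (1 <= a)%nat -> (1 <= b)%nat -> tauN (a * b) <= tauN a * tauN b.
Proof.
  intros Ha Hb. unfold tauN. rewrite <- mult_INR, <- length_prod. apply le_INR.
  apply (inj_length (fun D => (D / Nat.gcd D b, Nat.gcd D b)%nat)).
  - apply NoDup_divs.
  - intros D HD. apply in_divs in HD; [|nia]. pose proof (divs_pos (a * b) D ltac:(nia) HD).
    apply in_prod; apply in_divs; auto; [|apply Nat.gcd_divide_r].
    assert (Hg : (Nat.gcd D b <> 0)%nat) by (rewrite Nat.gcd_eq_0; lia).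
    destruct (Nat.gcd_divide_l D b) as [u Hu]. destruct (Nat.gcd_divide_r D b) as [w Hw].
    pose proof (Nat.gcd_div_gcd D b (Nat.gcd D b) Hg eq_refl) as Hc.
    apply (Nat.gauss _ (b / Nat.gcd D b)); auto.
    set (g := Nat.gcd D b) in *. clearbody g. rewrite Hu, Hw in *. rewrite !Nat.div_mul by auto.
    destruct HD as [z Hz]. exists z. apply (Nat.mul_cancel_r _ _ g); [auto|lia].
  - intros x y Hx Hy E. apply in_divs in Hx; [|nia]. apply in_divs in Hy; [|nia].
    pose proof (divs_pos (a * b) x ltac:(nia) Hx). pose proof (divs_pos (a * b) y ltac:(nia) Hy).
    injection E; intros E2 E1.
    assert (Hg : (Nat.gcd x b <> 0)%nat) by (rewrite Nat.gcd_eq_0; lia).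
    destruct (Nat.gcd_divide_l x b) as [u Hu]. destruct (Nat.gcd_divide_l y b) as [w Hw].
    rewrite <- E2 in *. set (g := Nat.gcd x b) in *. clearbody g.
    rewrite Hu, Hw in *. rewrite !Nat.div_mul in E1 by auto. subst; auto.
Qed.

(** * Primes and the divisor bound *)

Definition primeN (p : nat) : Prop := (2 <= p)%nat /\ forall d, Nat.divide d p -> d = 1%nat \/ d = p.

Lemma primeN_gcd p n : primeN p -> ~ Nat.divide p n -> Nat.gcd p n = 1%nat.
Proof.
  intros [Hp H] Hn. destruct (H (Nat.gcd p n) (Nat.gcd_divide_l p n)) as [E|E]; auto.
  destruct Hn. rewrite <- E at 1. apply Nat.gcd_divide_r.
Qed.

Lemma primeN_exists n : (2 <= n)%nat -> exists p, primeN p /\ Nat.divide p n.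
Proof.
  induction n as [n IH] using lt_wf_ind. intros Hn.
  destruct (classic (primeN n)) as [|H]; [exists n; split; auto; apply Nat.divide_refl|].
  assert (exists d, Nat.divide d n /\ d <> 1%nat /\ d <> n) as [d [Hd [H1 H2]]].
  { apply NNPP. intros C. apply H. split; auto. intros d Hd.
    destruct (Nat.eq_dec d 1); auto. destruct (Nat.eq_dec d n); auto. destruct C; eauto. }
  pose proof (divs_pos n d ltac:(lia) Hd).
  destruct (IH d ltac:(lia) ltac:(lia)) as [p [Hp Hpd]].
  exists p; split; auto. eapply Nat.divide_trans; eauto.
Qed.

Lemma factor_out p n : (2 <= p)%nat -> (1 <= n)%nat ->
  exists a m, n = (p ^ a * m)%nat /\ ~ Nat.divide p m /\ (1 <= m)%nat.
Proof.
  intros Hp. induction n as [n IH] using lt_wf_ind. intros Hn.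
  destruct (classic (Nat.divide p n)) as [[m Hm]|H].
  - destruct (IH m ltac:(nia) ltac:(nia)) as [a [m' [E [H1 H2]]]].
    exists (S a), m'. split; [|auto]. simpl. nia.
  - exists 0%nat, n. simpl. split; [lia|auto].
Qed.

Lemma divide_prime_pow p a d : primeN p -> Nat.divide d (p ^ a) ->
  exists i, (i <= a)%nat /\ d = (p ^ i)%nat.
Proof.
  intros Hp. revert d. induction a; intros d Hd.
  - exists 0%nat. simpl in *. apply Nat.divide_1_r in Hd. auto.
  - destruct (classic (Nat.divide p d)) as [[m Hm]|H].
    + destruct (IHa m) as [i [Hi E]].
      * destruct Hd as [z Hz]. simpl in Hz. exists z. destruct Hp. subst. nia.
      * exists (S i). split; [lia|]. simpl. subst. nia.
    + destruct (IHa d) as [i [Hi E]].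
      * apply (Nat.gauss d p); [simpl in Hd; auto|]. rewrite Nat.gcd_comm. apply primeN_gcd; auto.
      * exists i; split; auto; lia.
Qed.

Lemma tauN_prime_pow p a : primeN p -> tauN (p ^ a) <= INR a + 1.
Proof.
  intros Hp. rewrite <- S_INR. unfold tauN. apply le_INR.
  apply Nat.le_trans with (length (map (fun i => p ^ i)%nat (seq 0 (S a)))); [|rewrite length_map, length_seq; auto].
  apply NoDup_incl_length; [apply NoDup_divs|].
  intros d Hd. apply in_divs in Hd; [|destruct Hp; pose proof (Nat.pow_nonzero p a); lia].
  apply divide_prime_pow in Hd; auto. destruct Hd as [i [Hi ->]].
  apply in_map_iff. exists i. split; auto. apply in_seq; lia.
Qed.

Lemma Rexp_le x y : x <= y -> exp x <= exp y.
Proof. intros [H| ->]; [left; apply exp_increasing; auto|right; auto]. Qed.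

Lemma Rln_le x y : 0 < x -> x <= y -> ln x <= ln y.
Proof. intros H [H'| ->]; [left; apply ln_increasing; auto|right; auto]. Qed.

Lemma INR_ge1 n : (1 <= n)%nat -> 1 <= INR n.
Proof. intros H. apply le_INR in H. simpl in H. lra. Qed.

Lemma Rpower_pos x y : 0 < Rpower x y.
Proof. apply exp_pos. Qed.

Lemma ln_nonneg x : 1 <= x -> 0 <= ln x.
Proof. intros. rewrite <- ln_1. apply Rln_le; lra. Qed.

Lemma Rpower_ge1 x y : 1 <= x -> 0 <= y -> 1 <= Rpower x y.
Proof.
  intros. unfold Rpower. rewrite <- exp_0. apply Rexp_le. pose proof (ln_nonneg x H). nra.
Qed.

(** Induction on the bound for the primes. Admitting the prime [k] costs a factor [1 + / u] with
    [u = delta * ln 2], because [a + 1 <= (1 + / u) * (1 + a * u)] and [1 + a * u <= exp (a * u)],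
    which is at most the [delta]-th power of [k ^ a]. *)
Lemma tauN_smooth_bound delta k : 0 < delta ->
  exists C, 1 <= C /\ forall n, (1 <= n)%nat -> (forall p, primeN p -> Nat.divide p n -> (p < k)%nat) ->
    tauN n <= C * Rpower (INR n) delta.
Proof.
  intros Hd. induction k as [|k [C [HC IH]]].
  - exists 1. split; [lra|]. intros n Hn H. destruct (Nat.eq_dec n 1) as [->|].
    + change (tauN 1) with 1. pose proof (Rpower_ge1 (INR 1) delta). simpl in *. lra.
    + destruct (primeN_exists n ltac:(lia)) as [p [Hp Hpn]]. specialize (H p Hp Hpn). lia.
  - destruct (classic (primeN k)) as [Hk|Hk].
    2:{ exists C; split; auto. intros n Hn H. apply IH; auto. intros p Hp Hpn.
        specialize (H p Hp Hpn). assert (p <> k) by (intros ->; auto). lia. }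
    set (u := delta * ln 2). assert (Hu : 0 < u) by (apply Rmult_lt_0_compat; auto; rewrite <- ln_1; apply ln_increasing; lra).
    exists ((1 + / u) * C). pose proof (Rinv_0_lt_compat u Hu) as Hui. split; [nra|].
    intros n Hn H. destruct (factor_out k n) as [a [m [E [Hm1 Hm2]]]]; [destruct Hk; auto|auto|].
    assert (Hka : (1 <= k ^ a)%nat) by (destruct Hk; pose proof (Nat.pow_nonzero k a); lia).
    rewrite E. eapply Rle_trans; [apply tauN_mul_le; auto|].
    rewrite mult_INR, <- Rpower_mult_distr by (apply lt_0_INR; lia).
    assert (H1 : tauN m <= C * Rpower (INR m) delta).
    { apply IH; auto. intros p Hp Hpm. assert (p <> k) by (intros ->; auto).
      enough (p < S k)%nat by lia. apply H; auto. rewrite E. apply Nat.divide_mul_r; auto. }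
    assert (H2 : tauN (k ^ a) <= (1 + / u) * Rpower (INR (k ^ a)) delta).
    { eapply Rle_trans; [apply tauN_prime_pow; auto|].
      assert (H3 : 1 + INR a * u <= Rpower (INR (k ^ a)) delta).
      { unfold Rpower. eapply Rle_trans; [apply exp_ineq1_le|]. apply Rexp_le.
        rewrite pow_INR, ln_pow by (apply lt_0_INR; destruct Hk; lia).
        assert (ln 2 <= ln (INR k)).
        { destruct Hk as [Hk _]. apply le_INR in Hk. simpl in Hk. apply Rln_le; lra. }
        unfold u. pose proof (pos_INR a).
        replace (delta * (INR a * ln (INR k))) with (INR a * (delta * ln (INR k))) by ring.
        apply Rmult_le_compat_l; auto. apply Rmult_le_compat_l; lra. }
      assert (INR a + 1 <= (1 + / u) * (1 + INR a * u)).
      { replace ((1 + / u) * (1 + INR a * u)) with (1 + INR a + INR a * u + / u) by (field; lra).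
        pose proof (pos_INR a). nra. }
      nra. }
    pose proof (tauN_ge1 m Hm2). pose proof (tauN_ge1 (k ^ a) Hka).
    eapply Rle_trans; [apply Rmult_le_compat; [lra|lra|exact H2|exact H1]|]. right; ring.
Qed.

(** A prime [p] with [p ^ delta >= 2] satisfies [tauN p <= 2 <= p ^ delta], so such primes can be
    stripped off one at a time at no cost. Only the finitely many primes below [P] contribute to the
    constant. *)
Lemma divisor_bound delta : 0 < delta ->
  exists C, 1 <= C /\ forall n, (1 <= n)%nat -> tauN n <= C * Rpower (INR n) delta.
Proof.
  intros Hd. destruct (INR_unbounded (Rpower 2 (/ delta))) as [P HP].
  destruct (tauN_smooth_bound delta P Hd) as [C [HC H]].
  exists C; split; auto. intros n. induction n as [n IH] using lt_wf_ind. intros Hn.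
  destruct (classic (forall p, primeN p -> Nat.divide p n -> (p < P)%nat)) as [|Hc]; [auto|].
  assert (exists p, primeN p /\ Nat.divide p n /\ (P <= p)%nat) as [p [Hp [[m Hm] HPp]]].
  { apply NNPP; intros Hx. apply Hc. intros p H1 H2. destruct (le_lt_dec P p); auto. destruct Hx; eauto. }
  destruct Hp as [Hp2 Hp]. rewrite Hm.
  assert (Hm1 : (1 <= m)%nat) by nia.
  eapply Rle_trans; [apply tauN_mul_le; lia|].
  rewrite mult_INR, <- Rpower_mult_distr by (apply lt_0_INR; lia).
  pose proof (IH m ltac:(nia) Hm1).
  assert (tauN p <= 2).
  { pose proof (tauN_prime_pow p 1 (conj Hp2 Hp)). rewrite Nat.pow_1_r in *. simpl in *; lra. }
  assert (2 <= Rpower (INR p) delta).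
  { apply Rle_trans with (Rpower (Rpower 2 (/ delta)) delta).
    - rewrite Rpower_mult, Rinv_l by lra. rewrite Rpower_1; lra.
    - apply Rle_Rpower_l; [lra|]. apply le_INR in HPp. split; [apply Rpower_pos|lra]. }
  pose proof (tauN_ge1 m Hm1). pose proof (tauN_ge1 p ltac:(lia)).
  eapply Rle_trans; [apply Rmult_le_compat; [lra|lra|exact H0|]|].
  - apply Rle_trans with (Rpower (INR p) delta); [lra|apply Rle_refl].
  - right; ring.
Qed.

(** * The Moebius function *)

(** The recursion is the one imposed by Moebius inversion, that the sum over the divisors of [n] is
    1 for [n = 1] and 0 otherwise; no factorisation enters. Fuel [n] suffices because proper
    divisors are smaller. *)
Fixpoint mu_fuel (k n : nat) : R :=
  match k with
  | O => 0
  | S k => if (n =? 1)%nat then 1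
           else - Sum (filter (fun d => (d <? n)%nat) (divs n)) (mu_fuel k)
  end.
Definition mu (n : nat) : R := mu_fuel n n.

Lemma mu_fuel_stable k k' n : (1 <= n <= k)%nat -> (n <= k')%nat -> mu_fuel k n = mu_fuel k' n.
Proof.
  revert k' n. induction k; intros k' n H H'; [lia|]. destruct k'; [lia|]. simpl.
  destruct (n =? 1)%nat; auto. f_equal. apply Sum_ext. intros d Hd.
  apply filter_In in Hd. destruct Hd as [Hd Hl]. apply Nat.ltb_lt in Hl.
  apply in_divs in Hd; [|lia]. apply divs_pos in Hd; [|lia]. apply IHk; lia.
Qed.

Lemma mu_1 : mu 1 = 1.
Proof. reflexivity. Qed.

Lemma Sum_split_filter {A} (p : A -> bool) l f :
  Sum l f = Sum (filter p l) f + Sum (filter (fun x => negb (p x)) l) f.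
Proof.
  rewrite !Sum_filter, <- Sum_plus. apply Sum_ext. intros. destruct (p x); simpl; lra.
Qed.

Lemma Sum_same_elements {A} (l l' : list A) f :
  NoDup l -> NoDup l' -> (forall x, In x l <-> In x l') -> Sum l f = Sum l' f.
Proof.
  intros H1 H2 H. assert (HP : Permutation l l') by (apply NoDup_Permutation; auto).
  clear H1 H2 H. induction HP; rewrite ?Sum_cons; lra.
Qed.

Lemma divs_last n f : (1 <= n)%nat -> Sum (divs n) f = Sum (filter (fun d => (d <? n)%nat) (divs n)) f + f n.
Proof.
  intros Hn. rewrite (Sum_split_filter (fun d => (d <? n)%nat)). f_equal.
  rewrite (Sum_same_elements _ [n]); [unfold Sum; simpl; lra| | |].
  - apply NoDup_filter, NoDup_divs.
  - repeat constructor; auto.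
  - intros x. rewrite filter_In, in_divs by auto. rewrite Bool.negb_true_iff, Nat.ltb_ge. simpl. split.
    + intros [H1 H2]. apply divs_pos in H1; auto. lia.
    + intros [<-|[]]. split; [apply Nat.divide_refl|lia].
Qed.

Lemma Sum_mu n : (1 <= n)%nat -> Sum (divs n) mu = iv (n =? 1)%nat.
Proof.
  intros Hn. destruct (Nat.eq_dec n 1) as [->|H1]; [unfold Sum; simpl; rewrite mu_1; lra|].
  rewrite divs_last by auto. unfold mu at 2. destruct n; [lia|].
  change (mu_fuel (S n) (S n)) with (if (S n =? 1)%nat then 1
    else - Sum (filter (fun d => (d <? S n)%nat) (divs (S n))) (mu_fuel n)).
  replace (S n =? 1)%nat with false by (symmetry; apply Nat.eqb_neq; auto).
  rewrite (Sum_ext _ mu (mu_fuel n)); [unfold iv; lra|].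
  intros d Hd. apply filter_In in Hd. destruct Hd as [Hd Hl]. apply Nat.ltb_lt in Hl.
  apply in_divs in Hd; [|lia]. apply divs_pos in Hd; [|lia]. apply mu_fuel_stable; lia.
Qed.

(** The divisors of [p * m] are those of [m] together with their [p]-fold multiples. Both total sums
    vanish or cancel, and by induction every proper divisor [d] cancels against [p * d], which
    leaves only [m] and [p * m]. *)
Lemma mu_prime_mul p m : primeN p -> (1 <= m)%nat -> ~ Nat.divide p m -> mu (p * m) = - mu m.
Proof.
  intros Hp. assert (Hp2 := proj1 Hp). induction m as [m IH] using lt_wf_ind. intros Hm Hpm.
  assert (E : Sum (divs (p * m)) mu = Sum (divs m) mu + Sum (divs m) (fun d => mu (p * d))).
  { rewrite <- (Sum_map (fun d => (p * d)%nat) (divs m) mu), <- Sum_app.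
    apply Sum_same_elements; [apply NoDup_divs| |].
    - apply NoDup_app; [apply NoDup_divs|apply NoDup_map_on; [intros; nia|apply NoDup_divs]|].
      intros x Hx Hx'. apply in_map_iff in Hx'. destruct Hx' as [d [<- Hd]].
      apply in_divs in Hx; auto. apply Hpm. eapply Nat.divide_trans; [|exact Hx]. apply Nat.divide_factor_l.
    - intros x. rewrite in_app_iff, in_map_iff, !in_divs by nia. split.
      + intros H. destruct (classic (Nat.divide p x)) as [[y Hy]|Hx].
        * right. exists y. split; [lia|]. apply in_divs; auto. destruct H as [z Hz]. exists z. nia.
        * left. apply (Nat.gauss x p); auto. rewrite Nat.gcd_comm. apply primeN_gcd; auto.
      + intros [H|[y [<- H]]]; [apply Nat.divide_mul_r; auto|].
        apply in_divs in H; auto. apply Nat.mul_divide_mono_l; auto. }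
  rewrite (Sum_mu (p * m)) in E by nia. replace (p * m =? 1)%nat with false in E by (symmetry; apply Nat.eqb_neq; nia).
  rewrite (divs_last m (fun d => mu (p * d))), (divs_last m mu) in E by auto.
  rewrite (Sum_ext _ (fun d => mu (p * d)) (fun d => -1 * mu d)) in E.
  - rewrite Sum_scal in E. simpl iv in E. lra.
  - intros d Hd. apply filter_In in Hd. destruct Hd as [Hd Hl]. apply Nat.ltb_lt in Hl.
    apply in_divs in Hd; auto. pose proof (divs_pos _ _ Hm Hd).
    assert (Hpd : ~ Nat.divide p d) by (intros H1; apply Hpm; eapply Nat.divide_trans; eauto).
    rewrite (IH d Hl ltac:(lia) Hpd). lra.
Qed.

(** The divisors of [p * m] already have sum 0, so the remaining divisors of [p * (p * m)] do too.
    Each of these is divisible by [p] twice, hence vanishes by induction unless it is the whole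
    number. *)
Lemma mu_square p m : primeN p -> (1 <= m)%nat -> mu (p * (p * m)) = 0.
Proof.
  intros Hp. assert (Hp2 := proj1 Hp). induction m as [m IH] using lt_wf_ind. intros Hm.
  set (n := (p * (p * m))%nat). assert (Hn : (1 <= n)%nat) by (unfold n; nia).
  assert (E1 : Sum (divs n) mu = 0).
  { rewrite Sum_mu by auto. replace (n =? 1)%nat with false; auto. symmetry. apply Nat.eqb_neq. unfold n; nia. }
  assert (E2 : Sum (divs (p * m)) mu = 0).
  { rewrite Sum_mu by nia. replace (p * m =? 1)%nat with false; auto. symmetry. apply Nat.eqb_neq. nia. }
  rewrite (Sum_split_filter (fun d => divb d (p * m))) in E1.
  rewrite (Sum_same_elements (filter (fun d => divb d (p * m)) (divs n)) (divs (p * m))) in E1;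
    [|apply NoDup_filter, NoDup_divs|apply NoDup_divs|].
  2:{ intros x. rewrite filter_In, !in_divs by nia. rewrite divb_iff. split; [tauto|].
      intros H; split; auto. unfold n. apply Nat.divide_mul_r; auto. }
  rewrite E2, Rplus_0_l in E1.
  set (l := filter (fun x => negb (divb x (p * m))) (divs n)) in *.
  assert (Hl : In n l).
  { apply filter_In. split; [apply in_divs; auto; apply Nat.divide_refl|]. apply Bool.negb_true_iff.
    destruct (divb n (p * m)) eqn:E; auto. apply divb_le in E; [unfold n in E; nia|nia]. }
  rewrite <- (Sum_ind_unique l (fun x => x =? n)%nat n mu), <- E1; auto.
  - apply Sum_ext. intros x Hx. destruct (Nat.eqb_spec x n); [simpl; lra|]. simpl iv.
    rewrite Rmult_0_l. symmetry. apply filter_In in Hx. destruct Hx as [Hx Hx2].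
    apply in_divs in Hx; auto. apply Bool.negb_true_iff in Hx2.
    assert (Hnx : ~ Nat.divide x (p * m)) by (rewrite <- divb_iff, Hx2; discriminate).
    destruct (classic (Nat.divide p x)) as [[y Hy]|Hpx].
    2:{ destruct Hnx. apply (Nat.gauss x p); auto. rewrite Nat.gcd_comm. apply primeN_gcd; auto. }
    assert (Hy2 : Nat.divide y (p * m)) by (destruct Hx as [z Hz]; exists z; unfold n in Hz; nia).
    destruct (classic (Nat.divide p y)) as [[w Hw]|Hpy].
    + assert (w < m /\ 1 <= w)%nat.
      { apply divs_pos in Hx; auto. unfold n in *. split; nia. }
      replace x with (p * (p * w))%nat by nia. apply IH; lia.
    + destruct Hnx. rewrite Hy, Nat.mul_comm. apply Nat.mul_divide_mono_l.
      apply (Nat.gauss y p); auto. rewrite Nat.gcd_comm. apply primeN_gcd; auto.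
  - apply NoDup_filter, NoDup_divs.
  - intros x _. apply Nat.eqb_eq.
Qed.

Lemma mu_bound n : (1 <= n)%nat -> Rabs (mu n) <= 1.
Proof.
  induction n as [n IH] using lt_wf_ind. intros Hn.
  destruct (Nat.eq_dec n 1) as [->|]; [rewrite mu_1, Rabs_R1; lra|].
  destruct (primeN_exists n ltac:(lia)) as [p [Hp [m Hm]]]. assert (Hp2 := proj1 Hp).
  replace n with (p * m)%nat by lia. destruct (classic (Nat.divide p m)) as [[w Hw]|H].
  - replace m with (p * w)%nat by lia. rewrite mu_square, Rabs_R0; auto; [lra|nia].
  - rewrite mu_prime_mul, Rabs_Ropp by (auto; nia). apply IH; nia.
Qed.

Lemma mu_coprime u w Y : (1 <= u <= Y)%nat -> (1 <= w <= Y)%nat ->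
  iv (Nat.gcd u w =? 1)%nat = Sum (seq 1 Y) (fun a => mu a * (iv (divb a u) * iv (divb a w))).
Proof.
  intros Hu Hw. assert (Hg : (1 <= Nat.gcd u w)%nat).
  { destruct (Nat.gcd u w) eqn:E; [|lia]. apply Nat.gcd_eq_0 in E. lia. }
  assert (Nat.gcd u w <= u)%nat by (apply Nat.divide_pos_le; [lia|apply Nat.gcd_divide_l]).
  rewrite <- (Sum_mu _ Hg), (Sum_divs _ Y) by lia.
  apply Sum_ext. intros a _. rewrite <- iv_and, Rmult_comm. do 2 f_equal.
  apply Bool.eq_iff_eq_true. rewrite Bool.andb_true_iff, !divb_iff. split.
  - intros Ha. split; eapply Nat.divide_trans; eauto; [apply Nat.gcd_divide_l|apply Nat.gcd_divide_r].
  - intros []. apply Nat.gcd_greatest; auto.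
Qed.

Lemma Rdiv_nonneg x y : 0 <= x -> 0 < y -> 0 <= x / y.
Proof. apply Rle_mult_inv_pos. Qed.

(** * The divisor function of a product *)

Definition tcount (Y d n : nat) : R := Sum (seq 1 Y) (fun m => iv (divb (d * m) n)).
Definition cop (u w : nat) : bool := (Nat.gcd u w =? 1)%nat.

Lemma cop_div_gcd D n : (1 <= D)%nat -> Nat.gcd (D / Nat.gcd D n) (n / Nat.gcd D n) = 1%nat.
Proof. intros H. apply Nat.gcd_div_gcd; auto. rewrite Nat.gcd_eq_0. lia. Qed.

(* [d3 = gcd(D, n3)], [d2 = gcd(D / d3, n2)], [d1 = D / (d2 d3)] is the unique admissible
   factorisation of a divisor [D]. *)
Lemma gcd_split d e n : Nat.divide e n -> (1 <= n)%nat -> Nat.gcd d (n / e) = 1%nat ->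
  Nat.gcd (d * e) n = e.
Proof.
  intros [m Hm] Hn H. subst n. rewrite Nat.div_mul in H by nia.
  rewrite Nat.gcd_mul_mono_r, H. lia.
Qed.

Lemma gcd_mul_1 a b c : Nat.gcd a c = 1%nat -> Nat.gcd b c = 1%nat -> Nat.gcd (a * b) c = 1%nat.
Proof.
  intros H1 H2. apply Nat.divide_1_r. rewrite <- H2. apply Nat.gcd_greatest; [|apply Nat.gcd_divide_r].
  apply (Nat.gauss _ a); [apply Nat.gcd_divide_l|].
  apply Nat.divide_1_r. rewrite <- H1. apply Nat.gcd_greatest; [apply Nat.gcd_divide_r|].
  eapply Nat.divide_trans; [apply Nat.gcd_divide_l|apply Nat.gcd_divide_r].
Qed.

Lemma gcd_mul_1_l a b c : Nat.gcd (a * b) c = 1%nat -> Nat.gcd a c = 1%nat.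
Proof.
  intros H. apply Nat.divide_1_r. rewrite <- H. apply Nat.gcd_greatest; [|apply Nat.gcd_divide_r].
  apply Nat.divide_mul_l, Nat.gcd_divide_l.
Qed.

Lemma tau_triples n1 n2 n3 : (1 <= n1)%nat -> (1 <= n2)%nat -> (1 <= n3)%nat ->
  tauN (n1 * n2 * n3) = Sum (divs n1) (fun d1 => Sum (divs n2) (fun d2 => Sum (divs n3) (fun d3 =>
    iv (cop d1 (n2 / d2)) * iv (cop d1 (n3 / d3)) * iv (cop d2 (n3 / d3))))).
Proof.
  intros H1 H2 H3.
  set (l := filter (fun t => let '(d1, (d2, d3)) := t in
      (cop d1 (n2 / d2) && cop d1 (n3 / d3) && cop d2 (n3 / d3))%bool)
      (list_prod (divs n1) (list_prod (divs n2) (divs n3)))).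
  replace (tauN (n1 * n2 * n3)) with (INR (length l)).
  { unfold l. rewrite length_filter_Sum, Sum_list_prod. apply Sum_ext. intros d1 _.
    rewrite Sum_list_prod. apply Sum_ext. intros d2 _. apply Sum_ext. intros d3 _.
    rewrite !iv_and. auto. }
  set (phi := fun t : nat * (nat * nat) => let '(d1, (d2, d3)) := t in (d1 * d2 * d3)%nat).
  assert (Hl : forall d1 d2 d3, In (d1, (d2, d3)) l <-> (Nat.divide d1 n1 /\ Nat.divide d2 n2 /\ Nat.divide d3 n3) /\
     Nat.gcd d1 (n2 / d2) = 1%nat /\ Nat.gcd d1 (n3 / d3) = 1%nat /\ Nat.gcd d2 (n3 / d3) = 1%nat).
  { intros. unfold l, cop. rewrite filter_In, !in_prod_iff, !Bool.andb_true_iff, !Nat.eqb_eq, !in_divs by auto. tauto. }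
  assert (HN : (1 <= n1 * n2 * n3)%nat) by nia.
  assert (Hnd : NoDup l).
  { apply NoDup_filter, NoDup_list_prod; [|apply NoDup_list_prod]; apply NoDup_divs. }
  unfold tauN. f_equal. apply Nat.le_antisymm.
  - apply (inj_length phi); auto.
    + intros [d1 [d2 d3]] H. apply Hl in H. apply in_divs; auto. simpl.
      destruct H as [[[x Hx] [[y Hy] [z Hz]]] _].
      exists (x * y * z)%nat. subst. nia.
    + intros [d1 [d2 d3]] [e1 [e2 e3]] Hd He E. apply Hl in Hd. apply Hl in He. simpl in E.
      destruct Hd as [[A1 [A2 A3]] [B1 [B2 B3]]]. destruct He as [[C1 [C2 C3]] [D1 [D2 D3]]].
      pose proof (divs_pos _ _ H1 A1). pose proof (divs_pos _ _ H2 A2). pose proof (divs_pos _ _ H3 A3).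
      pose proof (divs_pos _ _ H1 C1). pose proof (divs_pos _ _ H2 C2). pose proof (divs_pos _ _ H3 C3).
      assert (E3 : d3 = e3).
      { transitivity (Nat.gcd (d1 * d2 * d3) n3); [symmetry|rewrite E]; apply gcd_split; auto;
          apply gcd_mul_1; auto. }
      subst e3. assert (E' : (d1 * d2 = e1 * e2)%nat) by nia.
      assert (E2 : d2 = e2).
      { transitivity (Nat.gcd (d1 * d2) n2); [symmetry|rewrite E']; apply gcd_split; auto. }
      subst e2. assert (d1 = e1) by nia. congruence.
  - apply Nat.le_trans with (length (map phi l)); [|rewrite length_map; auto].
    apply NoDup_incl_length; [apply NoDup_divs|]. intros D HD. apply in_divs in HD; auto.
    pose proof (divs_pos _ _ HN HD) as HDp. apply in_map_iff.
    pose proof (cop_div_gcd D n3 ltac:(lia)) as K3.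
    destruct (Nat.gcd_divide_l D n3) as [D' HD']. destruct (Nat.gcd_divide_r D n3) as [m3 Hm3].
    set (d3 := Nat.gcd D n3) in *. clearbody d3.
    assert (d3 <> 0)%nat by (intros ->; lia).
    rewrite HD', Hm3 in K3 at 1. rewrite !Nat.div_mul in K3 by auto.
    assert (HD'p : (1 <= D')%nat) by nia.
    pose proof (cop_div_gcd D' n2 HD'p) as K2.
    destruct (Nat.gcd_divide_l D' n2) as [d1 Hd1]. destruct (Nat.gcd_divide_r D' n2) as [m2 Hm2].
    set (d2 := Nat.gcd D' n2) in *. clearbody d2.
    assert (d2 <> 0)%nat by (intros ->; lia).
    rewrite Hd1, Hm2 in K2 at 1. rewrite !Nat.div_mul in K2 by auto.
    exists (d1, (d2, d3)). split; [simpl; nia|]. apply Hl.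
    assert (HD2 : Nat.divide D' (n1 * n2)).
    { apply (Nat.gauss D' m3); auto. destruct HD as [z Hz]. exists z. apply (Nat.mul_cancel_r _ _ d3); auto.
      subst D n3. nia. }
    assert (HD1 : Nat.divide d1 n1).
    { apply (Nat.gauss d1 m2); auto. destruct HD2 as [z Hz]. exists z. apply (Nat.mul_cancel_r _ _ d2); auto.
      subst D' n2. nia. }
    repeat split; auto; try (eexists; eauto; fail).
    + rewrite Hm2, Nat.div_mul by auto. auto.
    + rewrite Hm3, Nat.div_mul by auto. rewrite Hd1 in K3. apply gcd_mul_1_l in K3; auto.
    + rewrite Hm3, Nat.div_mul by auto. rewrite Hd1, Nat.mul_comm in K3. apply gcd_mul_1_l in K3; auto.
Qed.

(** Writing [d = c * m], the condition that [a] divides the cofactor [n / d] becomes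
    [a * c * m | n]; the substitution is a bijection. *)
Lemma Sum_divs_tcount a c n Y : (1 <= n <= Y)%nat -> (1 <= a)%nat -> (1 <= c)%nat ->
  Sum (divs n) (fun d => iv (divb a (n / d)) * iv (divb c d)) = tcount Y (a * c) n.
Proof.
  intros Hn Ha Hc. unfold tcount.
  rewrite (Sum_ext _ _ (fun d => iv (divb a (n / d) && divb c d))) by (intros; rewrite iv_and; auto).
  rewrite <- !length_filter_Sum. f_equal.
  rewrite <- (length_map (fun m => (c * m)%nat) (filter _ (seq 1 Y))).
  apply Permutation_length. apply NoDup_Permutation.
  - apply NoDup_filter, NoDup_divs.
  - apply NoDup_map_on; [intros; nia|apply NoDup_filter, seq_NoDup].
  - intros x. rewrite in_map_iff, filter_In, in_divs, Bool.andb_true_iff, !divb_iff by lia. split.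
    + intros [[z Hz] [Hx1 [m Hm]]]. exists m. split; [lia|]. rewrite filter_In, in_seq, divb_iff.
      rewrite Hz, Nat.div_mul in Hx1 by nia. destruct Hx1 as [w Hw].
      assert (1 <= z)%nat by (destruct z; lia). assert (1 <= x)%nat by (destruct x; lia).
      assert (1 <= m)%nat by (destruct m; lia).
      assert (x <= n)%nat by nia. assert (m <= x)%nat by nia. split; [lia|]. exists w. rewrite Hz, Hw, Hm. ring.
    + intros [m [<- Hm]]. rewrite filter_In, in_seq, divb_iff in Hm. destruct Hm as [Hm [z Hz]].
      assert (n = z * a * (c * m))%nat by nia. split; [exists (z * a)%nat; auto|]. split; [|exists m; lia].
      rewrite H, Nat.div_mul by nia. exists z; auto.
Qed.

Lemma iv_lcm a b d : iv (divb (Nat.lcm a b) d) = iv (divb a d) * iv (divb b d).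
Proof.
  rewrite <- iv_and. f_equal. apply Bool.eq_iff_eq_true.
  rewrite Bool.andb_true_iff, !divb_iff. split.
  - intros H. split; eapply Nat.divide_trans; eauto; [apply Nat.divide_lcm_l|apply Nat.divide_lcm_r].
  - intros []. apply Nat.lcm_least; auto.
Qed.

Lemma lcm_pos a b : (1 <= a)%nat -> (1 <= b)%nat -> (1 <= Nat.lcm a b)%nat.
Proof. intros. destruct (Nat.lcm a b) eqn:E; [apply Nat.lcm_eq_0 in E; lia|lia]. Qed.

Definition Sum3 {A} (l : list A) (f : A -> A -> A -> R) : R :=
  Sum l (fun a => Sum l (fun b => Sum l (fun c => f a b c))).

Lemma Sum3_ext {A} (l : list A) f g :
  (forall a b c, In a l -> In b l -> In c l -> f a b c = g a b c) -> Sum3 l f = Sum3 l g.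
Proof. intros H. do 3 (apply Sum_ext; intros). auto. Qed.

Lemma Sum3_le {A} (l : list A) f g :
  (forall a b c, In a l -> In b l -> In c l -> f a b c <= g a b c) -> Sum3 l f <= Sum3 l g.
Proof. intros H. do 3 (apply Sum_le; intros). auto. Qed.

Lemma Sum3_prod {A} (l : list A) f g h :
  Sum3 l (fun a b c => f a * g b * h c) = Sum l f * Sum l g * Sum l h.
Proof.
  unfold Sum3. rewrite Sum_mult, <- Sum_scal_r. apply Sum_ext. intros a _.
  rewrite <- Sum_scal_r. apply Sum_ext. intros b _. rewrite Sum_scal. auto.
Qed.

Lemma Sum3_scal {A} (l : list A) c f : Sum3 l (fun x y z => c * f x y z) = c * Sum3 l f.
Proof.
  unfold Sum3. rewrite <- Sum_scal. apply Sum_ext. intros. rewrite <- Sum_scal. apply Sum_ext. intros.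
  apply Sum_scal.
Qed.

Lemma Sum3_plus {A} (l : list A) f g : Sum3 l (fun x y z => f x y z + g x y z) = Sum3 l f + Sum3 l g.
Proof.
  unfold Sum3. rewrite <- Sum_plus. apply Sum_ext. intros. rewrite <- Sum_plus. apply Sum_ext. intros.
  apply Sum_plus.
Qed.

Lemma Sum3_swap1 {A B} (l : list A) (l' : list B) f :
  Sum l' (fun y => Sum3 l (fun a b c => f y a b c)) = Sum3 l (fun a b c => Sum l' (fun y => f y a b c)).
Proof.
  unfold Sum3. rewrite Sum_swap. apply Sum_ext. intros. rewrite Sum_swap. apply Sum_ext. intros.
  apply Sum_swap.
Qed.

Lemma Sum3_minus {A} (l : list A) f g : Sum3 l (fun x y z => f x y z - g x y z) = Sum3 l f - Sum3 l g.
Proof.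
  unfold Sum3. rewrite <- Sum_minus. apply Sum_ext. intros. rewrite <- Sum_minus. apply Sum_ext. intros.
  apply Sum_minus.
Qed.

Lemma Sum3_abs {A} (l : list A) f : Rabs (Sum3 l f) <= Sum3 l (fun x y z => Rabs (f x y z)).
Proof.
  unfold Sum3. eapply Rle_trans; [apply Sum_abs|]. apply Sum_le. intros.
  eapply Rle_trans; [apply Sum_abs|]. apply Sum_le. intros. apply Sum_abs.
Qed.

(* A divisor [D] of [n1 n2 n3] corresponds to a unique triple [di | ni] with [gcd(d1, n2/d2)],
   [gcd(d1, n3/d3)] and [gcd(d2, n3/d3)] equal to 1; Moebius inversion removes the three coprimality
   conditions. *)
Lemma tau3_formula n1 n2 n3 Y : (1 <= n1 <= Y)%nat -> (1 <= n2 <= Y)%nat -> (1 <= n3 <= Y)%nat ->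
  tauN (n1 * n2 * n3) = Sum3 (seq 1 Y) (fun a b c => mu a * mu b * mu c *
    (tcount Y (Nat.lcm a b) n1 * tcount Y (a * c) n2 * tcount Y (Nat.lcm b c) n3)).
Proof.
  intros H1 H2 H3. rewrite tau_triples by lia.
  rewrite (Sum_ext _ _ (fun d1 => Sum3 (seq 1 Y) (fun a b c => Sum (divs n2) (fun d2 => Sum (divs n3) (fun d3 =>
    (mu a * (iv (divb a d1) * iv (divb a (n2 / d2)))) * (mu b * (iv (divb b d1) * iv (divb b (n3 / d3)))) *
    (mu c * (iv (divb c d2) * iv (divb c (n3 / d3))))))))).
  2:{ intros d1 Hd1. rewrite <- Sum3_swap1. apply Sum_ext. intros d2 Hd2. rewrite <- Sum3_swap1.
      apply Sum_ext. intros d3 Hd3. rewrite Sum3_prod.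
      apply in_divs in Hd1; [|lia]. apply in_divs in Hd2; [|lia]. apply in_divs in Hd3; [|lia].
      assert (P : forall n d, (1 <= n <= Y)%nat -> Nat.divide d n -> (1 <= n / d <= Y)%nat).
      { intros n d Hn [z Hz]. assert (d <> 0)%nat by (intros ->; lia). assert (z <> 0)%nat by (intros ->; lia).
        subst n. rewrite Nat.div_mul by auto. nia. }
      pose proof (divs_pos _ _ (proj1 H1) Hd1). pose proof (divs_pos _ _ (proj1 H2) Hd2).
      unfold cop. rewrite !(mu_coprime _ _ Y); auto; lia. }
  rewrite Sum3_swap1. apply Sum3_ext. intros a b c Ha Hb Hc. apply in_seq in Ha, Hb, Hc.
  pose proof (lcm_pos a b ltac:(lia) ltac:(lia)). pose proof (lcm_pos b c ltac:(lia) ltac:(lia)).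
  (* In the first and third places one of the two conditions is absent; divisibility by 1 is
     inserted so that [Sum_divs_tcount] applies uniformly. Only [n2] receives conditions on both
     [d2] and its cofactor, hence the product [a * c] there and lcms elsewhere. *)
  rewrite <- (Nat.mul_1_l (Nat.lcm a b)), <- (Nat.mul_1_r (Nat.lcm b c)).
  rewrite <- !Sum_divs_tcount by lia.
  rewrite (Sum_mult (divs n1)), <- Sum_scal_r, <- Sum_scal. apply Sum_ext. intros d1 _.
  rewrite <- Sum_scal_r, <- Sum_scal. apply Sum_ext. intros d2 _.
  rewrite <- Sum_scal, <- Sum_scal. apply Sum_ext. intros d3 _.
  rewrite !iv_lcm. change (divb 1 (n1 / d1)) with ((n1 / d1) mod 1 =? 0)%nat.
  change (divb 1 d3) with (d3 mod 1 =? 0)%nat. rewrite !Nat.mod_1_r. simpl. ring.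
Qed.

(* The complementary divisor [N / (d m)] of [N / d] pairs [m < sqrt (N / d)] (the term [b = 1])
   with [m > sqrt (N / d)]. *)
Lemma hyperbola d N Y : (1 <= d)%nat -> (1 <= N <= Y)%nat ->
  tcount Y d N = Sum [0%nat; 1%nat] (fun b => Sum (seq 1 Y) (fun m =>
    iv (divb (d * m) N) * iv (d * m * m + b <=? N)%nat)).
Proof.
  intros Hd HN. unfold tcount.
  destruct (classic (Nat.divide d N)) as [[n Hn]|H].
  2:{ assert (Z0 : forall m, iv (divb (d * m) N) = 0).
      { intros m. destruct (divb (d * m) N) eqn:E; auto. apply divb_iff in E. destruct H.
        eapply Nat.divide_trans; [|exact E]. apply Nat.divide_factor_l. }
      rewrite Sum_zero by auto. symmetry. apply Sum_zero. intros b _. apply Sum_zero. intros m _.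
      rewrite Z0. lra. }
  subst N. assert (Hn : (1 <= n <= Y)%nat) by nia.
  assert (Ed : forall m, divb (d * m) (n * d) = divb m n).
  { intros m. apply Bool.eq_iff_eq_true. rewrite !divb_iff, (Nat.mul_comm n d).
    apply Nat.mul_divide_cancel_l. lia. }
  rewrite (Sum_ext _ _ (fun m => iv (divb m n) * 1)) by (intros; rewrite Ed; lra).
  rewrite <- Sum_divs by auto.
  rewrite (Sum_ext [0%nat; 1%nat] _ (fun b => Sum (divs n) (fun m => iv (m * m + b <=? n)%nat))).
  2:{ intros b Hb. rewrite (Sum_divs n Y) by auto. apply Sum_ext. intros m _. rewrite Ed. do 2 f_equal.
      apply Bool.eq_iff_eq_true. rewrite !Nat.leb_le. destruct Hb as [<-|[<-|[]]]; split; intros; nia. }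
  unfold Sum at 2. cbn [map fold_right]. rewrite Rplus_0_r.
  apply Rplus_eq_reg_r with (- Sum (divs n) (fun m => iv (m * m + 0 <=? n)%nat)).
  transitivity (Sum (divs n) (fun m => iv (n <? m * m)%nat)).
  { rewrite <- (Rminus_def (Sum _ _)), <- Sum_minus. apply Sum_ext. intros m _. rewrite Nat.add_0_r.
    destruct (Nat.leb_spec (m * m) n); destruct (Nat.ltb_spec n (m * m)); simpl; try lra; lia. }
  transitivity (Sum (divs n) (fun m => iv (m * m + 1 <=? n)%nat)); [|lra].
  rewrite <- !length_filter_Sum. f_equal.
  assert (Hinv : forall m, Nat.divide m n -> (n / m * m = n)%nat /\ (1 <= m)%nat).
  { intros m [z Hz]. assert (m <> 0)%nat by (intros ->; lia). subst n. rewrite Nat.div_mul by auto. lia. }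
  assert (Hdd : forall m, Nat.divide m n -> Nat.divide (n / m) n).
  { intros m Hm. destruct (Hinv m Hm). exists m. lia. }
  apply Nat.le_antisymm; apply (inj_length (fun m => n / m)%nat); try apply NoDup_filter, NoDup_divs.
  - intros m. rewrite !filter_In, !in_divs, Nat.ltb_lt, Nat.leb_le by lia. intros [Hm Hl].
    split; auto. destruct (Hinv m Hm). nia.
  - intros x y Hx Hy. rewrite !filter_In, !in_divs in * by lia. intros E.
    destruct (Hinv x (proj1 Hx)), (Hinv y (proj1 Hy)). rewrite E in *. nia.
  - intros m. rewrite !filter_In, !in_divs, Nat.ltb_lt, Nat.leb_le by lia. intros [Hm Hl].
    split; auto. destruct (Hinv m Hm). nia.
  - intros x y Hx Hy. rewrite !filter_In, !in_divs in * by lia. intros E.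
    destruct (Hinv x (proj1 Hx)), (Hinv y (proj1 Hy)). rewrite E in *. nia.
Qed.

(** * Lattice points in convex polygons *)

Definition zseq (X : nat) : list Z := map Z.of_nat (seq 1 X).
Definition box (X : nat) : list (Z * Z) := list_prod (zseq X) (zseq X).

Definition inR (cs : list (Z * Z * Z)) (x : Z * Z) : bool :=
  forallb (fun c => let '(A, B, C) := c in (C <=? A * fst x + B * snd x)%Z) cs.

Lemma in_box X x : In x (box X) <-> (1 <= fst x <= Z.of_nat X)%Z /\ (1 <= snd x <= Z.of_nat X)%Z.
Proof.
  assert (H : forall z, In z (zseq X) <-> (1 <= z <= Z.of_nat X)%Z).
  { intros z. unfold zseq. rewrite in_map_iff. split.
    - intros [n [<- Hn]]. apply in_seq in Hn. lia.
    - intros Hz. exists (Z.to_nat z). rewrite in_seq. lia. }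
  destruct x as [x1 x2]. unfold box. rewrite in_prod_iff, !H. tauto.
Qed.

Lemma NoDup_zseq X : NoDup (zseq X).
Proof. apply NoDup_map_on; [intros; lia|apply seq_NoDup]. Qed.

Lemma NoDup_box X : NoDup (box X).
Proof. apply NoDup_list_prod; apply NoDup_zseq. Qed.

(** * Plane lattices and reduced bases *)

Lemma exists_min_Z {A} (P : A -> Prop) (f : A -> Z) :
  (forall x, P x -> (0 <= f x)%Z) -> (exists x, P x) ->
  exists x, P x /\ forall y, P y -> (f x <= f y)%Z.
Proof.
  intros Hf [x Hx]. apply NNPP. intros C.
  assert (H : forall n y, P y -> (Z.to_nat (f y) <= n)%nat -> False).
  { induction n; intros y Hy Hn.
    - apply C. exists y. split; auto. intros z Hz. pose proof (Hf _ Hz). pose proof (Hf _ Hy). lia.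
    - apply C. exists y. split; auto. intros z Hz. apply Z.nlt_ge. intros Hlt.
      apply (IHn z); auto. pose proof (Hf _ Hz). lia. }
  apply (H _ x Hx (le_n _)).
Qed.

Lemma exists_min_list {A} (l : list A) (f : A -> Z) :
  l <> [] -> exists x, In x l /\ forall y, In y l -> (f x <= f y)%Z.
Proof.
  induction l; intros H; [congruence|]. destruct l.
  - exists a. split; [left; auto|]. intros y [<-|[]]. lia.
  - destruct IHl as [x [Hx Hm]]; [discriminate|]. destruct (Z.le_gt_cases (f a) (f x)).
    + exists a. split; [left; auto|]. intros y [<-|Hy]; [lia|]. specialize (Hm _ Hy). lia.
    + exists x. split; [right; auto|]. intros y [<-|Hy]; [lia|]. auto.
Qed.

(** Closure under subtraction makes a subgroup; the second clause gives full rank, hence a nonzero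
    vector and a positive determinant to minimise. Membership is Boolean so that points can be
    counted with [iv]. *)
Definition is_lattice (Lam : Z * Z -> bool) : Prop :=
  (forall x1 x2 y1 y2, Lam (x1, x2) = true -> Lam (y1, y2) = true -> Lam (x1 - y1, x2 - y2)%Z = true) /\
  exists N, (1 <= N)%Z /\ Lam (N, 0%Z) = true /\ Lam (0%Z, N) = true.

Lemma lat_sub Lam (HL : is_lattice Lam) x1 x2 y1 y2 : Lam (x1, x2) = true -> Lam (y1, y2) = true -> Lam (x1 - y1, x2 - y2)%Z = true.
Proof. apply HL. Qed.

Lemma lat_0 Lam (HL : is_lattice Lam) : Lam (0, 0)%Z = true.
Proof. destruct HL as [H [N [_ [HN _]]]]. pose proof (H _ _ _ _ HN HN). rewrite !Z.sub_diag in H0. auto. Qed.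

Lemma lat_opp Lam (HL : is_lattice Lam) x1 x2 : Lam (x1, x2) = true -> Lam (- x1, - x2)%Z = true.
Proof. intros H. apply (lat_sub Lam HL _ _ _ _ (lat_0 Lam HL) H). Qed.

Lemma lat_add Lam (HL : is_lattice Lam) x1 x2 y1 y2 : Lam (x1, x2) = true -> Lam (y1, y2) = true -> Lam (x1 + y1, x2 + y2)%Z = true.
Proof. intros H1 H2. apply (lat_opp Lam HL) in H2. pose proof (lat_sub Lam HL _ _ _ _ H1 H2). rewrite !Z.sub_opp_r in H. auto. Qed.

Lemma lat_mul Lam (HL : is_lattice Lam) k x1 x2 : Lam (x1, x2) = true -> Lam (k * x1, k * x2)%Z = true.
Proof.
  intros H. assert (P : forall n, Lam (Z.of_nat n * x1, Z.of_nat n * x2)%Z = true).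
  { induction n; [apply lat_0; auto|]. rewrite Nat2Z.inj_succ, !Z.mul_succ_l. apply lat_add; auto. }
  destruct (Z.le_gt_cases 0 k) as [Hk|Hk].
  - rewrite <- (Z2Nat.id k) by auto. apply P.
  - replace (k * x1)%Z with (- (Z.of_nat (Z.to_nat (- k)) * x1))%Z by (rewrite Z2Nat.id by lia; ring).
    replace (k * x2)%Z with (- (Z.of_nat (Z.to_nat (- k)) * x2))%Z by (rewrite Z2Nat.id by lia; ring).
    apply lat_opp; auto.
Qed.

Lemma lat_add_iff Lam (HL : is_lattice Lam) x1 x2 y1 y2 : Lam (y1, y2) = true -> Lam (x1 + y1, x2 + y2)%Z = Lam (x1, x2).
Proof.
  intros H. apply Bool.eq_iff_eq_true. split; intros H1.
  - pose proof (lat_sub Lam HL _ _ _ _ H1 H). rewrite !Z.add_simpl_r in H0. auto.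
  - apply lat_add; auto.
Qed.

(** [v] is a shortest nonzero vector and [w] minimises the positive determinant with [v]. For
    generation, minimality of the determinant removes a multiple of [w], leaving a vector parallel
    to [v]; rounding off a multiple of [v] leaves one too short to be nonzero. *)
Lemma lat_basis Lam (HL : is_lattice Lam) : exists v1 v2 w1 w2 : Z,
  Lam (v1, v2) = true /\ Lam (w1, w2) = true /\ (v1 <> 0 \/ v2 <> 0)%Z /\
  (0 < v1 * w2 - v2 * w1)%Z /\ (v1 * v1 + v2 * v2 <= 2 * (v1 * w2 - v2 * w1))%Z /\
  (forall x1 x2, Lam (x1, x2) = true -> exists j r, x1 = j * w1 + r * v1 /\ x2 = j * w2 + r * v2)%Z.
Proof.
  destruct (proj2 HL) as [N [HN [HN1 HN2]]].
  destruct (exists_min_Z (fun x : Z * Z => Lam x = true /\ (fst x <> 0 \/ snd x <> 0)%Z)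
     (fun x => fst x * fst x + snd x * snd x)%Z) as [[v1 v2] [[Hv Hv0] Hmin]]; [intros; nia| |].
  { exists (N, 0%Z). simpl. split; auto. lia. }
  simpl in Hv0, Hmin.
  assert (Hmin' : forall y1 y2, Lam (y1, y2) = true -> (y1 * y1 + y2 * y2 < v1 * v1 + v2 * v2)%Z -> y1 = 0%Z /\ y2 = 0%Z).
  { intros y1 y2 Hy Hlt. destruct (Z.eq_dec y1 0), (Z.eq_dec y2 0); auto;
      specialize (Hmin (y1, y2)); simpl in Hmin; exfalso; apply (Zlt_not_le _ _ Hlt), Hmin; auto. }
  destruct (exists_min_Z (fun x : Z * Z => Lam x = true /\ (0 < v1 * snd x - v2 * fst x)%Z)
     (fun x => v1 * snd x - v2 * fst x)%Z) as [[w1 w2] [[Hw Hw0] Hwmin]]; [intros; lia| |].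
  { destruct (Z.lt_trichotomy v1 0) as [H|[H|H]].
    - exists (-1 * 0, -1 * N)%Z. split; [apply lat_mul; auto|cbn [fst snd]; nia].
    - destruct (Z.lt_trichotomy v2 0) as [H'|[H'|H']]; [|lia|].
      + exists (N, 0%Z). split; auto. cbn [fst snd]; nia.
      + exists (-1 * N, -1 * 0)%Z. split; [apply lat_mul; auto|cbn [fst snd]; nia].
    - exists (0%Z, N). split; auto. cbn [fst snd]; nia. }
  simpl in Hw0, Hwmin.
  set (V := (v1 * v1 + v2 * v2)%Z) in *. assert (HV : (0 < V)%Z) by (unfold V; nia).
  (* subtracting the nearest multiple of [v] *)
  assert (Hround : forall x1 x2, exists r, (2 * Z.abs ((x1 - r * v1) * v1 + (x2 - r * v2) * v2) <= V)%Z).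
  { intros x1 x2. exists ((2 * (x1 * v1 + x2 * v2) + V) / (2 * V))%Z.
    pose proof (Z.div_mod (2 * (x1 * v1 + x2 * v2) + V) (2 * V) ltac:(lia)).
    pose proof (Z.mod_pos_bound (2 * (x1 * v1 + x2 * v2) + V) (2 * V) ltac:(lia)).
    set (q := ((2 * (x1 * v1 + x2 * v2) + V) / (2 * V))%Z) in *.
    replace ((x1 - q * v1) * v1 + (x2 - q * v2) * v2)%Z with (x1 * v1 + x2 * v2 - q * V)%Z by (unfold V; ring).
    lia. }
  set (h := (v1 * w2 - v2 * w1)%Z) in *.
  exists v1, v2, w1, w2. repeat split; auto.
  - destruct (Hround w1 w2) as [r Hr].
    set (u1 := (w1 - r * v1)%Z) in *. set (u2 := (w2 - r * v2)%Z) in *.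
    assert (Hu : Lam (u1, u2) = true) by (apply lat_sub; auto; apply lat_mul; auto).
    assert (Hh : (v1 * u2 - v2 * u1 = h)%Z) by (unfold u1, u2, h; ring).
    assert (HuV : (V <= u1 * u1 + u2 * u2)%Z).
    { apply Z.nlt_ge. intros Hlt. destruct (Hmin' _ _ Hu Hlt) as [E1 E2]. rewrite E1, E2 in Hh. lia. }
    (* Lagrange's identity. With [2 * |s| <= V] and [|u|^2 >= V] it gives [V^2 <= V^2 / 4 + h^2],
       more than enough for [V <= 2 * h]. *)
    assert (E : ((u1 * u1 + u2 * u2) * V = (u1 * v1 + u2 * v2) * (u1 * v1 + u2 * v2) + h * h)%Z)
      by (rewrite <- Hh; unfold V; ring).
    change (v1 * v1 + v2 * v2)%Z with V. fold h. set (s := (u1 * v1 + u2 * v2)%Z) in *. clearbody h V s u1 u2.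
    assert (4 * (s * s) <= V * V)%Z by nia.
    assert (V * V <= (u1 * u1 + u2 * u2) * V)%Z by nia. nia.
  - intros x1 x2 Hx. set (p := (v1 * x2 - v2 * x1)%Z).
    pose proof (Z.div_mod p h ltac:(lia)) as Hdm. pose proof (Z.mod_pos_bound p h ltac:(lia)) as Hmb.
    set (j := (p / h)%Z) in *.
    assert (Hy : Lam (x1 - j * w1, x2 - j * w2)%Z = true) by (apply lat_sub; auto; apply lat_mul; auto).
    set (y1 := (x1 - j * w1)%Z) in *. set (y2 := (x2 - j * w2)%Z) in *.
    assert (Hp : (v1 * y2 - v2 * y1 = p mod h)%Z).
    { replace (v1 * y2 - v2 * y1)%Z with (p - j * h)%Z by (unfold y1, y2, p, h; ring). lia. }
    assert (Hp0 : (v1 * y2 - v2 * y1 = 0)%Z).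
    { destruct (Z.eq_dec (v1 * y2 - v2 * y1) 0); auto. specialize (Hwmin (y1, y2)). simpl in Hwmin.
      assert (h <= v1 * y2 - v2 * y1)%Z by (apply Hwmin; split; auto; lia). lia. }
    destruct (Hround y1 y2) as [r Hr].
    set (z1 := (y1 - r * v1)%Z) in *. set (z2 := (y2 - r * v2)%Z) in *.
    assert (Hz : Lam (z1, z2) = true) by (apply lat_sub; auto; apply lat_mul; auto).
    assert (E : ((z1 * z1 + z2 * z2) * V = (z1 * v1 + z2 * v2) * (z1 * v1 + z2 * v2))%Z).
    { replace ((z1 * z1 + z2 * z2) * V)%Z with ((z1 * v1 + z2 * v2) * (z1 * v1 + z2 * v2) + (v1 * y2 - v2 * y1) * (v1 * y2 - v2 * y1))%Z
        by (unfold V, z1, z2; ring). rewrite Hp0. ring. }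
    destruct (Hmin' _ _ Hz) as [E1 E2].
    { set (s := (z1 * v1 + z2 * v2)%Z) in *. clearbody V s z1 z2.
      assert (4 * (s * s) <= V * V)%Z by nia. nia. }
    exists j, r. unfold z1, z2, y1, y2 in *. lia.
Qed.

Definition padd (x t : Z * Z) : Z * Z := (fst x + fst t, snd x + snd t)%Z.

(** The lines are the level sets of the determinant with [v], hence parallel to [v]. The parameter
    [t] selects a coset: the point is shifted by [t] before membership is tested. *)
Definition line_pts (cs : list (Z * Z * Z)) X (Lam : Z * Z -> bool) (v1 v2 : Z) (t : Z * Z) (s : Z) : list (Z * Z) :=
  filter (fun x => inR cs x && Lam (padd x t) && (v1 * snd x - v2 * fst x =? s)%Z)%bool (box X).

Lemma in_line_pts cs X Lam v1 v2 t s x : In x (line_pts cs X Lam v1 v2 t s) <->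
  In x (box X) /\ inR cs x = true /\ Lam (padd x t) = true /\ (v1 * snd x - v2 * fst x = s)%Z.
Proof. unfold line_pts. rewrite filter_In, !Bool.andb_true_iff, Z.eqb_eq. tauto. Qed.

Lemma NoDup_line_pts cs X Lam v1 v2 t s : NoDup (line_pts cs X Lam v1 v2 t s).
Proof. apply NoDup_filter, NoDup_box. Qed.

Lemma inR_iff cs x : inR cs x = true <->
  forall A B C, In (A, B, C) cs -> (C <= A * fst x + B * snd x)%Z.
Proof.
  unfold inR. rewrite forallb_forall. split.
  - intros H A B C Hc. specialize (H _ Hc). simpl in H. apply Z.leb_le in H. auto.
  - intros H [[A B] C] Hc. apply Z.leb_le. auto.
Qed.

Definition lat_gen (Lam : Z * Z -> bool) (v1 v2 w1 w2 : Z) : Prop :=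
  is_lattice Lam /\ Lam (v1, v2) = true /\ Lam (w1, w2) = true /\ (v1 <> 0 \/ v2 <> 0)%Z /\
  (0 < v1 * w2 - v2 * w1)%Z /\ (v1 * v1 + v2 * v2 <= 2 * (v1 * w2 - v2 * w1))%Z /\
  (forall x1 x2, Lam (x1, x2) = true -> exists j r, x1 = j * w1 + r * v1 /\ x2 = j * w2 + r * v2)%Z.

(** Two points of one coset on the same line differ by an integral multiple of [v]. Ordering them by
    the scalar product [psi] with [v], [K] points need at least [K - 1] steps between the
    extremes. *)
Lemma line_spread cs X Lam v1 v2 w1 w2 t s K : lat_gen Lam v1 v2 w1 w2 ->
  (1 <= K)%nat -> (K <= length (line_pts cs X Lam v1 v2 t s))%nat ->
  exists x r, In x (line_pts cs X Lam v1 v2 t s) /\ (Z.of_nat K - 1 <= r)%Z /\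
    In (padd x (r * v1, r * v2)%Z) (line_pts cs X Lam v1 v2 t s).
Proof.
  intros (HL & Hv & Hw & Hv0 & Hh & _ & Hgen) HK Hlen.
  set (l := line_pts cs X Lam v1 v2 t s) in *.
  set (V := (v1 * v1 + v2 * v2)%Z). assert (HV : (0 < V)%Z) by (unfold V; nia).
  set (psi := fun x : Z * Z => (v1 * fst x + v2 * snd x)%Z).
  destruct (exists_min_list l psi) as [x [Hx Hmin]].
  { intros E. rewrite E in Hlen. simpl in Hlen. lia. }
  assert (Hr : forall y, In y l -> exists r, (0 <= r)%Z /\ y = padd x (r * v1, r * v2)%Z).
  { intros y Hy. pose proof (Hmin y Hy) as Hp.
    apply in_line_pts in Hx. apply in_line_pts in Hy.
    destruct Hx as (_ & _ & Hx1 & Hx2). destruct Hy as (_ & _ & Hy1 & Hy2).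
    unfold padd in Hx1, Hy1. destruct x as [x1 x2], y as [y1 y2]. destruct t as [t1 t2]. unfold psi in Hp. cbn [fst snd] in *.
    pose proof (lat_sub Lam HL _ _ _ _ Hy1 Hx1) as Hd.
    destruct (Hgen _ _ Hd) as [j [r [E1 E2]]].
    assert (j * (v1 * w2 - v2 * w1) = 0)%Z.
    { replace (j * (v1 * w2 - v2 * w1))%Z with (v1 * (j * w2 + r * v2) - v2 * (j * w1 + r * v1))%Z by ring.
      rewrite <- E1, <- E2. lia. }
    assert (j = 0)%Z by nia. subst j. exists r. split.
    - assert (H0 : (0 <= r * V)%Z).
      { unfold V. replace (r * (v1 * v1 + v2 * v2))%Z with (v1 * (r * v1) + v2 * (r * v2))%Z by ring.
        replace (r * v1)%Z with (y1 - x1)%Z by lia. replace (r * v2)%Z with (y2 - x2)%Z by lia. lia. }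
      destruct (Z.le_gt_cases 0 r); auto. pose proof (Z.mul_neg_pos r V). lia.
    - unfold padd; cbn [fst snd]. f_equal; lia. }
  destruct (classic (exists r, (Z.of_nat K - 1 <= r)%Z /\ In (padd x (r * v1, r * v2)%Z) l)) as [[r [H1 H2]]|C].
  { exists x, r. auto. }
  exfalso. assert (length l <= length (seq 0 (K - 1)))%nat; [|rewrite length_seq in *; lia].
  apply (inj_length (fun y => Z.to_nat ((psi y - psi x) / V))).
  - apply NoDup_line_pts.
  - intros y Hy. destruct (Hr y Hy) as [r [Hr0 ->]]. apply in_seq.
    replace (psi (padd x (r * v1, r * v2)%Z) - psi x)%Z with (r * V)%Z by (unfold psi, padd, V; cbn [fst snd]; ring).
    rewrite Z.div_mul by lia. assert (r < Z.of_nat K - 1)%Z; [|lia].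
    apply Z.nle_gt. intros H. apply C. exists r. auto.
  - intros y z Hy Hz. destruct (Hr y Hy) as [r [Hr0 ->]]. destruct (Hr z Hz) as [r' [Hr0' ->]].
    replace (psi (padd x (r * v1, r * v2)%Z) - psi x)%Z with (r * V)%Z by (unfold psi, padd, V; cbn [fst snd]; ring).
    replace (psi (padd x (r' * v1, r' * v2)%Z) - psi x)%Z with (r' * V)%Z by (unfold psi, padd, V; cbn [fst snd]; ring).
    rewrite !Z.div_mul by lia. intros E. replace r' with r by lia. auto.
Qed.

(** Here [fP] and [fQ] are the slacks of one linear constraint at two points and [f] is its
    increment along [v]. If [f >= 0] moving forward is harmless; if [f < 0] the worst case is a
    shift by [K] steps, controlled by the far ends of both segments. *)
Lemma convex_aux (V a b E f fP fQ r1 r3 K : Z) : (0 < V)%Z -> (0 <= a)%Z -> (0 <= b)%Z ->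
  (0 <= K)%Z -> (K <= r1)%Z -> (K <= r3)%Z -> (0 <= fP)%Z -> (0 <= fQ)%Z ->
  (0 <= fP + r1 * f)%Z -> (0 <= fQ + r3 * f)%Z -> (0 <= E <= V * (a + b) * K)%Z ->
  (0 <= V * (a * fP + b * fQ) + E * f)%Z.
Proof.
  intros HV Ha Hb HK H1 H3 HP HQ HP' HQ' HE. destruct (Z.le_gt_cases 0 f) as [Hf|Hf].
  - apply Z.add_nonneg_nonneg; apply Z.mul_nonneg_nonneg; lia.
  - assert (r1 * f <= K * f)%Z by (apply Z.mul_le_mono_nonpos_r; lia).
    assert (r3 * f <= K * f)%Z by (apply Z.mul_le_mono_nonpos_r; lia).
    assert (V * (a + b) * K * f <= E * f)%Z by (apply Z.mul_le_mono_nonpos_r; lia).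
    assert (0 <= V * (a * (fP + K * f) + b * (fQ + K * f)))%Z; [|lia].
    apply Z.mul_nonneg_nonneg; [lia|].
    apply Z.add_nonneg_nonneg; apply Z.mul_nonneg_nonneg; lia.
Qed.

(* Convexity: the points found on the outer lines span segments whose convex hull meets the
   middle line in a segment long enough to contain [K - 1] points of the coset. *)
Lemma line_between cs X Lam v1 v2 w1 w2 t1 t2 t3 s1 s2 s3 y0 K : lat_gen Lam v1 v2 w1 w2 ->
  (forall x, inR cs x = true -> In x (box X)) ->
  (s1 <= s2)%Z -> (s2 <= s3)%Z -> (s1 < s3)%Z ->
  Lam (padd y0 t2) = true -> (v1 * snd y0 - v2 * fst y0 = s2)%Z ->
  (K <= length (line_pts cs X Lam v1 v2 t1 s1))%nat ->
  (K <= length (line_pts cs X Lam v1 v2 t3 s3))%nat ->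
  (K <= length (line_pts cs X Lam v1 v2 t2 s2) + 1)%nat.
Proof.
  intros HG Hbox H12 H23 H13 Hy0 Hs2 HK1 HK3. destruct K as [|K]; [lia|].
  assert (HSK : (1 <= S K)%nat) by lia.
  destruct (line_spread _ _ _ _ _ _ _ _ _ _ HG HSK HK1) as (P & r1 & HP & Hr1 & HP').
  destruct (line_spread _ _ _ _ _ _ _ _ _ _ HG HSK HK3) as (Q & r3 & HQ & Hr3 & HQ').
  apply in_line_pts in HP, HP', HQ, HQ'.
  destruct HP as (_ & HP & _ & HPs). destruct HP' as (_ & HP' & _ & _).
  destruct HQ as (_ & HQ & _ & HQs). destruct HQ' as (_ & HQ' & _ & _).
  destruct HG as (HL & Hv & _ & Hv0 & _).
  set (V := (v1 * v1 + v2 * v2)%Z). assert (HV : (0 < V)%Z) by (unfold V; nia).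
  destruct P as [p1 p2], Q as [q1 q2], y0 as [y1 y2], t2 as [u1 u2].
  unfold padd in HP', HQ', Hy0. cbn [fst snd] in *.
  set (a := (s3 - s2)%Z). set (b := (s2 - s1)%Z). set (sg := (a + b)%Z).
  assert (Ha : (0 <= a)%Z) by lia. assert (Hb : (0 <= b)%Z) by lia. assert (Hsg : (0 < sg)%Z) by lia.
  set (D := (sg * V)%Z). assert (HD : (0 < D)%Z) by (unfold D; nia).
  set (Az := (a * (v1 * p1 + v2 * p2) + b * (v1 * q1 + v2 * q2) - sg * (v1 * y1 + v2 * y2))%Z).
  (* The segment from [P] to [Q] meets the middle line at [y0] plus [Az / D] times [v]; [k0] is the
     ceiling of this quotient, the first coset point inside the convex hull. The rounding accounts
     for the one point lost in the conclusion. *)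
  set (k0 := (- ((- Az) / D))%Z).
  assert (Hk0 : (Az <= D * k0 < Az + D)%Z).
  { pose proof (Z.div_mod (- Az) D ltac:(lia)). pose proof (Z.mod_pos_bound (- Az) D HD). unfold k0. nia. }
  rewrite Nat.add_1_r. apply le_n_S. rewrite <- (length_seq K 0).
  apply (inj_length (fun i => (y1 + (k0 + Z.of_nat i) * v1, y2 + (k0 + Z.of_nat i) * v2)%Z)).
  - apply seq_NoDup.
  - intros i Hi. apply in_seq in Hi. set (k := (k0 + Z.of_nat i)%Z).
    assert (Hk : (Az <= D * k <= Az + D * Z.of_nat K)%Z) by (unfold k; nia).
    assert (HR : inR cs (y1 + k * v1, y2 + k * v2)%Z = true).
    { apply inR_iff. intros A B C Hc. cbn [fst snd].
      rewrite inR_iff in HP, HP', HQ, HQ'.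
      specialize (HP _ _ _ Hc). specialize (HP' _ _ _ Hc). specialize (HQ _ _ _ Hc). specialize (HQ' _ _ _ Hc).
      cbn [fst snd] in *.
      set (f := (A * v1 + B * v2)%Z).
      set (fP := (A * p1 + B * p2 - C)%Z). set (fQ := (A * q1 + B * q2 - C)%Z).
      set (fy := (A * (y1 + k * v1) + B * (y2 + k * v2) - C)%Z).
      assert (E : (V * (sg * fy) = V * (a * fP + b * fQ) + (D * k - Az) * f)%Z).
      { (* the difference is a combination of the [phi]-values, which cancel *)
        assert (E0 : (v1 * (sg * y2 - a * p2 - b * q2) - v2 * (sg * y1 - a * p1 - b * q1) = 0)%Z).
        { replace (v1 * (sg * y2 - a * p2 - b * q2) - v2 * (sg * y1 - a * p1 - b * q1))%Z with
            (sg * (v1 * y2 - v2 * y1) - a * (v1 * p2 - v2 * p1) - b * (v1 * q2 - v2 * q1))%Z by ring.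
          rewrite HPs, HQs, Hs2. unfold sg, a, b. ring. }
        replace (V * (sg * fy))%Z with (V * (a * fP + b * fQ) + (D * k - Az) * f +
          (v1 * (sg * y2 - a * p2 - b * q2) - v2 * (sg * y1 - a * p1 - b * q1)) * (v1 * B - v2 * A))%Z.
        - rewrite E0. ring.
        - unfold fy, fP, fQ, D, Az, f, V, sg. ring. }
      assert (HfP : (0 <= fP)%Z) by (unfold fP; lia). assert (HfQ : (0 <= fQ)%Z) by (unfold fQ; lia).
      assert (HfP' : (0 <= fP + r1 * f)%Z) by (unfold fP, f; nia).
      assert (HfQ' : (0 <= fQ + r3 * f)%Z) by (unfold fQ, f; nia).
      assert (0 <= fy)%Z; [|unfold fy in *; lia].
      assert (Hpos : (0 <= V * (a * fP + b * fQ) + (D * k - Az) * f)%Z).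
      { apply (convex_aux _ _ _ _ _ _ _ r1 r3 (Z.of_nat K)); lia. }
      rewrite <- E in Hpos. clear - Hpos HV Hsg. 
      apply Z.nlt_ge. intros Hlt. assert (sg * fy < 0)%Z by nia. nia. }
    apply in_line_pts. repeat split; auto.
    + unfold padd. cbn [fst snd].
      replace (y1 + k * v1 + u1)%Z with (y1 + u1 + k * v1)%Z by ring.
      replace (y2 + k * v2 + u2)%Z with (y2 + u2 + k * v2)%Z by ring.
      apply lat_add; auto. apply lat_mul; auto.
    + cbn [fst snd]. rewrite <- Hs2. ring.
  - intros i i' _ _ E. injection E; intros E2 E1. assert ((Z.of_nat i - Z.of_nat i') * v1 = 0)%Z by lia.
    assert ((Z.of_nat i - Z.of_nat i') * v2 = 0)%Z by lia. destruct Hv0; nia.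
Qed.

(** By [line_spread] two points of the box differ by at least [K - 1] copies of [v], and no
    coordinate can change by more than the side [X]. *)
Lemma line_max cs X Lam v1 v2 w1 w2 t s : lat_gen Lam v1 v2 w1 w2 -> (1 <= X)%nat ->
  INR (length (line_pts cs X Lam v1 v2 t s)) <= INR X / IZR (Z.max (Z.abs v1) (Z.abs v2)) + 1.
Proof.
  intros HG HX. set (M := Z.max (Z.abs v1) (Z.abs v2)).
  assert (HM : (1 <= M)%Z) by (destruct HG as (_ & _ & _ & Hv0 & _); unfold M; lia).
  assert (HM' : 1 <= IZR M) by (apply IZR_le; auto).
  set (K := length (line_pts cs X Lam v1 v2 t s)).
  destruct (Nat.eq_dec K 0) as [->|HK].
  { simpl. pose proof (pos_INR X). assert (0 <= INR X / IZR M) by (apply Rdiv_nonneg; lra). lra. }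
  assert (HK1 : (1 <= K)%nat) by lia.
  destruct (line_spread _ _ _ _ _ _ _ _ _ K HG HK1 (le_n _)) as (x & r & Hx & Hr & Hy).
  apply in_line_pts in Hx, Hy. destruct Hx as (Hx & _). destruct Hy as (Hy & _).
  apply in_box in Hx, Hy. unfold padd in Hy. cbn [fst snd] in Hy.
  assert (H : ((Z.of_nat K - 1) * M <= Z.of_nat X)%Z).
  { unfold M. destruct (Z.max_spec (Z.abs v1) (Z.abs v2)) as [[_ ->]|[_ ->]].
    - assert (Z.abs (r * v2) <= Z.of_nat X)%Z by lia. rewrite Z.abs_mul in *. nia.
    - assert (Z.abs (r * v1) <= Z.of_nat X)%Z by lia. rewrite Z.abs_mul in *. nia. }
  apply IZR_le in H. rewrite mult_IZR, minus_IZR, <- !INR_IZR_INZ in H.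
  assert (INR K - 1 <= INR X / IZR M); [|lra].
  apply Rmult_le_reg_r with (IZR M); [lra|]. unfold Rdiv. rewrite Rmult_assoc, Rinv_l; lra.
Qed.

Lemma exists_argmax (f : nat -> nat) n : (1 <= n)%nat ->
  exists p, (p < n)%nat /\ forall i, (i < n)%nat -> (f i <= f p)%nat.
Proof.
  induction n as [|n IH]; intros Hn; [lia|]. destruct n.
  - exists 0%nat. split; [lia|]. intros i Hi. replace i with 0%nat by lia. lia.
  - destruct IH as [p [Hp Hm]]; [lia|]. destruct (Nat.le_gt_cases (f (S n)) (f p)).
    + exists p. split; [lia|]. intros i Hi. destruct (Nat.eq_dec i (S n)); [subst; auto|apply Hm; lia].
    + exists (S n). split; [lia|]. intros i Hi. destruct (Nat.eq_dec i (S n)); [subst; auto|].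
      specialize (Hm i ltac:(lia)). lia.
Qed.

(** Terms before the peak [p] are charged to the same index of [g], terms after it to the preceding
    index, so no value of [g] is used twice. The peak itself is paid for by [M], and each other term
    loses at most 1. *)
Lemma peak_sum (f g : nat -> R) n p M : (p < n)%nat -> f p <= M ->
  (forall i, 0 <= g i) -> (forall i, (i < p)%nat -> f i <= g i + 1) ->
  (forall i, (p < i < n)%nat -> f i <= g (i - 1)%nat + 1) ->
  Sum (seq 0 n) f <= M + INR n + Sum (seq 0 n) g.
Proof.
  intros Hp HM Hg H1 H2.
  replace n with (p + S (n - p - 1))%nat at 1 by lia.
  rewrite seq_app, Sum_app. cbn [seq Nat.add]. rewrite Sum_cons.
  assert (E1 : Sum (seq 0 p) f <= Sum (seq 0 p) g + INR p).
  { rewrite <- (length_seq p 0) at 3. rewrite <- (Rmult_1_r (INR _)), <- Sum_const, <- Sum_plus.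
    apply Sum_le. intros i Hi. apply in_seq in Hi. apply H1; lia. }
  assert (E2 : Sum (seq (S p) (n - p - 1)) f <= Sum (seq p (n - p - 1)) g + INR (n - p - 1)).
  { rewrite <- (length_seq (n - p - 1) p) at 3. rewrite <- (Rmult_1_r (INR _)), <- Sum_const, <- Sum_plus.
    rewrite <- seq_shift, Sum_map. apply Sum_le. intros i Hi. apply in_seq in Hi.
    replace i with (S i - 1)%nat at 2 by lia. apply H2. lia. }
  assert (E3 : Sum (seq 0 n) g = Sum (seq 0 p) g + Sum (seq p (n - p - 1)) g + g (n - 1)%nat).
  { replace n with (p + (n - p - 1) + 1)%nat at 1 by lia. rewrite !seq_app, !Sum_app.
    cbn [seq Nat.add]. rewrite Sum_cons. unfold Sum at 3. simpl.
    replace (p + (n - p - 1))%nat with (n - 1)%nat by lia. lra. }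
  pose proof (Hg (n - 1)%nat). assert (INR p + INR (n - p - 1) <= INR n).
  { rewrite <- plus_INR. apply le_INR. lia. }
  lra.
Qed.

Definition cnt cs X (Lam : Z * Z -> bool) (t : Z * Z) : R :=
  Sum (box X) (fun x => iv (inR cs x && Lam (padd x t))).

Lemma Sum_unique_le1 {A} (l : list A) (p : A -> bool) : NoDup l ->
  (forall x y, In x l -> In y l -> p x = true -> p y = true -> x = y) ->
  Sum l (fun x => iv (p x)) <= 1.
Proof.
  intros Hn H. rewrite <- length_filter_Sum. apply (le_INR _ 1).
  assert (Hf : NoDup (filter p l)) by (apply NoDup_filter; auto).
  destruct (filter p l) as [|a [|b l']] eqn:E; simpl; try lia.
  assert (Ha : In a (filter p l)) by (rewrite E; left; auto).
  assert (Hb : In b (filter p l)) by (rewrite E; right; left; auto).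
  apply filter_In in Ha, Hb. inversion Hf; subst. destruct H2. left. symmetry. apply H; tauto.
Qed.

(** The lines of the two cosets interlace. Away from the longest line of the first coset, every line
    of it has, between itself and the longest one, a line of the second coset, which by
    [line_between] has at most one point less. The loss is one maximal line plus one point per
    line. *)
Lemma lattice_compare cs X Lam v1 v2 w1 w2 t t' : lat_gen Lam v1 v2 w1 w2 -> (1 <= X)%nat ->
  (forall x, inR cs x = true -> In x (box X)) ->
  cnt cs X Lam t <= cnt cs X Lam t' + 10 * (INR X / IZR (Z.max (Z.abs v1) (Z.abs v2)) + 1).
Proof.
  intros HG HX Hbox. assert (HG' := HG). destruct HG' as (HL & Hv & Hw & Hv0 & Hh & HVh & Hgen).
  set (h := (v1 * w2 - v2 * w1)%Z) in *.
  set (phi := fun x : Z * Z => (v1 * snd x - v2 * fst x)%Z).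
  assert (Hphi : forall x u, phi (padd x u) = (phi x + phi u)%Z) by (intros; unfold phi, padd; cbn [fst snd]; ring).
  assert (Hphiw : forall k, phi (k * w1, k * w2)%Z = (k * h)%Z) by (intros; unfold phi, h; cbn [fst snd]; ring).
  assert (Hcs : forall u k, cnt cs X Lam (padd u (k * w1, k * w2)%Z) = cnt cs X Lam u).
  { intros u k. unfold cnt. apply Sum_ext. intros x _. do 2 f_equal. unfold padd. cbn [fst snd].
    rewrite !Z.add_assoc. apply lat_add_iff; auto. apply lat_mul; auto. }
  (* Shifting [t] and [t'] by multiples of [w] changes no count and brings the levels into position:
     the line of index [i] for [t2] lies at or above that for [t1] and strictly below that of index
     [i + 1]. *)
  set (t1 := padd t (- (phi t / h) * w1, - (phi t / h) * w2)%Z).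
  assert (Ht1 : (0 <= phi t1 < h)%Z).
  { unfold t1. rewrite Hphi, Hphiw. pose proof (Z.div_mod (phi t) h). pose proof (Z.mod_pos_bound (phi t) h). lia. }
  set (q := ((phi t1 - phi t') / h)%Z).
  set (t2 := padd t' (q * w1, q * w2)%Z).
  assert (Ht2 : (phi t1 - h < phi t2 <= phi t1)%Z).
  { unfold t2. rewrite Hphi, Hphiw. pose proof (Z.div_mod (phi t1 - phi t') h).
    pose proof (Z.mod_pos_bound (phi t1 - phi t') h). unfold q. lia. }
  rewrite <- (Hcs t (- (phi t / h))%Z), <- (Hcs t' q). fold t1 t2.
  set (M := Z.max (Z.abs v1) (Z.abs v2)). assert (HM : (1 <= M)%Z) by (unfold M; lia).
  (* On the box [phi] is at most [2 * M * X] in absolute value, so indices between [-J] and [J]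
     catch every line. The reduced basis gives [M * M <= 2 * h], whence only [O(X / M + 1)]
     lines. *)
  set (J := (2 * M * Z.of_nat X / h + 1)%Z).
  assert (HJ : (1 <= J)%Z) by (unfold J; pose proof (Z.div_pos (2 * M * Z.of_nat X) h); lia).
  set (n := Z.to_nat (2 * J + 1)).
  set (s := fun (u : Z * Z) (i : nat) => ((Z.of_nat i - J) * h - phi u)%Z).
  set (A := fun i => length (line_pts cs X Lam v1 v2 t1 (s t1 i))).
  set (B := fun i => length (line_pts cs X Lam v1 v2 t2 (s t2 i))).
  assert (HsumE : forall u, Sum (seq 0 n) (fun i => INR (length (line_pts cs X Lam v1 v2 u (s u i)))) =
     Sum (box X) (fun x => iv (inR cs x && Lam (padd x u)) * Sum (seq 0 n) (fun i => iv (phi x =? s u i)%Z))).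
  { intros u. rewrite (Sum_ext _ _ (fun i => Sum (box X) (fun x => iv (inR cs x && Lam (padd x u)) * iv (phi x =? s u i)%Z))).
    - rewrite Sum_swap. apply Sum_ext. intros. apply Sum_scal.
    - intros i _. unfold line_pts. rewrite length_filter_Sum. apply Sum_ext. intros. rewrite iv_and. auto. }
  assert (Huniq : forall u x, Sum (seq 0 n) (fun i => iv (phi x =? s u i)%Z) <= 1).
  { intros u x. apply Sum_unique_le1; [apply seq_NoDup|]. intros i j _ _ Hi Hj.
    apply Z.eqb_eq in Hi, Hj. unfold s in *. assert ((Z.of_nat i - Z.of_nat j) * h = 0)%Z by lia. nia. }
  assert (HA : cnt cs X Lam t1 <= Sum (seq 0 n) (fun i => INR (A i))).
  { unfold A. rewrite HsumE. unfold cnt. apply Sum_le. intros x Hx.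
    destruct (inR cs x && Lam (padd x t1))%bool eqn:E; simpl; [|lra]. rewrite Rmult_1_l.
    apply Bool.andb_true_iff in E. destruct E as [_ E]. unfold padd in E.
    destruct (Hgen _ _ E) as [j [r [E1 E2]]].
    assert (Ej : (phi x + phi t1 = j * h)%Z).
    { unfold phi, h. replace (j * (v1 * w2 - v2 * w1))%Z with (v1 * (j * w2 + r * v2) - v2 * (j * w1 + r * v1))%Z by ring.
      rewrite <- E1, <- E2. ring. }
    assert (Hb : (Z.abs (phi x) <= 2 * M * Z.of_nat X)%Z).
    { apply in_box in Hx. unfold phi, M.
      assert (Z.abs (v1 * snd x) <= Z.max (Z.abs v1) (Z.abs v2) * Z.of_nat X)%Z by (rewrite Z.abs_mul; apply Z.mul_le_mono_nonneg; lia).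
      assert (Z.abs (v2 * fst x) <= Z.max (Z.abs v1) (Z.abs v2) * Z.of_nat X)%Z by (rewrite Z.abs_mul; apply Z.mul_le_mono_nonneg; lia).
      lia. }
    assert (Hj : (- J <= j <= J)%Z).
    { pose proof (Z.div_mod (2 * M * Z.of_nat X) h ltac:(lia)). pose proof (Z.mod_pos_bound (2 * M * Z.of_nat X) h Hh).
      unfold J. set (qq := (2 * M * Z.of_nat X / h)%Z) in *. clear - H H0 Hb Ej Ht1 Hh. split.
      - assert ((- qq - 1) * h <= j * h)%Z by nia. nia.
      - assert (j * h < (qq + 2) * h)%Z by nia. nia. }
    set (i := Z.to_nat (j + J)).
    pose proof (Sum_ge_term (seq 0 n) (fun i => iv (phi x =? s t1 i)%Z) i) as Hge. cbv beta in Hge.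
    replace (phi x =? s t1 i)%Z with true in Hge.
    - apply Hge; [intros; apply iv_bounds|]. apply in_seq. unfold i, n. lia.
    - symmetry. apply Z.eqb_eq. unfold s, i. rewrite Z2Nat.id by lia. lia. }
  assert (HB : Sum (seq 0 n) (fun i => INR (B i)) <= cnt cs X Lam t2).
  { unfold B. rewrite HsumE. unfold cnt. apply Sum_le. intros x Hx. pose proof (Huniq t2 x).
    pose proof (iv_bounds (inR cs x && Lam (padd x t2))). nra. }
  assert (HMr : 1 <= IZR M) by (apply IZR_le; auto).
  assert (Hn : INR n <= 8 * (INR X / IZR M) + 3).
  { unfold n. rewrite INR_IZR_INZ, Z2Nat.id by lia. rewrite plus_IZR, mult_IZR.
    assert (H : (2 * M * Z.of_nat X / h * M <= 4 * Z.of_nat X)%Z).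
    { pose proof (Z.mul_div_le (2 * M * Z.of_nat X) h Hh). pose proof (Z.div_pos (2 * M * Z.of_nat X) h ltac:(lia) Hh).
      set (qq := (2 * M * Z.of_nat X / h)%Z) in *.
      assert (M * M <= 2 * h)%Z.
      { etransitivity; [|exact HVh]. unfold M. destruct (Z.max_spec (Z.abs v1) (Z.abs v2)) as [[_ ->]|[_ ->]]; nia. }
      clear - H H0 H1 HM. nia. }
    apply IZR_le in H. rewrite !mult_IZR, <- INR_IZR_INZ in H.
    unfold J. rewrite plus_IZR.
    assert (IZR (2 * M * Z.of_nat X / h) <= 4 * (INR X / IZR M)); [|lra].
    apply Rmult_le_reg_r with (IZR M); [lra|]. unfold Rdiv. rewrite !Rmult_assoc, Rinv_l by lra. lra. }
  destruct (exists_argmax A n) as [p [Hp Hpm]]; [unfold n; lia|].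
  set (y0 := fun i => ((Z.of_nat i - J) * w1 - fst t2, (Z.of_nat i - J) * w2 - snd t2)%Z).
  assert (Hbase : forall i, Lam (padd (y0 i) t2) = true).
  { intros i. unfold padd, y0. cbn [fst snd]. rewrite !Z.sub_add. apply lat_mul; auto. }
  assert (Hbase2 : forall i, (v1 * snd (y0 i) - v2 * fst (y0 i) = s t2 i)%Z).
  { intros i. unfold s, phi, h, y0. cbn [fst snd]. ring. }
  pose proof (peak_sum (fun i => INR (A i)) (fun i => INR (B i)) n p (INR X / IZR M + 1) Hp) as Hpk.
  assert (Hfin : Sum (seq 0 n) (fun i => INR (A i)) <= INR X / IZR M + 1 + INR n + Sum (seq 0 n) (fun i => INR (B i))).
  { apply Hpk.
    - apply (line_max cs X Lam v1 v2 w1 w2 t1 _ HG HX).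
    - intros; apply pos_INR.
    - intros i Hi. rewrite <- S_INR. apply le_INR. rewrite <- Nat.add_1_r.
      apply (line_between cs X Lam v1 v2 w1 w2 t1 t2 t1 (s t1 i) (s t2 i) (s t1 p) (y0 i) (A i) HG Hbox); [| | |exact (Hbase _)|exact (Hbase2 _)| |].
      + unfold s. lia.
      + unfold s. assert ((Z.of_nat i + 1 - J) * h <= (Z.of_nat p - J) * h)%Z by (apply Z.mul_le_mono_nonneg_r; lia). lia.
      + unfold s. assert ((Z.of_nat i + 1 - J) * h <= (Z.of_nat p - J) * h)%Z by (apply Z.mul_le_mono_nonneg_r; lia). lia.
      + apply le_n.
      + apply Hpm. lia.
    - intros i Hi. rewrite <- S_INR. apply le_INR. rewrite <- Nat.add_1_r.
      apply (line_between cs X Lam v1 v2 w1 w2 t1 t2 t1 (s t1 p) (s t2 (i - 1)%nat) (s t1 i) (y0 (i - 1)%nat) (A i) HG Hbox); [| | |exact (Hbase _)|exact (Hbase2 _)| |].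
      + unfold s. assert ((Z.of_nat p - J) * h <= (Z.of_nat (i - 1) - J) * h)%Z by (apply Z.mul_le_mono_nonneg_r; lia). lia.
      + unfold s. replace (Z.of_nat i) with (Z.of_nat (i - 1) + 1)%Z by lia. lia.
      + unfold s. assert ((Z.of_nat p + 1 - J) * h <= (Z.of_nat i - J) * h)%Z by (apply Z.mul_le_mono_nonneg_r; lia). lia.
      + apply Hpm. lia.
      + apply le_n. }
  clear - HA HB Hn Hfin HMr. pose proof (pos_INR X).
  assert (0 <= INR X / IZR M) by (apply Rdiv_nonneg; lra). lra.
Qed.

Lemma Sum_periodic (g : Z -> R) N k : (forall z, g (z + Z.of_nat N)%Z = g z) ->
  Sum (seq 0 N) (fun t => g (Z.of_nat t + Z.of_nat k)%Z) = Sum (seq 0 N) (fun t => g (Z.of_nat t)).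
Proof.
  intros Hg. induction k.
  - apply Sum_ext. intros. f_equal. lia.
  - rewrite <- IHk. destruct N; [reflexivity|]. rewrite Sum_seq_S.
    cbn [seq]. rewrite Sum_cons. rewrite Rplus_comm. f_equal.
    + rewrite <- (Hg (Z.of_nat 0 + Z.of_nat k)%Z). f_equal. lia.
    + rewrite <- (seq_shift N 0), Sum_map. apply Sum_ext. intros. f_equal. lia.
Qed.

Definition dens (N : nat) (Lam : Z * Z -> bool) : R :=
  Sum (seq 0 N) (fun t1 => Sum (seq 0 N) (fun t2 => iv (Lam (Z.of_nat t1, Z.of_nat t2)))) / (INR N * INR N).

(* Any two translates of [Lam] have almost the same number of points in a convex polygon, and
   averaging over all translates gives exactly the density times the number of integer points. *)
Lemma lattice_count cs X Lam N : is_lattice Lam -> (1 <= N)%nat -> (1 <= X)%nat ->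
  Lam (Z.of_nat N, 0%Z) = true -> Lam (0%Z, Z.of_nat N) = true ->
  (forall x, inR cs x = true -> In x (box X)) ->
  exists v1 v2, Lam (v1, v2) = true /\ (v1 <> 0 \/ v2 <> 0)%Z /\
    Rabs (Sum (box X) (fun x => iv (inR cs x && Lam x)) - dens N Lam * Sum (box X) (fun x => iv (inR cs x)))
      <= 10 * (INR X / IZR (Z.max (Z.abs v1) (Z.abs v2)) + 1).
Proof.
  intros HL HN HX HN1 HN2 Hbox. destruct (lat_basis Lam HL) as (v1 & v2 & w1 & w2 & HG).
  assert (HG' : lat_gen Lam v1 v2 w1 w2) by (split; auto).
  exists v1, v2. split; [tauto|]. split; [tauto|].
  set (E := 10 * (INR X / IZR (Z.max (Z.abs v1) (Z.abs v2)) + 1)).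
  set (c0 := cnt cs X Lam (0, 0)%Z).
  assert (Ec0 : Sum (box X) (fun x => iv (inR cs x && Lam x)) = c0).
  { apply Sum_ext. intros [x1 x2] _. unfold padd. cbn [fst snd]. rewrite !Z.add_0_r. auto. }
  rewrite Ec0.
  set (avg := Sum (seq 0 N) (fun t1 => Sum (seq 0 N) (fun t2 => cnt cs X Lam (Z.of_nat t1, Z.of_nat t2)))).
  assert (HNr : 1 <= INR N) by (apply INR_ge1; auto).
  assert (Eavg : avg = INR N * INR N * (dens N Lam * Sum (box X) (fun x => iv (inR cs x)))).
  { unfold avg, cnt.
    rewrite (Sum_ext _ _ (fun t1 => Sum (box X) (fun x => Sum (seq 0 N) (fun t2 => iv (inR cs x && Lam (padd x (Z.of_nat t1, Z.of_nat t2)))))))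
      by (intros; apply Sum_swap).
    rewrite Sum_swap.
    replace (INR N * INR N * (dens N Lam * Sum (box X) (fun x => iv (inR cs x)))) with
      (Sum (box X) (fun x => iv (inR cs x)) * (dens N Lam * (INR N * INR N))) by ring.
    rewrite <- Sum_scal_r. apply Sum_ext. intros x Hx. apply in_box in Hx.
    unfold dens, Rdiv. rewrite Rmult_assoc, Rinv_l, Rmult_1_r by nra.
    transitivity (iv (inR cs x) * Sum (seq 0 N) (fun t1 => Sum (seq 0 N) (fun t2 => iv (Lam (padd x (Z.of_nat t1, Z.of_nat t2)))))).
    { rewrite <- Sum_scal. apply Sum_ext. intros t1 _. rewrite <- Sum_scal. apply Sum_ext. intros t2 _. apply iv_and. }
    f_equal. destruct x as [x1 x2]. cbn [fst snd] in Hx.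
    rewrite <- (Sum_periodic (fun z => Sum (seq 0 N) (fun t2 => iv (Lam (z, Z.of_nat t2)))) N (Z.to_nat x1)).
    2:{ intros z. apply Sum_ext. intros t2 _. f_equal.
        rewrite <- (lat_add_iff Lam HL z (Z.of_nat t2) (Z.of_nat N) 0%Z HN1). do 2 f_equal. lia. }
    apply Sum_ext. intros t1 _.
    rewrite <- (Sum_periodic (fun z => iv (Lam ((Z.of_nat t1 + Z.of_nat (Z.to_nat x1))%Z, z))) N (Z.to_nat x2)).
    2:{ intros z. f_equal. rewrite <- (lat_add_iff Lam HL _ z 0%Z (Z.of_nat N) HN2). do 2 f_equal. lia. }
    apply Sum_ext. intros t2 _. unfold padd. cbn [fst snd]. do 3 f_equal; lia. }
  assert (Hcmp : forall t, Rabs (c0 - cnt cs X Lam t) <= E).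
  { intros t. apply Rabs_le. pose proof (lattice_compare cs X Lam v1 v2 w1 w2 (0, 0)%Z t HG' HX Hbox).
    pose proof (lattice_compare cs X Lam v1 v2 w1 w2 t (0, 0)%Z HG' HX Hbox). fold c0 E in H, H0. lra. }
  assert (Hav : Rabs (INR N * INR N * c0 - avg) <= INR N * INR N * E).
  { replace (INR N * INR N * c0) with (Sum (seq 0 N) (fun _ => Sum (seq 0 N) (fun _ => c0)))
      by (rewrite !Sum_const, length_seq; ring).
    replace (INR N * INR N * E) with (Sum (seq 0 N) (fun _ => Sum (seq 0 N) (fun _ => E)))
      by (rewrite !Sum_const, length_seq; ring).
    apply Sum_abs_diff. intros. apply Sum_abs_diff. intros. apply Hcmp. }
  rewrite Eavg, <- Rmult_minus_distr_l, Rabs_mult, (Rabs_right (INR N * INR N)) in Hav by nra.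
  apply Rmult_le_reg_l in Hav; [auto|nra].
Qed.

(** * Densities of the lattices [n_i | L_i(x)] *)

Lemma cos_add_2kPI x (k : Z) : cos (x + 2 * PI * IZR k) = cos x.
Proof.
  destruct (Z.le_gt_cases 0 k).
  - rewrite <- (Z2Nat.id k) by auto. rewrite <- INR_IZR_INZ.
    rewrite <- (cos_period x (Z.to_nat k)). f_equal. ring.
  - rewrite <- (cos_period (x + 2 * PI * IZR k) (Z.to_nat (- k))). f_equal.
    rewrite INR_IZR_INZ, Z2Nat.id by lia. rewrite opp_IZR. ring.
Qed.

Lemma sin_add_2kPI x (k : Z) : sin (x + 2 * PI * IZR k) = sin x.
Proof.
  rewrite <- !cos_shift.
  replace (PI / 2 - (x + 2 * PI * IZR k)) with (PI / 2 - x + 2 * PI * IZR (- k)) by (rewrite opp_IZR; ring).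
  apply cos_add_2kPI.
Qed.

Definition zdivb (n : nat) (k : Z) : bool := (k mod Z.of_nat n =? 0)%Z.

Lemma zdivb_iff n k : (1 <= n)%nat -> (zdivb n k = true <-> Z.divide (Z.of_nat n) k).
Proof. intros H. unfold zdivb. rewrite Z.eqb_eq. apply Z.mod_divide. lia. Qed.

(** Orthogonality of additive characters in real form: multiplying by [2 * sin (th / 2)] makes the
    sum telescope. The free phase [phi] allows several variables to be summed one after another
    without complex exponentials. *)
Lemma cos_orth n (k : Z) phi : (1 <= n)%nat ->
  Sum (seq 0 n) (fun j => cos (INR j * (2 * PI * IZR k / INR n) + phi)) = iv (zdivb n k) * (INR n * cos phi).
Proof.
  intros Hn. assert (Hnr : 1 <= INR n) by (apply INR_ge1; auto).
  destruct (zdivb n k) eqn:E.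
  - apply zdivb_iff in E; auto. destruct E as [z Hz].
    rewrite (Sum_ext _ _ (fun _ => cos phi)).
    + rewrite Sum_const, length_seq. simpl. ring.
    + intros j _. rewrite <- (cos_add_2kPI phi (Z.of_nat j * z)). f_equal.
      rewrite Hz, !mult_IZR, <- !INR_IZR_INZ. field. lra.
  - simpl. rewrite Rmult_0_l.
    set (th := 2 * PI * IZR k / INR n).
    assert (Hs : sin (th / 2) <> 0).
    { intros H. apply sin_eq_0_0 in H. destruct H as [z Hz].
      assert (IZR k = IZR (z * Z.of_nat n)).
      { rewrite mult_IZR, <- INR_IZR_INZ. apply Rmult_eq_reg_l with PI; [|apply PI_neq0].
        replace (PI * IZR k) with (th / 2 * INR n) by (unfold th; field; lra). rewrite Hz. ring. }
      apply eq_IZR in H. assert (zdivb n k = true); [|congruence].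
      apply zdivb_iff; auto. exists z. auto. }
    apply Rmult_eq_reg_l with (2 * sin (th / 2)); [|lra]. rewrite Rmult_0_r, <- Sum_scal.
    assert (T : forall m, Sum (seq 0 m) (fun j => 2 * sin (th / 2) * cos (INR j * th + phi)) =
       sin (INR m * th - th / 2 + phi) - sin (- (th / 2) + phi)).
    { induction m.
      - unfold Sum. simpl. rewrite Rmult_0_l. unfold Rminus. rewrite Rplus_0_l. ring.
      - rewrite Sum_seq_S, IHm. cbn [Nat.add]. rewrite S_INR.
        replace ((INR m + 1) * th - th / 2 + phi) with ((INR m * th + phi) + th / 2) by field.
        replace (INR m * th - th / 2 + phi) with ((INR m * th + phi) - th / 2) by field.
        rewrite (sin_plus _ (th / 2)), (sin_minus _ (th / 2)). ring. }
    rewrite T.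
    replace (INR n * th - th / 2 + phi) with (- (th / 2) + phi + 2 * PI * IZR k) by (unfold th; field; lra).
    rewrite sin_add_2kPI. ring.
Qed.

Definition lamL (L1 L2 L3 : linform) (n1 n2 n3 : nat) (x : Z * Z) : bool :=
  (zdivb n1 (evalL L1 (fst x) (snd x)) && zdivb n2 (evalL L2 (fst x) (snd x)) && zdivb n3 (evalL L3 (fst x) (snd x)))%bool.

(* [condb] says that [s1/o1 L1 + s2/o2 L2 + s3/o3 L3] has integral coefficients. *)
Definition comb (u1 u2 u3 : Z) (o1 o2 o3 s1 s2 s3 : nat) : Z :=
  (Z.of_nat s1 * u1 * (Z.of_nat o2 * Z.of_nat o3) + Z.of_nat s2 * u2 * (Z.of_nat o1 * Z.of_nat o3)
   + Z.of_nat s3 * u3 * (Z.of_nat o1 * Z.of_nat o2))%Z.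
Definition condb (L1 L2 L3 : linform) (o1 o2 o3 s1 s2 s3 : nat) : bool :=
  (zdivb (o1 * o2 * o3) (comb (fst L1) (fst L2) (fst L3) o1 o2 o3 s1 s2 s3) &&
   zdivb (o1 * o2 * o3) (comb (snd L1) (snd L2) (snd L3) o1 o2 o3 s1 s2 s3))%bool.

Lemma is_lattice_lamL L1 L2 L3 n1 n2 n3 : (1 <= n1)%nat -> (1 <= n2)%nat -> (1 <= n3)%nat ->
  is_lattice (lamL L1 L2 L3 n1 n2 n3) /\
  lamL L1 L2 L3 n1 n2 n3 (Z.of_nat (n1 * n2 * n3), 0%Z) = true /\
  lamL L1 L2 L3 n1 n2 n3 (0%Z, Z.of_nat (n1 * n2 * n3)) = true.
Proof.
  intros H1 H2 H3.
  assert (HN : lamL L1 L2 L3 n1 n2 n3 (Z.of_nat (n1 * n2 * n3), 0%Z) = true /\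
               lamL L1 L2 L3 n1 n2 n3 (0%Z, Z.of_nat (n1 * n2 * n3)) = true).
  { unfold lamL, evalL. cbn [fst snd]. rewrite !Bool.andb_true_iff, !zdivb_iff, !Nat2Z.inj_mul by auto.
    repeat split.
    - exists (fst L1 * (Z.of_nat n2 * Z.of_nat n3))%Z. ring.
    - exists (fst L2 * (Z.of_nat n1 * Z.of_nat n3))%Z. ring.
    - exists (fst L3 * (Z.of_nat n1 * Z.of_nat n2))%Z. ring.
    - exists (snd L1 * (Z.of_nat n2 * Z.of_nat n3))%Z. ring.
    - exists (snd L2 * (Z.of_nat n1 * Z.of_nat n3))%Z. ring.
    - exists (snd L3 * (Z.of_nat n1 * Z.of_nat n2))%Z. ring. }
  split; [|auto]. split.
  - intros x1 x2 y1 y2. unfold lamL. rewrite !Bool.andb_true_iff, !zdivb_iff by auto. unfold evalL. cbn [fst snd].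
    intros [[A1 A2] A3] [[B1 B2] B3].
    assert (G : forall a b, (a * (x1 - y1) + b * (x2 - y2) = (a * x1 + b * x2) - (a * y1 + b * y2))%Z) by (intros; ring).
    rewrite !G. repeat split; apply Z.divide_sub_r; auto.
  - exists (Z.of_nat (n1 * n2 * n3)). split; [nia|auto].
Qed.

(** One sum of cosines is evaluated in two orders. Summing over the [ti] first detects the
    congruences [ni | Li(x)]; summing over [x1] and [x2] first detects that the combined frequency
    is integral. *)
Lemma dens_fourier L1 L2 L3 n1 n2 n3 : (1 <= n1)%nat -> (1 <= n2)%nat -> (1 <= n3)%nat ->
  dens (n1 * n2 * n3) (lamL L1 L2 L3 n1 n2 n3) =
  Sum (seq 0 n1) (fun t1 => Sum (seq 0 n2) (fun t2 => Sum (seq 0 n3) (fun t3 =>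
    iv (condb L1 L2 L3 n1 n2 n3 t1 t2 t3)))) / (INR n1 * INR n2 * INR n3).
Proof.
  intros H1 H2 H3. set (N := (n1 * n2 * n3)%nat).
  assert (HN : (1 <= N)%nat) by (unfold N; nia).
  assert (HNr : INR N = INR n1 * INR n2 * INR n3) by (unfold N; rewrite !mult_INR; auto).
  pose proof (INR_ge1 _ H1). pose proof (INR_ge1 _ H2). pose proof (INR_ge1 _ H3). pose proof (INR_ge1 _ HN).
  set (l := fun (L : linform) (x1 x2 : nat) => evalL L (Z.of_nat x1) (Z.of_nat x2)).
  (* The phase is nested so that the innermost summation variable comes first and the rest serves as
     the phase in [cos_orth]; the final [+ 0] is the phase of the last application. *)
  set (F := fun x1 x2 t1 t2 t3 => cos (INR t3 * (2 * PI * IZR (l L3 x1 x2) / INR n3) +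
     (INR t2 * (2 * PI * IZR (l L2 x1 x2) / INR n2) + (INR t1 * (2 * PI * IZR (l L1 x1 x2) / INR n1) + 0)))).
  assert (E1 : Sum (seq 0 N) (fun x1 => Sum (seq 0 N) (fun x2 => Sum (seq 0 n1) (fun t1 => Sum (seq 0 n2) (fun t2 =>
     Sum (seq 0 n3) (fun t3 => F x1 x2 t1 t2 t3))))) =
     INR N * Sum (seq 0 N) (fun x1 => Sum (seq 0 N) (fun x2 => iv (lamL L1 L2 L3 n1 n2 n3 (Z.of_nat x1, Z.of_nat x2))))).
  { rewrite <- Sum_scal. apply Sum_ext. intros x1 _. rewrite <- Sum_scal. apply Sum_ext. intros x2 _.
    unfold F.
    rewrite (Sum_ext _ _ (fun t1 => iv (zdivb n3 (l L3 x1 x2)) * INR n3 * (iv (zdivb n2 (l L2 x1 x2)) *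
       (INR n2 * cos (INR t1 * (2 * PI * IZR (l L1 x1 x2) / INR n1) + 0))))).
    2:{ intros t1 _. rewrite <- cos_orth by auto. rewrite <- Sum_scal. apply Sum_ext. intros t2 _.
        rewrite cos_orth by auto. ring. }
    rewrite Sum_scal, Sum_scal, Sum_scal, cos_orth by auto. rewrite cos_0, HNr.
    unfold lamL. rewrite !iv_and. cbn [fst snd]. unfold l. ring. }
  assert (E2 : Sum (seq 0 N) (fun x1 => Sum (seq 0 N) (fun x2 => Sum (seq 0 n1) (fun t1 => Sum (seq 0 n2) (fun t2 =>
     Sum (seq 0 n3) (fun t3 => F x1 x2 t1 t2 t3))))) =
     INR N * INR N * Sum (seq 0 n1) (fun t1 => Sum (seq 0 n2) (fun t2 => Sum (seq 0 n3) (fun t3 =>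
    iv (condb L1 L2 L3 n1 n2 n3 t1 t2 t3))))).
  { transitivity (Sum (seq 0 n1) (fun t1 => Sum (seq 0 n2) (fun t2 => Sum (seq 0 n3) (fun t3 =>
       Sum (seq 0 N) (fun x1 => Sum (seq 0 N) (fun x2 => F x1 x2 t1 t2 t3)))))).
    { rewrite (Sum_ext (seq 0 N) _ (fun x1 => Sum (seq 0 n1) (fun t1 => Sum (seq 0 n2) (fun t2 => Sum (seq 0 n3) (fun t3 =>
        Sum (seq 0 N) (fun x2 => F x1 x2 t1 t2 t3)))))).
      - rewrite Sum_swap. apply Sum_ext. intros t1 _. rewrite Sum_swap. apply Sum_ext. intros t2 _. apply Sum_swap.
      - intros x1 _. rewrite Sum_swap. apply Sum_ext. intros t1 _. rewrite Sum_swap. apply Sum_ext. intros t2 _. apply Sum_swap. }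
    rewrite <- Sum_scal. apply Sum_ext. intros t1 _. rewrite <- Sum_scal. apply Sum_ext. intros t2 _.
    rewrite <- Sum_scal. apply Sum_ext. intros t3 _.
    set (al := comb (fst L1) (fst L2) (fst L3) n1 n2 n3 t1 t2 t3).
    set (be := comb (snd L1) (snd L2) (snd L3) n1 n2 n3 t1 t2 t3).
    rewrite (Sum_ext _ _ (fun x1 => Sum (seq 0 N) (fun x2 => cos (INR x2 * (2 * PI * IZR be / INR N) +
       (INR x1 * (2 * PI * IZR al / INR N) + 0))))).
    2:{ intros x1 _. apply Sum_ext. intros x2 _. unfold F. f_equal.
        unfold l, evalL, al, be, comb. rewrite !plus_IZR, !mult_IZR, <- !INR_IZR_INZ, HNr. field. lra. }
    rewrite (Sum_ext _ _ (fun x1 => iv (zdivb N be) * INR N * cos (INR x1 * (2 * PI * IZR al / INR N) + 0)))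
      by (intros; rewrite cos_orth by auto; ring).
    rewrite Sum_scal, cos_orth, cos_0 by auto. unfold condb. rewrite iv_and. fold N al be. ring. }
  unfold dens. rewrite E1 in E2. clear E1.
  set (A := Sum (seq 0 N) _) in *. set (B := Sum (seq 0 n1) _) in *.
  assert (EA : A = INR N * B) by (apply Rmult_eq_reg_l with (INR N); lra).
  rewrite EA, <- HNr. field. lra.
Qed.

(** The hypothesis says that [p] depends only on the fraction [t / n]; grouping the fractions by
    their reduced denominator [o], which divides [n], gives the right-hand side. *)
Lemma frac_regroup (p : nat -> nat -> R) n Y :
  (forall g o s, (1 <= g)%nat -> (1 <= o)%nat -> p (g * o)%nat (g * s)%nat = p o s) -> (1 <= n <= Y)%nat ->
  Sum (seq 0 n) (fun t => p n t) =
  Sum (seq 1 Y) (fun o => iv (divb o n) * Sum (seq 0 o) (fun s => iv (cop s o) * p o s)).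
Proof.
  intros Hp Hn. rewrite <- Sum_divs by auto.
  assert (Hg : forall t, exists u w, (n = u * Nat.gcd t n /\ t = w * Nat.gcd t n /\ 1 <= Nat.gcd t n /\ 1 <= u)%nat).
  { intros t. destruct (Nat.gcd_divide_r t n) as [u Hu]. destruct (Nat.gcd_divide_l t n) as [w Hw].
    exists u, w. repeat split; auto.
    - destruct (Nat.gcd t n); lia.
    - destruct u; lia. }
  transitivity (Sum (seq 0 n) (fun t => Sum (divs n) (fun o => iv (n / Nat.gcd t n =? o)%nat * p n t))).
  { apply Sum_ext. intros t _. symmetry. apply (Sum_ind_unique (divs n) (fun o => (n / Nat.gcd t n =? o)%nat) (n / Nat.gcd t n)%nat (fun _ => p n t)).
    - apply NoDup_divs.
    - apply in_divs; [lia|]. destruct (Hg t) as (u & w & E1 & E2 & E3 & E4).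
      rewrite E1 at 1. rewrite Nat.div_mul by lia. exists (Nat.gcd t n). lia.
    - intros x _. rewrite Nat.eqb_eq. split; auto. }
  rewrite Sum_swap. apply Sum_ext. intros o Ho. apply in_divs in Ho; [|lia].
  pose proof (divs_pos n o ltac:(lia) Ho) as Hop. destruct Ho as [g Hg'].
  assert (Hg1 : (1 <= g)%nat) by (destruct g; lia).
  rewrite <- Sum_filter.
  rewrite <- (Sum_filter (fun s => cop s o)).
  rewrite (Sum_same_elements _ (map (fun s => (g * s)%nat) (filter (fun s => cop s o) (seq 0 o)))).
  - rewrite Sum_map. apply Sum_ext. intros s _. rewrite Hg'. apply Hp; lia.
  - apply NoDup_filter, seq_NoDup.
  - apply NoDup_map_on; [intros; nia|apply NoDup_filter, seq_NoDup].
  - intros t. rewrite filter_In, in_seq, in_map_iff, Nat.eqb_eq. destruct (Hg t) as (u & w & E1 & E2 & E3 & E4). split.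
    + intros [Ht E]. rewrite E1 in E at 1. rewrite Nat.div_mul in E by lia. subst u.
      assert (Egg : Nat.gcd t n = g) by nia. exists w. split; [rewrite Egg in E2; lia|].
      apply filter_In. split; [apply in_seq; nia|]. unfold cop. apply Nat.eqb_eq.
      assert (Nat.gcd (t / Nat.gcd t n) (n / Nat.gcd t n) = 1)%nat by (apply Nat.gcd_div_gcd; lia).
      rewrite Egg in *. rewrite E2, Hg', (Nat.mul_comm g o), !Nat.div_mul in H by lia. auto.
    + intros [s [Es Hs]]. apply filter_In in Hs. destruct Hs as [Hs1 Hs2]. apply in_seq in Hs1.
      unfold cop in Hs2. apply Nat.eqb_eq in Hs2. split; [nia|].
      assert (Nat.gcd t n = g) by (rewrite <- Es, Hg', Nat.gcd_mul_mono_l, Hs2; lia).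
      rewrite H, Hg', Nat.mul_comm. apply Nat.div_mul. lia.
Qed.

Lemma divide_scale (g P a : Z) : g <> 0%Z -> (Z.divide (g * P) (g * a) <-> Z.divide P a).
Proof. intros H. apply Z.mul_divide_cancel_l; auto. Qed.

Lemma condb_iff L1 L2 L3 o1 o2 o3 s1 s2 s3 : (1 <= o1)%nat -> (1 <= o2)%nat -> (1 <= o3)%nat ->
  (condb L1 L2 L3 o1 o2 o3 s1 s2 s3 = true <->
   Z.divide (Z.of_nat o1 * Z.of_nat o2 * Z.of_nat o3) (comb (fst L1) (fst L2) (fst L3) o1 o2 o3 s1 s2 s3) /\
   Z.divide (Z.of_nat o1 * Z.of_nat o2 * Z.of_nat o3) (comb (snd L1) (snd L2) (snd L3) o1 o2 o3 s1 s2 s3)).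
Proof.
  intros. unfold condb. rewrite Bool.andb_true_iff, !zdivb_iff, !Nat2Z.inj_mul by nia. tauto.
Qed.

(* The number of triples of reduced fractions [si/oi] modulo 1 whose combination [sum si/oi Li] is
   integral: by Fourier expansion these are the frequencies contributing to the density of
   [ni | Li(x)]. *)
Definition kfun (L1 L2 L3 : linform) (o1 o2 o3 : nat) : R :=
  Sum (seq 0 o1) (fun s1 => iv (cop s1 o1) * Sum (seq 0 o2) (fun s2 => iv (cop s2 o2) *
    Sum (seq 0 o3) (fun s3 => iv (cop s3 o3) * iv (condb L1 L2 L3 o1 o2 o3 s1 s2 s3)))).

(** After grouping by reduced denominators the moduli [ni] enter only through three separate
    factors, the indicator of [oi | ni] over [ni]. This separation is what later lets the sums over
    [m1], [m2], [m3] be evaluated independently. *)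
Lemma dens_kfun L1 L2 L3 n1 n2 n3 Y : (1 <= n1 <= Y)%nat -> (1 <= n2 <= Y)%nat -> (1 <= n3 <= Y)%nat ->
  dens (n1 * n2 * n3) (lamL L1 L2 L3 n1 n2 n3) =
  Sum3 (seq 1 Y) (fun o1 o2 o3 => kfun L1 L2 L3 o1 o2 o3 *
    (iv (divb o1 n1) / INR n1 * (iv (divb o2 n2) / INR n2) * (iv (divb o3 n3) / INR n3))).
Proof.
  intros H1 H2 H3. rewrite dens_fourier by lia.
  pose proof (INR_ge1 _ (proj1 H1)). pose proof (INR_ge1 _ (proj1 H2)). pose proof (INR_ge1 _ (proj1 H3)).
  transitivity (Sum3 (seq 1 Y) (fun o1 o2 o3 => iv (divb o1 n1) * iv (divb o2 n2) * iv (divb o3 n3) * kfun L1 L2 L3 o1 o2 o3)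
     / (INR n1 * INR n2 * INR n3)).
  2:{ unfold Rdiv. rewrite (Rmult_comm (Sum3 _ _)), <- Sum3_scal. apply Sum3_ext. intros. field. lra. }
  f_equal.
  (* [condb] depends only on the fractions [si / oi], as [frac_regroup] demands: multiplying one
     numerator and its denominator by [g] multiplies both the modulus and the combination by [g]. *)
  assert (Hsc : forall o1 o2 o3 s1 s2 s3 g, (1 <= g)%nat -> (1 <= o1)%nat -> (1 <= o2)%nat -> (1 <= o3)%nat ->
    condb L1 L2 L3 (g * o1) o2 o3 (g * s1) s2 s3 = condb L1 L2 L3 o1 o2 o3 s1 s2 s3 /\
    condb L1 L2 L3 o1 (g * o2) o3 s1 (g * s2) s3 = condb L1 L2 L3 o1 o2 o3 s1 s2 s3 /\
    condb L1 L2 L3 o1 o2 (g * o3) s1 s2 (g * s3) = condb L1 L2 L3 o1 o2 o3 s1 s2 s3).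
  { intros o1 o2 o3 s1 s2 s3 g Hg Ho1 Ho2 Ho3.
    repeat split; apply Bool.eq_iff_eq_true; rewrite !condb_iff by nia; unfold comb; rewrite !Nat2Z.inj_mul;
    rewrite <- (divide_scale (Z.of_nat g) (Z.of_nat o1 * Z.of_nat o2 * Z.of_nat o3)) by lia;
    rewrite <- (divide_scale (Z.of_nat g) (Z.of_nat o1 * Z.of_nat o2 * Z.of_nat o3) (_ * snd L1 * _ + _ + _)) by lia;
    match goal with |- (Z.divide ?a ?b /\ Z.divide ?c ?d) <-> (Z.divide ?e ?f /\ Z.divide ?g ?h) =>
      replace a with e by ring; replace b with f by ring; replace d with h by ring; tauto end. }
  rewrite (frac_regroup (fun n t1 => Sum (seq 0 n2) (fun t2 => Sum (seq 0 n3) (fun t3 => iv (condb L1 L2 L3 n n2 n3 t1 t2 t3)))) n1 Y);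
    [|intros; apply Sum_ext; intros; apply Sum_ext; intros; f_equal; apply Hsc; lia|auto].
  unfold Sum3. apply Sum_ext. intros o1 Ho1. apply in_seq in Ho1.
  rewrite (Sum_ext (seq 0 o1) _ (fun s1 => Sum (seq 1 Y) (fun o2 => iv (cop s1 o1) * (iv (divb o2 n2) * Sum (seq 0 o2) (fun s2 => iv (cop s2 o2) *
     Sum (seq 0 n3) (fun t3 => iv (condb L1 L2 L3 o1 o2 n3 s1 s2 t3))))))).
  2:{ intros s1 _. rewrite Sum_scal. f_equal.
      apply (frac_regroup (fun n t2 => Sum (seq 0 n3) (fun t3 => iv (condb L1 L2 L3 o1 n n3 s1 t2 t3))) n2 Y); auto.
      intros; apply Sum_ext; intros; f_equal; apply Hsc; lia. }
  rewrite Sum_swap, <- Sum_scal. apply Sum_ext. intros o2 Ho2. apply in_seq in Ho2.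
  rewrite (Sum_ext (seq 0 o1) _ (fun s1 => Sum (seq 1 Y) (fun o3 => iv (cop s1 o1) * (iv (divb o2 n2) * Sum (seq 0 o2) (fun s2 => iv (cop s2 o2) *
     (iv (divb o3 n3) * Sum (seq 0 o3) (fun s3 => iv (cop s3 o3) * iv (condb L1 L2 L3 o1 o2 o3 s1 s2 s3)))))))).
  2:{ intros s1 _. rewrite Sum_scal, Sum_scal. do 2 f_equal. rewrite Sum_swap. apply Sum_ext. intros s2 _.
      rewrite Sum_scal. f_equal.
      apply (frac_regroup (fun n t3 => iv (condb L1 L2 L3 o1 o2 n s1 s2 t3)) n3 Y); auto.
      intros; f_equal; apply Hsc; lia. }
  rewrite Sum_swap, <- Sum_scal. apply Sum_ext. intros o3 Ho3. unfold kfun.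
  rewrite <- Sum_scal, <- Sum_scal. apply Sum_ext. intros s1 _.
  rewrite !Rmult_assoc. rewrite <- !Sum_scal. apply Sum_ext. intros s2 _. ring.
Qed.

(** * Support and size of [kfun] *)

Lemma kfun_nonneg L1 L2 L3 o1 o2 o3 : 0 <= kfun L1 L2 L3 o1 o2 o3.
Proof.
  unfold kfun. apply Sum_nonneg. intros. apply Rmult_le_pos; [apply iv_bounds|].
  apply Sum_nonneg. intros. apply Rmult_le_pos; [apply iv_bounds|].
  apply Sum_nonneg. intros. apply Rmult_le_pos; apply iv_bounds.
Qed.

Lemma kfun_111 L1 L2 L3 : kfun L1 L2 L3 1 1 1 = 1.
Proof. unfold kfun, Sum. simpl. unfold condb, comb. simpl. unfold zdivb. simpl. rewrite ?Zmod_1_r. simpl. lra. Qed.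

Definition Rn (L1 L2 L3 : linform) : nat := Z.abs_nat (resL L1 L2 * resL L1 L3 * resL L2 L3).

(** Integrality holds for both coordinates; multiplying them by the coefficients of [L3],
    respectively [L2], and subtracting eliminates that form and leaves resultants as coefficients of
    the other two fractions. *)
Lemma comb_elim L1 L2 L3 o1 o2 o3 s1 s2 s3 : (1 <= o1)%nat -> (1 <= o2)%nat -> (1 <= o3)%nat ->
  condb L1 L2 L3 o1 o2 o3 s1 s2 s3 = true ->
  Z.divide (Z.of_nat o1 * Z.of_nat o2) (Z.of_nat s1 * resL L1 L3 * Z.of_nat o2 + Z.of_nat s2 * resL L2 L3 * Z.of_nat o1) /\
  Z.divide (Z.of_nat o1 * Z.of_nat o3) (Z.of_nat s1 * resL L1 L2 * Z.of_nat o3 + Z.of_nat s3 * - resL L2 L3 * Z.of_nat o1).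
Proof.
  intros H1 H2 H3 H. apply condb_iff in H; auto. destruct H as [Ha Hb]. split.
  - apply (Z.mul_divide_cancel_r _ _ (Z.of_nat o3)); [lia|].
    replace ((Z.of_nat s1 * resL L1 L3 * Z.of_nat o2 + Z.of_nat s2 * resL L2 L3 * Z.of_nat o1) * Z.of_nat o3)%Z with
      (snd L3 * comb (fst L1) (fst L2) (fst L3) o1 o2 o3 s1 s2 s3 - fst L3 * comb (snd L1) (snd L2) (snd L3) o1 o2 o3 s1 s2 s3)%Z
      by (unfold comb, resL; ring).
    apply Z.divide_sub_r; apply Z.divide_mul_r; auto.
  - apply (Z.mul_divide_cancel_r _ _ (Z.of_nat o2)); [lia|].
    replace ((Z.of_nat s1 * resL L1 L2 * Z.of_nat o3 + Z.of_nat s3 * - resL L2 L3 * Z.of_nat o1) * Z.of_nat o2)%Z with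
      (snd L2 * comb (fst L1) (fst L2) (fst L3) o1 o2 o3 s1 s2 s3 - fst L2 * comb (snd L1) (snd L2) (snd L3) o1 o2 o3 s1 s2 s3)%Z
      by (unfold comb, resL; ring).
    replace (Z.of_nat o1 * Z.of_nat o3 * Z.of_nat o2)%Z with (Z.of_nat o1 * Z.of_nat o2 * Z.of_nat o3)%Z by ring.
    apply Z.divide_sub_r; apply Z.divide_mul_r; auto.
Qed.

Lemma Zdivide_of_nat a b : Z.divide (Z.of_nat a) (Z.of_nat b) <-> Nat.divide a b.
Proof.
  split; intros [z Hz].
  - exists (Z.abs_nat z). apply Nat2Z.inj. rewrite Nat2Z.inj_mul, Zabs2Nat.id_abs.
    rewrite <- (Z.abs_eq (Z.of_nat a)), <- Z.abs_mul, <- Hz by lia. lia.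
  - exists (Z.of_nat z). rewrite Hz, Nat2Z.inj_mul. auto.
Qed.

Lemma Zgcd_of_nat_1 a b : Nat.gcd a b = 1%nat -> Z.gcd (Z.of_nat a) (Z.of_nat b) = 1%Z.
Proof.
  intros H. pose proof (Z.gcd_nonneg (Z.of_nat a) (Z.of_nat b)) as Hn.
  pose proof (Z.gcd_divide_l (Z.of_nat a) (Z.of_nat b)) as Ha.
  pose proof (Z.gcd_divide_r (Z.of_nat a) (Z.of_nat b)) as Hb.
  rewrite <- (Z2Nat.id _ Hn) in *. set (g := Z.to_nat _) in *.
  apply Zdivide_of_nat in Ha, Hb.
  assert (Nat.divide g 1) by (rewrite <- H; apply Nat.gcd_greatest; auto).
  apply Nat.divide_1_r in H0. lia.
Qed.

(** Modulo [o] only the term with [s] survives, and [s] is prime to [o]; hence [o] divides the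
    resultant times [p]. *)
Lemma cross_divide o p s t r u R : (1 <= o)%nat -> (1 <= p)%nat -> cop s o = true ->
  Z.divide (Z.of_nat o * Z.of_nat p) (Z.of_nat s * r * Z.of_nat p + t * u * Z.of_nat o) ->
  Nat.divide (Z.abs_nat r) R -> Nat.divide o (R * p).
Proof.
  intros Ho Hp Hs H [q Hq].
  assert (Z.divide (Z.of_nat o) (r * Z.of_nat p)).
  { apply (Z.gauss _ (Z.of_nat s)).
    - replace (Z.of_nat s * (r * Z.of_nat p))%Z with
        ((Z.of_nat s * r * Z.of_nat p + t * u * Z.of_nat o) - t * u * Z.of_nat o)%Z by ring.
      apply Z.divide_sub_r; [|apply Z.divide_factor_r].
      eapply Z.divide_trans; [|exact H]. apply Z.divide_factor_l.
    - unfold cop in Hs. apply Nat.eqb_eq in Hs. apply Zgcd_of_nat_1. rewrite Nat.gcd_comm. auto. }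
  apply Zdivide_of_nat. rewrite Hq, !Nat2Z.inj_mul, Zabs2Nat.id_abs.
  apply Z.divide_abs_r in H0. rewrite Z.abs_mul in H0.
  replace (Z.abs (Z.of_nat p)) with (Z.of_nat p) in H0 by lia.
  rewrite <- Z.mul_assoc. apply Z.divide_mul_r. auto.
Qed.

Lemma Rn_divide L1 L2 L3 : Nat.divide (Z.abs_nat (resL L1 L2)) (Rn L1 L2 L3) /\
  Nat.divide (Z.abs_nat (resL L1 L3)) (Rn L1 L2 L3) /\ Nat.divide (Z.abs_nat (resL L2 L3)) (Rn L1 L2 L3).
Proof.
  unfold Rn. rewrite !Zabs2Nat.inj_mul. repeat split.
  - rewrite <- Nat.mul_assoc. apply Nat.divide_factor_l.
  - apply Nat.divide_mul_l, Nat.divide_factor_r.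
  - apply Nat.divide_factor_r.
Qed.

Lemma iv_le_1 b c : (b = true -> c = true) -> iv b <= iv c.
Proof. destruct b, c; simpl; intros H; try lra; discriminate (H eq_refl). Qed.

Lemma Sum_ne0 {A} (l : list A) f : Sum l f <> 0 -> exists x, In x l /\ f x <> 0.
Proof.
  intros H. apply NNPP. intros C. apply H. apply Sum_zero. intros x Hx.
  apply NNPP. intros Hf. apply C. eauto.
Qed.

(** The denominators that occur agree up to divisors of the fixed number [Rn], so a sum over triples
    of them behaves like a sum over [o1] alone. *)
Lemma kfun_support L1 L2 L3 o1 o2 o3 : (1 <= o1)%nat -> (1 <= o2)%nat -> (1 <= o3)%nat ->
  kfun L1 L2 L3 o1 o2 o3 <> 0 ->
  let R := Rn L1 L2 L3 in
  Nat.divide o1 (R * o2) /\ Nat.divide o1 (R * o3) /\ Nat.divide o2 (R * o1) /\ Nat.divide o3 (R * o1).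
Proof.
  intros H1 H2 H3 H R. unfold kfun in H.
  apply Sum_ne0 in H. destruct H as [s1 [_ H]].
  destruct (cop s1 o1) eqn:E1; [simpl in H; rewrite Rmult_1_l in H|simpl in H; lra].
  apply Sum_ne0 in H. destruct H as [s2 [_ H]].
  destruct (cop s2 o2) eqn:E2; [simpl in H; rewrite Rmult_1_l in H|simpl in H; lra].
  apply Sum_ne0 in H. destruct H as [s3 [_ H]].
  destruct (cop s3 o3) eqn:E3; [simpl in H; rewrite Rmult_1_l in H|simpl in H; lra].
  destruct (condb L1 L2 L3 o1 o2 o3 s1 s2 s3) eqn:E; [|simpl in H; lra].
  apply comb_elim in E; auto. destruct E as [Ea Eb].
  pose proof (Rn_divide L1 L2 L3) as (R12 & R13 & R23). fold R in R12, R13, R23.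
  repeat split.
  - eapply cross_divide; eauto.
  - eapply cross_divide; eauto.
  - rewrite Z.add_comm, (Z.mul_comm (Z.of_nat o1)) in Ea. eapply cross_divide; eauto.
  - rewrite Z.add_comm, (Z.mul_comm (Z.of_nat o1)) in Eb. eapply cross_divide; eauto.
    replace (Z.abs_nat (- resL L2 L3)) with (Z.abs_nat (resL L2 L3)) by lia; auto.
Qed.

(** Two solutions [s] and [a] satisfy [(s - a) * r = z * o2] with [|z| <= |r|] because both lie
    below [o2]; a solution is recovered from [z], which takes at most [2 * |r| + 1] values. *)
Lemma count_congruence (o1 o2 : nat) (c r : Z) : (1 <= o1)%nat -> (1 <= o2)%nat -> r <> 0%Z ->
  Sum (seq 0 o2) (fun s => iv (zdivb (o1 * o2) (c + Z.of_nat s * r * Z.of_nat o1))) <= 2 * INR (Z.abs_nat r) + 1.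
Proof.
  intros H1 H2 Hr. rewrite <- length_filter_Sum.
  set (l := filter _ _).
  assert (Hl : forall s, In s l <-> (s < o2)%nat /\ Z.divide (Z.of_nat o1 * Z.of_nat o2) (c + Z.of_nat s * r * Z.of_nat o1)).
  { intros s. unfold l. rewrite filter_In, in_seq, zdivb_iff, Nat2Z.inj_mul by nia. split; intros []; split; auto; lia. }
  assert (Hnd : NoDup l) by apply NoDup_filter, seq_NoDup. clearbody l.
  destruct l as [|a l']; [simpl; pose proof (pos_INR (Z.abs_nat r)); lra|].
  set (l := a :: l') in *. assert (Ha : In a l) by (left; auto). apply Hl in Ha. destruct Ha as [Ha1 Ha2].
  assert (Hz : forall s, In s l -> exists z, ((Z.of_nat s - Z.of_nat a) * r = z * Z.of_nat o2)%Z /\ (Z.abs z <= Z.abs r)%Z).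
  { intros s Hs. apply Hl in Hs. destruct Hs as [Hs1 Hs2].
    assert (Hd : Z.divide (Z.of_nat o2) ((Z.of_nat s - Z.of_nat a) * r)).
    { apply (Z.mul_divide_cancel_l _ _ (Z.of_nat o1)); [lia|].
      replace (Z.of_nat o1 * ((Z.of_nat s - Z.of_nat a) * r))%Z with
       ((c + Z.of_nat s * r * Z.of_nat o1) - (c + Z.of_nat a * r * Z.of_nat o1))%Z by ring.
      apply Z.divide_sub_r; auto. }
    destruct Hd as [z Hz]. exists z. split; auto.
    assert (Z.abs z * Z.of_nat o2 <= Z.abs r * Z.of_nat o2)%Z; [|nia].
    replace (Z.abs z * Z.of_nat o2)%Z with (Z.abs (z * Z.of_nat o2)) by (rewrite Z.abs_mul; lia).
    rewrite <- Hz, Z.abs_mul, Z.mul_comm. apply Z.mul_le_mono_nonneg_l; lia. }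
  apply Rle_trans with (INR (length (seq 0 (2 * Z.abs_nat r + 1)))).
  2:{ rewrite length_seq, plus_INR, mult_INR. simpl. lra. }
  apply le_INR. apply (inj_length (fun s => Z.to_nat ((Z.of_nat s - Z.of_nat a) * r / Z.of_nat o2 + Z.abs r))); auto.
  - intros s Hs. destruct (Hz s Hs) as [z [Ez Hzb]]. rewrite Ez, Z.div_mul by lia. apply in_seq. lia.
  - intros s s' Hs Hs'. destruct (Hz s Hs) as [z [Ez Hzb]]. destruct (Hz s' Hs') as [z' [Ez' Hzb']].
    rewrite Ez, Ez', !Z.div_mul by lia. intros E. assert (z = z') by lia. subst z'.
    assert (((Z.of_nat s - Z.of_nat a) - (Z.of_nat s' - Z.of_nat a)) * r = 0)%Z by lia. nia.
Qed.

(** There are at most [o1] choices of [s1], and each determines [s2] and [s3] up to boundedly many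
    values: after elimination both congruences have the coefficient of [s2] or [s3] equal to plus or
    minus [resL L2 L3]. *)
Lemma kfun_bound L1 L2 L3 : resL L2 L3 <> 0%Z ->
  exists C, 1 <= C /\ forall o1 o2 o3, (1 <= o1)%nat -> (1 <= o2)%nat -> (1 <= o3)%nat ->
    kfun L1 L2 L3 o1 o2 o3 <= C * INR o1.
Proof.
  intros Hr. set (B := 2 * INR (Z.abs_nat (resL L2 L3)) + 1).
  assert (HB : 1 <= B) by (unfold B; pose proof (pos_INR (Z.abs_nat (resL L2 L3))); lra).
  exists (B * B). split; [nra|]. intros o1 o2 o3 H1 H2 H3.
  apply Rle_trans with (Sum (seq 0 o1) (fun s1 => B * B)).
  2:{ rewrite Sum_const, length_seq. lra. }
  unfold kfun. apply Sum_le. intros s1 _.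
  set (f2 := fun s2 => iv (zdivb (o1 * o2) (Z.of_nat s1 * resL L1 L3 * Z.of_nat o2 + Z.of_nat s2 * resL L2 L3 * Z.of_nat o1))).
  set (f3 := fun s3 => iv (zdivb (o1 * o3) (Z.of_nat s1 * resL L1 L2 * Z.of_nat o3 + Z.of_nat s3 * - resL L2 L3 * Z.of_nat o1))).
  assert (B2 : Sum (seq 0 o2) f2 <= B) by (apply count_congruence; auto).
  assert (B3 : Sum (seq 0 o3) f3 <= B).
  { unfold B. replace (Z.abs_nat (resL L2 L3)) with (Z.abs_nat (- resL L2 L3)) by lia. apply count_congruence; auto. lia. }
  assert (0 <= Sum (seq 0 o2) f2) by (apply Sum_nonneg; intros; apply iv_bounds).
  assert (0 <= Sum (seq 0 o3) f3) by (apply Sum_nonneg; intros; apply iv_bounds).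
  apply Rle_trans with (Sum (seq 0 o2) f2 * Sum (seq 0 o3) f3); [|apply Rmult_le_compat; auto].
  assert (Hmul : forall b x y, 0 <= x -> x <= y -> iv b * x <= y) by (intros [] x y; simpl; lra).
  rewrite Sum_mult. apply Hmul.
  { apply Sum_nonneg. intros. apply Rmult_le_pos; [apply iv_bounds|].
    apply Sum_nonneg. intros. apply Rmult_le_pos; apply iv_bounds. }
  apply Sum_le. intros s2 _. apply Hmul.
  { apply Sum_nonneg. intros. apply Rmult_le_pos; apply iv_bounds. }
  apply Sum_le. intros s3 _. apply Hmul; [apply iv_bounds|].
  unfold f2, f3. rewrite <- iv_and. apply iv_le_1. intros E. apply comb_elim in E; auto.
  rewrite Bool.andb_true_iff, !zdivb_iff, !Nat2Z.inj_mul by nia. auto.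
Qed.

(** * Power sums and convergence *)

Lemma Rpower_INR_1 s : Rpower (INR 1) s = 1.
Proof. unfold Rpower. simpl. rewrite ln_1, Rmult_0_r. apply exp_0. Qed.

Lemma ln_ge_inv x : 1 < x -> 1 / x <= ln (x / (x - 1)).
Proof.
  intros Hx. assert (Hp : 0 < (x - 1) / x) by (apply Rdiv_lt_0_compat; lra).
  replace (x / (x - 1)) with (/ ((x - 1) / x)) by (field; lra).
  rewrite ln_Rinv by auto. pose proof (exp_ineq1_le (ln ((x - 1) / x))) as H.
  rewrite exp_ln in H by auto. replace ((x - 1) / x) with (1 - 1 / x) in * by (field; lra). lra.
Qed.

Lemma sum_pow_conv u N : 0 < u -> Sum (seq 1 N) (fun q => Rpower (INR q) (- 1 - u)) <= 1 + / u.
Proof.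
  intros Hu. pose proof (Rinv_0_lt_compat u Hu).
  assert (T : Sum (seq 1 (S N)) (fun q => Rpower (INR q) (- 1 - u)) <= 1 + / u - / u * Rpower (INR (S N)) (- u)).
  { induction N.
    - rewrite Sum_seq_S. unfold Sum. cbn [seq map fold_right Nat.add]. rewrite !Rpower_INR_1. lra.
    - rewrite Sum_seq_S. cbn [Nat.add]. set (q := INR (S (S N))).
      assert (Hq : q = INR (S N) + 1) by (unfold q; rewrite (S_INR (S N)); auto).
      assert (HqN : 1 <= INR (S N)) by (apply INR_ge1; lia).
      assert (Hk : u * Rpower q (- 1 - u) <= Rpower (q - 1) (- u) - Rpower q (- u)).
      { replace (Rpower (q - 1) (- u)) with (Rpower q (- u) * exp (u * ln (q / (q - 1)))).
        2:{ unfold Rpower. rewrite <- exp_plus. f_equal. unfold Rdiv. rewrite ln_mult, ln_Rinv; try lra.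
            apply Rinv_0_lt_compat; lra. }
        replace (Rpower q (- 1 - u)) with (Rpower q (- u) * / q).
        2:{ rewrite <- (Rpower_1 q) at 2 by lra. rewrite <- Rpower_Ropp, <- Rpower_plus. f_equal. lra. }
        pose proof (exp_ineq1_le (u * ln (q / (q - 1)))). pose proof (ln_ge_inv q ltac:(lra)).
        pose proof (Rpower_pos q (- u)).
        assert (u * (1 / q) <= u * ln (q / (q - 1))) by (apply Rmult_le_compat_l; lra).
        unfold Rdiv in *. rewrite Rmult_1_l in *. nra. }
      replace (q - 1) with (INR (S N)) in Hk by lra.
      assert (Rpower q (- 1 - u) <= / u * Rpower (INR (S N)) (- u) - / u * Rpower q (- u)).
      { apply Rmult_le_reg_l with u; auto. replace (u * (/ u * Rpower (INR (S N)) (- u) - / u * Rpower q (- u))) with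
          (Rpower (INR (S N)) (- u) - Rpower q (- u)) by (field; lra). auto. }
      lra. }
  rewrite Sum_seq_S in T. pose proof (Rpower_pos (INR (1 + N)) (- 1 - u)).
  pose proof (Rpower_pos (INR (S N)) (- u)). nra.
Qed.

Lemma sum_pow_div s N : 0 < s <= 1 -> Sum (seq 1 N) (fun q => Rpower (INR q) (s - 1)) <= 2 / s * Rpower (INR (N + 1)) s.
Proof.
  intros Hs. induction N.
  - unfold Sum. simpl. rewrite Rpower_INR_1. assert (0 < 2 / s) by (apply Rdiv_lt_0_compat; lra). lra.
  - rewrite Sum_seq_S. cbn [Nat.add] in *. set (q := INR (S N)) in *.
    replace (N + 1)%nat with (S N) in IHN by lia. fold q in IHN.
    assert (Hq : 1 <= q) by (apply INR_ge1; lia).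
    replace (INR (S (N + 1))) with (q + 1) by (unfold q; rewrite <- S_INR; f_equal; lia).
    enough (Rpower q (s - 1) <= 2 / s * (Rpower (q + 1) s - Rpower q s)) by lra.
    replace (Rpower (q + 1) s) with (Rpower q s * exp (s * ln ((q + 1) / q))).
    2:{ unfold Rpower. rewrite <- exp_plus. f_equal. unfold Rdiv. rewrite ln_mult, ln_Rinv; try lra.
        apply Rinv_0_lt_compat; lra. }
    replace (Rpower q (s - 1)) with (Rpower q s * / q).
    2:{ rewrite <- (Rpower_1 q) at 2 by lra. rewrite <- Rpower_Ropp, <- Rpower_plus. f_equal. }
    pose proof (exp_ineq1_le (s * ln ((q + 1) / q))). pose proof (ln_ge_inv (q + 1) ltac:(lra)) as Hl.
    replace (q + 1 - 1) with q in Hl by lra.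
    pose proof (Rpower_pos q s).
    assert (/ q <= 2 * (1 / (q + 1))).
    { unfold Rdiv. rewrite Rmult_1_l. apply Rmult_le_reg_l with (q * (q + 1)); [nra|].
      replace (q * (q + 1) * / q) with (q + 1) by (field; lra).
      replace (q * (q + 1) * (2 * / (q + 1))) with (2 * q) by (field; lra). lra. }
    assert (Hx : / q <= 2 / s * (exp (s * ln ((q + 1) / q)) - 1)).
    { apply Rle_trans with (2 / s * (s * ln ((q + 1) / q))).
      - replace (2 / s * (s * ln ((q + 1) / q))) with (2 * ln ((q + 1) / q)) by (field; lra). lra.
      - apply Rmult_le_compat_l; [apply Rdiv_nonneg; lra|lra]. }
    replace (2 / s * (Rpower q s * exp (s * ln ((q + 1) / q)) - Rpower q s)) with
      (Rpower q s * (2 / s * (exp (s * ln ((q + 1) / q)) - 1))) by ring.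
    apply Rmult_le_compat_l; lra.
Qed.

Lemma sum_inv N : (1 <= N)%nat -> Sum (seq 1 N) (fun q => / INR q) <= 1 + ln (INR N).
Proof.
  intros HN. destruct N; [lia|]. clear HN. induction N.
  - unfold Sum. simpl. rewrite ln_1. lra.
  - rewrite Sum_seq_S. cbn [Nat.add]. set (q := INR (S (S N))).
    assert (Hq : q - 1 = INR (S N)) by (unfold q; rewrite (S_INR (S N)); lra).
    assert (HqN : 1 <= INR (S N)) by (apply INR_ge1; lia).
    pose proof (ln_ge_inv q ltac:(lra)) as H. unfold Rdiv in H.
    assert (0 < / (q - 1)) by (apply Rinv_0_lt_compat; lra).
    rewrite ln_mult, ln_Rinv, Rmult_1_l, Hq in H by lra. lra.
Qed.

(** With [c = (|c| + c) - |c|], both parts have nonnegative terms, so their sums over the increasing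
    lists are monotone and bounded. *)
Lemma sums_converge {A} (S : nat -> list A) (c : A -> R) B :
  (forall Y, NoDup (S Y)) -> (forall Y, incl (S Y) (S (Y + 1)%nat)) ->
  (forall Y, Sum (S Y) (fun x => Rabs (c x)) <= B) -> { l | Un_cv (fun Y => Sum (S Y) c) l }.
Proof.
  intros Hn Hi HB.
  assert (P : forall f : A -> R, (forall x, 0 <= f x <= 2 * Rabs (c x)) -> { l | Un_cv (fun Y => Sum (S Y) f) l }).
  { intros f Hf. apply growing_cv.
    - intros Y. rewrite <- Nat.add_1_r. apply Sum_incl_le; auto. intros; apply Hf.
    - exists (2 * B). intros z [Y ->]. apply Rle_trans with (2 * Sum (S Y) (fun x => Rabs (c x))).
      + rewrite <- Sum_scal. apply Sum_le. intros; apply Hf.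
      + specialize (HB Y). lra. }
  destruct (P (fun x => Rabs (c x) + c x)) as [l1 H1].
  { intros x. pose proof (Rle_abs (c x)). pose proof (Rle_abs (- c x)). rewrite Rabs_Ropp in *. lra. }
  destruct (P (fun x => Rabs (c x))) as [l2 H2].
  { intros x. pose proof (Rabs_pos (c x)). lra. }
  exists (l1 - l2). pose proof (CV_minus _ _ _ _ H1 H2) as H3.
  intros e He. destruct (H3 e He) as [N HN]. exists N. intros n Hn'. specialize (HN n Hn').
  rewrite <- Sum_minus in HN. rewrite (Sum_ext _ c (fun x => Rabs (c x) + c x - Rabs (c x))); auto. intros; lra.
Qed.

(** * Index sets and absolute convergence *)

Definition E3 : Type := (nat * nat * nat)%type.
Definition list3 (Y : nat) : list E3 := list_prod (list_prod (seq 1 Y) (seq 1 Y)) (seq 1 Y).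

Lemma Sum_list3 Y f : Sum (list3 Y) f = Sum3 (seq 1 Y) (fun a b c => f (a, b, c)).
Proof.
  unfold list3, Sum3. etransitivity; [apply (Sum_list_prod (list_prod (seq 1 Y) (seq 1 Y)))|].
  apply (Sum_list_prod _ _ (fun x => Sum (seq 1 Y) (fun y => f (x, y)))).
Qed.

Lemma in_list3 Y a b c : In (a, b, c) (list3 Y) <-> (1 <= a <= Y /\ 1 <= b <= Y /\ 1 <= c <= Y)%nat.
Proof. unfold list3. rewrite !in_prod_iff, !in_seq. lia. Qed.

Lemma NoDup_list3 Y : NoDup (list3 Y).
Proof. repeat apply NoDup_list_prod; apply seq_NoDup. Qed.

Lemma incl_list3 Y Y' : (Y <= Y')%nat -> incl (list3 Y) (list3 Y').
Proof. intros H [[a b] c]. rewrite !in_list3. lia. Qed.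

(* For an index [(a, b, c)] of [tau3_formula], the moduli dividing [n1], [n2], [n3]. *)
Definition dv1 (e : E3) : nat := let '(a, b, c) := e in Nat.lcm a b.
Definition dv2 (e : E3) : nat := let '(a, b, c) := e in (a * c)%nat.
Definition dv3 (e : E3) : nat := let '(a, b, c) := e in Nat.lcm b c.
Definition kf (L1 L2 L3 : linform) (o : E3) : R := let '(o1, o2, o3) := o in kfun L1 L2 L3 o1 o2 o3.
Definition p1 (o : E3) : nat := let '(o1, o2, o3) := o in o1.
Definition p2 (o : E3) : nat := let '(o1, o2, o3) := o in o2.
Definition p3 (o : E3) : nat := let '(o1, o2, o3) := o in o3.
Definition l1 (t : E3 * E3) : nat := Nat.lcm (p1 (snd t)) (dv1 (fst t)).
Definition l2 (t : E3 * E3) : nat := Nat.lcm (p2 (snd t)) (dv2 (fst t)).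
Definition l3 (t : E3 * E3) : nat := Nat.lcm (p3 (snd t)) (dv3 (fst t)).
Definition T6 (Y : nat) : list (E3 * E3) := list_prod (list3 Y) (list3 Y).

Lemma NoDup_T6 Y : NoDup (T6 Y).
Proof. apply NoDup_list_prod; apply NoDup_list3. Qed.

Lemma incl_T6 Y Y' : (Y <= Y')%nat -> incl (T6 Y) (T6 Y').
Proof.
  intros H [e o]. unfold T6. rewrite !in_prod_iff. intros [H1 H2].
  split; eapply incl_list3; eauto.
Qed.

Lemma mul_ge_lcm_gcd a b L G : (1 <= a)%nat -> (1 <= b)%nat ->
  Nat.divide L (Nat.lcm a b) -> Nat.divide G a -> Nat.divide G b -> (L * G <= a * b)%nat.
Proof.
  intros Ha Hb HL HGa HGb.
  assert (E : (Nat.lcm a b * Nat.gcd a b = a * b)%nat).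
  { unfold Nat.lcm. destruct (Nat.gcd_divide_r a b) as [u Hu].
    assert (Nat.gcd a b <> 0)%nat by (rewrite Nat.gcd_eq_0; lia).
    set (g := Nat.gcd a b) in *. clearbody g. rewrite Hu, Nat.div_mul by auto. nia. }
  rewrite <- E. pose proof (lcm_pos a b Ha Hb).
  assert (Nat.gcd a b <> 0)%nat by (rewrite Nat.gcd_eq_0; lia).
  apply Nat.mul_le_mono; apply Nat.divide_pos_le; auto; try lia. apply Nat.gcd_greatest; auto.
Qed.

(** The lcm of [o1], [a], [b], [c]. Every entry of an index in the support divides it up to the
    factor [Rn], so it serves as a one-dimensional size of a six-dimensional index. *)
Definition qq (t : E3 * E3) : nat :=
  let '(a, b, c) := fst t in Nat.lcm (Nat.lcm (p1 (snd t)) a) (Nat.lcm b c).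

Ltac divs_solve := repeat match goal with
  | |- Nat.divide (Nat.lcm _ _) _ => apply Nat.lcm_least
  | H : Nat.divide ?x ?y |- Nat.divide ?x ?y => exact H
  | |- Nat.divide ?x ?x => apply Nat.divide_refl
  | |- Nat.divide ?x (Nat.lcm ?a ?b) =>
      first [ apply Nat.divide_trans with a; [solve [divs_solve]|apply Nat.divide_lcm_l]
            | apply Nat.divide_trans with b; [solve [divs_solve]|apply Nat.divide_lcm_r] ]
  end.

(** Two applications of lcm times gcd: [k1] and [k2] have lcm [q] and common divisor [lcm o a],
    while [lcm o a] and [k3] have lcm [q] and common divisor [o]. Multiplying the two inequalities
    gives the bound. *)
Lemma lcm_triple o a b c : (1 <= o)%nat -> (1 <= a)%nat -> (1 <= b)%nat -> (1 <= c)%nat ->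
  let q := Nat.lcm (Nat.lcm o a) (Nat.lcm b c) in
  let k1 := Nat.lcm o (Nat.lcm a b) in let k2 := Nat.lcm o (Nat.lcm a c) in let k3 := Nat.lcm o (Nat.lcm b c) in
  (q * q * o <= k1 * k2 * k3)%nat /\ (k1 <= q)%nat /\ (k2 <= q)%nat /\ (k3 <= q)%nat /\ (o <= q)%nat.
Proof.
  intros Ho Ha Hb Hc q k1 k2 k3.
  assert (Hq : (1 <= q)%nat) by (repeat apply lcm_pos; auto).
  assert (H1 : (1 <= k1)%nat) by (repeat apply lcm_pos; auto).
  assert (H2 : (1 <= k2)%nat) by (repeat apply lcm_pos; auto).
  assert (H3 : (1 <= k3)%nat) by (repeat apply lcm_pos; auto).
  assert (Hg : (1 <= Nat.lcm o a)%nat) by (repeat apply lcm_pos; auto).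
  split; [|repeat split; (apply Nat.divide_pos_le; [lia|unfold k1, k2, k3, q; solve [divs_solve]])].
  assert (A1 : (q * Nat.lcm o a <= k1 * k2)%nat) by (apply mul_ge_lcm_gcd; auto; unfold k1, k2, q; divs_solve).
  assert (A2 : (q * o <= Nat.lcm o a * k3)%nat) by (apply mul_ge_lcm_gcd; auto; unfold k3, q; divs_solve).
  apply Nat.le_trans with (q * (Nat.lcm o a * k3))%nat.
  - rewrite <- Nat.mul_assoc. apply Nat.mul_le_mono_l; auto.
  - rewrite Nat.mul_assoc. apply Nat.mul_le_mono_r; auto.
Qed.

(** The general term of the density series with variable exponents: 1 is weakened to [zeta_exp] to
    absorb logarithms, and to [1 / 2] in the one place where a harmonic sum is replaced by its
    asymptotic value. *)
Definition wt (L1 L2 L3 : linform) (th1 th2 th3 : R) (t : E3 * E3) : R :=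
  kf L1 L2 L3 (snd t) * (Rpower (INR (l1 t)) (- th1) * Rpower (INR (l2 t)) (- th2) * Rpower (INR (l3 t)) (- th3)).

Lemma ln_INR_le a b : (1 <= a)%nat -> (a <= b)%nat -> ln (INR a) <= ln (INR b).
Proof. intros H1 H2. apply Rln_le; [apply lt_0_INR; lia|apply le_INR; auto]. Qed.

Definition zeta_exp : R := 49 / 50.

(** On the support [l1], [l2], [l3] are at least the [k1], [k2], [k3] of [lcm_triple] up to [Rn].
    Hence the term is at most a constant times [o1 * (q^2 * o1) ^ (-49/50) * q ^ (1/2)], and
    [o1 <= q] turns this into the exponent [1/50 - 98/50 + 1/2 = - 144/100]. The slack [1/2] in the
    hypothesis allows one exponent to drop from [49/50] to [1/2]. *)
Lemma wt_bound L1 L2 L3 : resL L1 L2 <> 0%Z -> resL L1 L3 <> 0%Z -> resL L2 L3 <> 0%Z ->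
  exists C, 0 <= C /\ forall th1 th2 th3 Y t, In t (T6 Y) ->
    0 <= th1 <= zeta_exp -> 0 <= th2 <= zeta_exp -> 0 <= th3 <= zeta_exp ->
    zeta_exp * 3 - 1 / 2 <= th1 + th2 + th3 ->
    wt L1 L2 L3 th1 th2 th3 t <= C * Rpower (INR (qq t)) (- (144 / 100)).
Proof.
  intros h12 h13 h23. destruct (kfun_bound L1 L2 L3 h23) as [C [HC Hk]].
  set (r := ln (INR (Rn L1 L2 L3))).
  assert (HRn : (1 <= Rn L1 L2 L3)%nat) by (unfold Rn; nia).
  exists (C * exp (3 * r)). split; [pose proof (exp_pos (3 * r)); nra|].
  intros th1 th2 th3 Y [[[a b] c] [[o1 o2] o3]] Ht B1 B2 B3 BS.
  unfold T6 in Ht. apply in_prod_iff in Ht. rewrite !in_list3 in Ht.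
  destruct Ht as [(Ha & Hb & Hc) (Ho1 & Ho2 & Ho3)].
  assert (Hr : 0 <= r) by (apply ln_nonneg, INR_ge1; auto).
  destruct (Req_dec (kfun L1 L2 L3 o1 o2 o3) 0) as [E|E].
  { unfold wt. cbn [fst snd kf]. rewrite E, Rmult_0_l. pose proof (exp_pos (3 * r)).
    apply Rmult_le_pos; [apply Rmult_le_pos; lra|left; apply Rpower_pos]. }
  destruct (kfun_support _ _ _ _ _ _ (proj1 Ho1) (proj1 Ho2) (proj1 Ho3) E) as (S1 & S2 & S3 & S4).
  set (R := Rn L1 L2 L3) in *.
  destruct (lcm_triple o1 a b c) as (T1 & T2 & T3 & T4 & T5); try lia.
  set (k1 := Nat.lcm o1 (Nat.lcm a b)) in *. set (k2 := Nat.lcm o1 (Nat.lcm a c)) in *.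
  set (k3 := Nat.lcm o1 (Nat.lcm b c)) in *. set (q := Nat.lcm (Nat.lcm o1 a) (Nat.lcm b c)) in *.
  assert (Hq : (1 <= q)%nat) by (repeat apply lcm_pos; lia).
  assert (K1 : (1 <= k1)%nat) by (repeat apply lcm_pos; lia).
  assert (K2 : (1 <= k2)%nat) by (repeat apply lcm_pos; lia).
  assert (K3 : (1 <= k3)%nat) by (repeat apply lcm_pos; lia).
  unfold wt, l1, l2, l3, qq. cbn [fst snd p1 p2 p3 dv1 dv2 dv3 kf].
  set (m1 := Nat.lcm o1 (Nat.lcm a b)). set (m2 := Nat.lcm o2 (a * c)). set (m3 := Nat.lcm o3 (Nat.lcm b c)).
  assert (M1 : (1 <= m1)%nat) by (repeat apply lcm_pos; lia).
  assert (M2 : (1 <= m2)%nat) by (apply lcm_pos; nia).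
  assert (M3 : (1 <= m3)%nat) by (repeat apply lcm_pos; lia).
  assert (Hle : forall x y, (1 <= x)%nat -> (1 <= y)%nat -> (x <= R * y)%nat -> ln (INR x) <= r + ln (INR y)).
  { intros x y Hx Hy Hxy. unfold r. rewrite <- ln_mult, <- mult_INR by (apply lt_0_INR; lia). apply ln_INR_le; auto. }
  assert (Z1 : ln (INR k1) <= r + ln (INR m1)) by (apply Hle; auto; unfold k1, m1; nia).
  assert (Z2 : ln (INR k2) <= r + ln (INR m2)).
  { apply Hle; auto. apply Nat.divide_pos_le; [nia|]. unfold k2, m2. apply Nat.lcm_least.
    - eapply Nat.divide_trans; [exact S1|]. apply Nat.mul_divide_mono_l, Nat.divide_lcm_l.
    - apply Nat.divide_mul_r. eapply Nat.divide_trans; [|apply Nat.divide_lcm_r].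
      apply Nat.lcm_least; [apply Nat.divide_factor_l|apply Nat.divide_factor_r]. }
  assert (Z3 : ln (INR k3) <= r + ln (INR m3)).
  { apply Hle; auto. apply Nat.divide_pos_le; [nia|]. unfold k3, m3. apply Nat.lcm_least.
    - eapply Nat.divide_trans; [exact S2|]. apply Nat.mul_divide_mono_l, Nat.divide_lcm_l.
    - apply Nat.divide_mul_r, Nat.divide_lcm_r. }
  assert (Z4 : 2 * ln (INR q) + ln (INR o1) <= ln (INR k1) + ln (INR k2) + ln (INR k3)).
  { replace (2 * ln (INR q)) with (ln (INR q) + ln (INR q)) by ring.
    rewrite <- !ln_mult, <- !mult_INR by (rewrite <- ?mult_INR; apply lt_0_INR; nia). apply ln_INR_le; nia. }
  pose proof (ln_INR_le k1 q K1 T2). pose proof (ln_INR_le k2 q K2 T3). pose proof (ln_INR_le k3 q K3 T4).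
  pose proof (ln_INR_le o1 q (proj1 Ho1) T5).
  pose proof (ln_nonneg (INR o1) (INR_ge1 _ (proj1 Ho1))).
  pose proof (Hk o1 o2 o3 (proj1 Ho1) (proj1 Ho2) (proj1 Ho3)) as HkB.
  pose proof (kfun_nonneg L1 L2 L3 o1 o2 o3).
  rewrite <- (exp_ln (INR o1)) in HkB by (apply lt_0_INR; lia).
  unfold Rpower. rewrite <- !exp_plus.
  set (x1 := ln (INR m1)) in *. set (x2 := ln (INR m2)) in *. set (x3 := ln (INR m3)) in *.
  set (y1 := ln (INR k1)) in *. set (y2 := ln (INR k2)) in *. set (y3 := ln (INR k3)) in *.
  set (Q := ln (INR q)) in *. set (O := ln (INR o1)) in *.
  apply Rle_trans with (C * exp O * exp (- th1 * x1 + - th2 * x2 + - th3 * x3)).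
  { apply Rmult_le_compat_r; [left; apply exp_pos|auto]. }
  rewrite !Rmult_assoc, <- !exp_plus. apply Rmult_le_compat_l; [lra|]. apply Rexp_le.
  unfold zeta_exp in *.
  assert (A1 : - th1 * x1 <= - th1 * y1 + th1 * r) by nra.
  assert (A2 : - th2 * x2 <= - th2 * y2 + th2 * r) by nra.
  assert (A3 : - th3 * x3 <= - th3 * y3 + th3 * r) by nra.
  assert (A4 : (49 / 50 - th1) * y1 <= (49 / 50 - th1) * Q) by (apply Rmult_le_compat_l; lra).
  assert (A5 : (49 / 50 - th2) * y2 <= (49 / 50 - th2) * Q) by (apply Rmult_le_compat_l; lra).
  assert (A6 : (49 / 50 - th3) * y3 <= (49 / 50 - th3) * Q) by (apply Rmult_le_compat_l; lra).
  assert (A7 : (th1 + th2 + th3) * r <= 3 * r) by (apply Rmult_le_compat_r; lra).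
  assert (A8 : (49 / 50 * 3 - (th1 + th2 + th3)) * Q <= 1 / 2 * Q) by (apply Rmult_le_compat_r; lra).
  fold q. fold Q. lra.
Qed.

(** Each index is charged to its [q]. The number of indices charged to [q] is at most a product of
    six divisor functions, of order [q ^ (6/50)], which still leaves the convergent exponent
    [- 144/100 + 12/100 = - 1 - 32/100]. *)
Lemma wt_sum_bound L1 L2 L3 : resL L1 L2 <> 0%Z -> resL L1 L3 <> 0%Z -> resL L2 L3 <> 0%Z ->
  exists B, 0 <= B /\ forall th1 th2 th3 Y,
    0 <= th1 <= zeta_exp -> 0 <= th2 <= zeta_exp -> 0 <= th3 <= zeta_exp ->
    zeta_exp * 3 - 1 / 2 <= th1 + th2 + th3 ->
    Sum (T6 Y) (wt L1 L2 L3 th1 th2 th3) <= B.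
Proof.
  intros h12 h13 h23. destruct (wt_bound L1 L2 L3 h12 h13 h23) as [C [HC Hw]].
  set (R := Rn L1 L2 L3).
  assert (HRn : (1 <= R)%nat) by (unfold R, Rn; nia).
  destruct (divisor_bound (1 / 50) ltac:(lra)) as [D [HD Htau]].
  set (K := C * (D ^ 6 * Rpower (INR R) (2 / 50))).
  assert (HK : 0 <= K).
  { unfold K. pose proof (Rpower_pos (INR R) (2 / 50)). apply Rmult_le_pos; auto.
    apply Rmult_le_pos; [apply pow_le; lra|lra]. }
  exists (K * (1 + / (32 / 100))). split; [apply Rmult_le_pos; [auto|]; lra|].
  intros th1 th2 th3 Y B1 B2 B3 BS.
  (* Indicator of the six divisibilities; [o2] and [o3] divide only [R * q], by [kfun_support]. *)
  set (f := fun (q : nat) (t : E3 * E3) => let '((a, b, c), (o1, o2, o3)) := t in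
     (iv (divb a q) * iv (divb b q) * iv (divb c q)) * (iv (divb o1 q) * iv (divb o2 (R * q)) * iv (divb o3 (R * q)))).
  apply Rle_trans with (Sum (T6 Y) (fun t => Sum (seq 1 (Y * Y * (Y * Y))) (fun q => C * Rpower (INR q) (- (144 / 100)) * f q t))).
  { apply Sum_le. intros t Ht. specialize (Hw th1 th2 th3 Y t Ht B1 B2 B3 BS).
    destruct (Req_dec (wt L1 L2 L3 th1 th2 th3 t) 0) as [E0|E0].
    { rewrite E0. apply Sum_nonneg. intros q _. destruct t as [[[a b] c] [[o1 o2] o3]]. unfold f.
      apply Rmult_le_pos; [apply Rmult_le_pos; [auto|left; apply Rpower_pos]|].
      repeat apply Rmult_le_pos; apply iv_bounds. }
    destruct t as [[[a b] c] [[o1 o2] o3]].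
    unfold T6 in Ht. apply in_prod_iff in Ht. rewrite !in_list3 in Ht.
    destruct Ht as [(Ha & Hb & Hc) (Ho1 & Ho2 & Ho3)].
    assert (E : kfun L1 L2 L3 o1 o2 o3 <> 0).
    { intros E. apply E0. unfold wt. cbn [snd kf]. rewrite E. ring. }
    destruct (kfun_support _ _ _ _ _ _ (proj1 Ho1) (proj1 Ho2) (proj1 Ho3) E) as (_ & _ & S3 & S4).
    fold R in S3, S4.
    set (q := qq ((a, b, c), (o1, o2, o3))) in *.
    assert (Eq : q = Nat.lcm (Nat.lcm o1 a) (Nat.lcm b c)) by reflexivity.
    assert (Hq1 : (1 <= q)%nat) by (rewrite Eq; repeat apply lcm_pos; lia).
    assert (Hlm : forall x y, (1 <= x)%nat -> (1 <= y)%nat -> (Nat.lcm x y <= x * y)%nat).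
    { intros x y Hx Hy. apply Nat.divide_pos_le; [nia|]. apply Nat.lcm_least; [apply Nat.divide_factor_l|apply Nat.divide_factor_r]. }
    assert (Hq2 : (q <= Y * Y * (Y * Y))%nat).
    { rewrite Eq. eapply Nat.le_trans; [apply Hlm; repeat apply lcm_pos; lia|].
      apply Nat.mul_le_mono; (eapply Nat.le_trans; [apply Hlm; lia|]; apply Nat.mul_le_mono; lia). }
    assert (F1 : f q ((a, b, c), (o1, o2, o3)) = 1).
    { assert (Dq : forall x y, Nat.divide x y -> iv (divb x y) = 1) by (intros x y H; apply divb_iff in H; rewrite H; auto).
      unfold f. rewrite !Dq; [lra| | | | | |]; try (rewrite Eq; divs_solve; fail).
      - eapply Nat.divide_trans; [exact S4|]. apply Nat.mul_divide_mono_l. rewrite Eq. divs_solve.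
      - eapply Nat.divide_trans; [exact S3|]. apply Nat.mul_divide_mono_l. rewrite Eq. divs_solve. }
    pose proof (Sum_ge_term (seq 1 (Y * Y * (Y * Y))) (fun q => C * Rpower (INR q) (- (144 / 100)) * f q ((a, b, c), (o1, o2, o3))) q) as HS.
    cbv beta in HS. rewrite F1, Rmult_1_r in HS. eapply Rle_trans; [exact Hw|]. apply HS; [|apply in_seq; lia].
    intros q' _. apply Rmult_le_pos; [apply Rmult_le_pos; [auto|left; apply Rpower_pos]|]. unfold f.
    repeat apply Rmult_le_pos; apply iv_bounds. }
  rewrite Sum_swap.
  apply Rle_trans with (Sum (seq 1 (Y * Y * (Y * Y))) (fun q => K * Rpower (INR q) (- 1 - 32 / 100))).
  2:{ rewrite Sum_scal. apply Rmult_le_compat_l; auto. apply sum_pow_conv. lra. }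
  apply Sum_le. intros q Hq. apply in_seq in Hq. rewrite Sum_scal.
  assert (HT : Sum (T6 Y) (f q) <= D ^ 6 * Rpower (INR R) (2 / 50) * Rpower (INR q) (6 / 50)).
  { unfold T6. rewrite Sum_list_prod.
    rewrite (Sum_ext _ _ (fun e => (let '(a, b, c) := e in iv (divb a q) * iv (divb b q) * iv (divb c q)) *
        Sum (list3 Y) (fun o => let '(o1, o2, o3) := o in iv (divb o1 q) * iv (divb o2 (R * q)) * iv (divb o3 (R * q))))).
    2:{ intros [[a b] c] _. rewrite <- Sum_scal. apply Sum_ext. intros [[o1 o2] o3] _. reflexivity. }
    rewrite Sum_scal_r, !Sum_list3.
    rewrite (Sum3_prod _ (fun a => iv (divb a q)) (fun a => iv (divb a q)) (fun a => iv (divb a q))).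
    rewrite (Sum3_prod _ (fun a => iv (divb a q)) (fun a => iv (divb a (R * q))) (fun a => iv (divb a (R * q)))).
    assert (Hq0 : (1 <= q)%nat) by lia. assert (HRq : (1 <= R * q)%nat) by nia.
    pose proof (Sum_ind_div_le q Y Hq0) as I1. pose proof (Sum_ind_div_le (R * q) Y HRq) as I2.
    pose proof (Htau q Hq0) as J1. pose proof (Htau (R * q)%nat HRq) as J2.
    rewrite mult_INR, <- Rpower_mult_distr in J2 by (apply lt_0_INR; lia).
    set (s := Sum (seq 1 Y) (fun a => iv (divb a q))) in *.
    set (s' := Sum (seq 1 Y) (fun a => iv (divb a (R * q)))) in *.
    assert (P1 : 0 <= s) by (apply Sum_nonneg; intros; apply iv_bounds).
    assert (P2 : 0 <= s') by (apply Sum_nonneg; intros; apply iv_bounds).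
    set (u := Rpower (INR q) (1 / 50)) in *. set (v := Rpower (INR R) (1 / 50)) in *.
    assert (s <= D * u) by lra. assert (s' <= D * (v * u)) by lra.
    replace (Rpower (INR q) (6 / 50)) with (u ^ 6).
    2:{ unfold u. rewrite <- Rpower_pow by apply Rpower_pos. rewrite Rpower_mult. f_equal. simpl. lra. }
    replace (Rpower (INR R) (2 / 50)) with (v ^ 2).
    2:{ unfold v. rewrite <- Rpower_pow by apply Rpower_pos. rewrite Rpower_mult. f_equal. simpl. lra. }
    replace (D ^ 6 * v ^ 2 * u ^ 6) with ((D * u) * (D * u) * (D * u) * ((D * u) * (D * (v * u)) * (D * (v * u)))) by ring.
    repeat (apply Rmult_le_compat; auto; try (repeat apply Rmult_le_pos; auto; fail)). }
  assert (0 <= C * Rpower (INR q) (- (144 / 100))) by (apply Rmult_le_pos; [auto|left; apply Rpower_pos]).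
  eapply Rle_trans; [apply Rmult_le_compat_l; [auto|exact HT]|].
  replace (Rpower (INR q) (- 1 - 32 / 100)) with (Rpower (INR q) (- (144 / 100)) * Rpower (INR q) (6 / 50))
    by (rewrite <- Rpower_plus; f_equal; lra).
  unfold K. right. ring.
Qed.

(** * The main term for a single point *)

Definition harm (M : nat) : R := Sum (seq 1 M) (fun m => / INR m).

Lemma ln_succ_le n : (1 <= n)%nat -> ln (INR n + 1) - ln (INR n) <= / INR n.
Proof.
  intros Hn. pose proof (INR_ge1 n Hn).
  pose proof (exp_ineq1_le (/ INR n)) as H1.
  assert (0 < / INR n) by (apply Rinv_0_lt_compat; lra).
  apply Rln_le in H1; [|lra]. rewrite ln_exp in H1.
  replace (INR n + 1) with (INR n * (1 + / INR n)) by (field; lra).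
  rewrite ln_mult by lra. lra.
Qed.

Lemma ln_succ_ge n : (1 <= n)%nat -> / (INR n + 1) <= ln (INR n + 1) - ln (INR n).
Proof.
  intros Hn. pose proof (INR_ge1 n Hn). pose proof (ln_ge_inv (INR n + 1) ltac:(lra)) as H1.
  unfold Rdiv in H1. replace (INR n + 1 - 1) with (INR n) in H1 by lra.
  assert (0 < / INR n) by (apply Rinv_0_lt_compat; lra).
  rewrite ln_mult, ln_Rinv in H1 by lra. lra.
Qed.

(** Euler's constant, squeezed between the increasing sequence [w] and the decreasing sequence [u],
    whose difference at [M] is at most [/ INR M]. *)
Lemma euler_gamma : exists g, 0 <= g <= 1 /\ forall M t, (1 <= M)%nat -> INR M <= t <= INR M + 1 ->
  Rabs (harm M - ln t - g) <= / INR M.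
Proof.
  set (w := fun n => harm n - ln (INR n + 1)). set (u := fun n => harm n - ln (INR n)).
  assert (HS : forall n, harm (S n) = harm n + / (INR n + 1)).
  { intros n. unfold harm. rewrite Sum_seq_S. cbn [Nat.add]. rewrite S_INR. auto. }
  assert (Hw : forall n, w n <= w (S n)).
  { intros n. unfold w. rewrite HS. pose proof (ln_succ_le (S n) ltac:(lia)). rewrite !S_INR in *. lra. }
  assert (Hu : forall n, (1 <= n)%nat -> u (S n) <= u n).
  { intros n Hn. unfold u. rewrite HS. pose proof (ln_succ_ge n Hn). rewrite !S_INR in *. lra. }
  assert (Hwm : forall n k, w n <= w (n + k)%nat).
  { induction k; [rewrite Nat.add_0_r; lra|]. rewrite Nat.add_succ_r. specialize (Hw (n + k)%nat). lra. }
  assert (Hum : forall n k, (1 <= n)%nat -> u (n + k)%nat <= u n).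
  { induction k; intros Hn; [rewrite Nat.add_0_r; lra|]. rewrite Nat.add_succ_r.
    specialize (Hu (n + k)%nat ltac:(lia)). specialize (IHk Hn). lra. }
  assert (Hwu : forall n, (1 <= n)%nat -> w n <= u n).
  { intros n Hn. unfold w, u. pose proof (INR_ge1 n Hn). assert (ln (INR n) <= ln (INR n + 1)) by (apply Rln_le; lra). lra. }
  assert (Hwun : forall m n, (1 <= n)%nat -> w m <= u n).
  { intros m n Hn. destruct (Nat.le_gt_cases m n).
    - specialize (Hwm m (n - m)%nat). replace (m + (n - m))%nat with n in Hwm by lia. specialize (Hwu n Hn). lra.
    - specialize (Hum n (m - n)%nat Hn). replace (n + (m - n))%nat with m in Hum by lia. specialize (Hwu m ltac:(lia)). lra. }
  destruct (completeness (fun x => exists n, x = w n)) as [g [Hg1 Hg2]].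
  { exists (u 1%nat). intros x [n ->]. apply Hwun. lia. }
  { exists (w 0%nat). eauto. }
  assert (Hge : forall n, w n <= g) by (intros n; apply Hg1; eauto).
  assert (Hle : forall n, (1 <= n)%nat -> g <= u n) by (intros n Hn; apply Hg2; intros x [m ->]; apply Hwun; auto).
  exists g. split.
  - specialize (Hge 0%nat). specialize (Hle 1%nat ltac:(lia)).
    unfold w, u, harm, Sum in Hge, Hle. simpl in Hge, Hle. rewrite Rplus_0_l, ln_1 in Hge. rewrite ln_1, Rinv_1 in Hle. lra.
  - intros M t HM Ht. pose proof (INR_ge1 M HM).
    assert (ln (INR M) <= ln t) by (apply Rln_le; lra). assert (ln t <= ln (INR M + 1)) by (apply Rln_le; lra).
    specialize (Hge M). specialize (Hle M HM). pose proof (ln_succ_le M HM). unfold w, u in *.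
    apply Rabs_le. lra.
Qed.

Lemma ln_le_id x : 0 < x -> ln x <= x.
Proof. intros H. pose proof (exp_ineq1_le (ln x)). rewrite exp_ln in H0 by auto. lra. Qed.

(** The error is weakened from [1 / t] to the power [-1/2] of [t] so that [M = 0] is included: for
    [t <= 1] this power is at least 1 and dominates [- ln t], which is twice its logarithm. *)
Lemma harm_est : exists g, 0 <= g <= 1 /\ forall M t, 0 < t -> INR M <= t <= INR M + 1 ->
  Rabs (harm M - (ln t + g)) <= 3 * Rpower t (- (1 / 2)).
Proof.
  destruct euler_gamma as [g [Hg H]]. exists g. split; auto. intros M t Ht0 Ht.
  assert (Hln : ln t = - 2 * ln (Rpower t (- (1 / 2)))) by (unfold Rpower; rewrite ln_exp; lra).
  assert (Hp : 0 < Rpower t (- (1 / 2))) by apply Rpower_pos.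
  destruct (Nat.eq_dec M 0) as [->|HM].
  - simpl in Ht. unfold harm, Sum. simpl.
    assert (ln t <= 0) by (rewrite <- ln_1; apply Rln_le; lra).
    assert (1 <= Rpower t (- (1 / 2))).
    { unfold Rpower. apply Rle_trans with (exp 0); [rewrite exp_0; lra|]. apply Rexp_le. lra. }
    pose proof (ln_le_id (Rpower t (- (1 / 2))) Hp). apply Rabs_le. lra.
  - assert (HM1 : (1 <= M)%nat) by lia. specialize (H M t HM1 Ht). pose proof (INR_ge1 M HM1).
    replace (harm M - (ln t + g)) with (harm M - ln t - g) by ring.
    eapply Rle_trans; [exact H|].
    assert (/ INR M <= 2 * / t).
    { apply Rmult_le_reg_l with (INR M * t); [nra|].
      replace (INR M * t * / INR M) with t by (field; lra).
      replace (INR M * t * (2 * / t)) with (2 * INR M) by (field; lra). lra. }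
    assert (/ t <= Rpower t (- (1 / 2))).
    { rewrite <- (Rpower_1 t) at 1 by auto. rewrite <- Rpower_Ropp. apply Rle_Rpower; lra. }
    lra.
Qed.

Lemma Sum_multiples q Y (g : nat -> R) : (1 <= q)%nat -> (forall m, (Y < m)%nat -> g m = 0) ->
  Sum (seq 1 Y) (fun m => iv (divb q m) * g m) = Sum (seq 1 Y) (fun m => g (q * m)%nat).
Proof.
  intros Hq Hg. rewrite <- Sum_filter.
  rewrite (Sum_split_filter (fun m => (q * m <=? Y)%nat) (seq 1 Y) (fun m => g (q * m)%nat)).
  rewrite (Sum_zero (filter (fun x => negb (q * x <=? Y)%nat) _)).
  2:{ intros x Hx. apply filter_In in Hx. destruct Hx as [_ Hx]. apply Bool.negb_true_iff, Nat.leb_gt in Hx. auto. }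
  rewrite Rplus_0_r, <- (Sum_map (fun m => (q * m)%nat) _ g).
  apply Sum_same_elements.
  - apply NoDup_filter, seq_NoDup.
  - apply NoDup_map_on; [intros; nia|apply NoDup_filter, seq_NoDup].
  - intros x. rewrite filter_In, in_map_iff, in_seq, divb_iff. split.
    + intros [Hx [z Hz]]. exists z. split; [lia|]. apply filter_In. rewrite in_seq, Nat.leb_le.
      assert (z <> 0)%nat by (intros ->; lia). nia.
    + intros [z [<- Hz]]. apply filter_In in Hz. rewrite in_seq, Nat.leb_le in Hz. split; [nia|]. apply Nat.divide_factor_l.
Qed.

(** Replaces integer square roots: a quadratic condition [d * m * m + b <= N] is monotone in [m],
    hence a bound [m <= M]. *)
Lemma threshold (p : nat -> bool) Y : (forall m m', (m <= m')%nat -> p m' = true -> p m = true) ->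
  p (Y + 1)%nat = false ->
  exists M, (M <= Y)%nat /\ (forall m, (1 <= m)%nat -> (p m = true <-> (m <= M)%nat)).
Proof.
  intros Hm. induction Y; intros HY.
  - exists 0%nat. split; auto. intros m H. split; [|lia]. intros Hp. assert (p 1%nat = true) by (apply (Hm 1%nat m); auto). simpl in HY. congruence.
  - destruct (p (Y + 1)%nat) eqn:E.
    + exists (Y + 1)%nat. split; [lia|]. intros m H. split.
      * intros Hp. apply Nat.nlt_ge. intros Hlt. assert (p (S Y + 1)%nat = true) by (apply (Hm (S Y + 1)%nat m); auto; lia). congruence.
      * intros Hle. apply (Hm m (Y + 1)%nat); auto.
    + destruct IHY as [M [H1 H2]]; auto. exists M. split; [lia|auto].
Qed.

(* The weight [iv (divb o (d m)) / (d m)] is the factor attached to the frequency denominator [o]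
   in [dens_kfun]. *)
Definition hfun (Y b N d o : nat) : R :=
  Sum (seq 1 Y) (fun m => iv (d * m * m + b <=? N)%nat * (iv (divb o (d * m)) / INR (d * m))).

(** The constant term of the logarithm: the length of the harmonic sum is about [sqrt (N * d) / l],
    with [l] the lcm, whose logarithm is [/ 2 * ln N] plus this expression without [g]. *)
Definition beta (g : R) (d l : nat) : R := g - ln (INR l) + / 2 * ln (INR d).

(** [o] divides [d * m] exactly when [q = lcm o d / d] divides [m]. Putting [m = q * k] gives
    [d * m = lcm o d * k], so a harmonic sum in [k] remains. *)
Lemma hfun_reduce Y b N d o : (1 <= N <= Y)%nat -> (b <= 1)%nat -> (1 <= d)%nat -> (1 <= o)%nat ->
  exists q M, Nat.lcm o d = (d * q)%nat /\ (M <= Y)%nat /\ (forall m, (1 <= m)%nat -> ((Nat.lcm o d * q * m * m + b <= N)%nat <-> (m <= M)%nat)) /\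
    hfun Y b N d o = / INR (Nat.lcm o d) * harm M.
Proof.
  intros HN Hb Hd Ho. destruct (Nat.divide_lcm_r o d) as [q Hq].
  pose proof (lcm_pos o d Ho Hd). assert (Hq1 : (1 <= q)%nat) by (destruct q; lia).
  set (l := Nat.lcm o d) in *.
  destruct (threshold (fun m => (l * q * m * m + b <=? N)%nat) Y) as [M [HM1 HM2]].
  { intros m m' Hm. rewrite !Nat.leb_le. intros. assert (l * q * m * m <= l * q * m' * m')%nat; [|lia].
    apply Nat.mul_le_mono; auto. apply Nat.mul_le_mono_l; auto. }
  { apply Nat.leb_gt. assert (Y + 1 <= l * q * (Y + 1) * (Y + 1))%nat by nia. lia. }
  exists q, M. split; [lia|]. split; [auto|]. split.
  { intros m Hm. specialize (HM2 m Hm). rewrite Nat.leb_le in HM2. auto. }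
  unfold hfun.
  rewrite (Sum_ext _ _ (fun m => iv (divb q m) * (iv (d * m * m + b <=? N)%nat * / INR (d * m)))).
  2:{ intros m _. replace (divb q m) with (divb o (d * m)); [unfold Rdiv; ring|].
      apply Bool.eq_iff_eq_true. rewrite !divb_iff. split; intros Hdv.
      - apply (Nat.mul_divide_cancel_l _ _ d); [lia|]. rewrite (Nat.mul_comm d q), <- Hq.
        apply Nat.lcm_least; auto. apply Nat.divide_factor_l.
      - eapply Nat.divide_trans; [apply (Nat.divide_lcm_l o d)|]. fold l. rewrite Hq, (Nat.mul_comm q d).
        apply Nat.mul_divide_mono_l; auto. }
  rewrite Sum_multiples; auto.
  2:{ intros m Hm. replace (d * m * m + b <=? N)%nat with false; [simpl; ring|]. symmetry. apply Nat.leb_gt. nia. }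
  assert (Hk0 : forall k, (M < k <= Y)%nat -> iv (d * (q * k) * (q * k) + b <=? N)%nat * / INR (d * (q * k)) = 0).
  { intros k Hk. replace (d * (q * k) * (q * k) + b <=? N)%nat with false; [simpl; ring|].
    symmetry. apply Nat.leb_gt. apply Nat.nle_gt. intros Hle.
    assert (k <= M)%nat; [apply HM2; [lia|]; apply Nat.leb_le; rewrite Hq; lia|lia]. }
  rewrite (Sum_seq_extend M Y); [|lia|exact Hk0].
  unfold harm. rewrite <- Sum_scal. apply Sum_ext. intros m Hm. apply in_seq in Hm.
  replace (d * (q * m) * (q * m) + b <=? N)%nat with true.
  - simpl. replace (d * (q * m))%nat with (l * m)%nat by (rewrite Hq; ring).
    rewrite mult_INR, Rinv_mult. ring.
  - symmetry. apply Nat.leb_le. assert (Hle : (l * q * m * m + b <= N)%nat) by (apply Nat.leb_le, HM2; lia). nia.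
Qed.

Lemma hfun_bound Y b N d o : (1 <= N <= Y)%nat -> (b <= 1)%nat -> (1 <= d)%nat -> (1 <= o)%nat ->
  0 <= hfun Y b N d o * INR (Nat.lcm o d) <= 1 + ln (INR N).
Proof.
  intros HN Hb Hd Ho. destruct (hfun_reduce Y b N d o HN Hb Hd Ho) as (q & M & E1 & E2 & E3 & E4).
  pose proof (lcm_pos o d Ho Hd). pose proof (INR_ge1 _ H). rewrite E4.
  replace (/ INR (Nat.lcm o d) * harm M * INR (Nat.lcm o d)) with (harm M) by (field; lra).
  split.
  - apply Sum_nonneg. intros m Hm. apply in_seq in Hm. left. apply Rinv_0_lt_compat, lt_0_INR. lia.
  - destruct (Nat.eq_dec M 0) as [->|HM].
    + unfold harm, Sum. simpl. pose proof (ln_nonneg (INR N) (INR_ge1 N ltac:(lia))). lra.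
    + eapply Rle_trans; [apply sum_inv; lia|]. apply Rplus_le_compat_l. apply ln_INR_le; [lia|].
      pose proof (proj2 (E3 M ltac:(lia)) (le_n _)) as HE. assert (1 <= q)%nat by (destruct q; lia).
      assert (1 <= Nat.lcm o d * q)%nat by nia. set (k := (Nat.lcm o d * q)%nat) in *. clearbody k. nia.
Qed.

(** The error of [harm_est] at [t = sqrt (N * d) / l] is at most a multiple of
    [l ^ (1/2) * N ^ (- 1/4)]. Here arise both the exponent [1 / 2] tolerated by [wt_sum_bound] and
    a contribution [X ^ (7/4)] to the final error. *)
Lemma hfun_est : exists g, 0 <= g <= 1 /\ forall Y b N d o, (1 <= N <= Y)%nat -> (b <= 1)%nat -> (1 <= d)%nat -> (1 <= o)%nat ->
  Rabs (hfun Y b N d o * INR (Nat.lcm o d) - (/ 2 * ln (INR N) + beta g d (Nat.lcm o d)))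
    <= 3 * (Rpower (INR (Nat.lcm o d)) (1 / 2) * Rpower (INR N) (- (1 / 4))).
Proof.
  destruct harm_est as [g [Hg H]]. exists g. split; auto. intros Y b N d o HN Hb Hd Ho.
  destruct (hfun_reduce Y b N d o HN Hb Hd Ho) as (q & M & E1 & E2 & E3 & E4).
  pose proof (lcm_pos o d Ho Hd) as Hl. set (l := Nat.lcm o d) in *. pose proof (INR_ge1 _ Hl) as Hlr. rewrite E4.
  replace (/ INR l * harm M * INR l) with (harm M) by (field; lra).
  assert (Hq : (1 <= q)%nat) by (destruct q; lia).
  pose proof (INR_ge1 N ltac:(lia)) as HNr. pose proof (INR_ge1 d Hd) as Hdr. pose proof (INR_ge1 q Hq) as Hqr.
  set (lt := / 2 * (ln (INR N) + ln (INR d)) - ln (INR l)).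
  set (t := exp lt).
  assert (Ht0 : 0 < t) by apply exp_pos.
  assert (Ht2 : t * t * (INR l * INR q) = INR N).
  { unfold t. rewrite <- exp_plus.
    replace (lt + lt) with (ln (INR N) + ln (INR d) + (- ln (INR l) + - ln (INR l))) by (unfold lt; lra).
    rewrite !exp_plus, exp_Ropp, !exp_ln by lra. rewrite E1, mult_INR. field. lra. }
  assert (Hlow : INR M <= t).
  { apply Rnot_lt_le. intros Hlt. destruct (Nat.eq_dec M 0) as [E0|HM]; [subst M; simpl in Hlt; lra|].
    pose proof (proj2 (E3 M ltac:(lia)) (le_n _)) as HE. assert (HE' : (l * q * (M * M) <= N)%nat) by nia.
    apply le_INR in HE'. rewrite !mult_INR in HE'. rewrite <- Ht2 in HE'.
    assert (0 < INR l * INR q) by nra. assert (t * t < INR M * INR M) by nra. nra. }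
  (* The shift [b <= 1] is absorbed here: failure at [M + 1] still gives [N <= l * q * (M + 1)^2],
     without [b]. Hence all choices of [b] have the same asymptotics. *)
  assert (Hup : t <= INR M + 1).
  { apply Rnot_lt_le. intros Hlt. rewrite <- S_INR in Hlt.
    assert (HE : ~ (l * q * S M * S M + b <= N)%nat) by (rewrite E3; lia).
    assert (HE' : (N <= l * q * (S M * S M))%nat) by nia.
    apply le_INR in HE'. rewrite !mult_INR in HE'. rewrite <- Ht2 in HE'.
    assert (0 < INR l * INR q) by nra. pose proof (pos_INR (S M)). assert (INR (S M) * INR (S M) < t * t) by nra. nra. }
  specialize (H M t Ht0 (conj Hlow Hup)).
  replace (ln t + g) with (/ 2 * ln (INR N) + beta g d l) in H by (unfold t; rewrite ln_exp; unfold lt, beta; lra).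
  eapply Rle_trans; [exact H|]. apply Rmult_le_compat_l; [lra|].
  unfold Rpower. rewrite <- exp_plus. apply Rexp_le. unfold t. rewrite ln_exp. unfold lt.
  pose proof (ln_nonneg _ Hdr). lra.
Qed.

(** * The main term as one series *)

Definition condN (b N e m : E3) : R :=
  iv (dv1 e * p1 m * p1 m + p1 b <=? p1 N)%nat * iv (dv2 e * p2 m * p2 m + p2 b <=? p2 N)%nat *
  iv (dv3 e * p3 m * p3 m + p3 b <=? p3 N)%nat.

Definition densem (L1 L2 L3 : linform) (e m : E3) : R :=
  dens (dv1 e * p1 m * (dv2 e * p2 m) * (dv3 e * p3 m))
       (lamL L1 L2 L3 (dv1 e * p1 m) (dv2 e * p2 m) (dv3 e * p3 m)).

(** Two ranges are kept apart: [Y0] bounds the inner sums over [m], [Y] the indices of the series,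
    so that the latter can tend to infinity with the former fixed. *)
Definition Gmain (L1 L2 L3 : linform) (Y0 Y : nat) (W : E3 -> R) (b N : E3) : R :=
  Sum (T6 Y) (fun t => W (fst t) * kf L1 L2 L3 (snd t) *
    (hfun Y0 (p1 b) (p1 N) (dv1 (fst t)) (p1 (snd t)) * hfun Y0 (p2 b) (p2 N) (dv2 (fst t)) (p2 (snd t)) *
     hfun Y0 (p3 b) (p3 N) (dv3 (fst t)) (p3 (snd t)))).

Lemma d_pos e Y : In e (list3 Y) -> (1 <= dv1 e)%nat /\ (1 <= dv2 e)%nat /\ (1 <= dv3 e)%nat.
Proof.
  destruct e as [[a b] c]. rewrite in_list3. intros (Ha & Hb & Hc). cbn.
  repeat split; try (apply lcm_pos; lia). nia.
Qed.

Lemma p_pos e Y : In e (list3 Y) -> (1 <= p1 e <= Y)%nat /\ (1 <= p2 e <= Y)%nat /\ (1 <= p3 e <= Y)%nat.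
Proof. destruct e as [[a b] c]. rewrite in_list3. auto. Qed.

(** Inserting [dens_kfun] and exchanging the sums over [m] and over frequencies, the sum over [m]
    factors into three independent [hfun]. *)
Lemma G_dens L1 L2 L3 Y W b N : In N (list3 Y) ->
  Sum (list3 Y) (fun e => Sum (list3 Y) (fun m => W e * (condN b N e m * densem L1 L2 L3 e m))) =
  Gmain L1 L2 L3 Y Y W b N.
Proof.
  intros HN. apply p_pos in HN. destruct HN as (N1 & N2 & N3).
  unfold Gmain, T6. rewrite Sum_list_prod. apply Sum_ext. intros e He.
  destruct (d_pos e Y He) as (D1 & D2 & D3). cbn [fst snd].
  rewrite (Sum_ext _ _ (fun m => Sum (list3 Y) (fun o => W e * kf L1 L2 L3 o *
    (iv (dv1 e * p1 m * p1 m + p1 b <=? p1 N)%nat * (iv (divb (p1 o) (dv1 e * p1 m)) / INR (dv1 e * p1 m)) *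
     (iv (dv2 e * p2 m * p2 m + p2 b <=? p2 N)%nat * (iv (divb (p2 o) (dv2 e * p2 m)) / INR (dv2 e * p2 m))) *
     (iv (dv3 e * p3 m * p3 m + p3 b <=? p3 N)%nat * (iv (divb (p3 o) (dv3 e * p3 m)) / INR (dv3 e * p3 m))))))).
  - rewrite Sum_swap. apply Sum_ext. intros [[o1 o2] o3] _. rewrite Sum_scal. f_equal.
    rewrite Sum_list3. unfold hfun. rewrite <- Sum3_prod. reflexivity.
  - intros m Hm. apply p_pos in Hm. destruct Hm as (M1 & M2 & M3). unfold condN.
    destruct (Nat.leb_spec (dv1 e * p1 m * p1 m + p1 b) (p1 N)) as [C1|C1];
      [|simpl; rewrite !Rmult_0_l, Rmult_0_r; symmetry; apply Sum_zero; intros; ring].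
    destruct (Nat.leb_spec (dv2 e * p2 m * p2 m + p2 b) (p2 N)) as [C2|C2];
      [|simpl; rewrite !Rmult_0_r, !Rmult_0_l, Rmult_0_r; symmetry; apply Sum_zero; intros; ring].
    destruct (Nat.leb_spec (dv3 e * p3 m * p3 m + p3 b) (p3 N)) as [C3|C3];
      [|simpl; rewrite !Rmult_0_r, !Rmult_0_l, Rmult_0_r; symmetry; apply Sum_zero; intros; ring].
    unfold densem. rewrite (dens_kfun _ _ _ _ _ _ Y) by nia.
    rewrite <- Sum3_scal, <- Sum3_scal. rewrite Sum_list3. apply Sum3_ext. intros o1 o2 o3 _ _ _.
    cbn [p1 p2 p3 kf]. simpl. ring.
Qed.

Lemma Sum_incl_eq {A} (l l' : list A) f : NoDup l -> NoDup l' -> incl l l' ->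
  (forall x, In x l' -> ~ In x l -> f x = 0) -> Sum l f = Sum l' f.
Proof.
  revert l'. induction l; intros l' Hn Hn' Hi Hz.
  - symmetry. apply Sum_zero. intros x Hx. apply Hz; auto.
  - inversion Hn; subst. assert (Ha : In a l') by (apply Hi; left; auto).
    apply in_split in Ha. destruct Ha as [u [w ->]].
    pose proof (NoDup_remove _ _ _ Hn') as [R1 R2].
    rewrite Sum_app, !Sum_cons, (IHl (u ++ w)); auto.
    + rewrite Sum_app. lra.
    + intros x Hx. specialize (Hi x (or_intror Hx)). apply in_app_iff in Hi. apply in_app_iff.
      destruct Hi as [|[->|]]; auto. contradiction.
    + intros x Hx Hx'. apply Hz.
      * apply in_app_iff in Hx. apply in_app_iff. simpl; tauto.
      * intros [->|]; auto.
Qed.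

Lemma hfun_zero Y b N d o : (N <= Y)%nat -> (Y < d \/ Y < o)%nat -> (1 <= d)%nat -> hfun Y b N d o = 0.
Proof.
  intros HN H Hd. unfold hfun. apply Sum_zero. intros m Hm. apply in_seq in Hm.
  destruct (Nat.leb_spec (d * m * m + b) N); [|simpl; ring].
  destruct (divb o (d * m)) eqn:E; [|simpl; unfold Rdiv; ring].
  apply divb_le in E; [|nia]. nia.
Qed.

(** For an index beyond [Y] some [hfun] is an empty sum, since [d * m * m <= N <= Y] and [o | d * m]
    bound both [d] and [o] by [Y]. The finite sum thus equals every longer truncation and can be
    compared with the limit. *)
Lemma Gmain_stable L1 L2 L3 Y Y' W b N : In N (list3 Y) -> (Y <= Y')%nat ->
  Gmain L1 L2 L3 Y Y W b N = Gmain L1 L2 L3 Y Y' W b N.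
Proof.
  intros HN HY. apply p_pos in HN. destruct HN as (N1 & N2 & N3).
  unfold Gmain. apply Sum_incl_eq; try apply NoDup_T6; [apply incl_T6; auto|].
  intros [e o] Ht Ht'. unfold T6 in Ht. apply in_prod_iff in Ht. destruct Ht as [He Ho].
  destruct (d_pos e Y' He) as (D1 & D2 & D3).
  assert (H : (Y < dv1 e \/ Y < p1 o)%nat \/ (Y < dv2 e \/ Y < p2 o)%nat \/ (Y < dv3 e \/ Y < p3 o)%nat).
  { apply NNPP. intros C. apply Ht'. apply in_prod_iff.
    destruct e as [[a1 a2] a3], o as [[o1 o2] o3]. rewrite !in_list3 in *. cbn [dv1 dv2 dv3 p1 p2 p3] in *.
    assert (a1 <= Nat.lcm a1 a2)%nat by (apply Nat.divide_pos_le; [lia|apply Nat.divide_lcm_l]).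
    assert (a2 <= Nat.lcm a1 a2)%nat by (apply Nat.divide_pos_le; [lia|apply Nat.divide_lcm_r]).
    assert (a3 <= Nat.lcm a2 a3)%nat by (apply Nat.divide_pos_le; [lia|apply Nat.divide_lcm_r]).
    lia. }
  cbn [fst snd]. destruct H as [H|[H|H]].
  - rewrite (hfun_zero Y (p1 b) (p1 N) (dv1 e) (p1 o)); auto; [ring|lia].
  - rewrite (hfun_zero Y (p2 b) (p2 N) (dv2 e) (p2 o)); auto; [ring|lia].
  - rewrite (hfun_zero Y (p3 b) (p3 N) (dv3 e) (p3 o)); auto; [ring|lia].
Qed.

Definition bl : list bool := [true; false].
Definition sel (s : bool) (x y : R) : R := if s then x else y.

Lemma prod_expand x1 x2 x3 y1 y2 y3 :
  (x1 + y1) * (x2 + y2) * (x3 + y3) = Sum3 bl (fun s1 s2 s3 => sel s1 x1 y1 * sel s2 x2 y2 * sel s3 x3 y3).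
Proof.
  rewrite (Sum3_prod bl (fun s => sel s x1 y1) (fun s => sel s x2 y2) (fun s => sel s x3 y3)).
  unfold bl, Sum. simpl. ring.
Qed.

Lemma Un_cv_Sum {A} (l : list A) (u : A -> nat -> R) (v : A -> R) :
  (forall x, In x l -> Un_cv (u x) (v x)) -> Un_cv (fun n => Sum l (fun x => u x n)) (Sum l v).
Proof.
  induction l; intros H.
  - unfold Sum; simpl. intros e He. exists 0%nat. intros. rewrite R_dist_eq. auto.
  - rewrite Sum_cons. apply CV_plus; [apply H; left; auto|]. apply IHl. intros; apply H; right; auto.
Qed.

Lemma Un_cv_scal (u : nat -> R) l c : Un_cv u l -> Un_cv (fun n => u n * c) (l * c).
Proof.
  intros H. apply (CV_mult u (fun _ => c)); auto. intros e He. exists 0%nat. intros. rewrite R_dist_eq. auto.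
Qed.

Lemma Un_cv_close (u : nat -> R) l g E N0 : Un_cv u l -> (forall n, (N0 <= n)%nat -> Rabs (g - u n) <= E) -> Rabs (g - l) <= E.
Proof.
  intros H HE. apply Rnot_lt_le. intros Hlt.
  destruct (H (Rabs (g - l) - E) ltac:(lra)) as [N HN]. specialize (HN (Nat.max N N0) ltac:(lia)).
  specialize (HE (Nat.max N N0) ltac:(lia)). unfold R_dist in HN.
  replace (g - l) with ((g - u (Nat.max N N0)) + (u (Nat.max N N0) - l)) in Hlt at 2 by ring.
  replace (g - l) with ((g - u (Nat.max N N0)) + (u (Nat.max N N0) - l)) in HN by ring.
  pose proof (Rabs_triang (g - u (Nat.max N N0)) (u (Nat.max N N0) - l)). lra.
Qed.

Lemma l_pos t Y : In t (T6 Y) -> (1 <= l1 t)%nat /\ (1 <= l2 t)%nat /\ (1 <= l3 t)%nat.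
Proof.
  destruct t as [e o]. unfold T6. rewrite in_prod_iff. intros [He Ho].
  destruct (d_pos _ _ He) as (D1 & D2 & D3). destruct (p_pos _ _ Ho) as (P1 & P2 & P3).
  unfold l1, l2, l3. cbn [fst snd]. repeat split; apply lcm_pos; lia.
Qed.

Lemma beta_bound g o d : 0 <= g <= 1 -> (1 <= o)%nat -> (1 <= d)%nat ->
  Rabs (beta g d (Nat.lcm o d)) <= 51 * Rpower (INR (Nat.lcm o d)) (1 / 50).
Proof.
  intros Hg Ho Hd. pose proof (lcm_pos o d Ho Hd) as Hl.
  assert (Hdl : (d <= Nat.lcm o d)%nat) by (apply Nat.divide_pos_le; [lia|apply Nat.divide_lcm_r]).
  pose proof (ln_INR_le d _ Hd Hdl). set (l := Nat.lcm o d) in *.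
  pose proof (ln_nonneg _ (INR_ge1 d Hd)). pose proof (INR_ge1 l Hl).
  pose proof (Rpower_ge1 (INR l) (1 / 50)).
  assert (ln (INR l) = 50 * ln (Rpower (INR l) (1 / 50))) by (unfold Rpower; rewrite ln_exp; lra).
  pose proof (ln_le_id (Rpower (INR l) (1 / 50)) (Rpower_pos _ _)).
  unfold beta. apply Rabs_le. lra.
Qed.

(** Coefficient of the monomial [mono] with the same selectors in the product of the three factors
    [/ 2 * ln Ni + beta]; [true] takes the logarithm, [false] the constant [beta]. *)
Definition coef (L1 L2 L3 : linform) (W : E3 -> R) (g : R) (s1 s2 s3 : bool) (t : E3 * E3) : R :=
  W (fst t) * kf L1 L2 L3 (snd t) * (/ INR (l1 t) * / INR (l2 t) * / INR (l3 t)) *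
  (sel s1 1 (beta g (dv1 (fst t)) (l1 t)) * sel s2 1 (beta g (dv2 (fst t)) (l2 t)) * sel s3 1 (beta g (dv3 (fst t)) (l3 t))).

Lemma Rinv_Rpower x : 0 < x -> / x = Rpower x (- (1)).
Proof. intros. rewrite Rpower_Ropp, Rpower_1; auto. Qed.

Lemma mult3_abs x1 x2 x3 y1 y2 y3 : Rabs x1 <= y1 -> Rabs x2 <= y2 -> Rabs x3 <= y3 ->
  Rabs (x1 * x2 * x3) <= y1 * y2 * y3.
Proof.
  intros H1 H2 H3. rewrite !Rabs_mult.
  pose proof (Rabs_pos x1). pose proof (Rabs_pos x2). pose proof (Rabs_pos x3).
  apply Rmult_le_compat; auto; [apply Rmult_le_pos; auto|apply Rmult_le_compat; auto].
Qed.

Lemma coef_bound L1 L2 L3 W g s1 s2 s3 Y t : 0 <= g <= 1 -> In t (T6 Y) ->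
  (forall e, In e (list3 Y) -> Rabs (W e) <= 1) ->
  Rabs (coef L1 L2 L3 W g s1 s2 s3 t) <= 51 ^ 3 * wt L1 L2 L3 zeta_exp zeta_exp zeta_exp t.
Proof.
  intros Hg Ht HW. destruct (l_pos t Y Ht) as (A1 & A2 & A3).
  destruct t as [e o]. unfold T6 in Ht. apply in_prod_iff in Ht. destruct Ht as [He Ho].
  destruct (d_pos _ _ He) as (D1 & D2 & D3). destruct (p_pos _ _ Ho) as (P1 & P2 & P3).
  unfold coef, wt. cbn [fst snd].
  assert (Hk : 0 <= kf L1 L2 L3 o) by (destruct o as [[o1 o2] o3]; apply kfun_nonneg).
  assert (HS : forall s d o, (1 <= o)%nat -> (1 <= d)%nat -> Rabs (sel s 1 (beta g d (Nat.lcm o d))) <= 51 * Rpower (INR (Nat.lcm o d)) (1 / 50)).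
  { intros s d o' Ho' Hd. destruct s; simpl; [|apply beta_bound; auto].
    rewrite Rabs_R1. pose proof (Rpower_ge1 (INR (Nat.lcm o' d)) (1 / 50) (INR_ge1 _ (lcm_pos _ _ Ho' Hd))). lra. }
  assert (HT : forall s d o, (1 <= o)%nat -> (1 <= d)%nat ->
     Rabs (/ INR (Nat.lcm o d) * sel s 1 (beta g d (Nat.lcm o d))) <= 51 * Rpower (INR (Nat.lcm o d)) (- zeta_exp)).
  { intros s d o' Ho' Hd. pose proof (lcm_pos _ _ Ho' Hd). assert (0 < INR (Nat.lcm o' d)) by (apply lt_0_INR; lia).
    rewrite Rabs_mult, Rabs_right by (left; apply Rinv_0_lt_compat; auto).
    eapply Rle_trans; [apply Rmult_le_compat_l; [left; apply Rinv_0_lt_compat; auto|apply HS; auto]|].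
    rewrite Rinv_Rpower by auto. unfold zeta_exp.
    replace (- (49 / 50)) with (- (1) + 1 / 50) by lra. rewrite Rpower_plus. right; ring. }
  pose proof (mult3_abs _ _ _ _ _ _ (HT s1 (dv1 e) (p1 o) (proj1 P1) D1) (HT s2 (dv2 e) (p2 o) (proj1 P2) D2) (HT s3 (dv3 e) (p3 o) (proj1 P3) D3)) as HM.
  unfold l1, l2, l3. cbn [fst snd].
  match type of HM with Rabs ?X <= ?Z => replace (W e * kf L1 L2 L3 o * _ * _) with (W e * (kf L1 L2 L3 o * X)) by ring;
    replace (51 ^ 3 * _) with (1 * (kf L1 L2 L3 o * Z)) by ring end.
  rewrite Rabs_mult. apply Rmult_le_compat; try apply Rabs_pos; [apply HW; auto|].
  rewrite Rabs_mult, (Rabs_right (kf _ _ _ _)) by lra. apply Rmult_le_compat_l; auto.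
Qed.

Lemma prod_diff x1 x2 x3 u1 u2 u3 e1 e2 e3 B1 B2 B3 X :
  Rabs (x1 - u1) <= e1 -> Rabs (x2 - u2) <= e2 -> Rabs (x3 - u3) <= e3 ->
  Rabs x2 <= X -> Rabs x3 <= X -> Rabs u1 <= B1 -> Rabs u2 <= B2 -> Rabs u3 <= B3 ->
  Rabs (x1 * x2 * x3 - u1 * u2 * u3) <= e1 * X * X + B1 * e2 * X + B1 * B2 * e3.
Proof.
  intros. replace (x1 * x2 * x3 - u1 * u2 * u3) with
    ((x1 - u1) * x2 * x3 + u1 * (x2 - u2) * x3 + u1 * u2 * (x3 - u3)) by ring.
  eapply Rle_trans; [apply Rabs_triang|]. apply Rplus_le_compat; [|apply mult3_abs; auto].
  eapply Rle_trans; [apply Rabs_triang|]. apply Rplus_le_compat; apply mult3_abs; auto.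
Qed.

Definition E4 (N : E3) : R :=
  Rpower (INR (p1 N)) (- (1 / 4)) + Rpower (INR (p2 N)) (- (1 / 4)) + Rpower (INR (p3 N)) (- (1 / 4)).

Definition mono (s1 s2 s3 : bool) (N : E3) : R :=
  sel s1 (/ 2 * ln (INR (p1 N))) 1 * sel s2 (/ 2 * ln (INR (p2 N))) 1 * sel s3 (/ 2 * ln (INR (p3 N))) 1.

(** Each [hfun] is multiplied by its lcm and replaced by its approximation, one factor at a time. In
    each of the three differences one factor carries [l ^ (1/2)], which produces the three weights
    on the right. The constant 52 is 51 from [beta_bound] plus 1 for the logarithm. *)
Lemma term_est L1 L2 L3 W Y0 Y b N Lam t g :
  0 <= g <= 1 ->
  (forall Y b N d o, (1 <= N <= Y)%nat -> (b <= 1)%nat -> (1 <= d)%nat -> (1 <= o)%nat ->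
    Rabs (hfun Y b N d o * INR (Nat.lcm o d) - (/ 2 * ln (INR N) + beta g d (Nat.lcm o d)))
      <= 3 * (Rpower (INR (Nat.lcm o d)) (1 / 2) * Rpower (INR N) (- (1 / 4)))) ->
  In t (T6 Y) -> In N (list3 Y0) -> (p1 b <= 1)%nat -> (p2 b <= 1)%nat -> (p3 b <= 1)%nat ->
  1 <= Lam -> 1 + ln (INR (p1 N)) <= Lam -> 1 + ln (INR (p2 N)) <= Lam -> 1 + ln (INR (p3 N)) <= Lam ->
  Rabs (W (fst t)) <= 1 ->
  Rabs (W (fst t) * kf L1 L2 L3 (snd t) *
    (hfun Y0 (p1 b) (p1 N) (dv1 (fst t)) (p1 (snd t)) * hfun Y0 (p2 b) (p2 N) (dv2 (fst t)) (p2 (snd t)) *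
     hfun Y0 (p3 b) (p3 N) (dv3 (fst t)) (p3 (snd t))) -
    Sum3 bl (fun s1 s2 s3 => coef L1 L2 L3 W g s1 s2 s3 t * mono s1 s2 s3 N))
  <= 52 ^ 2 * 3 * (Lam * Lam) * (E4 N *
     (wt L1 L2 L3 (1 / 2) zeta_exp zeta_exp t + wt L1 L2 L3 zeta_exp (1 / 2) zeta_exp t + wt L1 L2 L3 zeta_exp zeta_exp (1 / 2) t)).
Proof.
  intros Hg Hh Ht HN Hb1 Hb2 Hb3 HL HL1 HL2 HL3 HW. destruct (l_pos t Y Ht) as (A1 & A2 & A3).
  destruct t as [e o]. unfold T6 in Ht. apply in_prod_iff in Ht. destruct Ht as [He Ho].
  destruct (d_pos _ _ He) as (D1 & D2 & D3). destruct (p_pos _ _ Ho) as (P1 & P2 & P3).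
  destruct (p_pos _ _ HN) as (N1 & N2 & N3). cbn [fst snd] in *.
  assert (Hk : 0 <= kf L1 L2 L3 o) by (destruct o as [[o1 o2] o3]; apply kfun_nonneg).
  unfold l1, l2, l3 in A1, A2, A3. cbn [fst snd] in A1, A2, A3.
  pose proof (Hh Y0 (p1 b) (p1 N) (dv1 e) (p1 o) N1 Hb1 D1 (proj1 P1)) as H1.
  pose proof (Hh Y0 (p2 b) (p2 N) (dv2 e) (p2 o) N2 Hb2 D2 (proj1 P2)) as H2.
  pose proof (Hh Y0 (p3 b) (p3 N) (dv3 e) (p3 o) N3 Hb3 D3 (proj1 P3)) as H3.
  pose proof (hfun_bound Y0 (p2 b) (p2 N) (dv2 e) (p2 o) N2 Hb2 D2 (proj1 P2)) as X2.
  pose proof (hfun_bound Y0 (p3 b) (p3 N) (dv3 e) (p3 o) N3 Hb3 D3 (proj1 P3)) as X3.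
  pose proof (beta_bound g (p1 o) (dv1 e) Hg (proj1 P1) D1) as B1.
  pose proof (beta_bound g (p2 o) (dv2 e) Hg (proj1 P2) D2) as B2.
  pose proof (beta_bound g (p3 o) (dv3 e) Hg (proj1 P3) D3) as B3.
  replace (Sum3 bl _) with (W e * kf L1 L2 L3 o * (/ INR (l1 (e, o)) * / INR (l2 (e, o)) * / INR (l3 (e, o))) *
    ((/ 2 * ln (INR (p1 N)) + beta g (dv1 e) (l1 (e, o))) * (/ 2 * ln (INR (p2 N)) + beta g (dv2 e) (l2 (e, o))) *
     (/ 2 * ln (INR (p3 N)) + beta g (dv3 e) (l3 (e, o))))).
  2:{ rewrite prod_expand, <- Sum3_scal. apply Sum3_ext. intros s1 s2 s3 _ _ _. unfold coef, mono. cbn [fst snd].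
      destruct s1, s2, s3; simpl; ring. }
  unfold wt, l1, l2, l3, E4. cbn [fst snd].
  set (m1 := Nat.lcm (p1 o) (dv1 e)) in *. set (m2 := Nat.lcm (p2 o) (dv2 e)) in *. set (m3 := Nat.lcm (p3 o) (dv3 e)) in *.
  assert (R1 : 1 <= INR m1) by (apply INR_ge1; auto). assert (R2 : 1 <= INR m2) by (apply INR_ge1; auto).
  assert (R3 : 1 <= INR m3) by (apply INR_ge1; auto).
  set (h1 := hfun Y0 (p1 b) (p1 N) (dv1 e) (p1 o)) in *. set (h2 := hfun Y0 (p2 b) (p2 N) (dv2 e) (p2 o)) in *.
  set (h3 := hfun Y0 (p3 b) (p3 N) (dv3 e) (p3 o)) in *.
  set (be1 := beta g (dv1 e) m1) in *. set (be2 := beta g (dv2 e) m2) in *. set (be3 := beta g (dv3 e) m3) in *.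
  assert (HU : forall n m be, (1 <= n)%nat -> 1 + ln (INR n) <= Lam -> 1 <= INR m -> Rabs be <= 51 * Rpower (INR m) (1 / 50) ->
     Rabs (/ 2 * ln (INR n) + be) <= 52 * Lam * Rpower (INR m) (1 / 50)).
  { intros n m be Hn Hnl Hm Hbe. eapply Rle_trans; [apply Rabs_triang|].
    pose proof (ln_nonneg _ (INR_ge1 n Hn)). rewrite Rabs_right by lra.
    pose proof (Rpower_ge1 (INR m) (1 / 50) Hm ltac:(lra)). nra. }
  pose proof (HU _ _ _ (proj1 N1) HL1 R1 B1) as U1. pose proof (HU _ _ _ (proj1 N2) HL2 R2 B2) as U2.
  pose proof (HU _ _ _ (proj1 N3) HL3 R3 B3) as U3. clear HU.
  assert (V2 : Rabs (h2 * INR m2) <= Lam) by (rewrite Rabs_right; lra).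
  assert (V3 : Rabs (h3 * INR m3) <= Lam) by (rewrite Rabs_right; lra).
  pose proof (prod_diff _ _ _ _ _ _ _ _ _ _ _ _ _ H1 H2 H3 V2 V3 U1 U2 U3) as HP.
  set (u1 := / 2 * ln (INR (p1 N)) + be1) in *. set (u2 := / 2 * ln (INR (p2 N)) + be2) in *. set (u3 := / 2 * ln (INR (p3 N)) + be3) in *.
  set (n1 := Rpower (INR (p1 N)) (- (1 / 4))) in *. set (n2 := Rpower (INR (p2 N)) (- (1 / 4))) in *. set (n3 := Rpower (INR (p3 N)) (- (1 / 4))) in *.
  assert (Q1 : 0 < n1) by apply Rpower_pos. assert (Q2 : 0 < n2) by apply Rpower_pos. assert (Q3 : 0 < n3) by apply Rpower_pos.
  replace (W e * kf L1 L2 L3 o * (h1 * h2 * h3) - W e * kf L1 L2 L3 o * (/ INR m1 * / INR m2 * / INR m3) * (u1 * u2 * u3)) with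
    (W e * (kf L1 L2 L3 o * ((/ INR m1 * / INR m2 * / INR m3) * (h1 * INR m1 * (h2 * INR m2) * (h3 * INR m3) - u1 * u2 * u3))))
    by (field; lra).
  rewrite Rabs_mult. rewrite <- (Rmult_1_l (52 ^ 2 * 3 * _ * _)). apply Rmult_le_compat; try apply Rabs_pos; auto.
  rewrite Rabs_mult, (Rabs_right (kf _ _ _ _)) by lra.
  replace (52 ^ 2 * 3 * (Lam * Lam) * _) with (kf L1 L2 L3 o * (52 ^ 2 * 3 * (Lam * Lam) * ((n1 + n2 + n3) *
     (Rpower (INR m1) (- (1 / 2)) * Rpower (INR m2) (- zeta_exp) * Rpower (INR m3) (- zeta_exp) +
      Rpower (INR m1) (- zeta_exp) * Rpower (INR m2) (- (1 / 2)) * Rpower (INR m3) (- zeta_exp) +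
      Rpower (INR m1) (- zeta_exp) * Rpower (INR m2) (- zeta_exp) * Rpower (INR m3) (- (1 / 2)))))) by ring.
  apply Rmult_le_compat_l; auto.
  assert (HI : 0 < / INR m1 * / INR m2 * / INR m3) by (repeat apply Rmult_lt_0_compat; apply Rinv_0_lt_compat; lra).
  rewrite Rabs_mult, (Rabs_right (_ * _ * _)) by lra.
  eapply Rle_trans; [apply Rmult_le_compat_l; [lra|exact HP]|].
  assert (Hinv : forall m, 1 <= INR m -> / INR m * Rpower (INR m) (1 / 2) = Rpower (INR m) (- (1 / 2)) /\
     / INR m * Rpower (INR m) (1 / 50) = Rpower (INR m) (- zeta_exp) /\ 0 < / INR m <= Rpower (INR m) (- zeta_exp) /\
     0 < Rpower (INR m) (- (1 / 2))).
  { intros m Hm. unfold zeta_exp. split; [|split; [|split; [split|]]].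
    - rewrite Rinv_Rpower, <- Rpower_plus by lra. f_equal; lra.
    - rewrite Rinv_Rpower, <- Rpower_plus by lra. f_equal; lra.
    - apply Rinv_0_lt_compat; lra.
    - rewrite Rinv_Rpower by lra. apply Rle_Rpower; lra.
    - apply Rpower_pos. }
  destruct (Hinv m1 R1) as (I1 & J1 & K1 & Z1). destruct (Hinv m2 R2) as (I2 & J2 & K2 & Z2). destruct (Hinv m3 R3) as (I3 & J3 & K3 & Z3).
  clear Hinv.
  set (i1 := / INR m1) in *. set (i2 := / INR m2) in *. set (i3 := / INR m3) in *.
  set (q1 := Rpower (INR m1) (- zeta_exp)) in *. set (q2 := Rpower (INR m2) (- zeta_exp)) in *. set (q3 := Rpower (INR m3) (- zeta_exp)) in *.
  set (h1' := Rpower (INR m1) (- (1 / 2))) in *. set (h2' := Rpower (INR m2) (- (1 / 2))) in *. set (h3' := Rpower (INR m3) (- (1 / 2))) in *.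
  set (a1 := Rpower (INR m1) (1 / 2)) in *. set (a2 := Rpower (INR m2) (1 / 2)) in *. set (a3 := Rpower (INR m3) (1 / 2)) in *.
  set (b1 := Rpower (INR m1) (1 / 50)) in *. set (b2 := Rpower (INR m2) (1 / 50)) in *.
  replace (i1 * i2 * i3 * (3 * (a1 * n1) * Lam * Lam + 52 * Lam * b1 * (3 * (a2 * n2)) * Lam + 52 * Lam * b1 * (52 * Lam * b2) * (3 * (a3 * n3))))
    with (3 * (Lam * Lam) * (n1 * ((i1 * a1) * i2 * i3) + 52 * n2 * ((i1 * b1) * (i2 * a2) * i3) + 52 * 52 * n3 * ((i1 * b1) * (i2 * b2) * (i3 * a3)))) by ring.
  rewrite I1, I2, I3, J1, J2.
  assert (T1 : h1' * i2 * i3 <= h1' * q2 * q3) by (apply Rmult_le_compat; try lra; [apply Rmult_le_pos; lra|apply Rmult_le_compat_l; lra]).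
  assert (T2 : q1 * h2' * i3 <= q1 * h2' * q3) by (apply Rmult_le_compat_l; [apply Rmult_le_pos; lra|lra]).
  assert (0 <= h1' * q2 * q3) by (repeat apply Rmult_le_pos; lra).
  assert (0 <= q1 * h2' * q3) by (repeat apply Rmult_le_pos; lra).
  assert (0 <= q1 * q2 * h3') by (repeat apply Rmult_le_pos; lra).
  replace (52 ^ 2 * 3 * (Lam * Lam) * _) with (3 * (Lam * Lam) * (52 * 52 * ((n1 + n2 + n3) * (h1' * q2 * q3 + q1 * h2' * q3 + q1 * q2 * h3')))) by ring.
  apply Rmult_le_compat_l; [nra|].
  set (w1 := h1' * q2 * q3) in *. set (w2 := q1 * h2' * q3) in *. set (w3 := q1 * q2 * h3') in *.
  assert (F1 : n1 * (h1' * i2 * i3) <= n1 * w1) by (apply Rmult_le_compat_l; lra).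
  assert (F2 : n2 * (q1 * h2' * i3) <= n2 * w2) by (apply Rmult_le_compat_l; lra).
  assert (0 <= n1 * w1) by (apply Rmult_le_pos; lra). assert (0 <= n1 * w2) by (apply Rmult_le_pos; lra).
  assert (0 <= n1 * w3) by (apply Rmult_le_pos; lra). assert (0 <= n2 * w1) by (apply Rmult_le_pos; lra).
  assert (0 <= n2 * w2) by (apply Rmult_le_pos; lra). assert (0 <= n2 * w3) by (apply Rmult_le_pos; lra).
  assert (0 <= n3 * w1) by (apply Rmult_le_pos; lra). assert (0 <= n3 * w2) by (apply Rmult_le_pos; lra).
  assert (0 <= n3 * w3) by (apply Rmult_le_pos; lra). lra.
Qed.

(** The constants [Q] are the sums of the eight absolutely convergent series of [coef], so they do
    not depend on the point. The one for three logarithms is identified because it gives the leading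
    coefficient. *)
Lemma G_est L1 L2 L3 : resL L1 L2 <> 0%Z -> resL L1 L3 <> 0%Z -> resL L2 L3 <> 0%Z ->
  exists C, 0 <= C /\ forall W, (forall Y e, In e (list3 Y) -> Rabs (W e) <= 1) ->
  exists Q : bool -> bool -> bool -> R,
    Un_cv (fun Y => Sum (T6 Y) (fun t => W (fst t) * kf L1 L2 L3 (snd t) * (/ INR (l1 t) * / INR (l2 t) * / INR (l3 t)))) (Q true true true) /\
    forall Y b N Lam, In N (list3 Y) -> (p1 b <= 1)%nat -> (p2 b <= 1)%nat -> (p3 b <= 1)%nat ->
    1 <= Lam -> 1 + ln (INR (p1 N)) <= Lam -> 1 + ln (INR (p2 N)) <= Lam -> 1 + ln (INR (p3 N)) <= Lam ->
    Rabs (Gmain L1 L2 L3 Y Y W b N - Sum3 bl (fun s1 s2 s3 => Q s1 s2 s3 * mono s1 s2 s3 N)) <= C * (Lam * Lam) * E4 N.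
Proof.
  intros h12 h13 h23. destruct (wt_sum_bound L1 L2 L3 h12 h13 h23) as [B [HB Hw]].
  destruct hfun_est as [g [Hg Hh]].
  exists (52 ^ 2 * 3 * (3 * B)). split; [nra|]. intros W HW.
  assert (Hc : forall s1 s2 s3, { l | Un_cv (fun Y => Sum (T6 Y) (coef L1 L2 L3 W g s1 s2 s3)) l }).
  { intros s1 s2 s3. apply (sums_converge T6 (coef L1 L2 L3 W g s1 s2 s3) (51 ^ 3 * B)).
    - apply NoDup_T6.
    - intros Y. apply incl_T6. lia.
    - intros Y. apply Rle_trans with (51 ^ 3 * Sum (T6 Y) (wt L1 L2 L3 zeta_exp zeta_exp zeta_exp)).
      + rewrite <- Sum_scal. apply Sum_le. intros t Ht. apply (coef_bound L1 L2 L3 W g s1 s2 s3 Y t); auto. apply HW.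
      + apply Rmult_le_compat_l; [lra|]. apply Hw; unfold zeta_exp; lra. }
  exists (fun s1 s2 s3 => proj1_sig (Hc s1 s2 s3)). split.
  { destruct (Hc true true true) as [l Hl]. cbn [proj1_sig]. intros ep Hep. destruct (Hl ep Hep) as [n0 Hn0].
    exists n0. intros n Hn. specialize (Hn0 n Hn).
    rewrite (Sum_ext _ _ (coef L1 L2 L3 W g true true true)); auto. intros t _. unfold coef, sel. ring. }
  intros Y b N Lam HN Hb1 Hb2 Hb3 HL HL1 HL2 HL3.
  (* Only the truncation of the series tends to infinity; the left side is constant by
     [Gmain_stable], and the error bound is uniform in the truncation. *)
  apply (Un_cv_close (fun Y' => Sum3 bl (fun s1 s2 s3 => Sum (T6 Y') (coef L1 L2 L3 W g s1 s2 s3) * mono s1 s2 s3 N)) _ _ _ Y).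
  { unfold Sum3. do 3 (apply Un_cv_Sum; intros). apply Un_cv_scal. exact (proj2_sig (Hc x x0 x1)). }
  intros Y' HY. rewrite (Gmain_stable L1 L2 L3 Y Y' W b N HN HY).
  rewrite (Sum3_ext bl _ (fun s1 s2 s3 => Sum (T6 Y') (fun t => coef L1 L2 L3 W g s1 s2 s3 t * mono s1 s2 s3 N)))
    by (intros; rewrite Sum_scal_r; auto).
  rewrite <- Sum3_swap1. unfold Gmain.
  eapply Rle_trans; [apply Sum_abs_diff; intros t Ht; apply (term_est L1 L2 L3 W Y Y' b N Lam t g); auto|].
  { apply (HW Y'). destruct t as [e o]. unfold T6 in Ht. apply in_prod_iff in Ht. tauto. }
  rewrite Sum_scal, Sum_scal, !Sum_plus.
  assert (HE : 0 <= E4 N) by (unfold E4; pose proof (Rpower_pos (INR (p1 N)) (- (1 / 4)));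
     pose proof (Rpower_pos (INR (p2 N)) (- (1 / 4))); pose proof (Rpower_pos (INR (p3 N)) (- (1 / 4))); lra).
  pose proof (Hw (1 / 2) zeta_exp zeta_exp Y' ltac:(unfold zeta_exp; lra) ltac:(unfold zeta_exp; lra) ltac:(unfold zeta_exp; lra) ltac:(unfold zeta_exp; lra)) as G1.
  pose proof (Hw zeta_exp (1 / 2) zeta_exp Y' ltac:(unfold zeta_exp; lra) ltac:(unfold zeta_exp; lra) ltac:(unfold zeta_exp; lra) ltac:(unfold zeta_exp; lra)) as G2.
  pose proof (Hw zeta_exp zeta_exp (1 / 2) Y' ltac:(unfold zeta_exp; lra) ltac:(unfold zeta_exp; lra) ltac:(unfold zeta_exp; lra) ltac:(unfold zeta_exp; lra)) as G3.
  replace (52 ^ 2 * 3 * (3 * B) * (Lam * Lam) * E4 N) with (52 ^ 2 * 3 * (Lam * Lam) * (E4 N * (3 * B))) by ring.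
  apply Rmult_le_compat_l; [nra|]. apply Rmult_le_compat_l; auto.
  change (fun x => wt L1 L2 L3 (1 / 2) zeta_exp zeta_exp x) with (wt L1 L2 L3 (1 / 2) zeta_exp zeta_exp).
  lra.
Qed.

(** * Sums of logarithms of linear forms *)

Definition Labs (L : linform) (x : Z * Z) : nat := Z.abs_nat (evalL L (fst x) (snd x)).
Definition cf (L : linform) : nat := (Z.abs_nat (fst L) + Z.abs_nat (snd L))%nat.
Definition nzL (L : linform) (x : Z * Z) : bool := negb (Labs L x =? 0)%nat.

Lemma nzL_iff L x : nzL L x = true <-> (1 <= Labs L x)%nat.
Proof. unfold nzL. rewrite Bool.negb_true_iff, Nat.eqb_neq. lia. Qed.

Lemma Labs_le L X x : In x (box X) -> (Labs L x <= cf L * X)%nat.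
Proof.
  intros Hx. apply in_box in Hx. unfold Labs, cf, evalL.
  assert (Z.abs (fst L * fst x) <= Z.abs (fst L) * Z.of_nat X)%Z by (rewrite Z.abs_mul; apply Z.mul_le_mono_nonneg; lia).
  assert (Z.abs (snd L * snd x) <= Z.abs (snd L) * Z.of_nat X)%Z by (rewrite Z.abs_mul; apply Z.mul_le_mono_nonneg; lia).
  lia.
Qed.

Lemma count_form_eq L X (z : Z) : fst L <> 0%Z \/ snd L <> 0%Z ->
  Sum (box X) (fun x => iv (evalL L (fst x) (snd x) =? z)%Z) <= INR X.
Proof.
  intros HL. unfold box. rewrite Sum_list_prod. cbn [fst snd].
  assert (Hlen : INR (length (zseq X)) * 1 = INR X) by (unfold zseq; rewrite length_map, length_seq; ring).
  destruct HL as [HL|HL].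
  - rewrite Sum_swap. rewrite <- Hlen, <- Sum_const. apply Sum_le. intros y _.
    apply Sum_unique_le1; [apply NoDup_zseq|]. intros x x' _ _ E E'. apply Z.eqb_eq in E, E'. unfold evalL in *. nia.
  - rewrite <- Hlen, <- Sum_const. apply Sum_le. intros y _.
    apply Sum_unique_le1; [apply NoDup_zseq|]. intros x x' _ _ E E'. apply Z.eqb_eq in E, E'. unfold evalL in *. nia.
Qed.

Lemma count_Labs_eq L X n : fst L <> 0%Z \/ snd L <> 0%Z ->
  Sum (box X) (fun x => iv (Labs L x =? n)%nat) <= 2 * INR X.
Proof.
  intros HL.
  apply Rle_trans with (Sum (box X) (fun x => iv (evalL L (fst x) (snd x) =? Z.of_nat n)%Z + iv (evalL L (fst x) (snd x) =? - Z.of_nat n)%Z)).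
  - apply Sum_le. intros x _. destruct (Nat.eqb_spec (Labs L x) n) as [E|E].
    + unfold Labs in E. destruct (Z.eqb_spec (evalL L (fst x) (snd x)) (Z.of_nat n)); simpl;
        [pose proof (iv_bounds (evalL L (fst x) (snd x) =? - Z.of_nat n)%Z); lra|].
      replace (evalL L (fst x) (snd x) =? - Z.of_nat n)%Z with true by (symmetry; apply Z.eqb_eq; lia). simpl; lra.
    + pose proof (iv_bounds (evalL L (fst x) (snd x) =? Z.of_nat n)%Z).
      pose proof (iv_bounds (evalL L (fst x) (snd x) =? - Z.of_nat n)%Z). simpl; lra.
  - rewrite Sum_plus. pose proof (count_form_eq L X (Z.of_nat n) HL). pose proof (count_form_eq L X (- Z.of_nat n) HL). lra.
Qed.

(** A value of [|L|] is taken on at most two lines, each with at most [X] points of the box, so the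
    sum over the box reduces to a one-dimensional sum over values. *)
Lemma sum_form L X (g : nat -> R) : fst L <> 0%Z \/ snd L <> 0%Z -> (forall n, 0 <= g n) ->
  Sum (box X) (fun x => iv (nzL L x) * g (Labs L x)) <= 2 * INR X * Sum (seq 1 (cf L * X)) g.
Proof.
  intros HL Hg.
  rewrite (Sum_ext _ _ (fun x => Sum (seq 1 (cf L * X)) (fun n => iv (n =? Labs L x)%nat * g n))).
  - rewrite Sum_swap, <- Sum_scal. apply Sum_le. intros n _.
    rewrite Sum_scal_r. apply Rmult_le_compat_r; auto.
    rewrite (Sum_ext _ _ (fun x => iv (Labs L x =? n)%nat)) by (intros; rewrite Nat.eqb_sym; auto).
    apply count_Labs_eq; auto.
  - intros x Hx. pose proof (Labs_le L X x Hx). destruct (nzL L x) eqn:E.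
    + apply nzL_iff in E. simpl. rewrite Rmult_1_l. symmetry.
      apply (Sum_ind_unique (seq 1 (cf L * X)) (fun n => (n =? Labs L x)%nat) (Labs L x) g).
      * apply seq_NoDup.
      * apply in_seq. lia.
      * intros m _. apply Nat.eqb_eq.
    + simpl. rewrite Rmult_0_l. symmetry. apply Sum_zero. intros n Hn. apply in_seq in Hn.
      destruct (Nat.eqb_spec n (Labs L x)); [|simpl; ring]. exfalso.
      assert (nzL L x = true) by (apply nzL_iff; lia). congruence.
Qed.

Lemma Sum_seq_shift a k (f : nat -> R) : Sum (seq (1 + a) k) f = Sum (seq 1 k) (fun s => f (a + s)%nat).
Proof.
  induction k; [reflexivity|]. rewrite !Sum_seq_S, IHk. f_equal. f_equal. lia.
Qed.

Lemma block_1d M X (g : Z -> R) :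
  Sum (zseq (M * X)) g = Sum (zseq X) (fun x => Sum (zseq M) (fun s => g (Z.of_nat M * (x - 1) + s)%Z)).
Proof.
  unfold zseq. rewrite !Sum_map. induction X.
  - rewrite Nat.mul_0_r. reflexivity.
  - rewrite Sum_seq_S, <- IHX, Nat.mul_succ_r, seq_app, Sum_app. f_equal. rewrite Sum_map.
    rewrite Sum_seq_shift. apply Sum_ext. intros s _. f_equal. lia.
Qed.

Lemma block_2d M X (g : Z * Z -> R) :
  Sum (box (M * X)) g = Sum (box X) (fun x => Sum (box M) (fun s =>
    g (Z.of_nat M * (fst x - 1) + fst s, Z.of_nat M * (snd x - 1) + snd s)%Z)).
Proof.
  unfold box. rewrite !Sum_list_prod. rewrite block_1d. apply Sum_ext. intros x1 _.
  cbn [fst snd].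
  rewrite (Sum_ext (zseq X) (fun y => Sum (list_prod (zseq M) (zseq M)) _) (fun x2 => Sum (zseq M) (fun s1 => Sum (zseq M) (fun s2 =>
     g (Z.of_nat M * (x1 - 1) + s1, Z.of_nat M * (x2 - 1) + s2)%Z))))
    by (intros; rewrite Sum_list_prod; auto).
  rewrite (Sum_swap (zseq X) (zseq M)). apply Sum_ext. intros s1 _. apply (block_1d M X (fun y => g ((Z.of_nat M * (x1 - 1) + s1)%Z, y))).
Qed.

Definition nz3 (L1 L2 L3 : linform) (x : Z * Z) : bool := (nzL L1 x && nzL L2 x && nzL L3 x)%bool.

(** Subtracting [ln X] makes the logarithms invariant under dilation, so that the means over boxes
    can converge. Points where a form vanishes are excluded, as in [TW]. *)
Definition lgt (s1 s2 s3 : bool) (L1 L2 L3 : linform) (X : nat) (x : Z * Z) : R :=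
  iv (nz3 L1 L2 L3 x) * (sel s1 (ln (INR (Labs L1 x)) - ln (INR X)) 1 * sel s2 (ln (INR (Labs L2 x)) - ln (INR X)) 1 *
    sel s3 (ln (INR (Labs L3 x)) - ln (INR X)) 1).

(** The hypothesis makes [m / (k * n)] differ from 1 by at most [Cc / n], which is below 1/2; on
    that range [- 2 * u <= ln (1 - u)] and [ln (1 + u) <= u]. *)
Lemma ln_ratio n m k Cc : (1 <= k)%nat -> (2 * Cc < n)%nat -> (Z.abs (Z.of_nat m - Z.of_nat (k * n)) <= Z.of_nat (Cc * k))%Z ->
  (1 <= m)%nat /\ Rabs (ln (INR m) - ln (INR k) - ln (INR n)) <= 2 * INR Cc * / INR n.
Proof.
  intros Hk Hn Hm. assert (Hm1 : (1 <= m)%nat) by nia. split; auto.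
  pose proof (INR_ge1 k Hk) as Rk. pose proof (INR_ge1 m Hm1) as Rm. pose proof (INR_ge1 n ltac:(lia)) as Rn'.
  assert (A1 : INR m <= INR k * (INR n + INR Cc)).
  { rewrite <- plus_INR, <- mult_INR. apply le_INR. nia. }
  assert (A2 : INR k * (INR n - INR Cc) <= INR m).
  { rewrite <- minus_INR, <- mult_INR by lia. apply le_INR. nia. }
  assert (A3 : 2 * INR Cc <= INR n).
  { replace 2 with (INR 2) by (simpl; lra). rewrite <- mult_INR. apply le_INR. lia. }
  pose proof (pos_INR Cc) as A4. set (c := INR Cc) in *. set (nn := INR n) in *. set (kk := INR k) in *. set (mm := INR m) in *.
  replace (2 * c * / nn) with (2 * (c / nn)) by (unfold Rdiv; ring).
  assert (Hu : 0 <= c / nn <= 1 / 2).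
  { split; [apply Rdiv_nonneg; lra|]. apply Rmult_le_reg_r with nn; [lra|]. unfold Rdiv at 1. rewrite Rmult_assoc, Rinv_l by lra. lra. }
  assert (Hup : ln mm <= ln kk + ln nn + c / nn).
  { apply Rle_trans with (ln (kk * nn * (1 + c / nn))).
    - apply Rln_le; [lra|]. replace (kk * nn * (1 + c / nn)) with (kk * (nn + c)) by (field; lra). auto.
    - rewrite !ln_mult; try nra. pose proof (ln_le_id (1 + c / nn) ltac:(lra)) as H0.
      pose proof (exp_ineq1_le (c / nn)). assert (ln (1 + c / nn) <= c / nn); [|lra].
      rewrite <- (ln_exp (c / nn)) at 2. apply Rln_le; lra. }
  assert (Hlo : ln kk + ln nn - 2 * (c / nn) <= ln mm).
  { apply Rle_trans with (ln (kk * nn * (1 - c / nn))).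
    - rewrite !ln_mult; try nra. assert (- (2 * (c / nn)) <= ln (1 - c / nn)); [|lra].
      set (u := c / nn) in *.
      assert (H : 1 + 2 * u <= exp (2 * u)) by apply exp_ineq1_le.
      rewrite <- (ln_exp (- (2 * u))). apply Rln_le; [apply exp_pos|]. rewrite exp_Ropp.
      apply Rmult_le_reg_l with (exp (2 * u)); [apply exp_pos|]. rewrite Rinv_r by (pose proof (exp_pos (2 * u)); lra).
      apply Rle_trans with ((1 + 2 * u) * (1 - u)); [nra|apply Rmult_le_compat_r; lra].
    - apply Rln_le; [|]. { apply Rmult_lt_0_compat; nra. }
      replace (kk * nn * (1 - c / nn)) with (kk * (nn - c)) by (field; lra). auto. }
  apply Rabs_le. lra.
Qed.

(* Comparing the box of side [X] with the [M]-fold dilated box, one block of side [M] per point, makes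
   the normalised logarithmic sums Cauchy. *)
Lemma lgt_block L1 L2 L3 s1 s2 s3 X M Cc Lam x s : (1 <= X)%nat -> (1 <= M)%nat -> (1 <= Cc)%nat ->
  (cf L1 <= Cc)%nat -> (cf L2 <= Cc)%nat -> (cf L3 <= Cc)%nat -> Lam = 1 + ln (INR (Cc * M * X)) ->
  In x (box X) -> In s (box M) ->
  Rabs (lgt s1 s2 s3 L1 L2 L3 X x - lgt s1 s2 s3 L1 L2 L3 (M * X) (Z.of_nat M * (fst x - 1) + fst s, Z.of_nat M * (snd x - 1) + snd s)%Z)
  <= 2 * Lam ^ 3 * (iv (Labs L1 x <=? 2 * Cc)%nat + iv (Labs L2 x <=? 2 * Cc)%nat + iv (Labs L3 x <=? 2 * Cc)%nat) +
     2 * INR Cc * Lam ^ 2 * (iv (nzL L1 x) * / INR (Labs L1 x) + iv (nzL L2 x) * / INR (Labs L2 x) + iv (nzL L3 x) * / INR (Labs L3 x)).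
Proof.
  intros HX HM HC C1 C2 C3 HLam Hx Hs. set (y := (Z.of_nat M * (fst x - 1) + fst s, Z.of_nat M * (snd x - 1) + snd s)%Z).
  assert (Hy : In y (box (M * X))).
  { apply in_box in Hx, Hs. apply in_box. unfold y. cbn [fst snd]. rewrite Nat2Z.inj_mul. nia. }
  assert (HCMX : (1 <= Cc * M * X)%nat) by nia.
  assert (HMX1 : (1 <= M * X)%nat) by nia.
  assert (HMX2 : (M * X <= Cc * M * X)%nat) by (rewrite <- Nat.mul_assoc; nia).
  assert (HMX3 : (X <= Cc * M * X)%nat) by nia.
  assert (HLam1 : 1 <= Lam) by (rewrite HLam; pose proof (ln_nonneg _ (INR_ge1 _ HCMX)); lra).
  assert (Hlogb : forall n k, (1 <= n)%nat -> (1 <= k)%nat -> (n <= Cc * M * X)%nat -> (k <= Cc * M * X)%nat -> Rabs (ln (INR n) - ln (INR k)) <= Lam).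
  { intros n k Hn Hk Hn' Hk'. pose proof (ln_INR_le n _ Hn Hn'). pose proof (ln_INR_le k _ Hk Hk').
    pose proof (ln_nonneg _ (INR_ge1 n Hn)). pose proof (ln_nonneg _ (INR_ge1 k Hk)). apply Rabs_le. lra. }
  assert (Hselb : forall b L z k, (k = X \/ k = (M * X)%nat) -> (Labs L z <= Cc * M * X)%nat -> nzL L z = true ->
     Rabs (sel b (ln (INR (Labs L z)) - ln (INR k)) 1) <= Lam).
  { intros b L z k Hk Hz Hnz. apply nzL_iff in Hnz. destruct b; simpl; [|rewrite Rabs_R1; auto].
    apply Hlogb; auto; destruct Hk as [->| ->]; auto. }
  assert (HxL : forall L, (cf L <= Cc)%nat -> (Labs L x <= Cc * M * X)%nat).
  { intros L HL. pose proof (Labs_le L X x Hx). assert (cf L * X <= Cc * (M * X))%nat by (apply Nat.mul_le_mono; nia). lia. }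
  assert (HyL : forall L, (cf L <= Cc)%nat -> (Labs L y <= Cc * M * X)%nat).
  { intros L HL. pose proof (Labs_le L _ y Hy). assert (cf L * (M * X) <= Cc * (M * X))%nat by (apply Nat.mul_le_mono; nia). lia. }
  assert (Hfb : forall z k, (k = X \/ k = (M * X)%nat) -> (forall L, (cf L <= Cc)%nat -> (Labs L z <= Cc * M * X)%nat) ->
     Rabs (lgt s1 s2 s3 L1 L2 L3 k z) <= Lam ^ 3).
  { intros z k Hk Hz. unfold lgt, nz3.
    assert (0 <= Lam ^ 3) by (apply pow_le; lra).
    destruct (nzL L1 z) eqn:E1; [|simpl; rewrite Rmult_0_l, Rabs_R0; auto].
    destruct (nzL L2 z) eqn:E2; [|simpl; rewrite Rmult_0_l, Rabs_R0; auto].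
    destruct (nzL L3 z) eqn:E3; [|simpl; rewrite Rmult_0_l, Rabs_R0; auto].
    cbn [andb iv]. rewrite Rmult_1_l. replace (Lam ^ 3) with (Lam * Lam * Lam) by ring. apply mult3_abs; auto. }
  assert (Hinvp : forall L, 0 <= iv (nzL L x) * / INR (Labs L x)).
  { intros L. destruct (nzL L x) eqn:E; [|simpl; lra]. apply nzL_iff in E. simpl.
    assert (0 < / INR (Labs L x)) by (apply Rinv_0_lt_compat, lt_0_INR; lia). lra. }
  pose proof (Hinvp L1) as I1. pose proof (Hinvp L2) as I2. pose proof (Hinvp L3) as I3.
  pose proof (pos_INR Cc) as HCr.
  assert (HL3 : 0 <= 2 * Lam ^ 3) by (pose proof (pow_le Lam 3); lra).
  assert (HL2 : 0 <= 2 * INR Cc * Lam ^ 2) by (pose proof (pow_le Lam 2 ltac:(lra)); nra).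
  (* Where a form is at most [2 * Cc] it may vanish inside the block, and only the trivial bound is
     available; such points are few. Elsewhere [ln_ratio] applies to all three forms. *)
  destruct (Nat.le_gt_cases (Labs L1 x) (2 * Cc) ) as [G1|G1];
  [|destruct (Nat.le_gt_cases (Labs L2 x) (2 * Cc)) as [G2|G2];
  [|destruct (Nat.le_gt_cases (Labs L3 x) (2 * Cc)) as [G3|G3]]].
  1,2,3: eapply Rle_trans; [apply (Rabs_triang _ (- _))|]; rewrite Rabs_Ropp;
    pose proof (Hfb x X (or_introl eq_refl) HxL) as F1; pose proof (Hfb y (M * X)%nat (or_intror eq_refl) HyL) as F2;
    assert (0 <= 2 * INR Cc * Lam ^ 2 * (iv (nzL L1 x) * / INR (Labs L1 x) + iv (nzL L2 x) * / INR (Labs L2 x) + iv (nzL L3 x) * / INR (Labs L3 x)))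
      by (apply Rmult_le_pos; lra);
    assert (1 <= iv (Labs L1 x <=? 2 * Cc)%nat + iv (Labs L2 x <=? 2 * Cc)%nat + iv (Labs L3 x <=? 2 * Cc)%nat) by
     (pose proof (iv_bounds (Labs L1 x <=? 2 * Cc)%nat); pose proof (iv_bounds (Labs L2 x <=? 2 * Cc)%nat); pose proof (iv_bounds (Labs L3 x <=? 2 * Cc)%nat);
      first [apply Nat.leb_le in G1; rewrite G1 in *; simpl iv in *; lra | apply Nat.leb_le in G2; rewrite G2 in *; simpl iv in *; lra | apply Nat.leb_le in G3; rewrite G3 in *; simpl iv in *; lra]);
    nra.
  assert (Hrat : forall L, (cf L <= Cc)%nat -> (2 * Cc < Labs L x)%nat -> nzL L x = true /\ nzL L y = true /\
     Rabs (ln (INR (Labs L x)) - ln (INR X) - (ln (INR (Labs L y)) - ln (INR (M * X)))) <= 2 * INR Cc * / INR (Labs L x)).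
  { intros L HL HLx. destruct (ln_ratio (Labs L x) (Labs L y) M Cc HM HLx) as [P1 P2].
    { apply in_box in Hs. unfold Labs, y, evalL. cbn [fst snd].
      assert (Z.abs (fst L * (fst s - Z.of_nat M)) <= Z.abs (fst L) * Z.of_nat M)%Z by (rewrite Z.abs_mul; apply Z.mul_le_mono_nonneg; lia).
      assert (Z.abs (snd L * (snd s - Z.of_nat M)) <= Z.abs (snd L) * Z.of_nat M)%Z by (rewrite Z.abs_mul; apply Z.mul_le_mono_nonneg; lia).
      replace (fst L * (Z.of_nat M * (fst x - 1) + fst s) + snd L * (Z.of_nat M * (snd x - 1) + snd s))%Z with
        (Z.of_nat M * (fst L * fst x + snd L * snd x) + (fst L * (fst s - Z.of_nat M) + snd L * (snd s - Z.of_nat M)))%Z by ring.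
      set (l := (fst L * fst x + snd L * snd x)%Z). set (d := (fst L * (fst s - Z.of_nat M) + snd L * (snd s - Z.of_nat M))%Z).
      assert (Hd : (Z.abs d <= Z.of_nat (Cc * M))%Z).
      { unfold d. unfold cf in HL. rewrite Nat2Z.inj_mul. nia. }
      rewrite Nat2Z.inj_mul. rewrite !Zabs2Nat.id_abs.
      assert (Z.abs (Z.of_nat M * l) = Z.of_nat M * Z.abs l)%Z by (rewrite Z.abs_mul; lia).
      lia. }
    split; [apply nzL_iff; lia|]. split; [apply nzL_iff; auto|].
    replace (ln (INR (Labs L x)) - ln (INR X) - (ln (INR (Labs L y)) - ln (INR (M * X)))) with
      (- (ln (INR (Labs L y)) - ln (INR M) - ln (INR (Labs L x)))).
    - rewrite Rabs_Ropp. auto.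
    - rewrite mult_INR, ln_mult by (apply lt_0_INR; lia). ring. }
  destruct (Hrat L1 C1 G1) as (X1 & Y1 & Z1). destruct (Hrat L2 C2 G2) as (X2 & Y2 & Z2). destruct (Hrat L3 C3 G3) as (X3 & Y3 & Z3).
  replace (Labs L1 x <=? 2 * Cc)%nat with false by (symmetry; apply Nat.leb_gt; lia).
  replace (Labs L2 x <=? 2 * Cc)%nat with false by (symmetry; apply Nat.leb_gt; lia).
  replace (Labs L3 x <=? 2 * Cc)%nat with false by (symmetry; apply Nat.leb_gt; lia).
  unfold lgt, nz3. rewrite X1, X2, X3, Y1, Y2, Y3 in *. cbn [andb iv] in *. rewrite !Rmult_1_l in *.
  assert (Hsd : forall b a c e, Rabs (a - c) <= e -> Rabs (sel b a 1 - sel b c 1) <= e).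
  { intros b a c e He. destruct b; simpl; auto. rewrite Rminus_diag, Rabs_R0. pose proof (Rabs_pos (a - c)). lra. }
  pose proof (prod_diff _ _ _ _ _ _ _ _ _ Lam Lam Lam Lam (Hsd s1 _ _ _ Z1) (Hsd s2 _ _ _ Z2) (Hsd s3 _ _ _ Z3)
    (Hselb s2 L2 x X (or_introl eq_refl) (HxL L2 C2) X2) (Hselb s3 L3 x X (or_introl eq_refl) (HxL L3 C3) X3)
    (Hselb s1 L1 y (M * X)%nat (or_intror eq_refl) (HyL L1 C1) Y1) (Hselb s2 L2 y (M * X)%nat (or_intror eq_refl) (HyL L2 C2) Y2)
    (Hselb s3 L3 y (M * X)%nat (or_intror eq_refl) (HyL L3 C3) Y3)) as HP.
  eapply Rle_trans; [exact HP|]. simpl. right. ring.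
Qed.

Definition lsum (s1 s2 s3 : bool) (L1 L2 L3 : linform) (X : nat) : R := Sum (box X) (lgt s1 s2 s3 L1 L2 L3 X).

Lemma length_box X : INR (length (box X)) = INR X * INR X.
Proof. unfold box, zseq. rewrite length_prod, length_map, length_seq. apply mult_INR. Qed.

Lemma count_small L X Cc : fst L <> 0%Z \/ snd L <> 0%Z -> (1 <= Cc)%nat ->
  Sum (box X) (fun x => iv (Labs L x <=? 2 * Cc)%nat) <= 2 * (2 * INR Cc + 1) * INR X.
Proof.
  intros HL HC.
  apply Rle_trans with (Sum (box X) (fun x => Sum (seq 0 (2 * Cc + 1)) (fun n => iv (Labs L x =? n)%nat))).
  - apply Sum_le. intros x _. destruct (Nat.leb_spec (Labs L x) (2 * Cc)).
    + pose proof (Sum_ge_term (seq 0 (2 * Cc + 1)) (fun n => iv (Labs L x =? n)%nat) (Labs L x)) as HS. cbv beta in HS.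
      rewrite Nat.eqb_refl in HS. apply HS; [intros; apply iv_bounds|apply in_seq; lia].
    + apply Sum_nonneg. intros; apply iv_bounds.
  - rewrite Sum_swap. apply Rle_trans with (Sum (seq 0 (2 * Cc + 1)) (fun _ => 2 * INR X)).
    + apply Sum_le. intros n _. apply count_Labs_eq; auto.
    + rewrite Sum_const, length_seq, plus_INR, mult_INR. simpl. lra.
Qed.

Lemma sum_inv_form L X Cc : fst L <> 0%Z \/ snd L <> 0%Z -> (cf L <= Cc)%nat -> (1 <= Cc)%nat -> (1 <= X)%nat ->
  Sum (box X) (fun x => iv (nzL L x) * / INR (Labs L x)) <= 2 * INR X * (1 + ln (INR (Cc * X))).
Proof.
  intros HL HC HC1 HX.
  rewrite (Sum_ext _ _ (fun x => iv (nzL L x) * (fun n => iv (1 <=? n)%nat * / INR n) (Labs L x))).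
  2:{ intros x _. destruct (nzL L x) eqn:E; simpl; [|ring]. apply nzL_iff in E. apply Nat.leb_le in E.
      replace (match Labs L x with O => false | S _ => true end) with true by (destruct (Labs L x); [discriminate|auto]). simpl. ring. }
  eapply Rle_trans; [apply (sum_form L X (fun n => iv (1 <=? n)%nat * / INR n) HL)|].
  { intros n. apply Rmult_le_pos; [apply iv_bounds|]. destruct n; [simpl; rewrite Rinv_0; lra|].
    left. apply Rinv_0_lt_compat, lt_0_INR. lia. }
  pose proof (pos_INR X). apply Rmult_le_compat_l; [lra|].
  eapply Rle_trans; [|apply sum_inv; nia].
  apply Rle_trans with (Sum (seq 1 (cf L * X)) (fun n => / INR n)).
  - apply Sum_le. intros n Hn. apply in_seq in Hn.
    replace (1 <=? n)%nat with true by (symmetry; apply Nat.leb_le; lia). simpl iv. lra.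
  - apply Sum_incl_le; [apply seq_NoDup| |].
    + intros n. rewrite !in_seq. nia.
    + intros n Hn. apply in_seq in Hn. left. apply Rinv_0_lt_compat, lt_0_INR. lia.
Qed.

(** Summing [lgt_block]: the exceptional points number [O(X)] and cost a cube of a logarithm each,
    while the terms [1 / |L(x)|] sum to [O(X log X)]. Dividing by [X^2] leaves a saving of [X]. *)
Lemma lsum_scale s1 s2 s3 L1 L2 L3 : (fst L1 <> 0 \/ snd L1 <> 0)%Z -> (fst L2 <> 0 \/ snd L2 <> 0)%Z ->
  (fst L3 <> 0 \/ snd L3 <> 0)%Z ->
  exists K Cc, 0 <= K /\ (1 <= Cc)%nat /\ forall X M, (1 <= X)%nat -> (1 <= M)%nat ->
   Rabs (lsum s1 s2 s3 L1 L2 L3 (M * X) / (INR (M * X) * INR (M * X)) - lsum s1 s2 s3 L1 L2 L3 X / (INR X * INR X))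
   <= K * (1 + ln (INR (Cc * M * X))) ^ 3 / INR X.
Proof.
  intros H1 H2 H3. set (Cc := (cf L1 + cf L2 + cf L3 + 1)%nat).
  set (Kc := 2 * (3 * (2 * (2 * INR Cc + 1))) + 2 * INR Cc * (3 * 2)).
  exists Kc, Cc. pose proof (pos_INR Cc) as HCr. split; [unfold Kc; lra|]. split; [unfold Cc; lia|]. intros X M HX HM.
  set (Lam := 1 + ln (INR (Cc * M * X))).
  pose proof (INR_ge1 X HX) as RX. pose proof (INR_ge1 M HM) as RM.
  assert (HC1 : (1 <= Cc)%nat) by (unfold Cc; lia).
  assert (HCMX : (1 <= Cc * M * X)%nat) by nia.
  assert (HLam1 : 1 <= Lam) by (unfold Lam; pose proof (ln_nonneg _ (INR_ge1 _ HCMX)); lra).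
  assert (HLX : 1 + ln (INR (Cc * X)) <= Lam).
  { unfold Lam. apply Rplus_le_compat_l. apply ln_INR_le; nia. }
  set (err := fun x => 2 * Lam ^ 3 * (iv (Labs L1 x <=? 2 * Cc)%nat + iv (Labs L2 x <=? 2 * Cc)%nat + iv (Labs L3 x <=? 2 * Cc)%nat) +
     2 * INR Cc * Lam ^ 2 * (iv (nzL L1 x) * / INR (Labs L1 x) + iv (nzL L2 x) * / INR (Labs L2 x) + iv (nzL L3 x) * / INR (Labs L3 x))).
  assert (HD : Rabs (INR M * INR M * lsum s1 s2 s3 L1 L2 L3 X - lsum s1 s2 s3 L1 L2 L3 (M * X)) <= INR M * INR M * Sum (box X) err).
  { unfold lsum. rewrite block_2d, <- !Sum_scal. apply Sum_abs_diff. intros x Hx.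
    rewrite <- length_box, <- !Sum_const. apply Sum_abs_diff. intros s Hs.
    apply (lgt_block L1 L2 L3 s1 s2 s3 X M Cc Lam x s); auto; unfold Cc; lia. }
  assert (HE : Sum (box X) err <= Kc * Lam ^ 3 * INR X).
  { unfold err. rewrite Sum_plus, !Sum_scal, !Sum_plus.
    pose proof (count_small L1 X Cc H1 HC1). pose proof (count_small L2 X Cc H2 HC1). pose proof (count_small L3 X Cc H3 HC1).
    pose proof (sum_inv_form L1 X Cc H1 ltac:(unfold Cc; lia) HC1 HX) as S1. pose proof (sum_inv_form L2 X Cc H2 ltac:(unfold Cc; lia) HC1 HX) as S2.
    pose proof (sum_inv_form L3 X Cc H3 ltac:(unfold Cc; lia) HC1 HX) as S3.
    assert (S4 : 2 * INR X * (1 + ln (INR (Cc * X))) <= 2 * INR X * Lam) by (apply Rmult_le_compat_l; lra).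
    assert (P2 : 0 <= Lam ^ 2) by (apply pow_le; lra). assert (P3 : 0 <= Lam ^ 3) by (apply pow_le; lra).
    apply Rle_trans with (2 * Lam ^ 3 * (3 * (2 * (2 * INR Cc + 1) * INR X)) + 2 * INR Cc * Lam ^ 2 * (3 * (2 * INR X * Lam))).
    - apply Rplus_le_compat; apply Rmult_le_compat_l; try lra. apply Rmult_le_pos; lra.
    - unfold Kc. right. ring. }
  assert (HMr : 0 < INR M * INR M) by nra. assert (HXr : 0 < INR X * INR X) by nra.
  rewrite mult_INR.
  replace (lsum s1 s2 s3 L1 L2 L3 (M * X) / (INR M * INR X * (INR M * INR X)) - lsum s1 s2 s3 L1 L2 L3 X / (INR X * INR X)) with
    (- ((INR M * INR M * lsum s1 s2 s3 L1 L2 L3 X - lsum s1 s2 s3 L1 L2 L3 (M * X)) * / (INR M * INR M * (INR X * INR X)))) by (field; lra).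
  assert (HI : 0 < / (INR M * INR M * (INR X * INR X))) by (apply Rinv_0_lt_compat; nra).
  rewrite Rabs_Ropp, Rabs_mult, (Rabs_right (/ _)) by lra.
  apply Rle_trans with (INR M * INR M * (Kc * Lam ^ 3 * INR X) * / (INR M * INR M * (INR X * INR X))).
  - apply Rmult_le_compat_r; [lra|]. eapply Rle_trans; [exact HD|]. apply Rmult_le_compat_l; lra.
  - right. field. lra.
Qed.

(** Each doubling of [X] shrinks the bound by [2 ^ (- 1/2) <= 3 / 4], so a chain of doublings costs
    at most [1 / (1 - 3 / 4) = 4] times the first step. *)
Lemma dyadic_cauchy (B : nat -> R) K : 0 <= K ->
  (forall X Y, (1 <= X)%nat -> (X <= Y <= 2 * X)%nat -> Rabs (B X - B Y) <= K * Rpower (INR X) (- (1 / 2))) ->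
  exists beta, forall X, (1 <= X)%nat -> Rabs (B X - beta) <= 4 * K * Rpower (INR X) (- (1 / 2)).
Proof.
  intros HK H.
  assert (H2 : Rpower 2 (- (1 / 2)) <= 3 / 4).
  { set (r := Rpower 2 (- (1 / 2))). assert (0 < r) by apply Rpower_pos.
    assert (r * r = / 2). { unfold r. rewrite <- Rpower_plus. replace (- (1 / 2) + - (1 / 2)) with (- (1)) by lra. rewrite Rpower_Ropp, Rpower_1; lra. }
    nra. }
  assert (HD : forall k X Y, (1 <= X)%nat -> (X <= Y <= 2 ^ k * X)%nat -> Rabs (B X - B Y) <= 4 * K * Rpower (INR X) (- (1 / 2))).
  { induction k; intros X Y HX HY.
    - simpl in HY. replace Y with X by lia. rewrite Rminus_diag, Rabs_R0.
      pose proof (Rpower_pos (INR X) (- (1 / 2))). nra.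
    - pose proof (Rpower_pos (INR X) (- (1 / 2))) as Hp. destruct (Nat.le_gt_cases Y (2 * X)).
      + eapply Rle_trans; [apply H; lia|]. nra.
      + assert (E1 : Rabs (B (2 * X)%nat - B Y) <= 4 * K * Rpower (INR (2 * X)) (- (1 / 2))).
        { apply IHk; [lia|]. split; [lia|]. simpl in HY. nia. }
        assert (E2 := H X (2 * X)%nat HX ltac:(lia)).
        rewrite mult_INR, <- Rpower_mult_distr in E1 by (try apply lt_0_INR; lia || (simpl; lra)).
        replace (INR 2) with 2 in E1 by (simpl; lra).
        replace (B X - B Y) with ((B X - B (2 * X)%nat) + (B (2 * X)%nat - B Y)) by ring.
        eapply Rle_trans; [apply Rabs_triang|].
        assert (K * (Rpower 2 (- (1 / 2)) * Rpower (INR X) (- (1 / 2))) <= K * (3 / 4 * Rpower (INR X) (- (1 / 2)))).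
        { apply Rmult_le_compat_l; auto. apply Rmult_le_compat_r; lra. }
        lra. }
  assert (HDD : forall X Y, (1 <= X)%nat -> (X <= Y)%nat -> Rabs (B X - B Y) <= 4 * K * Rpower (INR X) (- (1 / 2))).
  { intros X Y HX HY. apply (HD Y); auto. split; auto. assert (Y < 2 ^ Y)%nat by (apply Nat.pow_gt_lin_r; lia). nia. }
  destruct (R_complete B) as [beta Hb].
  (* Beyond this [n] the power [n ^ (- 1/2)] is below [e / (8 * K + 1)], and two terms differ by at
     most [8 * K] times it. *)
  { intros e He. destruct (INR_unbounded (Rpower ((e / (8 * K + 1))) (-2))) as [n Hn].
    assert (Hn1 : (1 <= n)%nat).
    { destruct n; [simpl in Hn|lia]. pose proof (Rpower_pos (e / (8 * K + 1)) (-2)). lra. }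
    assert (Hsm : Rpower (INR n) (- (1 / 2)) < e / (8 * K + 1)).
    { assert (He' : 0 < e / (8 * K + 1)) by (apply Rdiv_lt_0_compat; lra).
      set (u := e / (8 * K + 1)) in *.
      apply Rlt_le_trans with (Rpower (Rpower u (-2)) (- (1 / 2))).
      - unfold Rpower at 1 2. apply exp_increasing.
        assert (ln (Rpower u (-2)) < ln (INR n)) by (apply ln_increasing; [apply Rpower_pos|lra]). lra.
      - rewrite Rpower_mult. replace (-2 * - (1 / 2)) with 1 by lra. rewrite Rpower_1; lra. }
    assert (Hfin : 4 * K * Rpower (INR n) (- (1 / 2)) * 2 < e).
    { pose proof (Rpower_pos (INR n) (- (1 / 2))). apply Rmult_lt_compat_r with (r := 8 * K + 1) in Hsm; [|lra].
      unfold Rdiv in Hsm. rewrite Rmult_assoc, Rinv_l in Hsm by lra. nra. }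
    exists n. intros a b Ha Hb. unfold R_dist.
    pose proof (HDD n a Hn1 ltac:(lia)) as A1. pose proof (HDD n b Hn1 ltac:(lia)) as A2.
    replace (B a - B b) with (- (B n - B a) + (B n - B b)) by ring.
    eapply Rle_lt_trans; [apply Rabs_triang|]. rewrite Rabs_Ropp. lra. }
  exists beta. intros X HX. apply (Un_cv_close B beta (B X) _ X Hb). intros n Hn. apply HDD; auto.
Qed.

Lemma ln_pow_bound k d : 0 < d -> exists C, 0 <= C /\ forall x, 1 <= x -> (1 + ln x) ^ k <= C * Rpower x d.
Proof.
  intros Hd. destruct k.
  { exists 1. split; [lra|]. intros x Hx. simpl. pose proof (Rpower_ge1 x d Hx ltac:(lra)). lra. }
  set (e := d / INR (S k)). assert (Hk : 0 < INR (S k)) by (apply lt_0_INR; lia).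
  assert (He : 0 < e) by (apply Rdiv_lt_0_compat; lra).
  exists ((1 + / e) ^ (S k)). assert (0 < / e) by (apply Rinv_0_lt_compat; auto). split; [apply pow_le; lra|].
  intros x Hx. replace (Rpower x d) with (Rpower x e ^ (S k)).
  2:{ rewrite <- Rpower_pow by apply Rpower_pos. rewrite Rpower_mult. f_equal. unfold e. field. lra. }
  rewrite <- Rpow_mult_distr. pose proof (ln_nonneg x Hx). apply pow_incr. split; [lra|].
  assert (ln x = / e * ln (Rpower x e)) by (unfold Rpower; rewrite ln_exp; field; lra).
  pose proof (ln_le_id (Rpower x e) (Rpower_pos _ _)). pose proof (Rpower_ge1 x e Hx ltac:(lra)).
  assert (/ e * ln (Rpower x e) <= / e * Rpower x e) by (apply Rmult_le_compat_l; lra). lra.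
Qed.

(** For [X <= Y <= 2 * X] the means at [X] and at [Y] are both compared with the mean at [X * Y], a
    common multiple of the two sides; the cubed logarithm costs [X ^ (1/2)] and leaves the rate
    needed by [dyadic_cauchy]. *)
Lemma lsum_asymp s1 s2 s3 L1 L2 L3 : (fst L1 <> 0 \/ snd L1 <> 0)%Z -> (fst L2 <> 0 \/ snd L2 <> 0)%Z ->
  (fst L3 <> 0 \/ snd L3 <> 0)%Z ->
  exists beta K, 0 <= K /\ forall X, (1 <= X)%nat ->
    Rabs (lsum s1 s2 s3 L1 L2 L3 X - beta * (INR X * INR X)) <= K * Rpower (INR X) (3 / 2).
Proof.
  intros H1 H2 H3. destruct (lsum_scale s1 s2 s3 L1 L2 L3 H1 H2 H3) as (K & Cc & HK & HC & HS).
  set (B := fun X => lsum s1 s2 s3 L1 L2 L3 X / (INR X * INR X)).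
  destruct (ln_pow_bound 3 (1 / 4) ltac:(lra)) as [C [HC0 HCl]].
  set (D := C * Rpower (INR (Cc * 4)) (1 / 4)).
  assert (HD : 0 <= D) by (unfold D; pose proof (Rpower_pos (INR (Cc * 4)) (1 / 4)); nra).
  destruct (dyadic_cauchy B (2 * (K * D)) ltac:(nra)) as [beta Hb].
  { intros X Y HX HY. pose proof (INR_ge1 X HX) as RX. pose proof (INR_ge1 Y ltac:(lia)) as RY.
    assert (HYX : (1 <= Y * X)%nat) by (assert (1 <= Y)%nat by lia; nia).
    assert (HCYX : (1 <= Cc * Y * X)%nat) by (rewrite <- Nat.mul_assoc; nia).
    assert (HCYX' : (Cc * Y * X <= Cc * 4 * (X * X))%nat).
    { rewrite <- !Nat.mul_assoc. apply Nat.mul_le_mono_l. assert (Y * X <= 2 * X * X)%nat by (apply Nat.mul_le_mono_r; lia). nia. }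
    pose proof (HS X Y HX ltac:(lia)) as A1. pose proof (HS Y X ltac:(lia) HX) as A2.
    rewrite (Nat.mul_comm X Y) in A2. replace (Cc * X * Y)%nat with (Cc * Y * X)%nat in A2 by lia.
    fold (B X) in A1. fold (B Y) in A2. fold (B (Y * X)%nat) in A1, A2.
    assert (HLe : (1 + ln (INR (Cc * Y * X))) ^ 3 <= D * Rpower (INR X) (1 / 2)).
    { eapply Rle_trans; [apply HCl, INR_ge1; auto|]. unfold D. rewrite Rmult_assoc. apply Rmult_le_compat_l; auto.
      apply Rle_trans with (Rpower (INR (Cc * 4 * (X * X))) (1 / 4)).
      - apply Rle_Rpower_l; [lra|]. split; [apply lt_0_INR; lia|]. apply le_INR. auto.
      - rewrite mult_INR, <- Rpower_mult_distr by (apply lt_0_INR; nia). right. f_equal.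
        rewrite mult_INR, <- Rpower_mult_distr, <- Rpower_plus by lra. f_equal. lra. }
    assert (HX' : K * (1 + ln (INR (Cc * Y * X))) ^ 3 / INR X <= K * D * Rpower (INR X) (- (1 / 2))).
    { replace (K * (1 + ln (INR (Cc * Y * X))) ^ 3 / INR X) with (K * ((1 + ln (INR (Cc * Y * X))) ^ 3 * / INR X)) by (unfold Rdiv; ring).
      rewrite Rmult_assoc. apply Rmult_le_compat_l; auto.
      replace (Rpower (INR X) (- (1 / 2))) with (Rpower (INR X) (1 / 2) * / INR X).
      - rewrite <- Rmult_assoc. apply Rmult_le_compat_r; auto. left; apply Rinv_0_lt_compat; lra.
      - rewrite Rinv_Rpower, <- Rpower_plus by lra. f_equal. lra. }
    assert (HY' : K * (1 + ln (INR (Cc * Y * X))) ^ 3 / INR Y <= K * (1 + ln (INR (Cc * Y * X))) ^ 3 / INR X).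
    { unfold Rdiv at 1 2. apply Rmult_le_compat_l.
      - apply Rmult_le_pos; auto. apply pow_le. pose proof (ln_nonneg (INR (Cc * Y * X)) (INR_ge1 _ HCYX)). lra.
      - apply Rinv_le_contravar; [lra|]. apply le_INR. lia. }
    replace (B X - B Y) with (- (B (Y * X)%nat - B X) + (B (Y * X)%nat - B Y)) by ring.
    eapply Rle_trans; [apply Rabs_triang|]. rewrite Rabs_Ropp. lra. }
  exists beta, (4 * (2 * (K * D))). split; [nra|]. intros X HX. specialize (Hb X HX). pose proof (INR_ge1 X HX) as RX.
  replace (lsum s1 s2 s3 L1 L2 L3 X - beta * (INR X * INR X)) with ((B X - beta) * (INR X * INR X)) by (unfold B; field; lra).
  rewrite Rabs_mult, (Rabs_right (INR X * INR X)) by nra.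
  assert (E2 : INR X * INR X = Rpower (INR X) 2).
  { replace 2 with (1 + 1) by lra. rewrite Rpower_plus, Rpower_1; lra. }
  replace (Rpower (INR X) (3 / 2)) with (Rpower (INR X) (- (1 / 2)) * (INR X * INR X)).
  - rewrite <- (Rmult_assoc (4 * _)). apply Rmult_le_compat_r; [nra|auto].
  - rewrite E2, <- Rpower_plus. f_equal. lra.
Qed.

(** * Reduction to the main term *)

Definition zr (V : nat) : list Z := map (fun k => (Z.of_nat k - Z.of_nat V)%Z) (seq 0 (2 * V + 1)).
Definition vnz (v : Z * Z) : bool := negb ((fst v =? 0)%Z && (snd v =? 0)%Z).
Definition vbox (V : nat) : list (Z * Z) := filter vnz (list_prod (zr V) (zr V)).
Definition vmax (v : Z * Z) : R := IZR (Z.max (Z.abs (fst v)) (Z.abs (snd v))).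

Lemma in_zr V z : In z (zr V) <-> (Z.abs z <= Z.of_nat V)%Z.
Proof.
  unfold zr. rewrite in_map_iff. split.
  - intros [k [<- Hk]]. apply in_seq in Hk. lia.
  - intros H. exists (Z.to_nat (z + Z.of_nat V)). rewrite in_seq. lia.
Qed.

Lemma in_vbox V v : In v (vbox V) <-> (Z.abs (fst v) <= Z.of_nat V /\ Z.abs (snd v) <= Z.of_nat V /\ (fst v <> 0 \/ snd v <> 0))%Z.
Proof.
  destruct v as [v1 v2]. unfold vbox, vnz. rewrite filter_In, in_prod_iff, !in_zr, Bool.negb_true_iff, Bool.andb_false_iff, !Z.eqb_neq. cbn [fst snd]. tauto.
Qed.

Lemma vmax_ge1 v : (fst v <> 0 \/ snd v <> 0)%Z -> 1 <= vmax v.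
Proof. intros H. apply IZR_le. lia. Qed.

(** A majorant of [X / |v| + 1] for the unspecified vector of [lattice_count]: either it is longer
    than [V], or it is one of the vectors summed. Summing over all short vectors of the lattice
    allows the order of summation to be exchanged later. *)
Definition errL (Lam : Z * Z -> bool) (X V : nat) : R :=
  1 + INR X / INR V + Sum (vbox V) (fun v => iv (Lam v) * (INR X / vmax v)).

(** The box is part of the constraints, so that a solution of the inequalities automatically lies in
    the box, as [lattice_count] requires. *)
Definition csB (X : nat) : list (Z * Z * Z) := [(1, 0, 1); (0, 1, 1); (-1, 0, - Z.of_nat X); (0, -1, - Z.of_nat X)]%Z.
Definition csF (L : linform) (sg : Z) (c : nat) : Z * Z * Z := (sg * fst L, sg * snd L, Z.of_nat c)%Z.

Lemma inR_cs X L1 L2 L3 u1 u2 u3 c1 c2 c3 x :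
  iv (inR (csB X ++ [csF L1 u1 c1; csF L2 u2 c2; csF L3 u3 c3]) x) =
  iv ((1 <=? fst x)%Z && (1 <=? snd x)%Z && (fst x <=? Z.of_nat X)%Z && (snd x <=? Z.of_nat X)%Z)%bool *
  (iv (Z.of_nat c1 <=? u1 * evalL L1 (fst x) (snd x))%Z * iv (Z.of_nat c2 <=? u2 * evalL L2 (fst x) (snd x))%Z *
   iv (Z.of_nat c3 <=? u3 * evalL L3 (fst x) (snd x))%Z).
Proof.
  rewrite <- !iv_and. f_equal. apply Bool.eq_iff_eq_true.
  unfold inR, csB, csF. cbn [app forallb]. rewrite !Bool.andb_true_iff, !Z.leb_le.
  unfold evalL.
  replace (u1 * (fst L1 * fst x + snd L1 * snd x))%Z with (u1 * fst L1 * fst x + u1 * snd L1 * snd x)%Z by ring.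
  replace (u2 * (fst L2 * fst x + snd L2 * snd x))%Z with (u2 * fst L2 * fst x + u2 * snd L2 * snd x)%Z by ring.
  replace (u3 * (fst L3 * fst x + snd L3 * snd x))%Z with (u3 * fst L3 * fst x + u3 * snd L3 * snd x)%Z by ring.
  lia.
Qed.

Definition sgs : list Z := [1; -1]%Z.

(** The condition on [|L(x)|] is not convex; since [c >= 1] it is the disjoint union of two
    half-planes, one for each sign of [L]. *)
Lemma sign_split c L x : (1 <= c)%nat ->
  iv (c <=? Labs L x)%nat = Sum sgs (fun u => iv (Z.of_nat c <=? u * evalL L (fst x) (snd x))%Z).
Proof.
  intros Hc. unfold sgs, Sum, Labs. cbn [map fold_right]. set (z := evalL L (fst x) (snd x)).
  destruct (Nat.leb_spec c (Z.abs_nat z)); destruct (Z.leb_spec (Z.of_nat c) (1 * z)); destruct (Z.leb_spec (Z.of_nat c) (-1 * z)); simpl iv; try lra; lia.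
Qed.

Definition reg (L1 L2 L3 : linform) (c1 c2 c3 : nat) (x : Z * Z) : R :=
  iv (c1 <=? Labs L1 x)%nat * iv (c2 <=? Labs L2 x)%nat * iv (c3 <=? Labs L3 x)%nat.

(** The three sign choices cut the region into eight convex polygons, each with the error 10 times
    [errL] of [lattice_count]; hence 80. *)
Lemma region_count L1 L2 L3 c1 c2 c3 n1 n2 n3 X V : (1 <= c1)%nat -> (1 <= c2)%nat -> (1 <= c3)%nat ->
  (1 <= n1)%nat -> (1 <= n2)%nat -> (1 <= n3)%nat -> (1 <= X)%nat -> (1 <= V)%nat ->
  Rabs (Sum (box X) (fun x => reg L1 L2 L3 c1 c2 c3 x * iv (lamL L1 L2 L3 n1 n2 n3 x)) -
        dens (n1 * n2 * n3) (lamL L1 L2 L3 n1 n2 n3) * Sum (box X) (reg L1 L2 L3 c1 c2 c3))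
  <= 80 * errL (lamL L1 L2 L3 n1 n2 n3) X V.
Proof.
  intros C1 C2 C3 N1 N2 N3 HX HV.
  destruct (is_lattice_lamL L1 L2 L3 n1 n2 n3 N1 N2 N3) as (HL & HL1 & HL2).
  set (Lam := lamL L1 L2 L3 n1 n2 n3) in *. set (D := dens (n1 * n2 * n3) Lam).
  set (cs := fun u1 u2 u3 => csB X ++ [csF L1 u1 c1; csF L2 u2 c2; csF L3 u3 c3]).
  assert (Hreg : forall x, In x (box X) -> reg L1 L2 L3 c1 c2 c3 x = Sum3 sgs (fun u1 u2 u3 => iv (inR (cs u1 u2 u3) x))).
  { intros x Hx. unfold reg. rewrite !sign_split by auto. rewrite <- Sum3_prod. apply Sum3_ext. intros u1 u2 u3 _ _ _.
    unfold cs. rewrite inR_cs. apply in_box in Hx.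
    replace ((1 <=? fst x)%Z && (1 <=? snd x)%Z && (fst x <=? Z.of_nat X)%Z && (snd x <=? Z.of_nat X)%Z)%bool with true; [simpl; ring|].
    symmetry. rewrite !Bool.andb_true_iff, !Z.leb_le. lia. }
  assert (E1 : Sum (box X) (fun x => reg L1 L2 L3 c1 c2 c3 x * iv (Lam x)) =
     Sum3 sgs (fun u1 u2 u3 => Sum (box X) (fun x => iv (inR (cs u1 u2 u3) x && Lam x)))).
  { rewrite <- Sum3_swap1. apply Sum_ext. intros x Hx. rewrite Hreg, Rmult_comm, <- Sum3_scal by auto.
    apply Sum3_ext. intros. rewrite iv_and. ring. }
  assert (E2 : D * Sum (box X) (reg L1 L2 L3 c1 c2 c3) =
     Sum3 sgs (fun u1 u2 u3 => D * Sum (box X) (fun x => iv (inR (cs u1 u2 u3) x)))).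
  { rewrite Sum3_scal. f_equal. rewrite <- Sum3_swap1. apply Sum_ext. auto. }
  rewrite E1, E2, <- Sum3_minus. eapply Rle_trans; [apply Sum3_abs|].
  apply Rle_trans with (Sum3 sgs (fun _ _ _ => 10 * errL Lam X V)).
  2:{ unfold Sum3. rewrite !Sum_const. unfold sgs. simpl. lra. }
  apply Sum3_le. intros u1 u2 u3 _ _ _.
  assert (HN : (1 <= n1 * n2 * n3)%nat) by nia.
  destruct (lattice_count (cs u1 u2 u3) X Lam (n1 * n2 * n3) HL HN HX HL1 HL2) as (v1 & v2 & Hv & Hv0 & HB).
  { intros x Hx. assert (Hi : iv (inR (cs u1 u2 u3) x) = 1) by (rewrite Hx; auto). unfold cs in Hi. rewrite inR_cs in Hi.
    apply in_box.
    destruct ((1 <=? fst x)%Z && (1 <=? snd x)%Z && (fst x <=? Z.of_nat X)%Z && (snd x <=? Z.of_nat X)%Z)%bool eqn:E; [|simpl in Hi; lra].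
    rewrite !Bool.andb_true_iff, !Z.leb_le in E. lia. }
  eapply Rle_trans; [exact HB|]. apply Rmult_le_compat_l; [lra|]. unfold errL.
  pose proof (INR_ge1 X HX) as RX. pose proof (INR_ge1 V HV) as RV.
  assert (Hterm : forall v, In v (vbox V) -> 0 <= iv (Lam v) * (INR X / vmax v)).
  { intros v Hin. apply in_vbox in Hin. apply Rmult_le_pos; [apply iv_bounds|]. apply Rdiv_nonneg; [lra|].
    pose proof (vmax_ge1 v ltac:(tauto)). lra. }
  (* A vector of size at most [V] is accounted for by its own term in [errL], a longer one by the
     term [X / V]. *)
  destruct (Z.le_gt_cases (Z.max (Z.abs v1) (Z.abs v2)) (Z.of_nat V)) as [Hle|Hgt].
  - assert (Hin : In (v1, v2) (vbox V)) by (apply in_vbox; cbn [fst snd]; lia).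
    pose proof (Sum_ge_term (vbox V) (fun v => iv (Lam v) * (INR X / vmax v)) (v1, v2) Hterm Hin) as HS.
    cbv beta in HS. rewrite Hv in HS. simpl iv in HS. unfold vmax in HS. cbn [fst snd] in HS.
    assert (0 <= INR X / INR V) by (apply Rdiv_nonneg; lra). unfold vmax. lra.
  - pose proof (Sum_nonneg _ _ Hterm).
    assert (INR X / IZR (Z.max (Z.abs v1) (Z.abs v2)) <= INR X / INR V); [|lra].
    unfold Rdiv. apply Rmult_le_compat_l; [lra|]. apply Rinv_le_contravar; [lra|].
    rewrite INR_IZR_INZ. apply IZR_le. lia.
Qed.

Definition Nx (L1 L2 L3 : linform) (x : Z * Z) : E3 := (Labs L1 x, Labs L2 x, Labs L3 x).
Definition bs : list E3 := list_prod (list_prod [0%nat; 1%nat] [0%nat; 1%nat]) [0%nat; 1%nat].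
Definition CL (L1 L2 L3 : linform) : nat := (cf L1 + cf L2 + cf L3 + 1)%nat.

(* [W = Wmu] gives the sum of [tau(L1 L2 L3)], and [W = Wone] the sum of [tau L1 * tau L2 * tau L3],
   which serves as a comparison to show that the leading coefficient is positive. *)
Definition TW (L1 L2 L3 : linform) (W : E3 -> R) (X : nat) : R :=
  let Y := (CL L1 L2 L3 * X)%nat in
  Sum (box X) (fun x => iv (nz3 L1 L2 L3 x) * Sum (list3 Y) (fun e => W e *
    (tcount Y (dv1 e) (Labs L1 x) * tcount Y (dv2 e) (Labs L2 x) * tcount Y (dv3 e) (Labs L3 x)))).

Definition okb (Y : nat) (e m : E3) : bool :=
  ((dv1 e * p1 m * p1 m <=? Y)%nat && (dv2 e * p2 m * p2 m <=? Y)%nat && (dv3 e * p3 m * p3 m <=? Y)%nat)%bool.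

Definition lamE (L1 L2 L3 : linform) (e m : E3) : Z * Z -> bool :=
  lamL L1 L2 L3 (dv1 e * p1 m) (dv2 e * p2 m) (dv3 e * p3 m).

Lemma in_bs b : In b bs -> (p1 b <= 1)%nat /\ (p2 b <= 1)%nat /\ (p3 b <= 1)%nat.
Proof.
  destruct b as [[b1 b2] b3]. unfold bs. intros H. apply in_prod_iff in H. destruct H as [H H3].
  apply in_prod_iff in H. cbn [p1 p2 p3]. simpl in *. lia.
Qed.

Lemma divb_zdivb n L x : (1 <= n)%nat -> divb n (Labs L x) = zdivb n (evalL L (fst x) (snd x)).
Proof.
  intros Hn. apply Bool.eq_iff_eq_true. rewrite divb_iff, zdivb_iff by auto.
  rewrite <- Zdivide_of_nat. unfold Labs. rewrite Zabs2Nat.id_abs. apply Z.divide_abs_r.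
Qed.

Lemma Nx_in L1 L2 L3 X x : In x (box X) -> nz3 L1 L2 L3 x = true -> In (Nx L1 L2 L3 x) (list3 (CL L1 L2 L3 * X)).
Proof.
  intros Hx Hn. unfold nz3 in Hn. rewrite !Bool.andb_true_iff, !nzL_iff in Hn. unfold Nx. apply in_list3.
  pose proof (Labs_le L1 X x Hx). pose proof (Labs_le L2 X x Hx). pose proof (Labs_le L3 X x Hx).
  unfold CL. nia.
Qed.

Lemma condN_nz b L1 L2 L3 e m x Y : In e (list3 Y) -> In m (list3 Y) ->
  iv (nz3 L1 L2 L3 x) * condN b (Nx L1 L2 L3 x) e m = condN b (Nx L1 L2 L3 x) e m.
Proof.
  intros He Hm. destruct (d_pos _ _ He) as (D1 & D2 & D3). destruct (p_pos _ _ Hm) as (P1 & P2 & P3).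
  destruct (nz3 L1 L2 L3 x) eqn:E; simpl; [ring|]. rewrite Rmult_0_l. symmetry. unfold condN, Nx. cbn [p1 p2 p3].
  unfold nz3 in E. rewrite !Bool.andb_false_iff in E.
  assert (Z : forall L d mm c, nzL L x = false -> (1 <= d)%nat -> (1 <= mm)%nat -> (d * mm * mm + c <=? Labs L x)%nat = false).
  { intros L d mm c HL Hd Hmm. apply Nat.leb_gt. unfold nzL in HL. apply Bool.negb_false_iff, Nat.eqb_eq in HL. nia. }
  destruct E as [[E|E]|E].
  - rewrite (Z L1) by (auto; lia). simpl. ring.
  - rewrite (Z L2) by (auto; lia). simpl. ring.
  - rewrite (Z L3) by (auto; lia). simpl. ring.
Qed.

Lemma TW_expand L1 L2 L3 W X : let Y := (CL L1 L2 L3 * X)%nat in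
  TW L1 L2 L3 W X = Sum bs (fun b => Sum (list3 Y) (fun e => Sum (list3 Y) (fun m => W e *
    Sum (box X) (fun x => condN b (Nx L1 L2 L3 x) e m * iv (lamE L1 L2 L3 e m x))))).
Proof.
  intros Y. unfold TW. fold Y.
  transitivity (Sum (box X) (fun x => Sum bs (fun b => Sum (list3 Y) (fun e => Sum (list3 Y) (fun m => W e *
     (condN b (Nx L1 L2 L3 x) e m * iv (lamE L1 L2 L3 e m x))))))).
  - apply Sum_ext. intros x Hx. rewrite Sum_swap, <- Sum_scal. apply Sum_ext. intros e He.
    destruct (d_pos _ _ He) as (D1 & D2 & D3).
    destruct (nz3 L1 L2 L3 x) eqn:E.
    + simpl iv. rewrite Rmult_1_l.
      pose proof (Nx_in L1 L2 L3 X x Hx E) as HN. fold Y in HN. apply p_pos in HN. destruct HN as (N1 & N2 & N3).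
      unfold Nx in N1, N2, N3. cbn [p1 p2 p3] in N1, N2, N3.
      rewrite (hyperbola (dv1 e) _ Y D1 N1), (hyperbola (dv2 e) _ Y D2 N2), (hyperbola (dv3 e) _ Y D3 N3).
      rewrite <- Sum3_prod, <- Sum3_scal. unfold bs.
      etransitivity; [|symmetry; apply (Sum_list_prod (list_prod [0%nat; 1%nat] [0%nat; 1%nat]))].
      rewrite Sum_list_prod. unfold Sum3 at 1. apply Sum_ext. intros b1 _. apply Sum_ext. intros b2 _. apply Sum_ext. intros b3 _.
      rewrite <- Sum3_prod, <- Sum3_scal, Sum_list3. apply Sum3_ext. intros m1 m2 m3 Hm1 Hm2 Hm3. apply in_seq in Hm1, Hm2, Hm3.
      unfold condN, lamE, lamL, Nx. cbn [p1 p2 p3]. rewrite !iv_and, <- !divb_zdivb by nia. ring.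
    + simpl iv. rewrite Rmult_0_l. symmetry. apply Sum_zero. intros b _. apply Sum_zero. intros m Hm.
      rewrite <- (condN_nz b L1 L2 L3 e m x Y He Hm), E. simpl iv. ring.
  - rewrite Sum_swap. apply Sum_ext. intros b _. rewrite Sum_swap. apply Sum_ext. intros e _. rewrite Sum_swap.
    apply Sum_ext. intros m _. apply Sum_scal.
Qed.

(** [region_count] is applied to each term of [TW_expand], and the densities are reassembled by
    [G_dens]. The constant is 80 times the eight choices of [b]. *)
Lemma TW_main L1 L2 L3 W X V : (1 <= X)%nat -> (1 <= V)%nat -> let Y := (CL L1 L2 L3 * X)%nat in
  (forall e, In e (list3 Y) -> Rabs (W e) <= 1) ->
  Rabs (TW L1 L2 L3 W X - Sum (box X) (fun x => iv (nz3 L1 L2 L3 x) * Sum bs (fun b => Gmain L1 L2 L3 Y Y W b (Nx L1 L2 L3 x))))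
  <= 640 * Sum (list3 Y) (fun e => Sum (list3 Y) (fun m => iv (okb Y e m) * errL (lamE L1 L2 L3 e m) X V)).
Proof.
  intros HX HV Y HW. rewrite TW_expand. fold Y.
  assert (E : Sum (box X) (fun x => iv (nz3 L1 L2 L3 x) * Sum bs (fun b => Gmain L1 L2 L3 Y Y W b (Nx L1 L2 L3 x))) =
    Sum bs (fun b => Sum (list3 Y) (fun e => Sum (list3 Y) (fun m => W e *
      (densem L1 L2 L3 e m * Sum (box X) (fun x => condN b (Nx L1 L2 L3 x) e m)))))).
  { transitivity (Sum (box X) (fun x => Sum bs (fun b => Sum (list3 Y) (fun e => Sum (list3 Y) (fun m => W e *
      (densem L1 L2 L3 e m * condN b (Nx L1 L2 L3 x) e m)))))).
    - apply Sum_ext. intros x Hx. rewrite <- Sum_scal. apply Sum_ext. intros b _.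
      destruct (nz3 L1 L2 L3 x) eqn:En.
      + simpl iv. rewrite Rmult_1_l, <- G_dens by (apply Nx_in; auto).
        apply Sum_ext. intros e _. apply Sum_ext. intros m _. ring.
      + simpl iv. rewrite Rmult_0_l. symmetry. apply Sum_zero. intros e He. apply Sum_zero. intros m Hm.
        rewrite <- (condN_nz b L1 L2 L3 e m x Y He Hm), En. simpl iv. ring.
    - rewrite Sum_swap. apply Sum_ext. intros b _. rewrite Sum_swap. apply Sum_ext. intros e _. rewrite Sum_swap.
      apply Sum_ext. intros m _. rewrite Sum_scal. f_equal. apply Sum_scal. }
  rewrite E.
  eapply Rle_trans; [apply (Sum_abs_diff bs _ _ (fun _ => 80 * Sum (list3 Y) (fun e => Sum (list3 Y) (fun m => iv (okb Y e m) * errL (lamE L1 L2 L3 e m) X V))))|].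
  2:{ rewrite Sum_const. unfold bs. simpl length. simpl INR. lra. }
  intros b Hb. rewrite <- Sum_scal. apply Sum_abs_diff. intros e He. rewrite <- Sum_scal. apply Sum_abs_diff. intros m Hm.
  destruct (d_pos _ _ He) as (D1 & D2 & D3). destruct (p_pos _ _ Hm) as (P1 & P2 & P3).
  rewrite <- Rmult_minus_distr_l, Rabs_mult.
  assert (HN1 : (1 <= dv1 e * p1 m)%nat) by nia. assert (HN2 : (1 <= dv2 e * p2 m)%nat) by nia. assert (HN3 : (1 <= dv3 e * p3 m)%nat) by nia.
  destruct (okb Y e m) eqn:Eok.
  - simpl iv. rewrite Rmult_1_l. rewrite <- (Rmult_1_l (80 * _)). apply Rmult_le_compat; try apply Rabs_pos; [auto|].
    apply (region_count L1 L2 L3 (dv1 e * p1 m * p1 m + p1 b) (dv2 e * p2 m * p2 m + p2 b) (dv3 e * p3 m * p3 m + p3 b)); auto; nia.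
  (* Since [|Li(x)| <= Y] on the box, a pair violating [okb] has an empty region, and both the count
     and its main term vanish. *)
  - assert (Z : forall x, In x (box X) -> condN b (Nx L1 L2 L3 x) e m = 0).
    { intros x Hx. unfold condN, Nx. cbn [p1 p2 p3].
      pose proof (Labs_le L1 X x Hx). pose proof (Labs_le L2 X x Hx). pose proof (Labs_le L3 X x Hx).
      assert (HY : (cf L1 * X <= Y /\ cf L2 * X <= Y /\ cf L3 * X <= Y)%nat) by (unfold Y, CL; nia).
      unfold okb in Eok. rewrite !Bool.andb_false_iff, !Nat.leb_gt in Eok.
      destruct Eok as [[Eo|Eo]|Eo].
      - replace (dv1 e * p1 m * p1 m + p1 b <=? Labs L1 x)%nat with false by (symmetry; apply Nat.leb_gt; lia). simpl; ring.
      - replace (dv2 e * p2 m * p2 m + p2 b <=? Labs L2 x)%nat with false by (symmetry; apply Nat.leb_gt; lia). simpl; ring.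
      - replace (dv3 e * p3 m * p3 m + p3 b <=? Labs L3 x)%nat with false by (symmetry; apply Nat.leb_gt; lia). simpl; ring. }
    rewrite (Sum_zero (box X) (fun x => condN b (Nx L1 L2 L3 x) e m)) by auto.
    rewrite Sum_zero by (intros x Hx; rewrite Z by auto; ring).
    simpl iv. rewrite Rmult_0_r, Rminus_diag, Rabs_R0. lra.
Qed.

(** * The error term *)

Lemma count_sq d Y : (1 <= d)%nat ->
  let c := Sum (seq 1 Y) (fun m => iv (d * m * m <=? Y)%nat) in 0 <= c /\ INR d * (c * c) <= INR Y.
Proof.
  intros Hd c. split; [apply Sum_nonneg; intros; apply iv_bounds|].
  destruct (threshold (fun m => (d * m * m <=? Y)%nat) Y) as [M [HM1 HM2]].
  { intros m m' Hm. rewrite !Nat.leb_le. intros. assert (d * m * m <= d * m' * m')%nat; [|lia].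
    apply Nat.mul_le_mono; auto. apply Nat.mul_le_mono_l; auto. }
  { apply Nat.leb_gt. nia. }
  assert (Hc : c = INR M).
  { unfold c. rewrite (Sum_seq_extend M Y); auto.
    - rewrite (Sum_ext _ _ (fun _ => 1)).
      + rewrite Sum_const, length_seq. ring.
      + intros m Hm. apply in_seq in Hm. replace (d * m * m <=? Y)%nat with true; auto. symmetry. apply HM2; lia.
    - intros k Hk. destruct (d * k * k <=? Y)%nat eqn:E; auto. apply HM2 in E; lia. }
  rewrite Hc. destruct (Nat.eq_dec M 0) as [->|HM]; [simpl; pose proof (pos_INR Y); lra|].
  rewrite <- !mult_INR. apply le_INR. assert (H : (d * M * M <=? Y)%nat = true) by (apply HM2; lia).
  apply Nat.leb_le in H. lia.
Qed.

(** The lcm of [a], [b], [c], written in the shape of [lcm_triple] with [o = 1]. *)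
Definition qe (e : E3) : nat := let '(a, b, c) := e in Nat.lcm (Nat.lcm 1 a) (Nat.lcm b c).

Lemma qe_bound e Y : In e (list3 Y) -> (1 <= qe e <= Y * (Y * Y))%nat /\ (qe e * qe e <= dv1 e * dv2 e * dv3 e)%nat /\
  Nat.divide (p1 e) (qe e) /\ Nat.divide (p2 e) (qe e) /\ Nat.divide (p3 e) (qe e).
Proof.
  destruct e as [[a b] c]. rewrite in_list3. intros (Ha & Hb & Hc). unfold qe. cbn [dv1 dv2 dv3 p1 p2 p3].
  assert (Hlm : forall x y, (1 <= x)%nat -> (1 <= y)%nat -> (Nat.lcm x y <= x * y)%nat).
  { intros x y Hx Hy. apply Nat.divide_pos_le; [nia|]. apply Nat.lcm_least; [apply Nat.divide_factor_l|apply Nat.divide_factor_r]. }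
  pose proof (lcm_triple 1 a b c ltac:(lia) ltac:(lia) ltac:(lia) ltac:(lia)) as (T & _).
  cbv zeta in T. rewrite !Nat.lcm_1_l in *. rewrite Nat.mul_1_r in T.
  pose proof (lcm_pos b c ltac:(lia) ltac:(lia)) as Hbc. pose proof (lcm_pos a (Nat.lcm b c) ltac:(lia) Hbc).
  split; [split; auto|split; [|repeat split]].
  - eapply Nat.le_trans; [apply Hlm; lia|]. apply Nat.mul_le_mono; [lia|].
    eapply Nat.le_trans; [apply Hlm; lia|]. apply Nat.mul_le_mono; lia.
  - eapply Nat.le_trans; [exact T|]. apply Nat.mul_le_mono_r. apply Nat.mul_le_mono_l. apply Hlm; lia.
  - divs_solve.
  - divs_solve.
  - divs_solve.
Qed.

(** By [count_sq] the numbers of [mi] multiply to at most [Y ^ (3/2) / sqrt (d1 * d2 * d3)], and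
    [lcm_triple] gives [q^2 <= d1 * d2 * d3] for the lcm [q] of [a], [b], [c]. Charging each triple
    to its [q] leaves the sum of [tauN q ^ 3 / q], a logarithm up to divisor bounds. *)
Lemma count_ok Y K : (1 <= Y)%nat -> 1 <= K ->
  (forall n, (1 <= n <= Y * (Y * Y))%nat -> tauN n <= K) ->
  Sum (list3 Y) (fun e => Sum (list3 Y) (fun m => iv (okb Y e m))) <=
  Rpower (INR Y) (3 / 2) * (K ^ 3 * (1 + ln (INR (Y * (Y * Y))))).
Proof.
  intros HY HK Htau. pose proof (INR_ge1 Y HY) as RY.
  set (Q := (Y * (Y * Y))%nat) in *. assert (HQ : (1 <= Q)%nat) by (unfold Q; nia).
  apply Rle_trans with (Sum (list3 Y) (fun e => Rpower (INR Y) (3 / 2) * / INR (qe e))).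
  - apply Sum_le. intros e He. destruct (d_pos _ _ He) as (D1 & D2 & D3).
    destruct (qe_bound e Y He) as (B1 & B2 & _).
    rewrite Sum_list3. unfold okb. cbn [p1 p2 p3].
    rewrite (Sum3_ext _ _ (fun a b c => iv (dv1 e * a * a <=? Y)%nat * iv (dv2 e * b * b <=? Y)%nat * iv (dv3 e * c * c <=? Y)%nat))
      by (intros; rewrite !iv_and; auto).
    rewrite (Sum3_prod _ (fun a => iv (dv1 e * a * a <=? Y)%nat) (fun a => iv (dv2 e * a * a <=? Y)%nat) (fun a => iv (dv3 e * a * a <=? Y)%nat)).
    destruct (count_sq (dv1 e) Y D1) as [A1 A1']. destruct (count_sq (dv2 e) Y D2) as [A2 A2']. destruct (count_sq (dv3 e) Y D3) as [A3 A3'].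
    set (c1 := Sum (seq 1 Y) (fun m => iv (dv1 e * m * m <=? Y)%nat)) in *.
    set (c2 := Sum (seq 1 Y) (fun m => iv (dv2 e * m * m <=? Y)%nat)) in *.
    set (c3 := Sum (seq 1 Y) (fun m => iv (dv3 e * m * m <=? Y)%nat)) in *.
    assert (Rq : 1 <= INR (qe e)) by (apply INR_ge1; lia).
    apply le_INR in B2. rewrite !mult_INR in B2.
    pose proof (INR_ge1 _ D1). pose proof (INR_ge1 _ D2). pose proof (INR_ge1 _ D3).
    set (P := Rpower (INR Y) (3 / 2)). assert (HP : 0 < P) by apply Rpower_pos.
    assert (HPP : P * P = INR Y * INR Y * INR Y).
    { unfold P. rewrite <- Rpower_plus. replace (3 / 2 + 3 / 2) with (1 + 1 + 1) by lra. rewrite !Rpower_plus, !Rpower_1; lra. }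
    apply Rmult_le_reg_r with (INR (qe e)); [lra|]. replace (P * / INR (qe e) * INR (qe e)) with P by (field; lra).
    apply Rsqr_incr_0; [|apply Rmult_le_pos; [repeat apply Rmult_le_pos; auto|lra]|lra]. unfold Rsqr. rewrite HPP.
    replace (c1 * c2 * c3 * INR (qe e) * (c1 * c2 * c3 * INR (qe e))) with ((c1 * c2 * c3) * (c1 * c2 * c3) * (INR (qe e) * INR (qe e))) by ring.
    apply Rle_trans with ((c1 * c2 * c3) * (c1 * c2 * c3) * (INR (dv1 e) * INR (dv2 e) * INR (dv3 e))).
    + apply Rmult_le_compat_l; auto. apply Rle_0_sqr.
    + replace ((c1 * c2 * c3) * (c1 * c2 * c3) * (INR (dv1 e) * INR (dv2 e) * INR (dv3 e))) with
        ((INR (dv1 e) * (c1 * c1)) * (INR (dv2 e) * (c2 * c2)) * (INR (dv3 e) * (c3 * c3))) by ring.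
      assert (S1 : 0 <= INR (dv1 e) * (c1 * c1)) by (apply Rmult_le_pos; [lra|apply Rle_0_sqr]).
      assert (S2 : 0 <= INR (dv2 e) * (c2 * c2)) by (apply Rmult_le_pos; [lra|apply Rle_0_sqr]).
      assert (S3 : 0 <= INR (dv3 e) * (c3 * c3)) by (apply Rmult_le_pos; [lra|apply Rle_0_sqr]).
      apply Rmult_le_compat; auto; [apply Rmult_le_pos; auto|apply Rmult_le_compat; auto].
  - rewrite Sum_scal. apply Rmult_le_compat_l; [left; apply Rpower_pos|].
    apply Rle_trans with (Sum (list3 Y) (fun e => Sum (seq 1 Q) (fun q => / INR q * (iv (divb (p1 e) q) * iv (divb (p2 e) q) * iv (divb (p3 e) q))))).
    + apply Sum_le. intros e He. destruct (qe_bound e Y He) as (B1 & _ & F1 & F2 & F3). fold Q in B1.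
      pose proof (Sum_ge_term (seq 1 Q) (fun q => / INR q * (iv (divb (p1 e) q) * iv (divb (p2 e) q) * iv (divb (p3 e) q))) (qe e)) as HS.
      cbv beta in HS. apply divb_iff in F1, F2, F3. rewrite F1, F2, F3 in HS. simpl iv in HS. rewrite !Rmult_1_r in HS.
      apply HS; [|apply in_seq; lia]. intros q Hq. apply in_seq in Hq.
      apply Rmult_le_pos; [left; apply Rinv_0_lt_compat, lt_0_INR; lia|]. repeat apply Rmult_le_pos; apply iv_bounds.
    + rewrite Sum_swap. apply Rle_trans with (Sum (seq 1 Q) (fun q => / INR q * K ^ 3)).
      * apply Sum_le. intros q Hq. apply in_seq in Hq. rewrite Sum_scal, Sum_list3. cbn [p1 p2 p3].
        assert (0 < / INR q) by (apply Rinv_0_lt_compat, lt_0_INR; lia). apply Rmult_le_compat_l; [lra|].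
        rewrite (Sum3_prod _ (fun a => iv (divb a q)) (fun a => iv (divb a q)) (fun a => iv (divb a q))).
        pose proof (Sum_ind_div_le q Y ltac:(lia)) as HI. specialize (Htau q ltac:(lia)).
        set (s := Sum (seq 1 Y) (fun a => iv (divb a q))) in *.
        assert (0 <= s) by (apply Sum_nonneg; intros; apply iv_bounds).
        replace (s * s * s) with (s ^ 3) by ring. apply pow_incr. lra.
      * rewrite Sum_scal_r, Rmult_comm. apply Rmult_le_compat_l; [apply pow_le; lra|]. apply sum_inv; auto.
Qed.

(** * Short vectors *)

Definition gz (z : Z) : R := if (z =? 0)%Z then 0 else / IZR (Z.abs z).

Lemma gz_nonneg z : 0 <= gz z.
Proof.
  unfold gz. destruct (Z.eqb_spec z 0); [lra|]. left. apply Rinv_0_lt_compat. apply IZR_lt. lia.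
Qed.

Lemma sum_gz V : (1 <= V)%nat -> Sum (zr V) gz <= 2 * (1 + ln (INR V)).
Proof.
  intros HV. unfold zr. rewrite Sum_map.
  replace (2 * V + 1)%nat with (V + (1 + V))%nat by lia. rewrite seq_app, Sum_app. cbn [Nat.add seq]. rewrite Sum_cons.
  assert (A1 : Sum (seq 0 V) (fun k => gz (Z.of_nat k - Z.of_nat V)) = Sum (seq 1 V) (fun q => / INR q)).
  { transitivity (Sum (map (fun k => (V - k)%nat) (seq 0 V)) (fun q => / INR q)).
    - rewrite Sum_map. apply Sum_ext. intros k Hk. apply in_seq in Hk. unfold gz.
      destruct (Z.eqb_spec (Z.of_nat k - Z.of_nat V) 0); [lia|]. rewrite INR_IZR_INZ. do 2 f_equal. lia.
    - apply Sum_same_elements; [apply NoDup_map_on; [|apply seq_NoDup]|apply seq_NoDup|].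
      + intros x y Hx Hy. apply in_seq in Hx, Hy. lia.
      + intros x. rewrite in_map_iff, in_seq. split.
        * intros [k [<- Hk]]. apply in_seq in Hk. lia.
        * intros Hx. exists (V - x)%nat. rewrite in_seq. lia. }
  assert (A2 : Sum (seq (S V) V) (fun k => gz (Z.of_nat k - Z.of_nat V)) = Sum (seq 1 V) (fun q => / INR q)).
  { replace (S V) with (1 + V)%nat by lia. rewrite Sum_seq_shift. apply Sum_ext. intros k Hk. apply in_seq in Hk. unfold gz.
    destruct (Z.eqb_spec (Z.of_nat (V + k) - Z.of_nat V) 0); [lia|]. rewrite INR_IZR_INZ. do 2 f_equal. lia. }
  rewrite A1, A2. unfold gz. rewrite Z.sub_diag. simpl. pose proof (sum_inv V HV). lra.
Qed.

Lemma inv_vmax v : (fst v <> 0)%Z -> / vmax v <= gz (fst v).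
Proof.
  intros H. unfold gz. destruct (Z.eqb_spec (fst v) 0); [contradiction|].
  apply Rinv_le_contravar; [apply IZR_lt; lia|]. apply IZR_le. lia.
Qed.

Lemma inv_vmax2 v : (snd v <> 0)%Z -> / vmax v <= gz (snd v).
Proof.
  intros H. unfold gz. destruct (Z.eqb_spec (snd v) 0); [contradiction|].
  apply Rinv_le_contravar; [apply IZR_lt; lia|]. apply IZR_le. lia.
Qed.

Lemma length_zr V : INR (length (zr V)) = 2 * INR V + 1.
Proof. unfold zr. rewrite length_map, length_seq, plus_INR, mult_INR. simpl. ring. Qed.

Lemma NoDup_zr V : NoDup (zr V).
Proof. apply NoDup_map_on; [intros; lia|apply seq_NoDup]. Qed.

Lemma sum_vmax V : (1 <= V)%nat -> Sum (vbox V) (fun v => / vmax v) <= 12 * INR V * (1 + ln (INR V)).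
Proof.
  intros HV. unfold vbox. rewrite Sum_filter.
  apply Rle_trans with (Sum (list_prod (zr V) (zr V)) (fun v => gz (fst v) + gz (snd v))).
  - apply Sum_le. intros v _. pose proof (gz_nonneg (fst v)). pose proof (gz_nonneg (snd v)).
    destruct (vnz v) eqn:E; [|simpl; lra]. simpl iv. unfold vnz in E.
    destruct (Z.eq_dec (fst v) 0) as [E1|E1].
    + destruct (Z.eq_dec (snd v) 0) as [E2|E2]; [rewrite E1, E2 in E; discriminate|].
      pose proof (inv_vmax2 v E2). lra.
    + pose proof (inv_vmax v E1). lra.
  - rewrite Sum_list_prod. cbn [fst snd].
    rewrite (Sum_ext _ _ (fun z => (2 * INR V + 1) * gz z + Sum (zr V) gz)).
    + rewrite Sum_plus, Sum_scal, Sum_const, length_zr. pose proof (sum_gz V HV). pose proof (INR_ge1 V HV).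
      assert (0 <= Sum (zr V) gz) by (apply Sum_nonneg; intros; apply gz_nonneg).
      pose proof (ln_nonneg _ H0). set (l := ln (INR V)) in *. set (S := Sum (zr V) gz) in *.
      apply Rle_trans with (6 * INR V * S); [nra|].
      apply Rle_trans with (6 * INR V * (2 * (1 + l))); [apply Rmult_le_compat_l; lra|right; ring].
    + intros z _. rewrite Sum_plus, Sum_const, length_zr. auto.
Qed.

(** On the line [L = 0] one coordinate determines the point and is nonzero for [v <> 0], so the sum
    is a one-dimensional harmonic sum. The saving over [sum_vmax] compensates the free modulus in
    [vector_count]. *)
Lemma sum_vmax_line L V : (1 <= V)%nat -> fst L <> 0%Z \/ snd L <> 0%Z ->
  Sum (vbox V) (fun v => iv (Labs L v =? 0)%nat * / vmax v) <= 2 * (1 + ln (INR V)).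
Proof.
  intros HV HL. eapply Rle_trans; [|apply sum_gz; auto]. unfold vbox. rewrite Sum_filter.
  assert (HZ : forall v, (Labs L v =? 0)%nat = true -> (fst L * fst v + snd L * snd v = 0)%Z).
  { intros v E. apply Nat.eqb_eq in E. unfold Labs, evalL in E. lia. }
  destruct (Z.eq_dec (snd L) 0) as [E0|E0].
  - assert (HL1 : fst L <> 0%Z) by tauto.
    apply Rle_trans with (Sum (list_prod (zr V) (zr V)) (fun v => iv (fst v =? 0)%Z * gz (snd v))).
    + apply Sum_le. intros v _. pose proof (gz_nonneg (snd v)). pose proof (iv_bounds (fst v =? 0)%Z).
      assert (0 <= iv (fst v =? 0)%Z * gz (snd v)) by (apply Rmult_le_pos; lra).
      destruct (vnz v) eqn:E; [|simpl; lra]. destruct (Labs L v =? 0)%nat eqn:E1; [|simpl; lra].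
      apply HZ in E1. rewrite E0 in E1. assert (F : fst v = 0%Z) by nia. unfold vnz in E. rewrite F in *. simpl in E.
      destruct (Z.eqb_spec (snd v) 0); [discriminate|]. simpl. pose proof (inv_vmax2 v n). lra.
    + rewrite Sum_list_prod, Sum_swap. cbn [fst snd]. apply Sum_le. intros y _. rewrite Sum_scal_r.
      rewrite <- (Rmult_1_l (gz y)) at 2. apply Rmult_le_compat_r; [apply gz_nonneg|].
      apply Sum_unique_le1; [apply NoDup_zr|]. intros a b _ _ Ha Hb. apply Z.eqb_eq in Ha, Hb. lia.
  - apply Rle_trans with (Sum (list_prod (zr V) (zr V)) (fun v => gz (fst v) * iv (Labs L v =? 0)%nat)).
    + apply Sum_le. intros v _. pose proof (gz_nonneg (fst v)).
      destruct (Labs L v =? 0)%nat eqn:E1; [|simpl; lra]. destruct (vnz v) eqn:E; [|simpl; lra].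
      apply HZ in E1. simpl. unfold vnz in E. destruct (Z.eq_dec (fst v) 0) as [F|F].
      * rewrite F in *. assert (F2 : snd v = 0%Z) by nia. rewrite F2 in E. discriminate.
      * pose proof (inv_vmax v F). lra.
    + rewrite Sum_list_prod. cbn [fst snd]. apply Sum_le. intros y _. rewrite Sum_scal.
      rewrite <- (Rmult_1_r (gz y)) at 2. apply Rmult_le_compat_l; [apply gz_nonneg|].
      apply Sum_unique_le1; [apply NoDup_zr|]. intros a b _ _ Ha Hb. apply HZ in Ha, Hb. cbn [fst snd] in *. nia.
Qed.

(** What remains known of [m] when [n = |L(v)|]: a divisor condition if [n] is nonzero; for [n = 0]
    divisibility is void, and only the size condition of [okb] is left. *)
Definition mub (Y n m : nat) : bool := if (n =? 0)%nat then (m * m <=? Y)%nat else divb m n.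

Lemma mub_sum Y n K : (1 <= Y)%nat -> 1 <= K -> ((1 <= n)%nat -> tauN n <= K) ->
  0 <= Sum (seq 1 Y) (fun m => iv (mub Y n m)) <= K * (1 + iv (n =? 0)%nat * sqrt (INR Y)).
Proof.
  intros HY HK Ht. split; [apply Sum_nonneg; intros; apply iv_bounds|].
  pose proof (sqrt_pos (INR Y)). unfold mub. destruct (Nat.eqb_spec n 0) as [E|E].
  - simpl iv. rewrite Rmult_1_l.
    destruct (count_sq 1 Y (le_n _)) as [A B]. 
    rewrite (Sum_ext _ _ (fun m => iv (1 * m * m <=? Y)%nat)) by (intros; rewrite Nat.mul_1_l; auto).
    simpl INR in B. rewrite Rmult_1_l in B. set (c := Sum _ _) in *.
    assert (c <= sqrt (INR Y)). { rewrite <- (sqrt_square c) by auto. apply sqrt_le_1_alt. auto. }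
    nra.
  - simpl iv. rewrite Rmult_0_l, Rplus_0_r, Rmult_1_r. eapply Rle_trans; [apply Sum_ind_div_le; lia|]. apply Ht. lia.
Qed.

Lemma at_most_one_zero L L' v : resL L L' <> 0%Z -> (fst v <> 0 \/ snd v <> 0)%Z -> Labs L v = 0%nat -> (1 <= Labs L' v)%nat.
Proof.
  intros Hr Hv H0. destruct (Nat.eq_dec (Labs L' v) 0) as [H1|]; [|lia]. exfalso.
  unfold Labs, evalL in *. unfold resL in Hr.
  assert (E0 : (fst L * fst v + snd L * snd v = 0)%Z) by lia. assert (E1 : (fst L' * fst v + snd L' * snd v = 0)%Z) by lia.
  assert (A : ((fst L * snd L' - fst L' * snd L) * fst v = 0)%Z).
  { replace ((fst L * snd L' - fst L' * snd L) * fst v)%Z with (snd L' * (fst L * fst v + snd L * snd v) - snd L * (fst L' * fst v + snd L' * snd v))%Z by ring.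
    rewrite E0, E1. ring. }
  assert (B : ((fst L * snd L' - fst L' * snd L) * snd v = 0)%Z).
  { replace ((fst L * snd L' - fst L' * snd L) * snd v)%Z with (fst L * (fst L' * fst v + snd L' * snd v) - fst L' * (fst L * fst v + snd L * snd v))%Z by ring.
    rewrite E0, E1. ring. }
  destruct Hv; nia.
Qed.

Lemma divb_mul_l d m n : divb (d * m) n = true -> divb d n = true.
Proof. rewrite !divb_iff. intros H. eapply Nat.divide_trans; [apply Nat.divide_factor_l|exact H]. Qed.

Lemma divb_mul_r d m n : divb (d * m) n = true -> divb m n = true.
Proof. rewrite !divb_iff. intros H. eapply Nat.divide_trans; [apply Nat.divide_factor_r|exact H]. Qed.

(** If no form vanishes at [v], the six variables all divide nonzero values and the divisor bound
    applies to each. At most one form can vanish, the resultants being nonzero; then the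
    corresponding [m] is free up to [sqrt Y], while each of [a], [b], [c] divides two of the values
    and so still divides a nonzero one. *)
Lemma vector_count L1 L2 L3 Y v K : resL L1 L2 <> 0%Z -> resL L1 L3 <> 0%Z -> resL L2 L3 <> 0%Z ->
  (fst v <> 0 \/ snd v <> 0)%Z -> (1 <= Y)%nat -> 1 <= K ->
  (forall L, L = L1 \/ L = L2 \/ L = L3 -> (1 <= Labs L v)%nat -> tauN (Labs L v) <= K) ->
  Sum (list3 Y) (fun e => Sum (list3 Y) (fun m => iv (okb Y e m) * iv (lamE L1 L2 L3 e m v))) <=
  K ^ 6 * (1 + (iv (Labs L1 v =? 0)%nat + iv (Labs L2 v =? 0)%nat + iv (Labs L3 v =? 0)%nat) * sqrt (INR Y)).
Proof.
  intros h12 h13 h23 Hv HY HK Ht.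
  set (n1 := Labs L1 v) in *. set (n2 := Labs L2 v) in *. set (n3 := Labs L3 v) in *.
  assert (T1 : (1 <= n1)%nat -> tauN n1 <= K) by (apply Ht; auto).
  assert (T2 : (1 <= n2)%nat -> tauN n2 <= K) by (apply Ht; auto).
  assert (T3 : (1 <= n3)%nat -> tauN n3 <= K) by (apply Ht; auto).
  assert (Z12 : n1 = 0%nat -> (1 <= n2)%nat) by (apply at_most_one_zero; auto).
  assert (Z13 : n1 = 0%nat -> (1 <= n3)%nat) by (apply at_most_one_zero; auto).
  assert (Z23 : n2 = 0%nat -> (1 <= n3)%nat) by (apply at_most_one_zero; auto).
  (* a nonzero value divisible by each of [a], [b], [c] *)
  set (na := if (n1 =? 0)%nat then n2 else n1). set (nb := if (n1 =? 0)%nat then n3 else n1).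
  set (nc := if (n2 =? 0)%nat then n3 else n2).
  assert (Na : (1 <= na)%nat /\ tauN na <= K) by (unfold na; destruct (Nat.eqb_spec n1 0); split; auto; try apply T1; lia).
  assert (Nb : (1 <= nb)%nat /\ tauN nb <= K) by (unfold nb; destruct (Nat.eqb_spec n1 0); split; auto; try apply T1; lia).
  assert (Nc : (1 <= nc)%nat /\ tauN nc <= K) by (unfold nc; destruct (Nat.eqb_spec n2 0); split; auto; try apply T2; lia).
  apply Rle_trans with (Sum (list3 Y) (fun e => (iv (divb (p1 e) na) * iv (divb (p2 e) nb) * iv (divb (p3 e) nc)) *
     Sum (list3 Y) (fun m => iv (mub Y n1 (p1 m)) * iv (mub Y n2 (p2 m)) * iv (mub Y n3 (p3 m))))).
  - apply Sum_le. intros e He. destruct (d_pos _ _ He) as (D1 & D2 & D3). rewrite <- Sum_scal. apply Sum_le. intros m Hm.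
    destruct (p_pos _ _ Hm) as (M1 & M2 & M3).
    rewrite <- !iv_and. apply iv_le_1. intros E.
    unfold okb, lamE, lamL in E. rewrite !Bool.andb_true_iff, !Nat.leb_le in E.
    rewrite <- !divb_zdivb in E by nia. fold n1 n2 n3 in E. destruct E as [[[O1 O2] O3] [[V1 V2] V3]].
    rewrite !Bool.andb_true_iff. destruct e as [[a b] c]. cbn [dv1 dv2 dv3 p1 p2 p3] in *.
    pose proof (divb_mul_l _ _ _ V1) as U1. pose proof (divb_mul_l _ _ _ V2) as U2. pose proof (divb_mul_l _ _ _ V3) as U3.
    pose proof (divb_mul_l _ _ _ U2) as U2a. pose proof (divb_mul_r _ _ _ U2) as U2c.
    assert (U1a : divb a n1 = true) by (rewrite divb_iff in *; eapply Nat.divide_trans; [apply Nat.divide_lcm_l|exact U1]).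
    assert (U1b : divb b n1 = true) by (rewrite divb_iff in *; eapply Nat.divide_trans; [apply Nat.divide_lcm_r|exact U1]).
    assert (U3b : divb b n3 = true) by (rewrite divb_iff in *; eapply Nat.divide_trans; [apply Nat.divide_lcm_l|exact U3]).
    assert (U3c : divb c n3 = true) by (rewrite divb_iff in *; eapply Nat.divide_trans; [apply Nat.divide_lcm_r|exact U3]).
    assert (MU : forall d mm n, (1 <= d)%nat -> (d * mm * mm <= Y)%nat -> divb (d * mm) n = true -> mub Y n mm = true).
    { intros d mm n Hd Ho Hdv. unfold mub. destruct (n =? 0)%nat; [apply Nat.leb_le; nia|]. eapply divb_mul_r; eauto. }
    unfold na, nb, nc. destruct (n1 =? 0)%nat, (n2 =? 0)%nat; repeat split; eauto.
  - rewrite Sum_scal_r, !Sum_list3. cbn [p1 p2 p3].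
    rewrite (Sum3_prod _ (fun a => iv (divb a na)) (fun a => iv (divb a nb)) (fun a => iv (divb a nc))).
    rewrite (Sum3_prod _ (fun a => iv (mub Y n1 a)) (fun a => iv (mub Y n2 a)) (fun a => iv (mub Y n3 a))).
    assert (SA : forall n, (1 <= n)%nat /\ tauN n <= K -> 0 <= Sum (seq 1 Y) (fun a => iv (divb a n)) <= K).
    { intros n [Hn Hn']. split; [apply Sum_nonneg; intros; apply iv_bounds|]. eapply Rle_trans; [apply Sum_ind_div_le; auto|auto]. }
    pose proof (SA _ Na). pose proof (SA _ Nb). pose proof (SA _ Nc).
    pose proof (mub_sum Y n1 K HY HK T1) as S1. pose proof (mub_sum Y n2 K HY HK T2) as S2. pose proof (mub_sum Y n3 K HY HK T3) as S3.
    apply Rle_trans with (K * K * K * (K * (1 + iv (n1 =? 0)%nat * sqrt (INR Y)) * (K * (1 + iv (n2 =? 0)%nat * sqrt (INR Y))) * (K * (1 + iv (n3 =? 0)%nat * sqrt (INR Y))))).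
    + repeat (apply Rmult_le_compat; try lra; try (repeat apply Rmult_le_pos; lra)).
    + replace (K * K * K * (K * (1 + iv (n1 =? 0)%nat * sqrt (INR Y)) * (K * (1 + iv (n2 =? 0)%nat * sqrt (INR Y))) * (K * (1 + iv (n3 =? 0)%nat * sqrt (INR Y)))))
        with (K ^ 6 * ((1 + iv (n1 =? 0)%nat * sqrt (INR Y)) * (1 + iv (n2 =? 0)%nat * sqrt (INR Y)) * (1 + iv (n3 =? 0)%nat * sqrt (INR Y)))) by ring.
      apply Rmult_le_compat_l; [apply pow_le; lra|].
      destruct (Nat.eqb_spec n1 0); destruct (Nat.eqb_spec n2 0); destruct (Nat.eqb_spec n3 0); simpl iv; try lra; exfalso; lia.
Qed.

(* With [V] about [X^(3/4)]: the [X / V] term is summed over the [O(X^(3/2+eps))] admissible pairs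
   [(e, m)]; the rest is summed over the short vectors [v], the divisor bound controlling the pairs
   [(e, m)] whose lattice contains [v] (the [v] with some [Li(v) = 0] being treated apart). *)
Lemma err_bound L1 L2 L3 eps : resL L1 L2 <> 0%Z -> resL L1 L3 <> 0%Z -> resL L2 L3 <> 0%Z -> 0 < eps ->
  exists C, 0 <= C /\ forall X, (1 <= X)%nat -> exists V, (1 <= V)%nat /\ let Y := (CL L1 L2 L3 * X)%nat in
    Sum (list3 Y) (fun e => Sum (list3 Y) (fun m => iv (okb Y e m) * errL (lamE L1 L2 L3 e m) X V)) <= C * Rpower (INR X) (7 / 4 + eps).
Proof.
  (* At most seven factors [u = X ^ del] accumulate from divisor bounds and logarithms, and [u ^ 10]
     is [X ^ eps]. *)
  intros h12 h13 h23 Heps. set (del := eps / 10). assert (Hdel : 0 < del) by (unfold del; lra).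
  (* The divisor bound is used for arguments up to [Y ^ 3], hence the third of [del]. *)
  destruct (divisor_bound (del / 3) ltac:(lra)) as [D [HD Htau]].
  destruct (ln_pow_bound 1 del Hdel) as [Cl [HCl0 HCl]].
  (* The factor 2 makes [B * X] dominate [V <= 2 * X ^ (3/4)] and the values of the forms at short
     vectors, besides [Y]. *)
  set (B := INR (2 * CL L1 L2 L3)).
  assert (HCL : (1 <= CL L1 L2 L3)%nat) by (unfold CL; lia).
  assert (HB : 1 <= B) by (apply INR_ge1; lia).
  set (K0 := D * Rpower B del). set (Lc := 3 * (Cl * Rpower B del)).
  assert (HBd : 1 <= Rpower B del) by (apply Rpower_ge1; lra).
  assert (HK0 : 1 <= K0) by (unfold K0; nra).
  assert (HLc : 0 <= Lc) by (unfold Lc; nra).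
  set (C1 := Rpower B (3 / 2) * (K0 ^ 3 * Lc) * 2).
  set (C2 := K0 ^ 6 * (24 * Lc + 6 * Lc * sqrt B)).
  assert (HC1 : 0 <= C1).
  { unfold C1. pose proof (Rpower_pos B (3 / 2)). pose proof (pow_le K0 3 ltac:(lra)). repeat apply Rmult_le_pos; lra. }
  assert (HC2 : 0 <= C2).
  { unfold C2. pose proof (pow_le K0 6 ltac:(lra)). pose proof (sqrt_pos B). apply Rmult_le_pos; auto. nra. }
  exists (C1 + C2). split; [lra|]. intros X HX. pose proof (INR_ge1 X HX) as RX.
  set (x34 := Rpower (INR X) (3 / 4)). assert (Hx34 : 1 <= x34) by (apply Rpower_ge1; lra).
  set (V := Z.to_nat (up x34)). destruct (archimed x34) as [U1 U2].
  assert (Hup : (1 <= up x34)%Z) by (apply le_IZR; simpl; lra).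
  assert (HV : (1 <= V)%nat) by (unfold V; lia).
  assert (EV : INR V = IZR (up x34)) by (unfold V; rewrite INR_IZR_INZ, Z2Nat.id by lia; auto).
  assert (V1 : x34 <= INR V <= 2 * x34) by lra.
  exists V. split; auto. intros Y.
  assert (HY : (1 <= Y)%nat) by (unfold Y; nia).
  assert (RY : INR Y <= B * INR X).
  { unfold Y, B. rewrite <- mult_INR. apply le_INR. nia. }
  assert (RY1 : 1 <= INR Y) by (apply INR_ge1; auto).
  set (u := Rpower (INR X) del). assert (Hu : 1 <= u) by (apply Rpower_ge1; lra).
  assert (Hx34X : x34 <= INR X) by (unfold x34; rewrite <- (Rpower_1 (INR X)) at 2 by lra; apply Rle_Rpower; lra).
  assert (HBX : forall z, 0 < z -> z <= B * INR X -> Rpower z del <= Rpower B del * u).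
  { intros z Hz Hz'. unfold u. rewrite Rpower_mult_distr by lra. apply Rle_Rpower_l; lra. }
  assert (Hln : forall z, 1 <= z -> z <= B * INR X -> 1 + ln z <= Cl * Rpower B del * u).
  { intros z Hz Hz'. specialize (HCl z Hz). simpl in HCl. rewrite Rmult_1_r in HCl. eapply Rle_trans; [exact HCl|].
    rewrite Rmult_assoc. apply Rmult_le_compat_l; auto. apply HBX; lra. }
  assert (Htau1 : forall n, (1 <= n <= Y * (Y * Y))%nat -> tauN n <= K0 * u).
  { intros n Hn. eapply Rle_trans; [apply Htau; lia|]. unfold K0. rewrite Rmult_assoc. apply Rmult_le_compat_l; [lra|].
    apply Rle_trans with (Rpower (INR (Y * (Y * Y))) (del / 3)).
    - apply Rle_Rpower_l; [lra|]. split; [apply lt_0_INR; lia|apply le_INR; lia].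
    - rewrite !mult_INR, <- !Rpower_mult_distr, <- !Rpower_plus by nra.
      replace (del / 3 + (del / 3 + del / 3)) with del by lra. apply HBX; lra. }
  assert (HYQ : 1 + ln (INR (Y * (Y * Y))) <= Lc * u).
  { rewrite !mult_INR, !ln_mult by nra. pose proof (Hln (INR Y) RY1 RY). unfold Lc. lra. }
  assert (HVln : 1 + ln (INR V) <= Lc * u).
  { assert (A : 1 <= INR V) by lra. assert (A' : INR V <= B * INR X).
    { apply Rle_trans with (2 * INR X); [lra|]. apply Rmult_le_compat_r; [lra|]. unfold B. replace 2 with (INR 2) by (simpl; lra). apply le_INR. lia. }
    pose proof (Hln (INR V) A A'). unfold Lc.
    assert (0 <= Cl * Rpower B del * u) by (repeat apply Rmult_le_pos; lra). lra. }
  assert (HN : Sum (list3 Y) (fun e => Sum (list3 Y) (fun m => iv (okb Y e m))) <=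
     Rpower B (3 / 2) * (K0 ^ 3 * Lc) * (Rpower (INR X) (3 / 2) * u ^ 4)).
  { assert (HKu : 1 <= K0 * u) by nra.
    eapply Rle_trans; [apply (count_ok Y (K0 * u) HY HKu Htau1)|].
    replace (Rpower B (3 / 2) * (K0 ^ 3 * Lc) * (Rpower (INR X) (3 / 2) * u ^ 4)) with
      ((Rpower B (3 / 2) * Rpower (INR X) (3 / 2)) * ((K0 * u) ^ 3 * (Lc * u))) by ring.
    assert (P3 : 0 <= (K0 * u) ^ 3) by (apply pow_le; lra).
    apply Rmult_le_compat.
    - left; apply Rpower_pos.
    - apply Rmult_le_pos; auto. pose proof (ln_nonneg (INR (Y * (Y * Y))) (INR_ge1 (Y * (Y * Y)) ltac:(nia))). lra.
    - rewrite Rpower_mult_distr by lra. apply Rle_Rpower_l; lra.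
    - apply Rmult_le_compat_l; auto. }
  assert (HXV : 1 + INR X / INR V <= 2 * Rpower (INR X) (1 / 4)).
  { assert (1 <= Rpower (INR X) (1 / 4)) by (apply Rpower_ge1; lra).
    assert (INR X / INR V <= Rpower (INR X) (1 / 4)); [|lra].
    apply Rmult_le_reg_r with (INR V); [lra|]. unfold Rdiv at 1. rewrite Rmult_assoc, Rinv_l, Rmult_1_r by lra.
    apply Rle_trans with (Rpower (INR X) (1 / 4) * x34); [|apply Rmult_le_compat_l; lra].
    unfold x34. rewrite <- Rpower_plus. replace (1 / 4 + 3 / 4) with 1 by lra. rewrite Rpower_1; lra. }
  assert (Hsplit : Sum (list3 Y) (fun e => Sum (list3 Y) (fun m => iv (okb Y e m) * errL (lamE L1 L2 L3 e m) X V)) =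
     (1 + INR X / INR V) * Sum (list3 Y) (fun e => Sum (list3 Y) (fun m => iv (okb Y e m))) +
     INR X * Sum (vbox V) (fun v => / vmax v * Sum (list3 Y) (fun e => Sum (list3 Y) (fun m => iv (okb Y e m) * iv (lamE L1 L2 L3 e m v))))).
  { rewrite <- !Sum_scal.
    rewrite (Sum_ext (vbox V) _ (fun v => Sum (list3 Y) (fun e => Sum (list3 Y) (fun m => INR X * (/ vmax v * (iv (okb Y e m) * iv (lamE L1 L2 L3 e m v))))))).
    2:{ intros v _. rewrite <- !Sum_scal. apply Sum_ext. intros e _. rewrite <- !Sum_scal. auto. }
    rewrite (Sum_swap (vbox V)), <- Sum_plus. apply Sum_ext. intros e _. rewrite (Sum_swap (vbox V)), <- Sum_scal, <- Sum_plus. apply Sum_ext. intros m _.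
    unfold errL. rewrite Rmult_plus_distr_l, <- Sum_scal. f_equal; [ring|]. apply Sum_ext. intros v _. unfold Rdiv. ring. }
  rewrite Hsplit.
  assert (HW : INR X * Sum (vbox V) (fun v => / vmax v * Sum (list3 Y) (fun e => Sum (list3 Y) (fun m => iv (okb Y e m) * iv (lamE L1 L2 L3 e m v))))
     <= INR X * ((K0 * u) ^ 6 * (24 * x34 * (Lc * u) + 6 * (Lc * u) * sqrt (INR Y)))).
  { apply Rmult_le_compat_l; [lra|].
    apply Rle_trans with (Sum (vbox V) (fun v => (K0 * u) ^ 6 * (/ vmax v + sqrt (INR Y) * (iv (Labs L1 v =? 0)%nat * / vmax v + iv (Labs L2 v =? 0)%nat * / vmax v + iv (Labs L3 v =? 0)%nat * / vmax v)))).
    - apply Sum_le. intros v Hv. apply in_vbox in Hv. destruct Hv as (Hv1 & Hv2 & Hv0).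
      assert (HKu : 1 <= K0 * u) by nra.
      pose proof (vmax_ge1 v Hv0) as Hvm. assert (0 < / vmax v) by (apply Rinv_0_lt_compat; lra).
      assert (HL : forall L, L = L1 \/ L = L2 \/ L = L3 -> (Labs L v <= CL L1 L2 L3 * V)%nat).
      { intros L HL. assert (HcL : (cf L <= CL L1 L2 L3)%nat) by (unfold CL; destruct HL as [->|[->| ->]]; lia).
        apply Nat.le_trans with (cf L * V)%nat; [|apply Nat.mul_le_mono_r; auto].
        unfold Labs, cf, evalL.
        assert (Z.abs (fst L * fst v) <= Z.abs (fst L) * Z.of_nat V)%Z by (rewrite Z.abs_mul; apply Z.mul_le_mono_nonneg; lia).
        assert (Z.abs (snd L * snd v) <= Z.abs (snd L) * Z.of_nat V)%Z by (rewrite Z.abs_mul; apply Z.mul_le_mono_nonneg; lia).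
        lia. }
      assert (HvT : forall L, L = L1 \/ L = L2 \/ L = L3 -> (1 <= Labs L v)%nat -> tauN (Labs L v) <= K0 * u).
      { intros L HLL Hn. eapply Rle_trans; [apply Htau; auto|]. unfold K0. rewrite Rmult_assoc. apply Rmult_le_compat_l; [lra|].
        assert (Hr : INR (Labs L v) <= B * INR X).
        { apply Rle_trans with (INR (CL L1 L2 L3 * V)); [apply le_INR; auto|]. unfold B. rewrite !mult_INR. simpl (INR 2).
          pose proof (pos_INR (CL L1 L2 L3)). nra. }
        pose proof (INR_ge1 _ Hn).
        apply Rle_trans with (Rpower (INR (Labs L v)) del); [apply Rle_Rpower; lra|]. apply HBX; lra. }
      pose proof (vector_count L1 L2 L3 Y v (K0 * u) h12 h13 h23 Hv0 HY HKu HvT) as HVC.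
      eapply Rle_trans; [apply Rmult_le_compat_l; [lra|exact HVC]|]. right. ring.
    - rewrite Sum_scal, Sum_plus, Sum_scal, !Sum_plus.
      pose proof (sum_vmax V HV) as S0.
      pose proof (sum_vmax_line L1 V HV ltac:(unfold resL in *; lia)) as S1.
      pose proof (sum_vmax_line L2 V HV ltac:(unfold resL in *; lia)) as S2.
      pose proof (sum_vmax_line L3 V HV ltac:(unfold resL in *; lia)) as S3.
      assert (P6 : 0 <= (K0 * u) ^ 6) by (apply pow_le; nra).
      apply Rmult_le_compat_l; auto. pose proof (sqrt_pos (INR Y)).
      pose proof (ln_nonneg (INR V) ltac:(lra)).
      apply Rplus_le_compat.
      + eapply Rle_trans; [exact S0|]. apply Rmult_le_compat; try lra.
      + rewrite Rmult_comm. apply Rmult_le_compat_r; auto. lra. }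
  assert (HsY : sqrt (INR Y) <= sqrt B * x34).
  { apply Rle_trans with (sqrt (B * INR X)); [apply sqrt_le_1_alt; auto|].
    rewrite sqrt_mult by lra. apply Rmult_le_compat_l; [apply sqrt_pos|].
    rewrite <- Rpower_sqrt by lra. apply Rle_Rpower; lra. }
  assert (Hu7 : u ^ 4 <= u ^ 10 /\ u ^ 7 <= u ^ 10) by (split; apply Rle_pow; auto; lia).
  assert (Hfin : Rpower (INR X) (7 / 4 + eps) = Rpower (INR X) (7 / 4) * u ^ 10).
  { rewrite Rpower_plus. f_equal. unfold u. rewrite <- Rpower_pow by apply Rpower_pos. rewrite Rpower_mult. f_equal.
    unfold del. simpl. lra. }
  rewrite Hfin. set (P := Rpower (INR X) (7 / 4)). assert (HP : 0 < P) by apply Rpower_pos.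
  assert (EP1 : Rpower (INR X) (3 / 2) * Rpower (INR X) (1 / 4) = P) by (unfold P; rewrite <- Rpower_plus; f_equal; lra).
  assert (EP2 : INR X * x34 = P).
  { unfold P, x34. rewrite <- (Rpower_1 (INR X)) at 1 by lra. rewrite <- Rpower_plus. f_equal. lra. }
  rewrite (Rmult_plus_distr_r C1 C2). apply Rplus_le_compat.
  - apply Rle_trans with (2 * Rpower (INR X) (1 / 4) * (Rpower B (3 / 2) * (K0 ^ 3 * Lc) * (Rpower (INR X) (3 / 2) * u ^ 4))).
    + apply Rmult_le_compat; auto.
      * assert (0 <= INR X / INR V) by (apply Rdiv_nonneg; lra). lra.
      * apply Sum_nonneg; intros; apply Sum_nonneg; intros; apply iv_bounds.
    + replace (2 * Rpower (INR X) (1 / 4) * (Rpower B (3 / 2) * (K0 ^ 3 * Lc) * (Rpower (INR X) (3 / 2) * u ^ 4))) with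
        (C1 * ((Rpower (INR X) (3 / 2) * Rpower (INR X) (1 / 4)) * u ^ 4)) by (unfold C1; ring).
      rewrite EP1. apply Rmult_le_compat_l; auto. apply Rmult_le_compat_l; lra.
  - eapply Rle_trans; [exact HW|].
    apply Rle_trans with (INR X * ((K0 * u) ^ 6 * (24 * x34 * (Lc * u) + 6 * (Lc * u) * (sqrt B * x34)))).
    + apply Rmult_le_compat_l; [lra|]. apply Rmult_le_compat_l; [apply pow_le; nra|].
      apply Rplus_le_compat_l. apply Rmult_le_compat_l; [|auto]. apply Rmult_le_pos; [lra|]. apply Rmult_le_pos; lra.
    + replace (INR X * ((K0 * u) ^ 6 * (24 * x34 * (Lc * u) + 6 * (Lc * u) * (sqrt B * x34)))) with
        (C2 * ((INR X * x34) * u ^ 7)) by (unfold C2; ring).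
      rewrite EP2. apply Rmult_le_compat_l; auto. apply Rmult_le_compat_l; lra.
Qed.

(** * The asymptotic expansion *)

(** Choice over a two-element type needs no axiom; three applications select the constants of all
    eight sums simultaneously. *)
Lemma bool_choice {A} (P : bool -> A -> Prop) : (forall b, exists x, P b x) -> exists f, forall b, P b (f b).
Proof.
  intros H. destruct (H true) as [x Hx]. destruct (H false) as [y Hy].
  exists (fun b : bool => if b then x else y). intros []; auto.
Qed.

(** With no logarithm selected the sum counts the points where no form vanishes. The exact constant
    1 is needed to recognise the leading coefficient. *)
Lemma lsum_FFF L1 L2 L3 X : (fst L1 <> 0 \/ snd L1 <> 0)%Z -> (fst L2 <> 0 \/ snd L2 <> 0)%Z ->
  (fst L3 <> 0 \/ snd L3 <> 0)%Z ->
  Rabs (lsum false false false L1 L2 L3 X - INR X * INR X) <= 6 * INR X.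
Proof.
  intros H1 H2 H3. unfold lsum. rewrite <- length_box, <- (Rmult_1_r (INR (length _))), <- Sum_const.
  eapply Rle_trans; [apply (Sum_abs_diff _ _ _ (fun x => iv (Labs L1 x =? 0)%nat + iv (Labs L2 x =? 0)%nat + iv (Labs L3 x =? 0)%nat))|].
  - intros x _. unfold lgt, nz3, nzL. simpl sel.
    destruct (Labs L1 x =? 0)%nat, (Labs L2 x =? 0)%nat, (Labs L3 x =? 0)%nat; simpl; apply Rabs_le; lra.
  - rewrite !Sum_plus. pose proof (count_Labs_eq L1 X 0 H1). pose proof (count_Labs_eq L2 X 0 H2). pose proof (count_Labs_eq L3 X 0 H3). lra.
Qed.

Lemma lsum_betas L1 L2 L3 : (fst L1 <> 0 \/ snd L1 <> 0)%Z -> (fst L2 <> 0 \/ snd L2 <> 0)%Z ->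
  (fst L3 <> 0 \/ snd L3 <> 0)%Z ->
  exists (beta : bool -> bool -> bool -> R) K, beta false false false = 1 /\ 0 <= K /\
  forall s1 s2 s3 X, (1 <= X)%nat -> Rabs (lsum s1 s2 s3 L1 L2 L3 X - beta s1 s2 s3 * (INR X * INR X)) <= K * Rpower (INR X) (3 / 2).
Proof.
  intros H1 H2 H3.
  assert (H : forall s1 s2 s3, exists p : R * R, ((s1 || s2 || s3)%bool = false -> fst p = 1) /\ 0 <= snd p /\ forall X, (1 <= X)%nat ->
    Rabs (lsum s1 s2 s3 L1 L2 L3 X - fst p * (INR X * INR X)) <= snd p * Rpower (INR X) (3 / 2)).
  { intros s1 s2 s3. destruct ((s1 || s2 || s3)%bool) eqn:E.
    - destruct (lsum_asymp s1 s2 s3 L1 L2 L3 H1 H2 H3) as (b & K & HK & HB). exists (b, K). split; [discriminate|]. auto.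
    - exists (1, 6). split; auto. cbn [fst snd]. split; [lra|]. intros X HX.
      destruct s1, s2, s3; try discriminate. rewrite Rmult_1_l. eapply Rle_trans; [apply lsum_FFF; auto|].
      pose proof (INR_ge1 X HX). apply Rmult_le_compat_l; [lra|]. rewrite <- (Rpower_1 (INR X)) at 1 by lra. apply Rle_Rpower; lra. }
  set (P := fun s1 s2 s3 (p : R * R) => ((s1 || s2 || s3)%bool = false -> fst p = 1) /\ 0 <= snd p /\ forall X, (1 <= X)%nat ->
    Rabs (lsum s1 s2 s3 L1 L2 L3 X - fst p * (INR X * INR X)) <= snd p * Rpower (INR X) (3 / 2)).
  assert (H' : exists f : bool -> bool -> bool -> R * R, forall s1 s2 s3, P s1 s2 s3 (f s1 s2 s3)).
  { apply (bool_choice (fun s1 (g : bool -> bool -> R * R) => forall s2 s3, P s1 s2 s3 (g s2 s3))). intros s1.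
    apply (bool_choice (fun s2 (g : bool -> R * R) => forall s3, P s1 s2 s3 (g s3))). intros s2.
    apply (bool_choice (fun s3 p => P s1 s2 s3 p)). apply H. }
  destruct H' as [f Hf].
  exists (fun s1 s2 s3 => fst (f s1 s2 s3)), (Sum3 bl (fun s1 s2 s3 => snd (f s1 s2 s3))).
  assert (Hin : forall s, In s bl) by (intros []; simpl; auto).
  assert (Hge : forall s1 s2 s3, snd (f s1 s2 s3) <= Sum3 bl (fun s1 s2 s3 => snd (f s1 s2 s3))).
  { intros s1 s2 s3. unfold Sum3.
    apply Rle_trans with (Sum bl (fun c => snd (f s1 s2 c))).
    { apply (Sum_ge_term bl (fun c => snd (f s1 s2 c))); auto. intros; apply Hf. }
    apply Rle_trans with (Sum bl (fun b => Sum bl (fun c => snd (f s1 b c)))).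
    { apply (Sum_ge_term bl (fun b => Sum bl (fun c => snd (f s1 b c)))); auto. intros; apply Sum_nonneg; intros; apply Hf. }
    apply (Sum_ge_term bl (fun a => Sum bl (fun b => Sum bl (fun c => snd (f a b c))))); auto.
    intros; apply Sum_nonneg; intros; apply Sum_nonneg; intros; apply Hf. }
  split; [apply Hf; auto|]. split.
  - eapply Rle_trans; [|apply (Hge true true true)]. apply Hf.
  - intros s1 s2 s3 X HX. eapply Rle_trans; [apply Hf; auto|]. apply Rmult_le_compat_r; [left; apply Rpower_pos|apply Hge].
Qed.

(** From [/ 2 * ln N = / 2 * (ln N - ln X) + / 2 * ln X]: for a factor of [mono] with selector [s],
    the part with selector [s'] in [lgt] has coefficient [al + al' * ln X]. *)
Definition al (s s' : bool) : R := sel s' (sel s (/ 2) 0) (sel s 0 1).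
Definition al' (s s' : bool) : R := sel s' 0 (sel s (/ 2) 0).

Lemma mono_expand s1 s2 s3 L1 L2 L3 X :
  Sum (box X) (fun x => iv (nz3 L1 L2 L3 x) * mono s1 s2 s3 (Nx L1 L2 L3 x)) =
  Sum3 bl (fun t1 t2 t3 => ((al s1 t1 + al' s1 t1 * ln (INR X)) * (al s2 t2 + al' s2 t2 * ln (INR X)) * (al s3 t3 + al' s3 t3 * ln (INR X))) *
    lsum t1 t2 t3 L1 L2 L3 X).
Proof.
  unfold lsum.
  rewrite (Sum3_ext bl _ (fun t1 t2 t3 => Sum (box X) (fun x => (al s1 t1 + al' s1 t1 * ln (INR X)) * (al s2 t2 + al' s2 t2 * ln (INR X)) * (al s3 t3 + al' s3 t3 * ln (INR X)) * lgt t1 t2 t3 L1 L2 L3 X x)))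
    by (intros; rewrite Sum_scal; auto).
  rewrite <- Sum3_swap1. apply Sum_ext. intros x _. unfold mono, Nx. cbn [p1 p2 p3].
  set (l := ln (INR X)). set (y1 := ln (INR (Labs L1 x))). set (y2 := ln (INR (Labs L2 x))). set (y3 := ln (INR (Labs L3 x))).
  assert (HS : forall s y, sel s (/ 2 * y) 1 = sel s (/ 2 * (y - l)) 0 + sel s (/ 2 * l) 1) by (intros [] y; simpl; lra).
  rewrite (HS s1 y1), (HS s2 y2), (HS s3 y3), prod_expand, <- Sum3_scal. apply Sum3_ext. intros t1 t2 t3 _ _ _. unfold lgt. fold l y1 y2 y3.
  assert (HT : forall s t y, sel t (sel s (/ 2 * (y - l)) 0) (sel s (/ 2 * l) 1) = (al s t + al' s t * l) * sel t (y - l) 1)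
    by (intros [] [] y; unfold al, al'; simpl; lra).
  rewrite !HT. ring.
Qed.

(** By [sum_form] the sum of [|L| ^ (- 1/4)] over the box is at most a multiple of [X] times a
    one-dimensional sum of size [X ^ (3/4)]. *)
Lemma sum_E4 L1 L2 L3 : (fst L1 <> 0 \/ snd L1 <> 0)%Z -> (fst L2 <> 0 \/ snd L2 <> 0)%Z -> (fst L3 <> 0 \/ snd L3 <> 0)%Z ->
  exists C, 0 <= C /\ forall X, (1 <= X)%nat ->
   Sum (box X) (fun x => iv (nz3 L1 L2 L3 x) * E4 (Nx L1 L2 L3 x)) <= C * Rpower (INR X) (7 / 4).
Proof.
  intros H1 H2 H3. set (Cc := (CL L1 L2 L3 + 1)%nat).
  exists (3 * (2 * (2 / (3 / 4) * Rpower (INR Cc) (3 / 4)))). pose proof (Rpower_pos (INR Cc) (3 / 4)) as HP.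
  assert (HC : (1 <= Cc)%nat) by (unfold Cc; lia).
  split; [repeat apply Rmult_le_pos; try lra|]. intros X HX. pose proof (INR_ge1 X HX) as RX.
  assert (HL : forall L, fst L <> 0%Z \/ snd L <> 0%Z -> (cf L <= CL L1 L2 L3)%nat ->
    Sum (box X) (fun x => iv (nzL L x) * Rpower (INR (Labs L x)) (- (1 / 4))) <= 2 * (2 / (3 / 4) * Rpower (INR Cc) (3 / 4)) * Rpower (INR X) (7 / 4)).
  { intros L HL HcL. eapply Rle_trans; [apply (sum_form L X (fun n => Rpower (INR n) (- (1 / 4))) HL); intros; left; apply Rpower_pos|].
    apply Rle_trans with (2 * INR X * (2 / (3 / 4) * Rpower (INR (Cc * X)) (3 / 4))).
    - apply Rmult_le_compat_l; [lra|].
      rewrite (Sum_ext _ _ (fun n => Rpower (INR n) (3 / 4 - 1))) by (intros; f_equal; lra).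
      eapply Rle_trans; [apply sum_pow_div; lra|]. apply Rmult_le_compat_l; [lra|].
      apply Rle_Rpower_l; [lra|]. split; [apply lt_0_INR; lia|]. apply le_INR. unfold Cc. nia.
    - rewrite mult_INR, <- Rpower_mult_distr by (apply lt_0_INR; lia).
      replace (Rpower (INR X) (7 / 4)) with (INR X * Rpower (INR X) (3 / 4)).
      + right; ring.
      + rewrite <- (Rpower_1 (INR X)) at 1 by lra. rewrite <- Rpower_plus. f_equal; lra. }
  apply Rle_trans with (Sum (box X) (fun x => iv (nzL L1 x) * Rpower (INR (Labs L1 x)) (- (1 / 4)) +
     iv (nzL L2 x) * Rpower (INR (Labs L2 x)) (- (1 / 4)) + iv (nzL L3 x) * Rpower (INR (Labs L3 x)) (- (1 / 4)))).
  - apply Sum_le. intros x _. unfold E4, Nx, nz3. cbn [p1 p2 p3].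
    pose proof (Rpower_pos (INR (Labs L1 x)) (- (1 / 4))). pose proof (Rpower_pos (INR (Labs L2 x)) (- (1 / 4))).
    pose proof (Rpower_pos (INR (Labs L3 x)) (- (1 / 4))).
    destruct (nzL L1 x), (nzL L2 x), (nzL L3 x); simpl; lra.
  - rewrite !Sum_plus. pose proof (HL L1 H1 ltac:(unfold CL; lia)). pose proof (HL L2 H2 ltac:(unfold CL; lia)). pose proof (HL L3 H3 ltac:(unfold CL; lia)). lra.
Qed.

Lemma res_nonzero L1 L2 : resL L1 L2 <> 0%Z -> (fst L1 <> 0 \/ snd L1 <> 0)%Z /\ (fst L2 <> 0 \/ snd L2 <> 0)%Z.
Proof. unfold resL. intros H. split; lia. Qed.

(** Three approximations, whose errors are the three constants added up in [C]: lattice counts by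
    densities, harmonic sums by logarithms ([M0] to [M1]), and logarithmic sums by their limits
    ([M1] to the polynomial). *)
Lemma TW_asymp L1 L2 L3 W eps : resL L1 L2 <> 0%Z -> resL L1 L3 <> 0%Z -> resL L2 L3 <> 0%Z -> 0 < eps ->
  (forall Y e, In e (list3 Y) -> Rabs (W e) <= 1) ->
  exists c0 c1 c2 c3 C, 0 <= C /\
    Un_cv (fun Y => Sum (T6 Y) (fun t => W (fst t) * kf L1 L2 L3 (snd t) * (/ INR (l1 t) * / INR (l2 t) * / INR (l3 t)))) c0 /\
    forall X, (1 <= X)%nat ->
     Rabs (TW L1 L2 L3 W X - INR X ^ 2 * (c0 * ln (INR X) ^ 3 + c1 * ln (INR X) ^ 2 + c2 * ln (INR X) + c3)) <= C * Rpower (INR X) (7 / 4 + eps).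
Proof.
  intros h12 h13 h23 Heps HW.
  destruct (res_nonzero _ _ h12) as [H1 H2]. destruct (res_nonzero _ _ h13) as [_ H3].
  destruct (err_bound L1 L2 L3 eps h12 h13 h23 Heps) as [Ce [HCe Herr]].
  destruct (G_est L1 L2 L3 h12 h13 h23) as [Cg [HCg HG]]. destruct (HG W HW) as [Q [HQ HGe]]. clear HG.
  destruct (lsum_betas L1 L2 L3 H1 H2 H3) as (beta & K & Hb0 & HK & Hbeta).
  destruct (sum_E4 L1 L2 L3 H1 H2 H3) as [C4 [HC4 HE4]].
  (* The squared logarithm of [G_est] meets an error already of size [X ^ (7/4)] and must cost only
     [X ^ eps]; the cubed one below meets [X ^ (3/2)] and may cost [X ^ (1/4)]. *)
  destruct (ln_pow_bound 2 eps Heps) as [Cl [HCl0 HCl]].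
  destruct (ln_pow_bound 3 (1 / 4) ltac:(lra)) as [Cm [HCm0 HCm]].
  set (B := INR (CL L1 L2 L3)).
  assert (HB : 1 <= B) by (apply INR_ge1; unfold CL; lia).
  set (SQ := Sum3 bl (fun s1 s2 s3 => Rabs (Q s1 s2 s3))).
  assert (HSQ : 0 <= SQ) by (unfold SQ, Sum3; repeat (apply Sum_nonneg; intros); apply Rabs_pos).
  set (S2 := fun F : bool -> bool -> bool -> bool -> bool -> bool -> R =>
     8 * Sum3 bl (fun s1 s2 s3 => Q s1 s2 s3 * Sum3 bl (fun t1 t2 t3 => beta t1 t2 t3 * F s1 s2 s3 t1 t2 t3))).
  set (c0 := S2 (fun s1 s2 s3 t1 t2 t3 => al' s1 t1 * al' s2 t2 * al' s3 t3)).
  set (c1 := S2 (fun s1 s2 s3 t1 t2 t3 => al s1 t1 * al' s2 t2 * al' s3 t3 + al' s1 t1 * al s2 t2 * al' s3 t3 + al' s1 t1 * al' s2 t2 * al s3 t3)).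
  set (c2 := S2 (fun s1 s2 s3 t1 t2 t3 => al s1 t1 * al s2 t2 * al' s3 t3 + al s1 t1 * al' s2 t2 * al s3 t3 + al' s1 t1 * al s2 t2 * al s3 t3)).
  set (c3 := S2 (fun s1 s2 s3 t1 t2 t3 => al s1 t1 * al s2 t2 * al s3 t3)).
  set (D1 := 8 * Cg * (Cl * Rpower B eps) * C4). set (D2 := 8 * (SQ * (8 * (Cm * K)))).
  exists c0, c1, c2, c3, (640 * Ce + D1 + D2).
  assert (HD1 : 0 <= D1).
  { unfold D1. pose proof (Rpower_pos B eps). repeat apply Rmult_le_pos; lra. }
  assert (HD2 : 0 <= D2) by (unfold D2; repeat apply Rmult_le_pos; lra).
  split; [lra|]. split.
  (* Only three selected logarithms reach the third power of [ln X]: the eight choices of [b] cancel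
     the factor [(1/2)^3], and the limit for no remaining logarithm is 1. *)
  { replace c0 with (Q true true true); auto. unfold c0, S2, Sum3, bl, Sum, al', sel. cbn [map fold_right]. rewrite Hb0. lra. }
  intros X HX. pose proof (INR_ge1 X HX) as RX. set (x := INR X) in *. set (l := ln x) in *.
  assert (Hl : 0 <= l) by (apply ln_nonneg; auto).
  destruct (Herr X HX) as [V [HV HE]]. cbv zeta in HE.
  set (Y := (CL L1 L2 L3 * X)%nat) in *.
  pose proof (TW_main L1 L2 L3 W X V HX HV (HW Y)) as HM. fold Y in HM.
  set (M0 := Sum (box X) (fun x => iv (nz3 L1 L2 L3 x) * Sum bs (fun b => Gmain L1 L2 L3 Y Y W b (Nx L1 L2 L3 x)))) in *.
  set (M1 := 8 * Sum3 bl (fun s1 s2 s3 => Q s1 s2 s3 * Sum (box X) (fun x => iv (nz3 L1 L2 L3 x) * mono s1 s2 s3 (Nx L1 L2 L3 x)))).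
  assert (A1 : Rabs (TW L1 L2 L3 W X - M0) <= 640 * Ce * Rpower x (7 / 4 + eps)).
  { eapply Rle_trans; [exact HM|]. rewrite Rmult_assoc. apply Rmult_le_compat_l; [lra|auto]. }
  assert (A2 : Rabs (M0 - M1) <= D1 * Rpower x (7 / 4 + eps)).
  { replace M1 with (Sum (box X) (fun x => iv (nz3 L1 L2 L3 x) * (8 * Sum3 bl (fun s1 s2 s3 => Q s1 s2 s3 * mono s1 s2 s3 (Nx L1 L2 L3 x))))).
    2:{ unfold M1. rewrite (Sum3_ext bl _ (fun s1 s2 s3 => Sum (box X) (fun x => Q s1 s2 s3 * (iv (nz3 L1 L2 L3 x) * mono s1 s2 s3 (Nx L1 L2 L3 x)))))
          by (intros; rewrite Sum_scal; auto).
        rewrite <- Sum3_swap1, <- Sum_scal. apply Sum_ext. intros y _. rewrite <- !Sum3_scal. apply Sum3_ext. intros; ring. }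
    set (Lam := 1 + ln (INR Y)).
    assert (HY1 : (1 <= Y)%nat) by (unfold Y, CL; nia).
    assert (HLam : 1 <= Lam) by (unfold Lam; pose proof (ln_nonneg _ (INR_ge1 Y HY1)); lra).
    apply Rle_trans with (Sum (box X) (fun y => 8 * Cg * (Lam * Lam) * (iv (nz3 L1 L2 L3 y) * E4 (Nx L1 L2 L3 y)))).
    - apply Sum_abs_diff. intros y Hy. destruct (nz3 L1 L2 L3 y) eqn:En.
      + simpl iv. rewrite !Rmult_1_l.
        pose proof (Nx_in L1 L2 L3 X y Hy En) as HN. fold Y in HN.
        destruct (p_pos _ _ HN) as (N1 & N2 & N3).
        replace (8 * Sum3 bl (fun s1 s2 s3 => Q s1 s2 s3 * mono s1 s2 s3 (Nx L1 L2 L3 y))) with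
          (Sum bs (fun _ => Sum3 bl (fun s1 s2 s3 => Q s1 s2 s3 * mono s1 s2 s3 (Nx L1 L2 L3 y)))) by (rewrite Sum_const; unfold bs; simpl length; simpl INR; ring).
        replace (8 * Cg * (Lam * Lam) * E4 (Nx L1 L2 L3 y)) with (Sum bs (fun _ => Cg * (Lam * Lam) * E4 (Nx L1 L2 L3 y)))
          by (rewrite Sum_const; unfold bs; simpl length; simpl INR; ring).
        apply Sum_abs_diff. intros b Hb. apply in_bs in Hb. destruct Hb as (b1 & b2 & b3).
        apply HGe; auto; unfold Lam; apply Rplus_le_compat_l; apply ln_INR_le; lia.
      + simpl iv. rewrite !Rmult_0_l, Rminus_diag, Rabs_R0. lra.
    - rewrite Sum_scal. specialize (HE4 X HX). fold x in HE4.
      assert (HLL : Lam * Lam <= Cl * Rpower B eps * Rpower x eps).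
      { specialize (HCl (INR Y) (INR_ge1 Y HY1)). fold Lam in HCl. simpl in HCl. rewrite Rmult_1_r in HCl.
        eapply Rle_trans; [exact HCl|]. rewrite Rmult_assoc, Rpower_mult_distr by lra.
        apply Rmult_le_compat_l; auto. right. f_equal. unfold Y. rewrite mult_INR. auto. }
      apply Rle_trans with (8 * Cg * (Cl * Rpower B eps * Rpower x eps) * (C4 * Rpower x (7 / 4))).
      + apply Rmult_le_compat; auto.
        * apply Rmult_le_pos; [lra|nra].
        * apply Sum_nonneg. intros y _. apply Rmult_le_pos; [apply iv_bounds|]. unfold E4.
          pose proof (Rpower_pos (INR (p1 (Nx L1 L2 L3 y))) (- (1 / 4))). pose proof (Rpower_pos (INR (p2 (Nx L1 L2 L3 y))) (- (1 / 4))).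
          pose proof (Rpower_pos (INR (p3 (Nx L1 L2 L3 y))) (- (1 / 4))). lra.
        * apply Rmult_le_compat_l; lra.
      + rewrite Rpower_plus. unfold D1. right. ring. }
  set (PX := x ^ 2 * (c0 * l ^ 3 + c1 * l ^ 2 + c2 * l + c3)).
  assert (A3 : Rabs (M1 - PX) <= D2 * Rpower x (7 / 4 + eps)).
  { set (pol := fun s1 s2 s3 t1 t2 t3 : bool => (al s1 t1 + al' s1 t1 * l) * (al s2 t2 + al' s2 t2 * l) * (al s3 t3 + al' s3 t3 * l)).
    assert (EP : PX = 8 * Sum3 bl (fun s1 s2 s3 => Q s1 s2 s3 * Sum3 bl (fun t1 t2 t3 => pol s1 s2 s3 t1 t2 t3 * (beta t1 t2 t3 * (x * x))))).
    { unfold PX, c0, c1, c2, c3, S2.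
      transitivity (8 * (Sum3 bl (fun s1 s2 s3 => x * x * l ^ 3 * (Q s1 s2 s3 * Sum3 bl (fun t1 t2 t3 => beta t1 t2 t3 * (al' s1 t1 * al' s2 t2 * al' s3 t3)))) +
        Sum3 bl (fun s1 s2 s3 => x * x * l ^ 2 * (Q s1 s2 s3 * Sum3 bl (fun t1 t2 t3 => beta t1 t2 t3 * (al s1 t1 * al' s2 t2 * al' s3 t3 + al' s1 t1 * al s2 t2 * al' s3 t3 + al' s1 t1 * al' s2 t2 * al s3 t3)))) +
        Sum3 bl (fun s1 s2 s3 => x * x * l * (Q s1 s2 s3 * Sum3 bl (fun t1 t2 t3 => beta t1 t2 t3 * (al s1 t1 * al s2 t2 * al' s3 t3 + al s1 t1 * al' s2 t2 * al s3 t3 + al' s1 t1 * al s2 t2 * al s3 t3)))) +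
        Sum3 bl (fun s1 s2 s3 => x * x * (Q s1 s2 s3 * Sum3 bl (fun t1 t2 t3 => beta t1 t2 t3 * (al s1 t1 * al s2 t2 * al s3 t3)))))).
      { rewrite !Sum3_scal. ring. }
      f_equal. rewrite <- !Sum3_plus. apply Sum3_ext. intros s1 s2 s3 _ _ _.
      rewrite <- !Sum3_scal, <- !Sum3_plus. apply Sum3_ext. intros t1 t2 t3 _ _ _. unfold pol. ring. }
    rewrite EP. unfold M1. rewrite <- Rmult_minus_distr_l, Rabs_mult, (Rabs_right 8) by lra.
    unfold D2. rewrite !(Rmult_assoc 8). apply Rmult_le_compat_l; [lra|].
    rewrite <- Sum3_minus. eapply Rle_trans; [apply Sum3_abs|].
    rewrite (Rmult_assoc SQ). unfold SQ. rewrite (Rmult_comm (Sum3 _ _)), <- Sum3_scal. apply Sum3_le. intros s1 s2 s3 _ _ _.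
    rewrite <- Rmult_minus_distr_l, Rabs_mult, (Rmult_comm (8 * (Cm * K) * Rpower x (7 / 4 + eps))).
    apply Rmult_le_compat_l; [apply Rabs_pos|].
    rewrite mono_expand. fold x l. rewrite <- Sum3_minus. eapply Rle_trans; [apply Sum3_abs|].
    replace (8 * (Cm * K) * Rpower x (7 / 4 + eps)) with (Sum3 bl (fun _ _ _ => Cm * K * Rpower x (7 / 4 + eps)))
      by (unfold Sum3; rewrite !Sum_const; simpl; ring).
    apply Sum3_le. intros t1 t2 t3 _ _ _. rewrite <- Rmult_minus_distr_l, Rabs_mult.
    assert (Hal : forall s t, Rabs (al s t + al' s t * l) <= 1 + l) by (intros [] []; unfold al, al'; simpl; apply Rabs_le; lra).
    assert (H3l : Rabs ((al s1 t1 + al' s1 t1 * l) * (al s2 t2 + al' s2 t2 * l) * (al s3 t3 + al' s3 t3 * l)) <= Cm * Rpower x (1 / 4)).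
    { eapply Rle_trans; [apply (mult3_abs _ _ _ (1 + l) (1 + l) (1 + l)); apply Hal|].
      replace ((1 + l) * (1 + l) * (1 + l)) with ((1 + l) ^ 3) by ring. apply HCm. auto. }
    eapply Rle_trans; [apply Rmult_le_compat; [apply Rabs_pos|apply Rabs_pos|exact H3l|apply Hbeta; auto]|]. fold x.
    apply Rle_trans with (Cm * K * Rpower x (7 / 4)).
    - right. replace (7 / 4) with (1 / 4 + 3 / 2) by lra. rewrite Rpower_plus. ring.
    - apply Rmult_le_compat_l; [nra|]. apply Rle_Rpower; lra. }
  replace (TW L1 L2 L3 W X - PX) with ((TW L1 L2 L3 W X - M0) + (M0 - M1) + (M1 - PX)) by ring.
  eapply Rle_trans; [apply Rabs_triang|]. eapply Rle_trans; [apply Rplus_le_compat_r, Rabs_triang|]. lra.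
Qed.

(** * The two divisor sums as instances of [TW] *)

Definition Wmu (e : E3) : R := let '(a, b, c) := e in mu a * mu b * mu c.
Definition Wone (e : E3) : R := let '(a, b, c) := e in iv ((a =? 1)%nat && (b =? 1)%nat && (c =? 1)%nat).
Definition Fn (L1 L2 L3 : linform) (x : Z * Z) : nat := (Labs L1 x * Labs L2 x * Labs L3 x)%nat.
Definition Tn (L1 L2 L3 : linform) (X : nat) : R :=
  Sum (box X) (fun x => iv (nz3 L1 L2 L3 x) * tauN (Fn L1 L2 L3 x)).

Lemma Wmu_bound Y e : In e (list3 Y) -> Rabs (Wmu e) <= 1.
Proof.
  destruct e as [[a b] c]. rewrite in_list3. intros (Ha & Hb & Hc). unfold Wmu.
  replace 1 with (1 * 1 * 1) by ring. apply mult3_abs; apply mu_bound; lia.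
Qed.

Lemma Wone_bound e : Rabs (Wone e) <= 1.
Proof. destruct e as [[a b] c]. unfold Wone. pose proof (iv_bounds ((a =? 1)%nat && (b =? 1)%nat && (c =? 1)%nat)). apply Rabs_le. lra. Qed.

Lemma TW_mu L1 L2 L3 X : TW L1 L2 L3 Wmu X = Tn L1 L2 L3 X.
Proof.
  unfold TW, Tn. apply Sum_ext. intros x Hx. destruct (nz3 L1 L2 L3 x) eqn:E; [|simpl; ring]. f_equal.
  pose proof (Nx_in L1 L2 L3 X x Hx E) as HN. apply p_pos in HN. destruct HN as (N1 & N2 & N3). unfold Nx in *. cbn [p1 p2 p3] in *.
  unfold Fn. rewrite (tau3_formula _ _ _ (CL L1 L2 L3 * X)) by auto. rewrite Sum_list3. reflexivity.
Qed.

Lemma TW_one L1 L2 L3 X : TW L1 L2 L3 Wone X =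
  Sum (box X) (fun x => iv (nz3 L1 L2 L3 x) * (tauN (Labs L1 x) * tauN (Labs L2 x) * tauN (Labs L3 x))).
Proof.
  unfold TW. apply Sum_ext. intros x Hx. destruct (nz3 L1 L2 L3 x) eqn:E; [|simpl; ring]. f_equal.
  pose proof (Nx_in L1 L2 L3 X x Hx E) as HN. apply p_pos in HN. destruct HN as (N1 & N2 & N3). unfold Nx in *. cbn [p1 p2 p3] in *.
  set (Y := (CL L1 L2 L3 * X)%nat) in *.
  assert (Ht : forall n, (1 <= n <= Y)%nat -> tcount Y 1 n = tauN n).
  { intros n Hn. rewrite (tauN_Sum n Y Hn). unfold tcount. apply Sum_ext. intros m _. rewrite Nat.mul_1_l. auto. }
  rewrite <- (Ht (Labs L1 x)), <- (Ht (Labs L2 x)), <- (Ht (Labs L3 x)) by auto.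
  rewrite (Sum_ext _ _ (fun e => iv ((p1 e =? 1)%nat && (p2 e =? 1)%nat && (p3 e =? 1)%nat) *
     (tcount Y (dv1 e) (Labs L1 x) * tcount Y (dv2 e) (Labs L2 x) * tcount Y (dv3 e) (Labs L3 x)))) by (intros [[a b] c] _; reflexivity).
  apply (Sum_ind_unique (list3 Y) (fun e => ((p1 e =? 1)%nat && (p2 e =? 1)%nat && (p3 e =? 1)%nat)%bool) (1%nat, 1%nat, 1%nat)
    (fun e => tcount Y (dv1 e) (Labs L1 x) * tcount Y (dv2 e) (Labs L2 x) * tcount Y (dv3 e) (Labs L3 x))).
  - apply NoDup_list3.
  - apply in_list3. lia.
  - intros [[a b] c] _. cbn [p1 p2 p3]. rewrite !Bool.andb_true_iff, !Nat.eqb_eq. split; [intros [[-> ->] ->]; auto|intros H; injection H; auto].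
Qed.

Lemma tau_eq z : INR (tau z) = if (Z.abs_nat z =? 0)%nat then 0 else tauN (Z.abs_nat z).
Proof.
  unfold tau, tauN, divs. destruct (Nat.eqb_spec (Z.abs_nat z) 0) as [E|E]; [rewrite E; reflexivity|].
  do 2 f_equal. apply filter_ext_in. intros d Hd. apply in_seq in Hd. apply Bool.eq_iff_eq_true.
  rewrite divb_iff, Z.eqb_eq, Z.rem_divide, <- Zdivide_of_nat, Zabs2Nat.id_abs by lia. symmetry. apply Z.divide_abs_r.
Qed.

Lemma T_eq L1 L2 L3 X : T L1 L2 L3 X = Tn L1 L2 L3 (floorN X).
Proof.
  unfold Tn, box, zseq. rewrite Sum_list_prod, Sum_map. unfold T.
  change (fold_right Rplus 0 (map ?f ?l)) with (Sum l f). apply Sum_ext. intros x1 _. rewrite Sum_map.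
  change (fold_right Rplus 0 (map ?f ?l)) with (Sum l f). apply Sum_ext. intros x2 _. cbv zeta.
  rewrite tau_eq. unfold Fn, Labs, nz3, nzL, Labs. cbn [fst snd]. rewrite !Zabs2Nat.inj_mul.
  set (n1 := Z.abs_nat (evalL L1 (Z.of_nat x1) (Z.of_nat x2))). set (n2 := Z.abs_nat (evalL L2 (Z.of_nat x1) (Z.of_nat x2))).
  set (n3 := Z.abs_nat (evalL L3 (Z.of_nat x1) (Z.of_nat x2))).
  destruct (Nat.eqb_spec n1 0) as [->|E1]; [simpl; ring|].
  destruct (Nat.eqb_spec n2 0) as [->|E2]; [rewrite Nat.mul_0_r; simpl; ring|].
  destruct (Nat.eqb_spec n3 0) as [->|E3]; [rewrite Nat.mul_0_r; simpl; ring|].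
  destruct (Nat.eqb_spec (n1 * n2 * n3) 0) as [E|E]; [nia|]. simpl. ring.
Qed.

(** * Positivity of the leading coefficient *)

(* The pair [(e1, e2)] of divisors is recovered from [e1 * e2] and [gcd e2 (a / e1)]. *)
Lemma tau_mul_gcd a b : (1 <= a)%nat -> (1 <= b)%nat -> tauN a * tauN b <= tauN (Nat.gcd a b) * tauN (a * b).
Proof.
  intros Ha Hb. assert (Hg : (1 <= Nat.gcd a b)%nat) by (assert (Nat.gcd a b <> 0)%nat by (rewrite Nat.gcd_eq_0; lia); lia).
  assert (Hab : (1 <= a * b)%nat) by nia.
  unfold tauN. rewrite <- !mult_INR, <- !length_prod. apply le_INR.
  apply (inj_length (fun t => (Nat.gcd (snd t) (a / fst t), (fst t * snd t)%nat))).
  - apply NoDup_list_prod; apply NoDup_divs.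
  - intros [e1 e2] H. apply in_prod_iff in H. rewrite !in_divs in H by auto. destruct H as [[u Hu] [w Hw]]. cbn [fst snd].
    apply in_prod; apply in_divs; auto.
    + apply Nat.gcd_greatest.
      * eapply Nat.divide_trans; [apply Nat.gcd_divide_r|]. assert (e1 <> 0)%nat by (intros ->; lia).
        rewrite Hu, Nat.div_mul by auto. apply Nat.divide_factor_l.
      * eapply Nat.divide_trans; [apply Nat.gcd_divide_l|]. exists w. auto.
    + exists (u * w)%nat. subst. ring.
  - intros [e1 e2] [f1 f2] H H'. apply in_prod_iff in H, H'. rewrite !in_divs in H, H' by auto. cbn [fst snd].
    intros E. injection E; intros E2 E1.
    assert (K : forall e1 e2, Nat.divide e1 a -> Nat.gcd (e1 * e2) a = (e1 * Nat.gcd e2 (a / e1))%nat).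
    { intros x y [u Hu]. assert (x <> 0)%nat by (intros ->; lia). rewrite Hu at 1. rewrite (Nat.mul_comm u x), Nat.gcd_mul_mono_l.
      rewrite Hu, Nat.div_mul by auto. auto. }
    pose proof (K e1 e2 (proj1 H)) as G1. pose proof (K f1 f2 (proj1 H')) as G2. rewrite E2, G2, E1 in G1.
    assert (Nat.gcd f2 (a / f1) <> 0)%nat.
    { rewrite Nat.gcd_eq_0. intros [Z _]. destruct H' as [_ [w Hw]]. rewrite Z in Hw. lia. }
    assert (e1 = f1) by (apply (Nat.mul_cancel_r _ _ (Nat.gcd f2 (a / f1))); auto). subst f1.
    assert (e1 <> 0)%nat by (intros ->; destruct H as [[u Hu] _]; lia).
    assert (e2 = f2) by (apply (Nat.mul_cancel_l _ _ e1); auto). subst. auto.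
Qed.

(** Both [y1] and [y2] times the resultant are integral combinations of the two values; a Bezout
    relation between [y1] and [y2] combines them. So at a primitive point a common divisor of the
    values divides the resultant. *)
Lemma resultant_bezout L M (y1 y2 p q : Z) : (p * y1 + q * y2 = 1)%Z ->
  exists u w, (resL L M = u * evalL L y1 y2 + w * evalL M y1 y2)%Z.
Proof.
  intros H. exists (p * snd M - q * fst M)%Z, (q * fst L - p * snd L)%Z.
  transitivity (resL L M * (p * y1 + q * y2))%Z; [rewrite H; ring|]. unfold resL, evalL. ring.
Qed.

(** [tau_mul_gcd] is used twice. At a primitive point the two gcds divide [resL L1 L2] and
    [resL L1 L3 * resL L2 L3], and [tauN g <= g] bounds their divisor functions by the product of
    resultants. *)
Lemma tau_primitive L1 L2 L3 y1 y2 : resL L1 L2 <> 0%Z -> resL L1 L3 <> 0%Z -> resL L2 L3 <> 0%Z ->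
  Nat.gcd y1 y2 = 1%nat -> let y := (Z.of_nat y1, Z.of_nat y2) in nz3 L1 L2 L3 y = true ->
  tauN (Labs L1 y) * tauN (Labs L2 y) * tauN (Labs L3 y) <= INR (Rn L1 L2 L3) * tauN (Fn L1 L2 L3 y).
Proof.
  intros h12 h13 h23 Hg y Hn. unfold nz3 in Hn. rewrite !Bool.andb_true_iff, !nzL_iff in Hn. destruct Hn as [[N1 N2] N3].
  apply Zgcd_of_nat_1 in Hg. destruct (Z.gcd_bezout _ _ _ Hg) as [p [q Hpq]].
  destruct (resultant_bezout L1 L2 _ _ p q Hpq) as (u1 & w1 & R12).
  destruct (resultant_bezout L1 L3 _ _ p q Hpq) as (u2 & w2 & R13).
  destruct (resultant_bezout L2 L3 _ _ p q Hpq) as (u3 & w3 & R23).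
  unfold Fn. set (n1 := Labs L1 y) in *. set (n2 := Labs L2 y) in *. set (n3 := Labs L3 y) in *.
  set (z1 := evalL L1 (Z.of_nat y1) (Z.of_nat y2)) in *. set (z2 := evalL L2 (Z.of_nat y1) (Z.of_nat y2)) in *. set (z3 := evalL L3 (Z.of_nat y1) (Z.of_nat y2)) in *.
  assert (E1 : Z.of_nat n1 = Z.abs z1) by apply Zabs2Nat.id_abs. assert (E2 : Z.of_nat n2 = Z.abs z2) by apply Zabs2Nat.id_abs.
  assert (E3 : Z.of_nat n3 = Z.abs z3) by apply Zabs2Nat.id_abs.
  assert (Hd : forall k n z, Z.of_nat n = Z.abs z -> Nat.divide k n -> Z.divide (Z.of_nat k) z).
  { intros k n z E H. apply Z.divide_abs_r. rewrite <- E. apply Zdivide_of_nat. auto. }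
  assert (Hle : forall k z, z <> 0%Z -> Z.divide (Z.of_nat k) z -> tauN k <= INR (Z.abs_nat z)).
  { intros k z Hz H. eapply Rle_trans; [apply tauN_le|]. apply le_INR.
    assert (Z.of_nat k <= Z.abs z)%Z by (apply Z.divide_pos_le; [lia|apply Z.divide_abs_r; auto]). lia. }
  assert (B1 : tauN (Nat.gcd n1 n2) <= INR (Z.abs_nat (resL L1 L2))).
  { apply Hle; auto. rewrite R12. apply Z.divide_add_r; apply Z.divide_mul_r.
    - apply (Hd _ n1); auto. apply Nat.gcd_divide_l.
    - apply (Hd _ n2); auto. apply Nat.gcd_divide_r. }
  assert (B2 : tauN (Nat.gcd (n1 * n2) n3) <= INR (Z.abs_nat (resL L1 L3 * resL L2 L3))).
  { apply Hle; [nia|]. rewrite R13, R23.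
    replace ((u2 * z1 + w2 * z3) * (u3 * z2 + w3 * z3))%Z with (u2 * u3 * (z1 * z2) + (w2 * u3 * z2 + u2 * z1 * w3 + w2 * w3 * z3) * z3)%Z by ring.
    apply Z.divide_add_r; apply Z.divide_mul_r.
    - apply (Hd _ (n1 * n2)%nat); [rewrite Nat2Z.inj_mul, E1, E2, Z.abs_mul; auto|apply Nat.gcd_divide_l].
    - apply (Hd _ n3); auto. apply Nat.gcd_divide_r. }
  assert (N12 : (1 <= n1 * n2)%nat) by nia. assert (N123 : (1 <= n1 * n2 * n3)%nat) by nia.
  pose proof (tau_mul_gcd n1 n2 N1 N2) as T1. pose proof (tau_mul_gcd (n1 * n2) n3 N12 N3) as T2.
  pose proof (tauN_ge1 n1 N1). pose proof (tauN_ge1 n2 N2). pose proof (tauN_ge1 n3 N3). pose proof (tauN_ge1 _ N12). pose proof (tauN_ge1 _ N123).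
  assert (0 <= tauN (Nat.gcd n1 n2)) by apply pos_INR. assert (0 <= tauN (Nat.gcd (n1 * n2) n3)) by apply pos_INR.
  unfold Rn. rewrite <- Z.mul_assoc, Zabs2Nat.inj_mul, mult_INR.
  set (r1 := INR (Z.abs_nat (resL L1 L2))) in *. set (r2 := INR (Z.abs_nat (resL L1 L3 * resL L2 L3))) in *.
  apply Rle_trans with (tauN (Nat.gcd n1 n2) * tauN (n1 * n2) * tauN n3); [apply Rmult_le_compat_r; lra|].
  rewrite !Rmult_assoc. apply Rmult_le_compat; auto; [apply Rmult_le_pos; lra|].
  eapply Rle_trans; [exact T2|]. apply Rmult_le_compat_r; lra.
Qed.

Lemma Sum_div g X (h : nat -> R) : (1 <= g)%nat ->
  Sum (seq 1 X) (fun x => iv (divb g x) * h (x / g)%nat) = Sum (seq 1 (X / g)) h.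
Proof.
  intros Hg. rewrite <- Sum_filter. rewrite (Sum_same_elements _ (map (fun k => (k * g)%nat) (seq 1 (X / g)))).
  - rewrite Sum_map. apply Sum_ext. intros k _. rewrite Nat.div_mul by lia. auto.
  - apply NoDup_filter, seq_NoDup.
  - apply NoDup_map_on; [intros; nia|apply seq_NoDup].
  - intros x. rewrite filter_In, in_map_iff, in_seq, divb_iff. split.
    + intros [Hx [z Hz]]. exists z. split; auto. apply in_seq. assert (z <> 0)%nat by (intros ->; lia).
      assert (z <= X / g)%nat by (apply Nat.div_le_lower_bound; lia). lia.
    + intros [k [<- Hk]]. apply in_seq in Hk. pose proof (Nat.mul_div_le X g ltac:(lia)).
      split; [nia|]. exists k. auto.
Qed.

Lemma Sum_box_nat X f : Sum (box X) f = Sum (seq 1 X) (fun i => Sum (seq 1 X) (fun j => f (Z.of_nat i, Z.of_nat j))).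
Proof. unfold box, zseq. rewrite Sum_list_prod, Sum_map. apply Sum_ext. intros i _. rewrite Sum_map. reflexivity. Qed.

(** Writing a point as [g] times a primitive one multiplies each form by [g], which costs
    [tauN g ^ 3] by submultiplicativity. On the right all common divisors of the coordinates occur;
    only the term of their gcd is needed. *)
Lemma compare_sums L1 L2 L3 X : resL L1 L2 <> 0%Z -> resL L1 L3 <> 0%Z -> resL L2 L3 <> 0%Z ->
  TW L1 L2 L3 Wone X <= INR (Rn L1 L2 L3) * Sum (seq 1 X) (fun g => tauN g ^ 3 * Tn L1 L2 L3 (X / g)).
Proof.
  intros h12 h13 h23. rewrite TW_one, Sum_box_nat.
  set (h := fun i j => iv (nz3 L1 L2 L3 (Z.of_nat i, Z.of_nat j)) * tauN (Fn L1 L2 L3 (Z.of_nat i, Z.of_nat j))).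
  assert (Hh : forall i j, 0 <= h i j) by (intros; apply Rmult_le_pos; [apply iv_bounds|apply pos_INR]).
  assert (HR : 0 <= INR (Rn L1 L2 L3)) by apply pos_INR.
  rewrite (Sum_ext (seq 1 X) (fun g => tauN g ^ 3 * _) (fun g => Sum (seq 1 X) (fun i => Sum (seq 1 X) (fun j =>
     iv (divb g i) * (iv (divb g j) * (tauN g ^ 3 * h (i / g)%nat (j / g)%nat)))))).
  2:{ intros g Hg. apply in_seq in Hg. unfold Tn. rewrite Sum_box_nat, <- (Sum_div g X) by lia. rewrite <- Sum_scal. apply Sum_ext. intros i _.
      rewrite <- (Sum_div g X (fun j => iv (nz3 L1 L2 L3 (Z.of_nat (i / g), Z.of_nat j)) * tauN (Fn L1 L2 L3 (Z.of_nat (i / g), Z.of_nat j)))) by lia.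
      rewrite <- !Sum_scal. apply Sum_ext. intros j _. unfold h. ring. }
  match goal with |- ?t <= _ => set (lhs := t) end. rewrite Sum_swap, <- Sum_scal. unfold lhs.
  apply Sum_le. intros i Hi. rewrite Sum_swap, <- Sum_scal. apply Sum_le. intros j Hj. cbv beta.
  apply in_seq in Hi, Hj.
  set (F := fun g => iv (divb g i) * (iv (divb g j) * (tauN g ^ 3 * h (i / g)%nat (j / g)%nat))).
  assert (HF : forall g, 0 <= F g).
  { intros g. unfold F. apply Rmult_le_pos; [apply iv_bounds|]. apply Rmult_le_pos; [apply iv_bounds|].
    apply Rmult_le_pos; [apply pow_le, pos_INR|apply Hh]. }
  destruct (nz3 L1 L2 L3 (Z.of_nat i, Z.of_nat j)) eqn:En.
  2:{ simpl iv. rewrite Rmult_0_l. apply Rmult_le_pos; auto. apply Sum_nonneg. intros; apply HF. }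
  simpl iv. rewrite Rmult_1_l.
  destruct (Nat.gcd_divide_l i j) as [i' Hi']. destruct (Nat.gcd_divide_r i j) as [j' Hj'].
  assert (Hg0 : (Nat.gcd i j <> 0)%nat) by (rewrite Nat.gcd_eq_0; lia).
  assert (Hgi : (Nat.gcd i j <= i)%nat) by (apply Nat.divide_pos_le; [lia|apply Nat.gcd_divide_l]).
  pose proof (Nat.gcd_div_gcd i j (Nat.gcd i j) Hg0 eq_refl) as Hc.
  pose proof (Nat.gcd_divide_l i j) as Gi. pose proof (Nat.gcd_divide_r i j) as Gj.
  set (g := Nat.gcd i j) in *.
  apply Rle_trans with (INR (Rn L1 L2 L3) * F g).
  2:{ apply Rmult_le_compat_l; auto. apply (Sum_ge_term (seq 1 X) F g); [intros; apply HF|apply in_seq; lia]. }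
  assert (EF : F g = tauN g ^ 3 * h i' j').
  { unfold F. apply divb_iff in Gi, Gj. rewrite Gi, Gj. simpl iv. rewrite !Rmult_1_l. do 2 f_equal.
    - rewrite Hi' at 1. apply Nat.div_mul; auto.
    - rewrite Hj' at 1. apply Nat.div_mul; auto. }
  replace (i / g)%nat with i' in Hc by (rewrite Hi'; symmetry; apply Nat.div_mul; auto).
  replace (j / g)%nat with j' in Hc by (rewrite Hj'; symmetry; apply Nat.div_mul; auto).
  assert (EL : forall L, Labs L (Z.of_nat i, Z.of_nat j) = (g * Labs L (Z.of_nat i', Z.of_nat j'))%nat).
  { intros L. unfold Labs, evalL. cbn [fst snd].
    replace (fst L * Z.of_nat i + snd L * Z.of_nat j)%Z with (Z.of_nat g * (fst L * Z.of_nat i' + snd L * Z.of_nat j'))%Z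
      by (rewrite Hi', Hj', !Nat2Z.inj_mul; ring).
    rewrite Zabs2Nat.inj_mul. f_equal. lia. }
  rewrite EF, !EL. unfold nz3 in En. rewrite !Bool.andb_true_iff, !nzL_iff, !EL in En. destruct En as [[M1 M2] M3].
  set (n1 := Labs L1 (Z.of_nat i', Z.of_nat j')) in *. set (n2 := Labs L2 (Z.of_nat i', Z.of_nat j')) in *. set (n3 := Labs L3 (Z.of_nat i', Z.of_nat j')) in *.
  assert (K1 : (1 <= n1)%nat) by (destruct n1; lia). assert (K2 : (1 <= n2)%nat) by (destruct n2; lia). assert (K3 : (1 <= n3)%nat) by (destruct n3; lia).
  assert (Hnz : nz3 L1 L2 L3 (Z.of_nat i', Z.of_nat j') = true) by (unfold nz3; rewrite !Bool.andb_true_iff, !nzL_iff; auto).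
  pose proof (tau_primitive L1 L2 L3 i' j' h12 h13 h23 Hc Hnz) as TP. cbv zeta in TP. fold n1 n2 n3 in TP.
  unfold h. rewrite Hnz. simpl iv. rewrite Rmult_1_l.
  pose proof (tauN_mul_le g n1 ltac:(lia) K1) as A1. pose proof (tauN_mul_le g n2 ltac:(lia) K2) as A2. pose proof (tauN_mul_le g n3 ltac:(lia) K3) as A3.
  assert (P0 : forall n, 0 <= tauN n) by (intros; apply pos_INR).
  apply Rle_trans with ((tauN g * tauN n1) * (tauN g * tauN n2) * (tauN g * tauN n3)).
  - repeat (apply Rmult_le_compat; auto; try (apply Rmult_le_pos; auto)).
  - replace (tauN g * tauN n1 * (tauN g * tauN n2) * (tauN g * tauN n3)) with (tauN g ^ 3 * (tauN n1 * tauN n2 * tauN n3)) by ring.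
    replace (INR (Rn L1 L2 L3) * (tauN g ^ 3 * tauN (Fn L1 L2 L3 (Z.of_nat i', Z.of_nat j')))) with
      (tauN g ^ 3 * (INR (Rn L1 L2 L3) * tauN (Fn L1 L2 L3 (Z.of_nat i', Z.of_nat j')))) by ring.
    apply Rmult_le_compat_l; auto. apply pow_le; auto.
Qed.

Definition lead (L1 L2 L3 : linform) (W : E3 -> R) (Y : nat) : R :=
  Sum (T6 Y) (fun t => W (fst t) * kf L1 L2 L3 (snd t) * (/ INR (l1 t) * / INR (l2 t) * / INR (l3 t))).

(** All terms are nonnegative for [Wone], and the index with all entries equal to 1 contributes
    exactly 1. *)
Lemma lead_one L1 L2 L3 c : Un_cv (lead L1 L2 L3 Wone) c -> 1 <= c.
Proof.
  intros H. apply Rnot_lt_le. intros Hlt. destruct (H (1 - c) ltac:(lra)) as [N HN].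
  specialize (HN (N + 1)%nat ltac:(lia)). unfold R_dist in HN.
  assert (1 <= lead L1 L2 L3 Wone (N + 1)); [|apply Rabs_def2 in HN; lra].
  unfold lead. set (o := ((1, 1, 1), (1, 1, 1))%nat : E3 * E3).
  set (f := fun t => Wone (fst t) * kf L1 L2 L3 (snd t) * (/ INR (l1 t) * / INR (l2 t) * / INR (l3 t))).
  replace 1 with (f o).
  - apply (Sum_ge_term (T6 (N + 1)) f o).
    + intros t Ht. destruct (l_pos t _ Ht) as (A1 & A2 & A3). unfold f. apply Rmult_le_pos.
      * apply Rmult_le_pos; [destruct (fst t) as [[a b] d]; apply iv_bounds|destruct (snd t) as [[a b] d]; apply kfun_nonneg].
      * repeat apply Rmult_le_pos; left; apply Rinv_0_lt_compat, lt_0_INR; lia.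
    + apply in_prod; apply in_list3; lia.
  - unfold f, o. cbn [fst snd kf]. rewrite kfun_111. unfold l1, l2, l3. cbn. lra.
Qed.

Lemma quad_bound c1 c2 c3 l : 0 <= l -> Rabs (c1 * l ^ 2 + c2 * l + c3) <= (Rabs c1 + Rabs c2 + Rabs c3) * (1 + l) ^ 2.
Proof.
  intros Hl. eapply Rle_trans; [apply Rabs_triang|]. eapply Rle_trans; [apply Rplus_le_compat_r, Rabs_triang|].
  rewrite !Rabs_mult, (Rabs_right (l ^ 2)), (Rabs_right l) by (try lra; apply Rle_ge, pow_le; auto).
  pose proof (Rabs_pos c1). pose proof (Rabs_pos c2). pose proof (Rabs_pos c3).
  assert (Rabs c1 * l ^ 2 <= Rabs c1 * (1 + l) ^ 2) by (apply Rmult_le_compat_l; nra).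
  assert (Rabs c2 * l <= Rabs c2 * (1 + l) ^ 2) by (apply Rmult_le_compat_l; nra).
  assert (Rabs c3 * 1 <= Rabs c3 * (1 + l) ^ 2) by (apply Rmult_le_compat_l; nra). lra.
Qed.

(* If the leading coefficient were not positive, then [T(X) = O(X^2 log^2 X)]; extracting
   [gcd(x1, x2)] bounds the sum of [tau L1 * tau L2 * tau L3] by [T(X/g)], whence the latter is
   [O(X^2 log^2 X)] too, although its leading coefficient is at least 1. *)
Lemma lead_mu_pos L1 L2 L3 c : resL L1 L2 <> 0%Z -> resL L1 L3 <> 0%Z -> resL L2 L3 <> 0%Z ->
  Un_cv (lead L1 L2 L3 Wmu) c -> 0 < c.
Proof.
  intros h12 h13 h23 Hc. apply Rnot_le_lt. intros Hneg.
  destruct (TW_asymp L1 L2 L3 Wmu (1 / 8) h12 h13 h23 ltac:(lra) Wmu_bound) as (c0 & c1 & c2 & c3 & C & HC & Hcv & HT).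
  assert (E0 : c0 = c) by (apply (UL_sequence _ _ _ Hcv Hc)). subst c0. clear Hcv.
  destruct (TW_asymp L1 L2 L3 Wone (1 / 8) h12 h13 h23 ltac:(lra) ltac:(intros; apply Wone_bound)) as (b0 & b1 & b2 & b3 & B & HB & Hcv & HS).
  apply lead_one in Hcv.
  destruct (divisor_bound (1 / 8) ltac:(lra)) as [D [HD Htau]].
  assert (Hx : forall X, (1 <= X)%nat -> Rpower (INR X) (7 / 4 + 1 / 8) <= INR X ^ 2).
  { intros X HX. rewrite <- Rpower_pow by (apply lt_0_INR; lia). apply Rle_Rpower; [apply INR_ge1; auto|simpl; lra]. }
  set (K1 := Rabs c1 + Rabs c2 + Rabs c3 + C).
  assert (HK1 : 0 <= K1) by (unfold K1; pose proof (Rabs_pos c1); pose proof (Rabs_pos c2); pose proof (Rabs_pos c3); lra).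
  assert (Hup : forall X, (1 <= X)%nat -> Tn L1 L2 L3 X <= K1 * (INR X ^ 2 * (1 + ln (INR X)) ^ 2)).
  { intros X HX. specialize (HT X HX). rewrite TW_mu in HT. pose proof (INR_ge1 X HX). set (l := ln (INR X)) in *.
    assert (Hl : 0 <= l) by (apply ln_nonneg; auto). specialize (Hx X HX).
    pose proof (quad_bound c1 c2 c3 l Hl) as HQ.
    pose proof (Rle_abs (Tn L1 L2 L3 X - INR X ^ 2 * (c * l ^ 3 + c1 * l ^ 2 + c2 * l + c3))).
    pose proof (Rle_abs (c1 * l ^ 2 + c2 * l + c3)).
    assert (Hx2 : 0 <= INR X ^ 2) by (apply pow_le; lra).
    assert (Hl3 : c * l ^ 3 <= 0) by (pose proof (pow_le l 3 Hl); nra).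
    assert (A1 : INR X ^ 2 * (c * l ^ 3 + c1 * l ^ 2 + c2 * l + c3) <= INR X ^ 2 * ((Rabs c1 + Rabs c2 + Rabs c3) * (1 + l) ^ 2)) by (apply Rmult_le_compat_l; lra).
    assert (A2 : C * Rpower (INR X) (7 / 4 + 1 / 8) <= C * (INR X ^ 2 * (1 + l) ^ 2)).
    { apply Rmult_le_compat_l; auto. eapply Rle_trans; [exact Hx|]. rewrite <- (Rmult_1_r (INR X ^ 2)) at 1. apply Rmult_le_compat_l; auto. nra. }
    unfold K1. lra. }
  (* The sum over [g] has terms [g ^ (3/8) * g ^ (- 2)]: the cube of the divisor bound with exponent
     [1 / 8], and the area of the box of side [X / g]. It converges with [2 - 3/8 = 1 + 5/8]. *)
  set (K2 := INR (Rn L1 L2 L3) * (D ^ 3 * K1 * (1 + / (5 / 8)))).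
  assert (HD3 : 0 <= D ^ 3) by (apply pow_le; lra).
  assert (HR : 0 <= INR (Rn L1 L2 L3)) by apply pos_INR.
  assert (HK2 : 0 <= K2) by (unfold K2; repeat apply Rmult_le_pos; lra).
  assert (HSup : forall X, (1 <= X)%nat -> TW L1 L2 L3 Wone X <= K2 * (INR X ^ 2 * (1 + ln (INR X)) ^ 2)).
  { intros X HX. eapply Rle_trans; [apply compare_sums; auto|]. unfold K2. rewrite Rmult_assoc. apply Rmult_le_compat_l; auto.
    pose proof (INR_ge1 X HX) as RX. set (l := ln (INR X)) in *. assert (Hl : 0 <= l) by (apply ln_nonneg; auto).
    assert (Hm : 0 <= D ^ 3 * K1 * (INR X ^ 2 * (1 + l) ^ 2)).
    { apply Rmult_le_pos; [apply Rmult_le_pos; auto|]. apply Rmult_le_pos; apply pow_le; lra. }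
    apply Rle_trans with (Sum (seq 1 X) (fun g => D ^ 3 * K1 * (INR X ^ 2 * (1 + l) ^ 2) * Rpower (INR g) (- 1 - 5 / 8))).
    2:{ rewrite Sum_scal. replace (D ^ 3 * K1 * (1 + / (5 / 8)) * (INR X ^ 2 * (1 + l) ^ 2)) with (D ^ 3 * K1 * (INR X ^ 2 * (1 + l) ^ 2) * (1 + / (5 / 8))) by ring.
        apply Rmult_le_compat_l; auto. apply sum_pow_conv. lra. }
    apply Sum_le. intros g Hg. apply in_seq in Hg. assert (Hg1 : (1 <= g)%nat) by lia. pose proof (INR_ge1 g Hg1) as Rg.
    assert (Hq : (1 <= X / g)%nat) by (apply Nat.div_le_lower_bound; lia).
    pose proof (INR_ge1 _ Hq) as Rq.
    assert (Hqg : INR (X / g) <= INR X * / INR g).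
    { apply Rmult_le_reg_r with (INR g); [lra|]. rewrite Rmult_assoc, Rinv_l, Rmult_1_r by lra. rewrite <- mult_INR. apply le_INR.
      rewrite Nat.mul_comm. apply Nat.mul_div_le. lia. }
    assert (HlX : ln (INR (X / g)) <= l).
    { apply Rln_le; [lra|]. apply le_INR. apply Nat.Div0.div_le_upper_bound. nia. }
    pose proof (ln_nonneg _ Rq) as Hlq.
    assert (B1 : Tn L1 L2 L3 (X / g) <= K1 * (INR X ^ 2 * (/ INR g) ^ 2 * (1 + l) ^ 2)).
    { eapply Rle_trans; [apply Hup; auto|]. apply Rmult_le_compat_l; auto. apply Rmult_le_compat.
      - apply pow_le; lra.
      - apply pow_le; lra.
      - rewrite <- Rpow_mult_distr. apply pow_incr. lra.
      - apply pow_incr. lra. }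
    assert (B2 : tauN g ^ 3 <= D ^ 3 * Rpower (INR g) (3 / 8)).
    { replace (Rpower (INR g) (3 / 8)) with (Rpower (INR g) (1 / 8) ^ 3).
      - rewrite <- Rpow_mult_distr. apply pow_incr. split; [apply pos_INR|auto].
      - rewrite <- Rpower_pow by apply Rpower_pos. rewrite Rpower_mult. f_equal. simpl. lra. }
    assert (B0 : 0 <= Tn L1 L2 L3 (X / g)).
    { unfold Tn. apply Sum_nonneg. intros. apply Rmult_le_pos; [apply iv_bounds|apply pos_INR]. }
    eapply Rle_trans; [apply Rmult_le_compat; [apply pow_le, pos_INR|exact B0|exact B2|exact B1]|].
    right. replace (Rpower (INR g) (- 1 - 5 / 8)) with (Rpower (INR g) (3 / 8) * (/ INR g) ^ 2); [ring|].
    replace ((/ INR g) ^ 2) with (Rpower (INR g) (- (2))).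
    - rewrite <- Rpower_plus. f_equal. lra.
    - rewrite Rpower_Ropp. replace 2 with (INR 2) at 1 by (simpl; lra). rewrite Rpower_pow by lra. rewrite pow_inv. auto. }
  set (K3 := K2 + (Rabs b1 + Rabs b2 + Rabs b3) + B).
  assert (HK3 : 0 <= K3) by (unfold K3; pose proof (Rabs_pos b1); pose proof (Rabs_pos b2); pose proof (Rabs_pos b3); lra).
  (* The two bounds give [l ^ 3 <= K3 * (1 + l) ^ 2 <= 4 * K3 * l ^ 2] for [l = ln X], contradicted
     by any [l > 4 * K3]. *)
  destruct (INR_unbounded (exp (4 * K3 + 1))) as [X HX].
  assert (HX1 : (1 <= X)%nat).
  { destruct X; [|lia]. simpl in HX. pose proof (exp_pos (4 * K3 + 1)). lra. }
  pose proof (INR_ge1 X HX1) as RX. set (l := ln (INR X)).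
  assert (Hl : 4 * K3 + 1 < l) by (unfold l; rewrite <- (ln_exp (4 * K3 + 1)); apply ln_increasing; [apply exp_pos|lra]).
  specialize (HS X HX1). specialize (HSup X HX1). specialize (Hx X HX1). fold l in HS, HSup.
  assert (Hx2 : 0 < INR X ^ 2) by (apply pow_lt; lra).
  pose proof (quad_bound b1 b2 b3 l ltac:(lra)) as HQ.
  pose proof (Rle_abs (- (TW L1 L2 L3 Wone X - INR X ^ 2 * (b0 * l ^ 3 + b1 * l ^ 2 + b2 * l + b3)))) as HA. rewrite Rabs_Ropp in HA.
  pose proof (Rle_abs (- (b1 * l ^ 2 + b2 * l + b3))) as HA2. rewrite Rabs_Ropp in HA2.
  assert (Hl2 : 1 <= (1 + l) ^ 2) by nra.
  assert (A2 : B * Rpower (INR X) (7 / 4 + 1 / 8) <= B * (INR X ^ 2 * (1 + l) ^ 2)).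
  { apply Rmult_le_compat_l; auto. eapply Rle_trans; [exact Hx|]. rewrite <- (Rmult_1_r (INR X ^ 2)) at 1. apply Rmult_le_compat_l; lra. }
  assert (A3 : INR X ^ 2 * (b0 * l ^ 3) <= INR X ^ 2 * (K3 * (1 + l) ^ 2)).
  { assert (INR X ^ 2 * (- (b1 * l ^ 2 + b2 * l + b3)) <= INR X ^ 2 * ((Rabs b1 + Rabs b2 + Rabs b3) * (1 + l) ^ 2)) by (apply Rmult_le_compat_l; lra).
    unfold K3. lra. }
  apply Rmult_le_reg_l in A3; auto.
  assert (Hl3 : 0 < l ^ 3) by (apply pow_lt; lra).
  assert (A4 : l ^ 3 <= K3 * (1 + l) ^ 2) by nra.
  assert (A5 : K3 * (1 + l) ^ 2 <= K3 * (4 * l ^ 2)) by (apply Rmult_le_compat_l; nra).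
  assert (A6 : l ^ 2 * l <= l ^ 2 * (4 * K3)) by (simpl in *; lra).
  apply Rmult_le_reg_l in A6; [lra|apply pow_lt; lra].
Qed.

(** * From integers to real arguments *)

(** Replacing [X] by its integer part changes [X^2] by at most [2 * X] and [ln X] by at most
    [1 / N], so the main term moves by [O(X)] times a cube of a logarithm, well below the error. *)
Lemma floor_poly c0 c1 c2 c3 eps : 0 < eps -> exists C, 0 <= C /\ forall X N, 1 <= N -> N <= X -> X <= N + 1 ->
  Rabs (N ^ 2 * (c0 * ln N ^ 3 + c1 * ln N ^ 2 + c2 * ln N + c3) - X ^ 2 * (c0 * ln X ^ 3 + c1 * ln X ^ 2 + c2 * ln X + c3))
  <= C * Rpower X (7 / 4 + eps).
Proof.
  intros Heps. destruct (ln_pow_bound 3 (3 / 4) ltac:(lra)) as [Cl [HCl0 HCl]].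
  set (S := Rabs c0 + Rabs c1 + Rabs c2 + Rabs c3).
  assert (P0 := Rabs_pos c0). assert (P1 := Rabs_pos c1). assert (P2 := Rabs_pos c2). assert (P3 := Rabs_pos c3).
  exists (5 * S * Cl). split; [unfold S; repeat apply Rmult_le_pos; lra|]. intros X N HN HNX HXN.
  set (u := ln X). set (w := ln N).
  assert (Hw : 0 <= w) by (apply ln_nonneg; auto). assert (Hwu : w <= u) by (apply Rln_le; lra).
  assert (Huw : (u - w) * N <= 1).
  { assert (H : u - w <= / N).
    { unfold u, w. pose proof (exp_ineq1_le (/ N)). assert (0 < / N) by (apply Rinv_0_lt_compat; lra).
      assert (ln (N * (1 + / N)) <= ln N + / N).
      { rewrite ln_mult by lra. apply Rplus_le_compat_l. rewrite <- (ln_exp (/ N)) at 2. apply Rln_le; lra. }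
      assert (ln X <= ln (N * (1 + / N))) by (apply Rln_le; [lra|]; replace (N * (1 + / N)) with (N + 1) by (field; lra); auto). lra. }
    apply Rmult_le_compat_r with (r := N) in H; [|lra]. rewrite Rinv_l in H; lra. }
  set (pu := c0 * u ^ 3 + c1 * u ^ 2 + c2 * u + c3). set (pw := c0 * w ^ 3 + c1 * w ^ 2 + c2 * w + c3).
  set (v := 1 + u). assert (Hv : 1 <= v) by (unfold v; lra).
  assert (Hmul : forall a b y, 0 <= b <= y -> Rabs (a * b) <= Rabs a * y).
  { intros a b y Hb. rewrite Rabs_mult, (Rabs_right b) by lra. apply Rmult_le_compat_l; [apply Rabs_pos|lra]. }
  assert (Hv2 : v <= v ^ 2) by nra. assert (Hv3 : v ^ 2 <= v ^ 3) by (simpl; nra).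
  assert (Bu : Rabs pu <= S * v ^ 3).
  { unfold pu, S. eapply Rle_trans; [apply Rabs_triang|]. eapply Rle_trans; [apply Rplus_le_compat_r, Rabs_triang|].
    eapply Rle_trans; [apply Rplus_le_compat_r, Rplus_le_compat_r, Rabs_triang|].
    assert (U3 : 0 <= u ^ 3 <= v ^ 3) by (split; [apply pow_le; lra|apply pow_incr; unfold v; lra]).
    assert (U2 : 0 <= u ^ 2 <= v ^ 3) by (split; [apply pow_le; lra|apply Rle_trans with (v ^ 2); auto; apply pow_incr; unfold v; lra]).
    assert (U1 : 0 <= u <= v ^ 3) by (split; [lra|unfold v in *; lra]).
    pose proof (Hmul c0 _ _ U3). pose proof (Hmul c1 _ _ U2). pose proof (Hmul c2 _ _ U1).
    assert (Rabs c3 * 1 <= Rabs c3 * v ^ 3) by (apply Rmult_le_compat_l; lra). lra. }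
  assert (Bd : Rabs (pu - pw) <= (u - w) * (3 * S * v ^ 3)).
  { replace (pu - pw) with ((u - w) * (c0 * (u * u + u * w + w * w) + c1 * (u + w) + c2)) by (unfold pu, pw; ring).
    rewrite Rabs_mult, (Rabs_right (u - w)) by lra. apply Rmult_le_compat_l; [lra|].
    eapply Rle_trans; [apply Rabs_triang|]. eapply Rle_trans; [apply Rplus_le_compat_r, Rabs_triang|].
    assert (U3 : 0 <= u * u + u * w + w * w <= 3 * v ^ 2) by (unfold v; split; nra).
    assert (U2 : 0 <= u + w <= 3 * v ^ 2) by (unfold v in *; split; nra).
    pose proof (Hmul c0 _ _ U3). pose proof (Hmul c1 _ _ U2).
    assert (Rabs c2 * 1 <= Rabs c2 * (3 * v ^ 2)) by (apply Rmult_le_compat_l; lra).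
    assert (S * v ^ 2 <= S * v ^ 3) by (apply Rmult_le_compat_l; [unfold S; lra|auto]).
    assert (Rabs c3 * v ^ 2 >= 0) by (apply Rle_ge, Rmult_le_pos; lra).
    unfold S in *. lra. }
  replace (N ^ 2 * pw - X ^ 2 * pu) with (- ((X ^ 2 - N ^ 2) * pu + N ^ 2 * (pu - pw))) by ring.
  rewrite Rabs_Ropp. eapply Rle_trans; [apply Rabs_triang|]. rewrite !Rabs_mult.
  assert (HX2 : 0 <= X ^ 2 - N ^ 2 <= 2 * X) by (split; nra).
  rewrite (Rabs_right (X ^ 2 - N ^ 2)), (Rabs_right (N ^ 2)) by (try lra; apply Rle_ge, pow_le; lra).
  assert (HSv : 0 <= S * v ^ 3) by (apply Rmult_le_pos; [unfold S; lra|lra]).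
  assert (Q1 : (X ^ 2 - N ^ 2) * Rabs pu <= 2 * X * (S * v ^ 3)).
  { apply Rmult_le_compat; try lra. apply Rabs_pos. }
  assert (Q2 : N ^ 2 * Rabs (pu - pw) <= X * (3 * (S * v ^ 3))).
  { apply Rle_trans with (N ^ 2 * ((u - w) * (3 * S * v ^ 3))); [apply Rmult_le_compat_l; [apply pow_le; lra|auto]|].
    replace (N ^ 2 * ((u - w) * (3 * S * v ^ 3))) with (N * (((u - w) * N) * (3 * (S * v ^ 3)))) by ring.
    apply Rmult_le_compat; [lra| |lra|].
    - apply Rmult_le_pos; [apply Rmult_le_pos; lra|lra].
    - rewrite <- (Rmult_1_l (3 * _)) at 2. apply Rmult_le_compat_r; lra. }
  apply Rle_trans with (5 * S * (X * v ^ 3)); [lra|].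
  replace (5 * S * Cl * Rpower X (7 / 4 + eps)) with (5 * S * (Cl * Rpower X (7 / 4 + eps))) by ring.
  apply Rmult_le_compat_l; [unfold S; lra|].
  apply Rle_trans with (X * (Cl * Rpower X (3 / 4))).
  - apply Rmult_le_compat_l; [lra|]. apply HCl. lra.
  - replace (X * (Cl * Rpower X (3 / 4))) with (Cl * (X * Rpower X (3 / 4))) by ring. apply Rmult_le_compat_l; auto.
    rewrite <- (Rpower_1 X) at 1 by lra. rewrite <- Rpower_plus. apply Rle_Rpower; lra.
Qed.

Theorem theorem1 (L1 L2 L3 : linform)
  (h12 : resL L1 L2 <> 0%Z) (h13 : resL L1 L3 <> 0%Z) (h23 : resL L2 L3 <> 0%Z)
  (eps : R) (heps : 0 < eps) :
  exists c0 c1 c2 c3 : R, 0 < c0 /\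
    exists C : R, forall X : R, 1 <= X ->
      Rabs (T L1 L2 L3 X
            - (c0 * X ^ 2 * ln X ^ 3 + c1 * X ^ 2 * ln X ^ 2
               + c2 * X ^ 2 * ln X + c3 * X ^ 2))
      <= C * Rpower X (2 - 1/4 + eps).
Proof.
  destruct (TW_asymp L1 L2 L3 Wmu eps h12 h13 h23 heps Wmu_bound) as (c0 & c1 & c2 & c3 & C & HC & Hcv & HT).
  destruct (floor_poly c0 c1 c2 c3 eps heps) as [C' [HC' HF]].
  exists c0, c1, c2, c3. split; [apply (lead_mu_pos L1 L2 L3 c0 h12 h13 h23 Hcv)|].
  exists (C + C'). intros X HX. rewrite T_eq, <- TW_mu.
  set (N := floorN X). destruct (base_Int_part X) as [B1 B2].
  assert (HI : (0 < Int_part X)%Z) by (apply lt_IZR; lra).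
  assert (HN : (1 <= N)%nat) by (unfold N, floorN; lia).
  assert (EN : INR N = IZR (Int_part X)) by (unfold N, floorN; rewrite INR_IZR_INZ, Z2Nat.id by lia; auto).
  pose proof (INR_ge1 N HN) as RN. specialize (HT N HN). specialize (HF X (INR N) RN ltac:(lra) ltac:(lra)).
  replace (2 - 1 / 4 + eps) with (7 / 4 + eps) by lra.
  assert (HP : Rpower (INR N) (7 / 4 + eps) <= Rpower X (7 / 4 + eps)) by (apply Rle_Rpower_l; lra).
  set (PN := INR N ^ 2 * (c0 * ln (INR N) ^ 3 + c1 * ln (INR N) ^ 2 + c2 * ln (INR N) + c3)) in *.
  replace (TW L1 L2 L3 Wmu N - (c0 * X ^ 2 * ln X ^ 3 + c1 * X ^ 2 * ln X ^ 2 + c2 * X ^ 2 * ln X + c3 * X ^ 2)) with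
    ((TW L1 L2 L3 Wmu N - PN) + (PN - X ^ 2 * (c0 * ln X ^ 3 + c1 * ln X ^ 2 + c2 * ln X + c3))) by ring.
  eapply Rle_trans; [apply Rabs_triang|].
  assert (C * Rpower (INR N) (7 / 4 + eps) <= C * Rpower X (7 / 4 + eps)) by (apply Rmult_le_compat_l; auto). lra.
Qed.
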